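(* Assume $m>2$ is an integer. For any integer $k\ge 0$, there exists a unique radial stationary solution $Q_k\in C^\infty(\overline\Omega)$ of (NLW) such that $Q_k(x)=0$ for $x\in\partial\Omega$, and $r\mapsto Q_k(r)$ has exactly $k$ zeros on $(1,\infty)$ and is positive for large $r$. More precisely, there exists $c_k>0$ such that $$\left|Q_k(r)-\frac{c_k}{r}\right|\lesssim\frac1{r^2},\qquad \lim_{r\to\infty}r^2\frac{dQ_k}{dr}(r)=-c_k .$$ Moreover, the sequence $(E(Q_k,0))_{k\in\mathbb N}$ is increasing. Finally, the set of stationary solutions of (NLW) is exactly $$\{Q_k:\ k\in\mathbb N\}\cup\{-Q_k:\ k\in\mathbb N\}\cup\{0\}.$$
   Context: Let $\mathbb B=\{x\in\mathbb R^3:|x|<1\}$ and $\Omega=\mathbb R^3\setminus\mathbb B$. $\dot H^1_0(\Omega)$ is the completion of smooth functions compactly supported in $\{|x|>1\}$ for the norm $\|\nabla f\|_{L^2(\Omega)}$, and $\mathcal H$ is the space of radial elements of $\dot H^1_0(\Omega)\times L^2(\Omega)$. Radial functions are written as functions of $r=|x|$. $\mathbb N=\{0,1,2,\dots\}$. (NLW) is the equation $(\partial_t^2-\Delta)u=|u|^{2m}u$ on $\mathbb R\times\Omega$, with $(u,\partial_tu)|_{t=0}=(u_0,u_1)\in\mathcal H$ and Dirichlet condition $u_{|\partial\Omega}=0$. A stationary solution of (NLW) is a time-independent solution, i.e. a radial $Q\in\dot H^1_0(\Omega)$ with $-\Delta Q=|Q|^{2m}Q$ in $\Omega$, $Q_{|\partial\Omega}=0$.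 The energy is $$E(u_0,u_1)=\frac12\int_\Omega|\nabla u_0|^2dx+\frac12\int_\Omega u_1^2dx-\frac1{2(m+1)}\int_\Omega|u_0|^{2(m+1)}dx .$$ The notation $a\lesssim b$ means $a\le Cb$ for some constant $C>0$ (here independent of $r\geq 1$). *)

(* Defs.v *)
From HB Require Import structures.
From mathcomp Require Import all_boot all_order all_algebra.
From mathcomp Require Import all_classical all_reals all_analysis.
Set Implicit Arguments.
Unset Strict Implicit.
Unset Printing Implicit Defensive.
Import Order.TTheory GRing.Theory Num.Theory.
Import numFieldNormedType.Exports.
Local Open Scope classical_set_scope.
Local Open Scope ring_scope.

Section definitions.
Context {R : realType}.

(* measurableTypeR R unfolds to R; it is the form of R on which the library puts
   lebesgue_measure. The topology and the derivatives on E3 are those of the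
   normed module R * R * R (sup norm); enorm is the Euclidean norm. *)
Definition E3 : Type :=
  (measurableTypeR R * measurableTypeR R * measurableTypeR R)%type.

Definition leb3 : {measure set E3 -> \bar R} :=
  ((@lebesgue_measure R \x @lebesgue_measure R) \x @lebesgue_measure R)%E.

Definition enorm (x : E3) : R :=
  Num.sqrt (x.1.1 ^+ 2 + x.1.2 ^+ 2 + x.2 ^+ 2).

(* Integrals and equations live on the open exterior domain; the unit sphere is
   a null set. *)
Definition exterior : set E3 := [set x | 1 < enorm x].
Definition cl_exterior : set E3 := [set x | 1 <= enorm x].

Definition eball (rho : R) : set E3 := [set x | enorm x < rho].

Definition basis3 (i : 'I_3) : E3 :=
  (((i == 0 :> nat)%:R, (i == 1 :> nat)%:R), (i == 2 :> nat)%:R).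

Definition pderiv (i : 'I_3) (f : E3 -> R) : E3 -> R :=
  fun x => 'D_(basis3 i) f x.

Definition iter_pderiv (s : seq 'I_3) (f : E3 -> R) : E3 -> R :=
  foldr pderiv f s.

Definition smooth_on (U : set E3) (f : E3 -> R) : Prop :=
  forall (s : seq 'I_3) (x : E3), U x ->
    {for x, continuous (iter_pderiv s f)} /\
    forall i : 'I_3, derivable (iter_pderiv s f) x (basis3 i).

Definition smooth_cl_exterior (f : E3 -> R) : Prop :=
  exists U : set E3, exists g : E3 -> R,
    [/\ open U, cl_exterior `<=` U, smooth_on U g &
        forall x, cl_exterior x -> g x = f x].

Definition laplacian (f : E3 -> R) (x : E3) : R :=
  \sum_(i < 3) pderiv i (pderiv i f) x.

Definition grad_sq (f : E3 -> R) (x : E3) : R :=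
  \sum_(i < 3) pderiv i f x ^+ 2.

Definition test_function (phi : E3 -> R) : Prop :=
  smooth_on setT phi /\
  exists K : set E3,
    [/\ compact K, K `<=` exterior & forall x, ~ K x -> phi x = 0].

(* The completion of the test functions for the norm of the gradient, realized
   as a space of functions: by the Sobolev (or Hardy) inequality, a Cauchy
   sequence for that norm converges in L^1 on bounded subsets of the exterior
   domain, and its limit there determines its class in the completion. *)
Definition dotH10 (u : E3 -> R) : Prop :=
  measurable_fun exterior u /\
  exists phi : nat -> E3 -> R,
    [/\ forall n, test_function (phi n),
        forall e : R, 0 < e -> exists N : nat, forall n p : nat,
          (N <= n)%N -> (N <= p)%N ->
          (\int[leb3]_(x in exterior)
             (grad_sq (fun y => phi n y - phi p y) x)%:E < e%:E)%E &
        forall rho : R,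
          (\int[leb3]_(x in exterior `&` eball rho)
             `|phi n x - u x|%:E)%E @[n --> \oo] --> 0%:E].

Definition radial_fun (q : R -> R) (x : E3) : R := q (enorm x).

Definition radial (u : E3 -> R) : Prop :=
  exists q : R -> R,
    measurable_fun [set: R] q /\ ae_eq leb3 exterior u (radial_fun q).

Definition loc_integrable (u : E3 -> R) : Prop :=
  forall K : set E3, compact K -> K `<=` exterior ->
    leb3.-integrable K (EFin \o u).

(* - Delta u = g in the exterior domain, in the sense of distributions *)
Definition distr_poisson (u g : E3 -> R) : Prop :=
  [/\ loc_integrable u, loc_integrable g &
      forall phi, test_function phi ->
        (\int[leb3]_(x in exterior) (u x * - laplacian phi x)%:E =
         \int[leb3]_(x in exterior) (g x * phi x)%:E)%E].

(* Elements of dotH10 have no pointwise values; the Dirichlet condition is the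
   one carried by membership in dotH10. *)
Definition stationary (m : nat) (u : E3 -> R) : Prop :=
  [/\ dotH10 u, radial u &
      distr_poisson u (fun x => `|u x| ^+ (2 * m) * u x)].

(* the set of measurable representatives of the class of u *)
Definition ae_class (u : E3 -> R) : set (E3 -> R) :=
  [set v | measurable_fun exterior v /\ ae_eq leb3 exterior v u].

(* The gradient is the classical one, so this is meant for u0 differentiable in
   the exterior domain. *)
Definition energy (m : nat) (u0 u1 : E3 -> R) : \bar R :=
  ((2^-1)%:E * (\int[leb3]_(x in exterior) (grad_sq u0 x)%:E)
   + (2^-1)%:E * (\int[leb3]_(x in exterior) (u1 x ^+ 2)%:E)
   - ((2 * m.+1)%:R^-1)%:E *
       (\int[leb3]_(x in exterior) (`|u0 x| ^+ (2 * m.+1))%:E))%E.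

Definition nodal_solution (m k : nat) (q : R -> R) : Prop :=
  [/\ stationary m (radial_fun q),
      smooth_cl_exterior (radial_fun q),
      forall x, enorm x = 1 -> radial_fun q x = 0,
      ([set r : R | 1 < r /\ q r = 0] #= `I_k)%card &
      \forall r \near +oo, 0 < q r].

End definitions.
Arguments E3 R : clear implicits.

(* Main.v *)
From HB Require Import structures.
Require Import Defs.
From mathcomp Require Import all_boot all_order all_algebra.
From mathcomp Require Import all_classical all_reals all_analysis.
From mathcomp Require Import measurable_realfun.
From mathcomp Require Import ring lra zify.
Import Order.TTheory GRing.Theory Num.Theory.
Import numFieldNormedType.Exports.
Local Open Scope classical_set_scope.
Local Open Scope ring_scope.
Set Implicit Arguments.
Unset Strict Implicit.
Unset Printing Implicit Defensive.

(* Writing Q(r) = v(1/r), the radial equation becomes v'' = - s^-4 v^(2m+1). As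
   2m+1 > 4, the Cauchy problem v(0) = 0, v'(0) = 1 is well posed at the singular
   point s = 0 (contraction in a weighted norm), and an energy argument gives
   |v(s)| <= s. The scalings v(X^m/r)/X of this single solution behave like c/r at
   infinity, with every c > 0 attained once; the Dirichlet condition at r = 1 says
   that X^m is a zero of v. In the Emden-Fowler variables s = e^(mt), y = e^(-t) v, the
   equation is autonomous with the anti-damping term (m-2) y', whose energy H
   increases: this forces infinitely many simple zeros t_k, with y'(t_k)^2
   increasing. By the virial and Pohozaev identities the energy of Q_k is a fixed
   multiple of Q_k'(1)^2, hence of y'(t_k)^2.

   Conversely, let u = q(|x|) be stationary. Testing against radial functions,
   duality in the energy space gives |q(r)| <= C r^(-1/2) almost everywhere, and
   q(r) -> 0 as r -> 1. Testing against mollified second differences of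
   r -> max(r-a,0) gives a q(a) = alpha + int_a^oo (r-a) f(r) dr for almost every
   a, where f = - r |q|^(2m) q. For given alpha this integral equation has only one
   bounded solution, so q is 0, or plus or minus a scaling of v. *)

(** * Calculus on the line *)

(** The singular factor [s^-4] is tamed by [|v| <= s], which is not known before [v] exists. So the
    nonlinearity is first truncated at [|v / s| = 1], which makes it globally Lipschitz, and the
    energy of [v / s] shows afterwards that the truncation never acts. Zeros keep coming because a
    solution of constant sign is concave up to sign and stays bounded in the Emden-Fowler variables,
    whereas [H > 0] with anti-damping forbids bounded trajectories. For the converse, the obstacle
    is that [u] is only a class in a completion: no pointwise values, no trace, no regularity.
    Duality replaces them. Radial fields with divergence [g(|x|) / |x|^2] come from the primitives
    [G] of [g], and the free constant matters: [G] vanishing near 1 gives decay at infinity, [G]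
    vanishing near infinity gives the Dirichlet condition. With [|q| <= C r^(-1/2)], the bound on
    [r^2 |q|^(2m+1)] is integrable as soon as [2m+1 > 6], which is [m > 2] once more. Second
    differences avoid differentiating [q]: they show that [r q] minus a potential is affine, and the
    decay kills the slope. *)

Section derive_rules.
Context {R : realType}.
Implicit Types (f g : R -> R) (x a b : R).

Lemma deq f x a b : is_derive x 1 f a -> a = b -> is_derive x 1 f b.
Proof. by move=> ? <-. Qed.
Lemma dcst x c : is_derive x 1 (fun=> c : R) 0.
Proof. exact: is_derive_cst. Qed.
Lemma did x : is_derive x 1 (fun y : R => y) 1.
Proof. exact: is_derive_id. Qed.
Lemma dD f g x a b : is_derive x 1 f a -> is_derive x 1 g b ->
  is_derive x 1 (fun y => f y + g y) (a + b).
Proof. by move=> ? ?; exact: is_deriveD. Qed.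
Lemma dN f x a : is_derive x 1 f a -> is_derive x 1 (fun y => - f y) (- a).
Proof. by move=> ?; exact: is_deriveN. Qed.
Lemma dNid x : is_derive x 1 (-%R : R -> R) (- 1).
Proof. exact: (dN (did x)). Qed.
Lemma dM f g x a b : is_derive x 1 f a -> is_derive x 1 g b ->
  is_derive x 1 (fun y => f y * g y) (a * g x + f x * b).
Proof.
move=> fa gb; apply: (deq (is_deriveM fa gb)).
by rewrite /GRing.scale/=; ring.
Qed.
Lemma dX f n x a : is_derive x 1 f a ->
  is_derive x 1 (fun y => f y ^+ n) (n%:R * f x ^+ n.-1 * a).
Proof.
move=> fa; elim: n => [|n IH]; first by rewrite !mul0r; exact: dcst.
have -> : (fun y => f y ^+ n.+1) = (fun y => f y * f y ^+ n).
  by apply/funext => y; rewrite exprS.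
apply: (deq (dM fa IH)) => /=; case: n {IH} => [|n]; first by rewrite expr0; ring.
by rewrite exprS /= (mulrS 1 n.+1); ring.
Qed.
Lemma dV f x a : f x != 0 -> is_derive x 1 f a ->
  is_derive x 1 (fun y => (f y)^-1) (- a * (f x)^-1 ^+ 2).
Proof.
move=> fx fa; apply: (deq (is_deriveV fx fa)).
by rewrite /GRing.scale/= exprVn; ring.
Qed.
Lemma dVid x : x != 0 -> is_derive x 1 (@GRing.inv R) (- 1 * x^-1 ^+ 2).
Proof. by move=> x0; exact: (dV (f := fun y => y) x0 (did x)). Qed.
Lemma dMl x c : is_derive x 1 ( *%R c) (c : R).
Proof. by apply: (deq (dM (dcst x c) (did x))); ring. Qed.
Lemma dDl x c : is_derive x 1 (+%R c) (1 : R).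
Proof. by apply: (deq (dD (dcst x c) (did x))); ring. Qed.
Lemma dcomp f g x a b : is_derive (g x) 1 f a -> is_derive x 1 g b ->
  is_derive x 1 (fun y => f (g y)) (a * b).
Proof. by move=> fa gb; exact: (is_derive1_comp fa gb). Qed.
Lemma dexp f x a : is_derive x 1 f a ->
  is_derive x 1 (fun y => expR (f y)) (expR (f x) * a).
Proof. by move=> fa; apply: dcomp => //; exact: is_derive_expR. Qed.
Lemma deqf f g x a : (forall y, g y = f y) -> is_derive x 1 f a -> is_derive x 1 g a.
Proof. by move=> /funext ->. Qed.
Lemma dcont f x a : is_derive x 1 f a -> {for x, continuous f}.
Proof. by case=> fd _; apply: differentiable_continuous; exact/derivable1_diffP. Qed.

Lemma dnear f g x a : (\near x, f x = g x) -> is_derive x 1 f a -> is_derive x 1 g a.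
Proof. exact: near_eq_is_derive. Qed.
End derive_rules.

(** Differentiation by the shape of the function. At arithmetic nodes [dcst] is tried first, so that
    subterms free of the variable are not opened. The derivative is left as an existential variable,
    and [der] leaves its equality with the announced value to [ring] or [field]. *)
Ltac der1 :=
  lazymatch goal with
  | |- is_derive _ _ (fun y => GRing.add (@?f y) (@?g y)) _ => first [exact: dcst | eapply dD]
  | |- is_derive _ _ (fun y => GRing.opp (@?f y)) _ => first [exact: dcst | eapply dN]
  | |- is_derive _ _ (fun y => GRing.mul (@?f y) (@?g y)) _ => first [exact: dcst | eapply dM]
  | |- is_derive _ _ (fun y => GRing.exp (@?f y) _) _ => first [exact: dcst | eapply dX]
  | |- is_derive _ _ (fun y => GRing.inv (@?f y)) _ => first [exact: dcst | eapply dV]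
  | |- is_derive _ _ (fun y => expR (@?f y)) _ => first [exact: dcst | eapply dexp]
  | |- is_derive _ _ (fun y => y) _ => exact: did
  | |- is_derive _ _ (@GRing.opp _) _ => exact: dNid
  | |- is_derive _ _ (GRing.mul _) _ => exact: dMl
  | |- is_derive _ _ (GRing.add _) _ => exact: dDl
  | |- is_derive _ _ (@GRing.inv _) _ => eapply dVid
  | |- is_derive _ _ (@expR _) _ => exact: is_derive_expR
  | |- is_derive _ _ (fun y => ?F y) _ => eassumption
  | |- is_derive _ _ (fun y => ?F (@?g y)) _ => first [exact: dcst | eapply dcomp]
  | |- is_derive _ _ (fun y => _) _ => exact: dcst
  | |- is_derive _ _ _ _ => first [eassumption | (match goal with H : context [is_derive _ _ _ _] |- _ => eapply H end)]
  end.
Ltac der := eapply deq; [repeat der1 | cbv beta].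

Section mono.
Context {R : realType}.
Implicit Types (f g df dg : R -> R) (a b : R).

Lemma mono_le f df a b : a <= b ->
  (forall x, a <= x <= b -> is_derive x 1 f (df x)) ->
  (forall x, a < x < b -> 0 <= df x) -> f a <= f b.
Proof.
rewrite le_eqVlt => /predU1P[->//|ab] fd df0.
have fc : {within `[a, b], continuous f}.
  apply: continuous_in_subspaceT => x /[!inE]/= /[!in_itv]/= xab.
  exact: dcont (fd _ xab).
have fd' x : x \in `]a, b[%R -> is_derive x 1 f (df x).
  by rewrite in_itv/= => /andP[xa xb]; apply: fd; rewrite !ltW.
have [c cab ce] := MVT ab fd' fc.
rewrite -subr_ge0 ce mulr_ge0 ?subr_ge0 ?(ltW ab)//; apply: df0.
by move: cab; rewrite in_itv.
Qed.

Lemma mono_lt f df a b : a < b ->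
  (forall x, a <= x <= b -> is_derive x 1 f (df x)) ->
  (forall x, a < x < b -> 0 < df x) -> f a < f b.
Proof.
move=> ab fd df0.
have fc : {within `[a, b], continuous f}.
  apply: continuous_in_subspaceT => x /[!inE]/= /[!in_itv]/= xab.
  exact: dcont (fd _ xab).
have fd' x : x \in `]a, b[%R -> is_derive x 1 f (df x).
  by rewrite in_itv/= => /andP[xa xb]; apply: fd; rewrite !ltW.
have [c cab ce] := MVT ab fd' fc.
rewrite -subr_gt0 ce mulr_gt0 ?subr_gt0//; apply: df0.
by move: cab; rewrite in_itv.
Qed.

Lemma const_eq f a b : a <= b ->
  (forall x, a <= x <= b -> is_derive x 1 f 0) -> f a = f b.
Proof.
move=> ab fd; apply/eqP; rewrite eq_le (mono_le (df := fun=> 0) ab)//=.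
rewrite -lerN2; apply: (@mono_le (fun x => - f x) (fun=> 0) a b ab) => // x /fd h.
by der; rewrite oppr0.
Qed.

Lemma mono_norm f df g dg a b : a <= b ->
  (forall x, a <= x <= b -> is_derive x 1 f (df x)) ->
  (forall x, a <= x <= b -> is_derive x 1 g (dg x)) ->
  (forall x, a < x < b -> `|df x| <= dg x) -> `|f b - f a| <= g b - g a.
Proof.
move=> ab fd gd dfg; rewrite ler_norml; apply/andP; split.
  suff: (fun x => g x + f x) a <= (fun x => g x + f x) b by move=> /= ?; lra.
  apply: (@mono_le (fun x => g x + f x) (fun x => dg x + df x) a b ab) => // x xab.
    by have h1 := fd _ xab; have h2 := gd _ xab; der.
  by have := dfg _ xab; rewrite ler_norml => /andP[? ?]; lra.
suff: (fun x => g x - f x) a <= (fun x => g x - f x) b by move=> /= ?; lra.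
apply: (@mono_le (fun x => g x - f x) (fun x => dg x - df x) a b ab) => // x xab.
  by have h1 := fd _ xab; have h2 := gd _ xab; der.
by have := dfg _ xab; rewrite ler_norml => /andP[? ?]; lra.
Qed.

Lemma mvt_ex f df a b : a < b ->
  (forall x, a <= x <= b -> is_derive x 1 f (df x)) ->
  exists2 c, a < c < b & f b - f a = df c * (b - a).
Proof.
move=> ab fd.
have fc : {within `[a, b], continuous f}.
  apply: continuous_in_subspaceT => x /[!inE]/= /[!in_itv]/= xab.
  exact: dcont (fd _ xab).
have fd' x : x \in `]a, b[%R -> is_derive x 1 f (df x).
  by rewrite in_itv/= => /andP[xa xb]; apply: fd; rewrite !ltW.
have [c cab ce] := MVT ab fd' fc; exists c => //.
Qed.

Local Notation mu := (@lebesgue_measure R).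

Lemma continuous_integrable_itv f a b : continuous f ->
  mu.-integrable `[a, b] (EFin \o f).
Proof.
move=> fc; apply: continuous_compact_integrable; first exact: segment_compact.
exact: continuous_subspaceT.
Qed.

Lemma primitive_itv f a : continuous f ->
  exists F : R -> R, forall x : R, a < x -> is_derive x 1 F (f x).
Proof.
move=> fc; exists (fun x => \int[mu]_(t in `[a, x]) f t)%R => x ax.
have xx1 : x < x + 1 by rewrite ltrDl.
have [d e] := continuous_FTC1_closed xx1 (continuous_integrable_itv a (x + 1) fc) ax (fc x).
by split; [exact: d | rewrite -derive1E; exact: e].
Qed.

(** An integral from a base point is a primitive only to the right of that point. The primitives
    based at [x0 - n], normalized to vanish at [x0], agree wherever two of them are defined, hence
    glue to one on the whole line. *)
Lemma primitive_ex f (x0 : R) : continuous f ->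
  exists F : R -> R, F x0 = 0 /\ forall x : R, is_derive x 1 F (f x).
Proof.
move=> fc.
have Fe (n : nat) : {F : R -> R | forall x, x0 - n%:R < x -> is_derive x 1 F (f x)}.
  by apply/cid; exact: primitive_itv.
pose F n := projT1 (Fe n).
have Fd n x : x0 - n%:R < x -> is_derive x 1 (F n) (f x) by exact: (projT2 (Fe n)).
have FnE n k x : x0 - n.+1%:R < x -> x0 - k.+1%:R < x ->
    F n.+1 x - F n.+1 x0 = F k.+1 x - F k.+1 x0.
  move=> nx kx.
  have n0 i : x0 - i.+1%:R < x0 by rewrite ltrBlDr ltrDl ltr0n.
  pose D (x : R) := F n.+1 x - F k.+1 x.
  suff: D x = D x0 by rewrite /D; lra.
  have aux (z : R) : x0 - n.+1%:R < z -> x0 - k.+1%:R < z ->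
      is_derive z 1 D 0.
    move=> nz kz; have h1 := Fd _ _ nz; have h2 := Fd _ _ kz.
    by rewrite /D; der; rewrite subrr.
  case: (leP x x0) => [xx|/ltW xx].
    by apply: const_eq => // z /andP[xz _]; apply: aux; exact: lt_le_trans xz.
  by symmetry; apply: const_eq => // z /andP[xz _]; apply: aux; exact: lt_le_trans xz.
pose N x := (Num.truncn `|x - x0|).
have NP x : x0 - (N x).+1%:R < x.
  have : `|x - x0| < (N x).+1%:R by exact: truncnS_gt.
  by rewrite ltr_norml => /andP[? _]; lra.
exists (fun x => F (N x).+1 x - F (N x).+1 x0); split; first by rewrite subrr.
move=> x.
have x1 : x0 - (N x).+1%:R < x by [].
apply: (@dnear _ (fun y => F (N x).+1 y - F (N x).+1 x0)); last first.
  by have h := Fd _ _ (NP x); der; rewrite ?subr0 ?addr0 ?oppr0 ?addr0.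
near=> y; apply: FnE; last exact: NP.
near: y; exact: lt_nbhsr.
Unshelve. all: by end_near. Qed.

Definition prim (f : R -> R) : R -> R :=
  xget (fun=> 0) [set F : R -> R | F 0 = 0 /\ forall x : R, is_derive x 1 F (f x)].

Lemma primP f : continuous f ->
  prim f 0 = 0 /\ forall x : R, is_derive x 1 (prim f) (f x).
Proof.
move=> fc; rewrite /prim; case: xgetP => [F _ //|] h.
by have [F FP] := primitive_ex 0 fc; have := h F.
Qed.

(** Two integrations of [|f2| <= g2]. With [g] a multiple of a rapidly growing weight, a Picard step
    becomes an inequality between second derivatives. *)
Lemma second_order_comparison f f1 f2 g g1 g2 :
  (forall x : R, 0 <= x -> is_derive x 1 f (f1 x)) ->
  (forall x : R, 0 <= x -> is_derive x 1 f1 (f2 x)) ->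
  (forall x : R, 0 <= x -> is_derive x 1 g (g1 x)) ->
  (forall x : R, 0 <= x -> is_derive x 1 g1 (g2 x)) ->
  f 0 = 0 -> f1 0 = 0 -> 0 <= g 0 -> 0 <= g1 0 ->
  (forall x, 0 < x -> `|f2 x| <= g2 x) ->
  forall x, 0 <= x -> `|f x| <= g x /\ `|f1 x| <= g1 x.
Proof.
move=> fd f1d gd g1d f0 f10 g0 g10 h.
have A x : 0 <= x -> `|f1 x| <= g1 x.
  move=> x0; have := @mono_norm f1 f2 g1 g2 0 x x0.
  rewrite f10 subr0 => B; apply: (le_trans (B _ _ _)).
  - by move=> z /andP[z0 _]; exact: f1d.
  - by move=> z /andP[z0 _]; exact: g1d.
  - by move=> z /andP[z0 _]; exact: h.
  - by rewrite gerBl.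
move=> x x0; split; last exact: A.
have := @mono_norm f f1 g g1 0 x x0.
rewrite f0 subr0 => B; apply: (le_trans (B _ _ _)).
- by move=> z /andP[z0 _]; exact: fd.
- by move=> z /andP[z0 _]; exact: gd.
- by move=> z /andP[z0 _]; apply: A; exact: ltW.
- by rewrite gerBl.
Qed.

End mono.

(** * The Cauchy problem at infinity *)

Section picard.
Context {R : realType} (m : nat) (hm : (2 < m)%N).
Implicit Types (s t v a b x : R).

(** Cutting [v / s] off at 1 in absolute value makes the nonlinearity globally Lipschitz in [v]; the
    cut turns out to be inactive once [|v s| <= s] is proved. *)
Definition clip (t : R) : R := Num.max (-1) (Num.min t 1).

Lemma clip_norm_le1 t : `|clip t| <= 1.
Proof. by rewrite /clip ler_norml le_max lexx /= ge_max ge_min lexx orbT andbT lerNl; lra. Qed.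

Lemma clip_id t : `|t| <= 1 -> clip t = t.
Proof.
rewrite ler_norml /clip => /andP[t1 t2].
by rewrite (min_idPl _)// (max_idPr _).
Qed.

Lemma clip_ge1 t : 1 <= t -> clip t = 1.
Proof. by move=> t1; rewrite /clip (min_idPr _)// (max_idPr _)//; lra. Qed.

Lemma clipN t : clip (- t) = - clip t.
Proof.
rewrite /clip /Num.max /Num.min.
by do 4 case: ifP => /negP; rewrite -?real_leNgt ?num_real//; try lra.
Qed.

Lemma clip_lip a b : `|clip a - clip b| <= `|a - b|.
Proof.
have h11 : (-1 < 1 :> R) by lra.
rewrite /clip !maxElt !minElt.
have [a1|a1] := ltP a 1; have [b1|b1] := ltP b 1; rewrite ?h11;
  try (have [?|?] := ltP (-1) a); try (have [?|?] := ltP (-1) b);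
  have h1 := ler_norm (a - b); have h2 := ler_norm (- (a - b)); rewrite normrN in h2;
  by rewrite ler_norml; apply/andP; split; lra.
Qed.

Lemma clip_continuous : continuous clip.
Proof.
move=> t; apply: (@continuous_max _ R (cst (-1)) (fun t => Num.min t 1)); first exact: cst_continuous.
by apply: (@continuous_min _ R id (cst 1)) => //; exact: cst_continuous.
Qed.

Lemma pow_lip (n : nat) (M a b : R) : `|a| <= M -> `|b| <= M ->
  `|a ^+ n - b ^+ n| <= n%:R * M ^+ n.-1 * `|a - b|.
Proof.
move=> aM bM; have M0 : 0 <= M by exact: le_trans aM.
elim: n => [|n IH]; first by rewrite !expr0 subrr normr0 !mul0r.
have -> : a ^+ n.+1 - b ^+ n.+1 = a * (a ^+ n - b ^+ n) + (a - b) * b ^+ n.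
  by rewrite !exprS; ring.
apply: (le_trans (ler_normD _ _)); rewrite !normrM normrX /=.
have h1 : `|a| * `|a ^+ n - b ^+ n| <= n%:R * M ^+ n * `|a - b|.
  case: n IH => [|n] IH; first by rewrite !expr0 subrr normr0 mulr0 !mul0r.
  rewrite [M ^+ n.+1]exprS; have := ler_pM (normr_ge0 _) (normr_ge0 _) aM IH.
  by congr (_ <= _); rewrite /=; ring.
have h2 : `|a - b| * `|b| ^+ n <= M ^+ n * `|a - b|.
  by rewrite mulrC ler_wpM2r// lerXn2r ?nnegrE.
by rewrite mulrS; lra.
Qed.

(** Where [|v| <= s] this is [s^-4 v^(2m+1)]. The value 0 for [s <= 0] extends the equation
    continuously through the singular point. *)
Definition G (s v : R) : R :=
  if s <= 0 then 0 else s ^+ (2 * m - 3) * clip (v / s) ^+ (2 * m).+1.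

Lemma G_bound s v : 0 <= s -> `|G s v| <= s ^+ (2 * m - 3).
Proof.
move=> s0; rewrite /G; case: (leP s 0) => s1; first by rewrite normr0 exprn_ge0.
rewrite normrM normrX ger0_norm ?exprn_ge0// ler_piMr ?exprn_ge0//.
by rewrite normrX exprn_ile1// clip_norm_le1.
Qed.

Lemma G_lip s v1 v2 : 0 < s ->
  `|G s v1 - G s v2| <= (2 * m).+1%:R * s ^+ (2 * m - 4) * `|v1 - v2|.
Proof.
move=> s0; rewrite /G (leNgt s) s0 /=.
rewrite -mulrBr normrM ger0_norm ?exprn_ge0 ?(ltW s0)//.
have h := pow_lip (2 * m).+1 (clip_norm_le1 (v1 / s)) (clip_norm_le1 (v2 / s)).
have h2 := clip_lip (v1 / s) (v2 / s).
rewrite expr1n mulr1 in h.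
have -> : (2 * m - 3 = (2 * m - 4).+1)%N by lia.
rewrite exprS.
have e : `|v1 / s - v2 / s| = `|v1 - v2| / s.
  by rewrite -mulrBl normrM (gtr0_norm (x := s^-1)) ?invr_gt0.
rewrite e in h2.
apply: (@le_trans _ _ (s * s ^+ (2 * m - 4) * ((2 * m).+1%:R * (`|v1 - v2| / s)))).
  apply: ler_wpM2l; first by rewrite mulr_ge0 ?exprn_ge0 ?ltW.
  by apply: (le_trans h); rewrite ler_wpM2l.
by rewrite le_eqVlt; apply/orP; left; apply/eqP; field; rewrite gt_eqF.
Qed.

Lemma G_continuous (v : R -> R) : (forall s, 0 < s -> {for s, continuous v}) ->
  continuous (fun s => G s (v s)).
Proof.
move=> vc s; case: (ltgtP s 0) => s0.
- apply: (@near_cst_continuous _ _ 0); near=> t.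
  rewrite /G ifT//; apply: ltW; near: t; exact: lt_nbhsl.
- have e : \forall t \near s, t ^+ (2 * m - 3) * clip (v t / t) ^+ (2 * m).+1 = G t (v t).
    near=> t; rewrite /G ifF//; apply/negbTE; rewrite -ltNge.
    near: t; exact: lt_nbhsr.
  rewrite /continuous_at -(nbhs_singleton e).
  apply: cvg_trans; first by apply: near_eq_cvg e.
  apply: cvgM; first exact: exprn_continuous.
  apply: (@continuous_comp _ _ _ (fun t => clip (v t / t)) (fun x => x ^+ _)); last exact: exprn_continuous.
  apply: (@continuous_comp _ _ _ (fun t => v t / t) clip); last exact: clip_continuous.
  by apply: cvgM; [exact: vc | apply: cvgV; rewrite ?gt_eqF].
- rewrite s0 /continuous_at {2}/G lexx; apply/cvgrPdist_le => e e0.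
  near=> t; rewrite sub0r normrN.
  have t1 : `|t| <= 1 by near: t; exact: (@nbhs0_le R R 1 ltr01).
  have te : `|t| <= e by near: t; exact: (@nbhs0_le R R e e0).
  case: (leP t 0) => t0; first by rewrite /G t0 normr0 ltW.
  apply: (le_trans (G_bound _ (ltW t0))).
  have -> : (2 * m - 3 = (2 * m - 4).+1)%N by lia.
  rewrite exprS; apply: (le_trans _ te); rewrite (gtr0_norm t0).
  rewrite ler_piMr ?(ltW t0)// exprn_ile1 ?(ltW t0)//.
  by rewrite (le_trans (ler_norm _)).
Unshelve. all: by end_near. Qed.
(** The intervals of centre [u n] and radius [2 C 2^-n] are nested; the limit is the supremum of
    their left ends, and the rate comes with it. *)
Lemma nested_limit (u : nat -> R) (C : R) :
  (forall n, `|u n.+1 - u n| <= C * 2^-1 ^+ n) ->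
  exists l, forall n, `|l - u n| <= 2 * C * 2^-1 ^+ n.
Proof.
move=> h.
pose a n := u n - 2 * C * 2^-1 ^+ n; pose b n := u n + 2 * C * 2^-1 ^+ n.
have C0 : 0 <= C by have := h 0%N; rewrite expr0 mulr1; apply: le_trans.
have p0 n : 0 <= C * 2^-1 ^+ n :> R by rewrite mulr_ge0// exprn_ge0// invr_ge0.
have aS n : a n <= a n.+1.
  by have := h n; rewrite /a exprS ler_norml => /andP[]; lra.
have bS n : b n.+1 <= b n.
  by have := h n; rewrite /b exprS ler_norml => /andP[]; lra.
have aM n k : a n <= a (n + k)%N.
  by elim: k => [|k IH]; rewrite ?addn0// addnS (le_trans IH).
have bM n k : b (n + k)%N <= b n.
  by elim: k => [|k IH]; rewrite ?addn0// addnS (le_trans _ IH).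
have ab n k : a n <= b k.
  apply: (le_trans (aM n k)); apply: (@le_trans _ _ (b (n + k)%N)).
    by rewrite /a /b; have := p0 (n + k)%N; lra.
  by rewrite addnC.
have hs : has_sup (range a).
  by split; [exists (a 0%N), 0%N | exists (b 0%N) => _ [n _ <-]].
exists (sup (range a)) => n.
have h1 : a n <= sup (range a) by apply: (ub_le_sup hs.2); exists n.
have h2 : sup (range a) <= b n by apply: (ge_sup hs.1) => _ [k _ <-].
by rewrite ler_norml; move: h1 h2; rewrite /a /b => *; apply/andP; split; lra.
Qed.

Lemma geometric_small (C e : R) : 0 < e -> exists n, C * 2^-1 ^+ n <= e.
Proof.
move=> e0; have : geometric C (2^-1 : R) @ \oo --> 0.
  by apply: cvg_geometric; rewrite ger0_norm// invf_lt1//; lra.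
move=> /cvgrPdist_le /(_ e e0) [n _ /(_ n (leqnn n))] /=.
rewrite sub0r normrN => hn; exists n.
exact: le_trans (ler_norm _) hn.
Qed.

Let T (v : R -> R) (s : R) : R := s - prim (prim (fun s => G s (v s))) s.
Let T1 (v : R -> R) (s : R) : R := 1 - prim (fun s => G s (v s)) s.

Let TP (v : R -> R) : (forall s, 0 < s -> {for s, continuous v}) ->
  [/\ T v 0 = 0, T1 v 0 = 1, forall s, is_derive s 1 (T v) (T1 v s) &
      forall s, is_derive s 1 (T1 v) (- G s (v s))].
Proof.
move=> vc; have Gc := G_continuous vc.
have [p0 pd] := primP Gc.
have pc : continuous (prim (fun s => G s (v s))) by move=> s; exact: dcont (pd s).
have [q0 qd] := primP pc.
split; rewrite /T /T1 ?q0 ?p0 ?subr0// => s.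
  by have h := qd s; der.
by have h := pd s; der; rewrite sub0r.
Qed.

Let k := (m - 3)%N.
Let mE : m = k.+3. Proof. by rewrite /k; lia. Qed.

(** The weight [exp(2 s^(m-1))] satisfies [W'' >= 2 Lip W], where [Lip = (2m+1) s^(2m-4)] is the
    Lipschitz constant of [G]; the factor 2 makes each Picard step halve the weighted distance. *)
Let W s : R := expR (2 * s ^+ k.+2).
Let W1 s : R := 2 * k.+2%:R * s ^+ k.+1 * W s.
Let W2 s : R := (4 * k.+2%:R ^+ 2 * s ^+ (k.*2).+2 + 2 * k.+2%:R * k.+1%:R * s ^+ k) * W s.

Let Wd s : is_derive s 1 W (W1 s).
Proof. by rewrite /W; der; rewrite /W1 /W /=; ring. Qed.

Let W1d s : is_derive s 1 W1 (W2 s).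
Proof.
have h := Wd s; rewrite /W1; der; rewrite /W2 /W1 /=.
by rewrite -addnn !exprS exprD; ring.
Qed.

Let W_ge s : 0 <= s -> 1 <= W s /\ s <= W s.
Proof.
move=> s0; have h := expR_ge1Dx (2 * s ^+ k.+2); rewrite -/(W s) in h.
have p0 : 0 <= s ^+ k.+2 by rewrite exprn_ge0.
split; first by lra.
case: (leP s 1) => s1; first by lra.
have : 1 <= s ^+ k.+1 by rewrite exprn_ege1// ltW.
by rewrite exprS in p0 h; nra.
Qed.

Let W2_ge s : 0 < s -> 2 * ((2 * m).+1%:R * s ^+ (2 * m - 4)) * W s <= W2 s.
Proof.
move=> s0; rewrite /W2 ler_wpM2r ?expR_ge0//.
have -> : (2 * m - 4 = (k.*2).+2)%N by lia.
have -> : ((2 * m).+1%:R = 2 * k%:R + 7 :> R) by rewrite mE -natrM -natrD; congr (_%:R); lia.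
have h : 0 <= 2 * k.+2%:R * k.+1%:R * s ^+ k :> R by rewrite !mulr_ge0// exprn_ge0// ltW.
(* With [m = k + 3] this is [2 (2m+1) <= 4 (m-1)^2], true from [m = 3] on: 14 against 16. *)
suff : (2 * (2 * k%:R + 7)) * s ^+ (k.*2).+2 <= 4 * k.+2%:R ^+ 2 * s ^+ (k.*2).+2 by lra.
rewrite ler_wpM2r ?exprn_ge0 ?ltW//.
have k0 : 0 <= k%:R :> R by [].
have -> : k.+2%:R = k%:R + 2 :> R by rewrite -natrD addn2.
by nra.
Qed.

Let W2_ge' s : 0 < s -> s ^+ (2 * m - 3) <= W2 s.
Proof.
move=> s0; apply: le_trans (W2_ge s0).
have -> : (2 * m - 3 = (2 * m - 4).+1)%N by lia.
have [_ h] := W_ge (ltW s0).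
rewrite exprS mulrC.
have p0 : 0 <= s ^+ (2 * m - 4) by rewrite exprn_ge0// ltW.
have : 1 <= (2 * m).+1%:R :> R by rewrite ler1n.
set N := _%:R => N1.
apply: (@le_trans _ _ (1 * s ^+ (2 * m - 4) * W s)); first by rewrite mul1r ler_wpM2l.
rewrite ler_wpM2r ?expR_ge0//.
by rewrite mulrA ler_wpM2r//; lra.
Qed.

Let vn n := iter n T id.
Let vnc n : forall s, 0 < s -> {for s, continuous (vn n)}.
Proof.
elim: n => [|n IH] s s0; first exact: (dcont (did s)).
by have [_ _ h _] := TP IH; exact: (dcont (h s)).
Qed.

(** The first step uses the bound [|G| <= s^(2m-3) <= W2], the later ones the Lipschitz estimate
    against [W2_ge]. *)
Let vnd n s : 0 <= s -> `|vn n.+1 s - vn n s| <= W s * 2^-1 ^+ n.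
Proof.
elim: n s => [|n IH] s s0.
  rewrite expr0 mulr1 /=.
  have [p0 p1 pd pd1] := TP (@vnc 0).
  have := @second_order_comparison _ (fun s => T id s - s) (fun s => T1 id s - 1)
    (fun s => - G s s) W W1 W2.
  case/(_ _ _ _ _ _ _ _ _ _ _ s0).
  - by move=> x _; have h : is_derive x 1 (T1 id) (- G x x) := pd1 x; der; lra.
  - by move=> x _; exact: Wd.
  - by move=> x _; exact: W1d.
  - by rewrite p0 subr0.
  - by rewrite p1 subrr.
  - exact: expR_ge0.
  - by rewrite /W1 expr0n /= mulr0 mul0r.
  - by move=> x x0; rewrite normrN (le_trans (G_bound _ (ltW x0)))// W2_ge'.
  - by [].
have [p0 p1 pd pd1] := TP (@vnc n); have [q0 q1 qd qd1] := TP (@vnc n.+1).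
have := @second_order_comparison _ (fun s => T (vn n.+1) s - T (vn n) s)
    (fun s => T1 (vn n.+1) s - T1 (vn n) s)
    (fun s => - G s (vn n.+1 s) - (- G s (vn n s)))
    (fun s => W s * 2^-1 ^+ n.+1) (fun s => W1 s * 2^-1 ^+ n.+1) (fun s => W2 s * 2^-1 ^+ n.+1).
have e0 : 0 <= 2^-1 ^+ n.+1 :> R by rewrite exprn_ge0// invr_ge0.
case/(_ _ _ _ _ _ _ _ _ _ _ s0).
- by move=> x _; have h := Wd x; der; rewrite mulr0 addr0.
- by move=> x _; have h := W1d x; der; rewrite mulr0 addr0.
- by rewrite p0 q0 subrr.
- by rewrite p1 q1 subrr.
- by rewrite mulr_ge0// expR_ge0.
- by rewrite /W1 expr0n /= mulr0 !mul0r.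
move=> x x0; rewrite -opprD normrN (le_trans (G_lip _ _ x0))//.
have := IH x (ltW x0); have := W2_ge x0.
set A := _%:R * _ ^+ _ => hA h.
have A0 : 0 <= A by rewrite mulr_ge0// exprn_ge0// ltW.
apply: (@le_trans _ _ (A * (W x * 2^-1 ^+ n))); first by rewrite ler_wpM2l.
have e1 : 0 <= 2^-1 ^+ n :> R by rewrite exprn_ge0// invr_ge0.
rewrite exprS.
have := ler_wpM2r e1 hA; lra.
by [].
Qed.

Lemma truncated_solution : exists v v1 : R -> R,
  [/\ v 0 = 0, v1 0 = 1, forall s, is_derive s 1 v (v1 s) &
      forall s, is_derive s 1 v1 (- G s (v s))].
Proof.
have lim s : {l | 0 <= s -> forall n, `|l - vn n s| <= 2 * W s * 2^-1 ^+ n}.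
  (* For [s < 0] the iterates are not controlled and the value 0 is a mere default. *)
  apply: cid; have [s0|s0] := leP 0 s; last by exists 0.
  have [l hl] := nested_limit (u := fun n => vn n s) (fun n => @vnd n s s0).
  by exists l.
pose v s := projT1 (lim s).
have hv s : 0 <= s -> forall n, `|v s - vn n s| <= 2 * W s * 2^-1 ^+ n.
  exact: (projT2 (lim s)).
have vc s : 0 < s -> {for s, continuous v}.
  move=> s0; apply/cvgrPdist_le => e e0.
  have Wc : {for s, continuous W} by exact: dcont (Wd s).
  have [n hn] : exists n, 2 * (W s + 1) * 2^-1 ^+ n <= e / 3.
    have W0 : 0 < W s := expR_gt0 _.
    by apply: geometric_small; lra.
  have e3 : 0 < e / 3 by lra.
  near=> t.
  have t0 : 0 < t by near: t; exact: lt_nbhsr.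
  have Wt : W t <= W s + 1.
    have : `|W s - W t| <= 1 by near: t; move/cvgrPdist_le : Wc; apply; lra.
    by rewrite ler_norml => /andP[]; lra.
  have vt : `|vn n s - vn n t| <= e / 3.
    by near: t; have /cvgrPdist_le := @vnc n s s0; apply.
  have h1 := hv _ (ltW s0) n; have h2 := hv _ (ltW t0) n.
  have e1 : 0 <= 2^-1 ^+ n :> R by rewrite exprn_ge0// invr_ge0.
  have h3 : 2 * W t * 2^-1 ^+ n <= e / 3.
    by apply: (le_trans _ hn); rewrite ler_wpM2r//; lra.
  have h4 : 2 * W s * 2^-1 ^+ n <= e / 3.
    by apply: (le_trans _ hn); rewrite ler_wpM2r//; lra.
  have := le_trans h1 h4; have := le_trans h2 h3; move: vt.
  by rewrite !ler_norml => /andP[? ?] /andP[? ?] /andP[? ?]; apply/andP; split; lra.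
have [p0 p1 pd pd1] := TP vc.
have Tv s : 0 <= s -> T v s = v s.
  move=> s0; apply/eqP; rewrite -subr_eq0 -normr_le0; apply/ler_addgt0Pr => e e0.
  rewrite add0r.
  have W0 : 0 < W s := expR_gt0 _.
  have [n hn] : exists n, 4 * W s * 2^-1 ^+ n <= e.
    exact: geometric_small.
  apply: le_trans hn.
  have h1 := hv s s0 n.+1.
  have [q0 q1 qd qd1] := TP (@vnc n).
  have := @second_order_comparison _ (fun s => T v s - T (vn n) s)
    (fun s => T1 v s - T1 (vn n) s)
    (fun s => - G s (v s) - (- G s (vn n s)))
    (fun s => W s * 2^-1 ^+ n) (fun s => W1 s * 2^-1 ^+ n) (fun s => W2 s * 2^-1 ^+ n).
  have e1 : 0 <= 2^-1 ^+ n :> R by rewrite exprn_ge0// invr_ge0.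
  case/(_ _ _ _ _ _ _ _ _ _ _ s0).
  - by move=> x _; have h := Wd x; der; rewrite mulr0 addr0.
  - by move=> x _; have h := W1d x; der; rewrite mulr0 addr0.
  - by rewrite p0 q0 subrr.
  - by rewrite p1 q1 subrr.
  - by rewrite mulr_ge0// expR_ge0.
  - by rewrite /W1 expr0n /= mulr0 !mul0r.
  - move=> x x0; rewrite -opprD normrN (le_trans (G_lip _ _ x0))//.
    have := hv x (ltW x0) n; have := W2_ge x0.
    set A := _%:R * _ ^+ _ => hA h.
    have A0 : 0 <= A by rewrite mulr_ge0// exprn_ge0// ltW.
    apply: (@le_trans _ _ (A * (2 * W x * 2^-1 ^+ n))); first by rewrite ler_wpM2l.
    have := ler_wpM2r e1 hA; lra.
  move=> h2 _; move: h1 h2; rewrite [_ ^+ n.+1]exprS /= -/(vn n) => h1 h2.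
  have WW : 0 <= W s * 2^-1 ^+ n by rewrite mulr_ge0// ltW.
  move: h1 h2; rewrite !ler_norml => /andP[? ?] /andP[? ?]; apply/andP; split; lra.
(* [T v] rather than [v]: both agree for [s >= 0], but [T v] is differentiable on the whole line and
   solves the equation also for [s <= 0], where [G] is 0. *)
exists (T v), (T1 v); split => // s.
apply: (deq (pd1 s)); rewrite /G; case: (leP s 0) => // s0.
by rewrite Tv// ltW.
Unshelve. all: by end_near. Qed.

(** The truncated solution never reaches the truncation. With [w = v / s], the energy
    [z^2 / (2 s^(2m)) + P w] is nonincreasing and starts from [P 1] at [s = 0]; since [P] is even
    and exceeds [P 1] beyond 1, [P w <= P 1] forces [|w| <= 1]. *)
Lemma emden_fowler_solution : exists v v1 : R -> R,
  [/\ v 0 = 0, v1 0 = 1, forall s, is_derive s 1 v (v1 s),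
      forall s, 0 < s -> is_derive s 1 v1 (- (v s ^+ (2 * m).+1 * s^-1 ^+ 4)) &
      [/\ forall s, {for s, continuous v1}, forall s, 0 <= s -> `|v s| <= s &
       forall s, 0 <= s <= 1 -> `|v1 s - 1| <= s]].
Proof.
have [v [v1 [v0 v10 vd v1d]]] := truncated_solution.
have pow1 (n : nat) s : 0 <= s <= 1 -> s ^+ n.+1 <= s.
  by move=> /andP[s0 s1]; rewrite exprS ler_piMr// exprn_ile1.
have v1_close s : 0 <= s <= 1 -> `|v1 s - 1| <= s.
  move=> /andP[s0 s1]; have := @mono_norm _ v1 (fun s => - G s (v s)) (fun x => x) (fun=> 1) 0 s s0.
  rewrite v10 subr0 => h; apply: h => x /andP[x0 xs].
  rewrite normrN (le_trans (G_bound _ (ltW x0)))// exprn_ile1 ?(ltW x0)//.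
  by rewrite ltW// (lt_le_trans xs).
have v_close s : 0 <= s <= 1 -> `|v s - s| <= s * s.
  move=> /andP[s0 s1].
  have := @mono_norm _ (fun s => v s - s) (fun s => v1 s - 1)
    (fun x => x * x) (fun x => 2 * x) 0 s s0.
  rewrite v0 mulr0 !subr0.
  have A x : 0 <= x <= s -> is_derive x 1 (fun s => v s - s) (v1 x - 1).
    by move=> _; have h := vd x; der.
  have B x : 0 <= x <= s -> is_derive x 1 (fun y : R => y * y) (2 * x).
    by move=> _; der; lra.
  move=> /(_ A B); apply=> x /andP[x0 xs].
  by apply: (le_trans (v1_close x _)); lra.
pose F t := clip t ^+ (2 * m).+1.
have Fc : continuous F.
  by move=> t; apply: (@continuous_comp _ _ _ clip (fun x => x ^+ _)); [exact: clip_continuous|exact: exprn_continuous].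
have F1 t : `|F t| <= 1 by rewrite /F normrX exprn_ile1// clip_norm_le1.
have FN t : F (- t) = - F t.
  by rewrite /F clipN exprNn -signr_odd /= oddM /= expr1 mulN1r.
have [P0 Pd] := primP Fc; set P := prim F in P0 Pd.
have PN t : 0 <= t -> P (- t) = P t.
  move=> t0.
  have A x : 0 <= x <= t -> is_derive x 1 (fun t => P (- t) - P t) 0.
    by move=> _; have h1 := Pd (- x); have h2 := Pd x; der; rewrite FN; lra.
  by have := const_eq t0 A; rewrite oppr0 subrr; lra.
have P_gt t : 1 < t -> P 1 < P t.
  move=> t1; apply: (mono_lt t1 (fun x _ => Pd x)) => x /andP[x1 _].
  by rewrite /F clip_ge1 ?(ltW x1)// expr1n.
(* For [s > 0], [z = s^2 w'] with [w = v / s], so that [z' = - s^(2m-2) F w]; multiplying by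
   [z / s^(2m)] yields the energy [E] below. *)
pose z s := s * v1 s - v s.
have zd s : is_derive s 1 z (- (s * G s (v s))).
  by have h1 := vd s; have h2 := v1d s; rewrite /z; der; rewrite /=; ring.
(* This makes the kinetic part [z^2 / s^(2m)] vanish at the singular point. *)
have z_small s : 0 <= s <= 1 -> `|z s| <= s ^+ (2 * m - 1).
  move=> /andP[s0 s1].
  have zz := @mono_norm _ z (fun s => - (s * G s (v s))) (fun x => x ^+ (2 * m - 1))
    (fun x => (2 * m - 1)%:R * x ^+ (2 * m - 1).-1 * 1) 0 s s0.
  have z0 : z 0 = 0 by rewrite /z v0; lra.
  have e : (2 * m - 1 = (2 * m - 3).+2)%N by lia.
  rewrite z0 e expr0n subr0 subr0 -e in zz.
  have B x : 0 <= x <= s -> is_derive x 1 (fun y : R => y ^+ (2 * m - 1))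
     ((2 * m - 1)%:R * x ^+ (2 * m - 1).-1 * 1) by move=> _; exact: (dX _ (did x)).
  apply: (zz (fun x _ => zd x) B) => x /andP[x0 xs].
  rewrite normrN normrM gtr0_norm// mulr1 e /= exprS.
  have h := G_bound (v x) (ltW x0).
  apply: (@le_trans _ _ (1 * (x * x ^+ (2 * m - 3)))); first by rewrite mul1r ler_wpM2l// ltW.
  by rewrite ler_wpM2r ?mulr_ge0 ?exprn_ge0 ?(ltW x0)// ler1n.
pose E s := 2^-1 * z s ^+ 2 * s^-1 ^+ (2 * m) + P (v s / s).
have Ed s : 0 < s -> is_derive s 1 E (- (m%:R * z s ^+ 2 * s^-1 ^+ (2 * m).+1)).
  move=> s0; have sn0 : s != 0 by rewrite gt_eqF.
  have h1 := vd s; have h2 := zd s; have h3 := Pd (v s / s); rewrite /E; der => //.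
  rewrite /G (leNgt s) s0 /= -/(F (v s / s)) /z.
  have [j mj] : exists j, m = j.+2 by exists (m - 2)%N; lia.
  have -> : (2 * m - 3 = (2 * j).+1)%N by lia.
  have -> : (2 * m = (2 * j).+4)%N by lia.
  have -> : m%:R = j%:R + 2 :> R by rewrite mj -addn2 natrD.
  have -> : (2 * j).+4%:R = 2 * j%:R + 4 :> R by rewrite -natrM -natrD; congr (_%:R); lia.
  rewrite /= !exprS !expr0.
  set X := s ^+ (2 * j); set Y := s^-1 ^+ (2 * j).
  have XY : X * Y = 1 by rewrite /X /Y -exprMn mulfV// expr1n.
  set f := F _; set a := v1 s; set b := v s.
  have -> : Y = X^-1 by rewrite -(mul1r X^-1) -XY mulrAC mulfV ?mul1r// expf_neq0.
  by field; rewrite expf_neq0.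
have E_lim s : 0 < s <= 1 -> E s <= P 1 + 2 * s.
  move=> /andP[s0 s1]; have ss : 0 <= s <= 1 by rewrite (ltW s0).
  have hw : `|v s / s - 1| <= s.
    have -> : v s / s - 1 = (v s - s) / s by field; rewrite gt_eqF.
    by rewrite normrM (gtr0_norm (x := s^-1)) ?invr_gt0// ler_pdivrMr// v_close.
  have hP : P (v s / s) <= P 1 + s.
    have lip a b : a <= b -> `|P b - P a| <= b - a.
      by move=> ab; apply: (mono_norm ab (fun x _ => Pd x) (fun x _ => did x)) => x _.
    case: (leP (v s / s) 1) => w1.
      by have := lip _ _ w1; move: hw; rewrite !ler_norml => /andP[? ?] /andP[? ?]; lra.
    by have := lip _ _ (ltW w1); move: hw; rewrite !ler_norml => /andP[? ?] /andP[? ?]; lra.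
  have hz : z s ^+ 2 * s^-1 ^+ (2 * m) <= s.
    rewrite exprVn ler_pdivrMr ?exprn_gt0//.
    have := z_small _ ss; rewrite -(@ler_pXn2r _ 2) ?nnegrE ?normr_ge0 ?exprn_ge0 ?(ltW s0)//.
    rewrite -normrX ger0_norm ?sqr_ge0// => /le_trans; apply.
    rewrite -exprM -exprS.
    have -> : ((2 * m - 1) * 2 = (2 * m).+1 + (2 * m - 3))%N by lia.
    by rewrite exprD ler_piMr ?exprn_ge0 ?exprn_ile1 ?(ltW s0)//.
  rewrite /E; lra.
have E_le s : 0 < s -> E s <= P 1.
  move=> s0; apply/ler_addgt0Pr => e e0.
  pose t := Num.min (Num.min s 1) (e / 2).
  have t0 : 0 < t by rewrite /t !lt_min s0 ltr01 /=; lra.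
  have ts : t <= s by rewrite /t !ge_min lexx.
  have t1 : t <= 1 by rewrite /t !ge_min lexx orbT.
  have te : t <= e / 2 by rewrite /t !ge_min lexx !orbT.
  have h := E_lim t; rewrite t0 t1 in h; have {}h := h isT.
  have : - E t <= - E s.
    have A x : t <= x <= s -> is_derive x 1 (fun s => - E s) (- - (m%:R * z x ^+ 2 * x^-1 ^+ (2 * m).+1)).
      by move=> /andP[tx _]; have hh := Ed x (lt_le_trans t0 tx); der.
    apply: (mono_le ts A) => x /andP[tx _]; rewrite opprK mulr_ge0//.
      by rewrite mulr_ge0// sqr_ge0.
    by rewrite exprn_ge0// invr_ge0 ltW// (lt_trans t0).
  lra.
have vs s : 0 <= s -> `|v s| <= s.
  rewrite le_eqVlt => /predU1P[<-|s0]; first by rewrite v0 normr0.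
  rewrite leNgt; apply/negP => h.
  have h1 : 1 < `|v s / s|.
    by rewrite normrM (gtr0_norm (x := s^-1)) ?invr_gt0// ltr_pdivlMr// mul1r.
  have : P (v s / s) <= P 1.
    apply: le_trans (E_le s s0); rewrite /E lerDr mulr_ge0//.
      by rewrite mulr_ge0// sqr_ge0.
    by rewrite exprn_ge0// invr_ge0 ltW.
  have := P_gt _ h1; case: (leP 0 (v s / s)) => w0.
    by rewrite ger0_norm//; lra.
  by rewrite ltr0_norm// -(PN (- _)) ?opprK; lra.
exists v, v1; split => //; last by split=> // s; exact: dcont (v1d s).
move=> s s0; apply: (deq (v1d s)); congr (- _).
rewrite /G (leNgt s) s0 /= clip_id; last first.
  rewrite normrM (gtr0_norm (x := s^-1)) ?invr_gt0// ler_pdivrMr// mul1r.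
  by apply: vs; exact: ltW.
rewrite expr_div_n.
have -> : ((2 * m).+1 = (2 * m - 3) + 4)%N by lia.
rewrite [s ^+ (_ + 4)]exprD; field.
by rewrite gt_eqF// gt_eqF// exprn_gt0.
Qed.

End picard.

(** * Oscillation *)

Section emden_fowler_zeros.
Context {R : realType} (m : nat) (hm : (2 < m)%N).
Implicit Types (s t x T : R).

Let m3 : 3 <= m%:R :> R. Proof. by rewrite (ler_nat R 3). Qed.

Let m0 : (0 < m)%N. Proof. by lia. Qed.
Let mm0 : (0 < 2 * m)%N. Proof. by lia. Qed.

(** A positive solution is concave, hence increasing, since a descending tangent would carry it to
    0. Integrating the equation over [[s, 2s]] bounds [v1] below by a multiple of [v^(2m+1) s^-3],
    and integrating the resulting inequality for [v^(-2m)] bounds [v] above. *)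
Lemma positive_solution_bounds (v v1 : R -> R) (s0 : R) : 0 < s0 ->
  (forall s, 0 < s -> is_derive s 1 v (v1 s)) ->
  (forall s, 0 < s -> is_derive s 1 v1 (- (v s ^+ (2 * m).+1 * s^-1 ^+ 4))) ->
  (forall s, s0 <= s -> 0 < v s) ->
  forall s, 2 * s0 <= s -> v s ^+ (2 * m) <= 2 * s ^+ 2 /\ `|v1 s| <= 2 * v s / s.
Proof.
move=> s00 vd v1d vpos.
have pos s : s0 <= s -> 0 < s by exact: lt_le_trans.
have v1_dec a b : s0 <= a -> a <= b -> v1 b <= v1 a.
  move=> sa ab; rewrite -lerN2.
  have A x : a <= x <= b -> is_derive x 1 (fun x => - v1 x) (v x ^+ (2 * m).+1 * x^-1 ^+ 4).
    move=> /andP[ax _]; have h := v1d x (pos _ (le_trans sa ax)).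
    by der; rewrite opprK.
  apply: (mono_le ab A) => x /andP[ax _]; have sx := ltW (le_lt_trans sa ax).
  by rewrite mulr_ge0// exprn_ge0// ?invr_ge0 ltW// ?vpos// pos.
have v1_ge0 s : s0 <= s -> 0 <= v1 s.
  move=> ss; rewrite leNgt; apply/negP => v1s.
  (* The point where the tangent at [s] meets 0; by concavity [v b <= 0]. *)
  pose b := s + v s / (- v1 s).
  have vs0 := vpos s ss.
  have sb : s <= b by rewrite /b lerDl divr_ge0// ?ltW// oppr_gt0.
  have A x : s <= x <= b -> is_derive x 1 (fun x => v1 s * x - v x) (v1 s - v1 x).
    move=> /andP[sx _]; have h := vd x (pos _ (le_trans ss sx)).
    by der; ring.
  have h : v1 s * s - v s <= v1 s * b - v b.
    apply: (mono_le sb A) => x /andP[sx _]; rewrite subr_ge0.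
    exact: v1_dec (ltW sx).
  have : v1 s * b = v1 s * s - v s.
    by rewrite /b; field; rewrite lt_eqF.
  by have := vpos b (le_trans ss sb); lra.
have v_inc a b : s0 <= a -> a <= b -> v a <= v b.
  move=> sa ab.
  apply: (@mono_le _ v v1) => // [x /andP[ax _]|x /andP[ax _]].
    exact: vd (pos _ (le_trans sa ax)).
  by apply: v1_ge0; exact: (le_trans sa (ltW ax)).
(* [7/24 = (1 - 1/8) / 3] comes from the integral of [x^-4] over [[s, 2s]], with [v x >= v s] and
   [v1 (2s) >= 0]. *)
have v1_low s : s0 <= s -> 7 / 24 * v s ^+ (2 * m).+1 * s^-1 ^+ 3 <= v1 s.
  move=> ss; have sp := pos _ ss.
  have s2 : s <= 2 * s by lra.
  pose K := v s ^+ (2 * m).+1.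
  have A x : s <= x <= 2 * s -> is_derive x 1 (fun x => K / 3 * x^-1 ^+ 3 - v1 x)
     (v x ^+ (2 * m).+1 * x^-1 ^+ 4 - K * x^-1 ^+ 4).
    move=> /andP[sx _]; have xp := pos _ (le_trans ss sx).
    have h := v1d x xp; der; first by rewrite gt_eqF.
    by rewrite /=; field; rewrite gt_eqF.
  have : K / 3 * s^-1 ^+ 3 - v1 s <= K / 3 * (2 * s)^-1 ^+ 3 - v1 (2 * s).
    apply: (mono_le s2 A) => x /andP[sx _].
    have xp := pos _ (le_trans ss (ltW sx)).
    rewrite -mulrBl mulr_ge0// ?exprn_ge0 ?invr_ge0 ?(ltW xp)// subr_ge0 /K.
    rewrite lerXn2r ?nnegrE ?(ltW (vpos _ _))//; last exact: v_inc (ltW sx).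
    exact: le_trans (ltW sx).
  have := v1_ge0 (2 * s) (le_trans ss s2).
  rewrite invfM exprMn -/K; set B := s^-1 ^+ 3.
  have -> : (2^-1 : R) ^+ 3 = 8^-1 by rewrite exprVn; congr (_^-1); rewrite -natrX.
  lra.
move=> s s2; have ss : s0 <= s by lra.
have sp := pos _ ss; have vp := vpos _ ss.
split; last first.
  have ls : s0 < s by lra.
  have [x xs hx] : exists2 x, s0 < x < s & v s - v s0 = v1 x * (s - s0).
    by apply: mvt_ex => // x /andP[sx _]; exact: vd (pos _ sx).
  have : v1 s <= v1 x by move: xs => /andP[a b]; apply: v1_dec; exact: ltW.
  rewrite ger0_norm ?v1_ge0// ler_pdivlMr// => h.
  have v0 := vpos s0 (lexx _); have := v1_ge0 _ ss.
  have : v1 s * (s - s0) <= v1 x * (s - s0) by rewrite ler_wpM2r// subr_ge0 ltW.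
  nra.
have s22 : s <= 2 * s by lra.
(* [v^(-2m)] decreases at rate at least [2m (7/24) x^-3]. Over [[s, 2s]] this gives
   [v^(-2m) >= (7m/32) s^-2], and [7m/32 >= 1/2] for [m >= 3]. *)
have A x : s <= x <= 2 * s -> is_derive x 1 (fun x => - (v x)^-1 ^+ (2 * m) + m%:R * 7 / 24 * x^-1 ^+ 2)
   ((2 * m)%:R * (v x)^-1 ^+ (2 * m).+1 * v1 x - (2 * m)%:R * 7 / 24 * x^-1 ^+ 3).
  move=> /andP[sx _]; have xs := le_trans ss sx; have xp := pos _ xs; have vx := vpos _ xs.
  have h := vd x xp; der; rewrite ?gt_eqF//.
  have -> : (2 * m).+1 = ((2 * m).-1 + 2)%N by rewrite addn2 prednK.
  rewrite natrM exprD /=; field.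
  by rewrite !gt_eqF.
have h : - (v s)^-1 ^+ (2 * m) + m%:R * 7 / 24 * s^-1 ^+ 2 <=
         - (v (2 * s))^-1 ^+ (2 * m) + m%:R * 7 / 24 * (2 * s)^-1 ^+ 2.
  apply: (mono_le s22 A) => x /andP[sx _]; have xs := le_trans ss (ltW sx).
  have xp := pos _ xs; have vx := vpos _ xs.
  have := v1_low x xs; set V := v x ^+ _ => hl.
  have V0 : 0 < V by rewrite exprn_gt0.
  rewrite exprVn -/V -!mulrA -mulrBr mulr_ge0// subr_ge0 mulrCA.
  by rewrite ler_pdivlMl// mulrCA; move: hl; rewrite mulrCA mulrA; lra.
have vi : 0 < (v s)^-1 ^+ (2 * m) by rewrite exprn_gt0// invr_gt0.
have vi2 : 0 <= (v (2 * s))^-1 ^+ (2 * m) by rewrite exprn_ge0// invr_ge0 ltW// vpos//; lra.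
have h2 : m%:R * 7 / 32 * s^-1 ^+ 2 <= (v s)^-1 ^+ (2 * m).
  move: h vi2; rewrite invfM exprMn; set B := s^-1 ^+ 2.
  have -> : (2^-1 : R) ^+ 2 = 4^-1 by rewrite exprVn; congr (_^-1); rewrite -natrX.
  by have := m3; lra.
rewrite -(ler_pM2l vi) -exprMn mulVf ?gt_eqF// expr1n.
have sq : 0 < s ^+ 2 by rewrite exprn_gt0.
apply: (@le_trans _ _ (m%:R * 7 / 32 * s^-1 ^+ 2 * (2 * s ^+ 2))).
  rewrite exprVn.
  have -> : m%:R * 7 / 32 * (s ^+ 2)^-1 * (2 * s ^+ 2) = m%:R * 7 / 16 by field; rewrite gt_eqF.
  by have := m3; lra.
by rewrite ler_wpM2r// mulr_ge0// ltW.
Qed.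

Section trajectory.
Variables v v1 : R -> R.
Hypothesis vd : forall s, 0 < s -> is_derive s 1 v (v1 s).
Hypothesis v1d : forall s, 0 < s -> is_derive s 1 v1 (- (v s ^+ (2 * m).+1 * s^-1 ^+ 4)).

(* Emden-Fowler variables: with s = e^(m t) and y(t) = e^(-t) v(s) the equation
   becomes autonomous, y'' = (m-2) y' + (m-1) y - m^2 y^(2m+1). *)
Definition ef_y t := v (expR t ^+ m) * (expR t)^-1.
Definition ef_y1 t := m%:R * expR t ^+ m.-1 * v1 (expR t ^+ m) - ef_y t.
Definition ef_H t := 2^-1 * ef_y1 t ^+ 2 - (m%:R - 1) / 2 * ef_y t ^+ 2
   + m%:R ^+ 2 / (2 * m.+1%:R) * ef_y t ^+ (2 * m.+1).
Local Notation y := ef_y.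
Local Notation y1 := ef_y1.
Local Notation H := ef_H.

Let Xm t : expR t ^+ m = expR t ^+ m.-2 * expR t ^+ 2.
Proof. by rewrite -exprD; congr (_ ^+ _); lia. Qed.
Let Xm1 t : expR t ^+ m.-1 = expR t ^+ m.-2 * expR t.
Proof. by rewrite -exprSr; congr (_ ^+ _); lia. Qed.
Let e0 t : expR t != 0. Proof. by rewrite gt_eqF// expR_gt0. Qed.

Lemma ef_y_derive t : is_derive t 1 y (y1 t).
Proof.
have h := vd (exprn_gt0 m (expR_gt0 t)).
have h1 := is_derive_expR t.
rewrite /ef_y; der => //; rewrite /ef_y1 /ef_y Xm1.
by set a := v1 _; set b := v _; field.
Qed.

Lemma ef_y1_derive t :
  is_derive t 1 y1 ((m%:R - 2) * y1 t + (m%:R - 1) * y t - m%:R ^+ 2 * y t ^+ (2 * m).+1).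
Proof.
have h0 := ef_y_derive t.
have h := v1d (exprn_gt0 m (expR_gt0 t)).
have h1 := is_derive_expR t.
rewrite /ef_y1; der; rewrite -/(ef_y1 t) /=.
have -> : v (expR t ^+ m) = y t * expR t by rewrite /ef_y mulfVK.
have -> : m.-1%:R = m%:R - 1 :> R by rewrite -subn1 natrB//; lia.
rewrite /ef_y1 !Xm1; set a := v1 _; set b := y t.
have -> : (b * expR t) ^+ (2 * m).+1 = b ^+ (2 * m).+1 * (expR t ^+ m.-2) ^+ 2 * expR t ^+ 5.
  rewrite exprMn -mulrA; congr (_ * _); rewrite -exprM -exprD; congr (_ ^+ _); lia.
rewrite Xm; have := @expf_neq0 _ (expR t) m.-2 (e0 t).
set c := expR t ^+ m.-2; set x := expR t => c0.
have x0 : x != 0 := e0 t.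
set B := b ^+ _.
by field; rewrite ?c0 ?x0.
Qed.

Lemma ef_H_derive t : is_derive t 1 H ((m%:R - 2) * y1 t ^+ 2).
Proof.
have h0 := ef_y_derive t; have h1 := ef_y1_derive t.
rewrite /ef_H; der; rewrite mulnS /= exprS.
have -> : (2 + 2 * m)%:R = 2 * m.+1%:R :> R by rewrite -natrM mulnS.
field.
by rewrite gt_eqF//; have := m3; lra.
Qed.

Lemma ef_H_mono a b : a <= b -> H a <= H b.
Proof.
move=> ab; apply: (mono_le ab (fun x _ => ef_H_derive x)) => x _.
by rewrite mulr_ge0 ?sqr_ge0//; have := m3; lra.
Qed.

(** Boundedness would bound the functional [L] from below, while [L] decreases at rate at least
    [2 (m+1) H T]. *)
Lemma ef_no_bounded (T C : R) : 0 < H T ->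
  (forall t, T <= t -> `|y t| <= C /\ `|y1 t| <= C) -> False.
Proof.
move=> HT bd.
(* The coefficient for which [L'] has no term in [y1^2] besides the one of [- 2 (m+1) H]; the rest,
   [- m (m-1) y^2], has a sign. *)
pose kp : R := (m%:R + 2) / (m%:R - 2).
pose L t := y t * y1 t - (m%:R - 2) / 2 * y t ^+ 2 - kp * H t.
have m2 : m%:R - 2 != 0 :> R by rewrite gt_eqF//; have := m3; lra.
have Ld t : is_derive t 1 L (- m%:R * (m%:R - 1) * y t ^+ 2 - 2 * m.+1%:R * H t).
  have h0 := ef_y_derive t; have h1 := ef_y1_derive t; have h2 := ef_H_derive t.
  rewrite /L; der; rewrite /ef_H mulnS !exprS /kp /=; field.
  by rewrite m2 andbT gt_eqF//; have := m3; lra.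
pose d := 2 * m.+1%:R * H T.
have d0 : 0 < d by rewrite mulr_gt0.
have Lt t : T <= t -> L t <= L T - d * (t - T).
  move=> Tt.
  have A x : T <= x <= t -> is_derive x 1 (fun x => - L x - d * x)
      (- (- m%:R * (m%:R - 1) * y x ^+ 2 - 2 * m.+1%:R * H x) - d).
    by move=> _; have h := Ld x; der.
  have : - L T - d * T <= - L t - d * t.
    apply: (mono_le Tt A) => x /andP[Tx _].
    have : H T <= H x by apply: ef_H_mono; exact: ltW.
    rewrite -(@ler_pM2l _ (2 * m.+1%:R)) ?mulr_gt0// -/d.
    have : 0 <= m%:R * (m%:R - 1) * y x ^+ 2.
      by rewrite mulr_ge0 ?sqr_ge0// mulr_ge0//; have := m3; lra.
    by lra.
  by lra.
have C0 : 0 <= C by have [h _] := bd T (lexx _); exact: le_trans h.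
have kp0 : 0 <= kp by rewrite /kp divr_ge0//; have := m3; lra.
pose B := C * C + (m%:R - 2) / 2 * C ^+ 2 + kp * (2^-1 * C ^+ 2 + m%:R ^+ 2 / (2 * m.+1%:R) * C ^+ (2 * m.+1)).
have LB t : T <= t -> - B <= L t.
  move=> Tt; have [yC y1C] := bd t Tt.
  have a1 : - (C * C) <= y t * y1 t.
    have : `|y t * y1 t| <= C * C by rewrite normrM ler_pM.
    by rewrite ler_norml => /andP[].
  have sq u : `|u| <= C -> u ^+ 2 <= C ^+ 2.
    by move=> uC; rewrite -real_normK ?num_real// lerXn2r ?nnegrE.
  have a2 : (m%:R - 2) / 2 * y t ^+ 2 <= (m%:R - 2) / 2 * C ^+ 2.
    by rewrite ler_wpM2l ?sq// divr_ge0//; have := m3; lra.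
  have a3 : kp * H t <= kp * (2^-1 * C ^+ 2 + m%:R ^+ 2 / (2 * m.+1%:R) * C ^+ (2 * m.+1)).
    rewrite ler_wpM2l// /ef_H.
    have b1 := sq _ y1C.
    have b2 : 0 <= (m%:R - 1) / 2 * y t ^+ 2.
      by rewrite mulr_ge0 ?sqr_ge0// divr_ge0//; have := m3; lra.
    have b3 : m%:R ^+ 2 / (2 * m.+1%:R) * y t ^+ (2 * m.+1) <=
              m%:R ^+ 2 / (2 * m.+1%:R) * C ^+ (2 * m.+1).
      rewrite ler_wpM2l ?divr_ge0 ?exprn_ge0 ?mulr_ge0//.
      by rewrite !exprM lerXn2r ?nnegrE ?sqr_ge0 ?sq.
    apply: lerD b3; apply: (@le_trans _ _ (2^-1 * y1 t ^+ 2)); first by rewrite gerBl.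
    by rewrite ler_wpM2l.
  by have := lerB (lerB a1 a2) a3; rewrite /L /B !opprD.
pose t := T + (L T + B + 1) / d.
have Tt : T <= t.
  rewrite /t lerDl divr_ge0 ?(ltW d0)//; have := LB T (lexx _); lra.
have := Lt t Tt; have := LB t Tt.
have -> : d * (t - T) = L T + B + 1 by rewrite /t; field; rewrite gt_eqF.
lra.
Qed.

(** If [y] had no zero beyond [T], then [v] or [- v] would be positive from some point on;
    [positive_solution_bounds] translates into bounds on [y] and [y1], against [ef_no_bounded]. Both
    signs are treated through one pair [w], [w1], since the power is odd. *)
Lemma ef_zero_unbounded : (forall t, 0 < ef_H t) -> forall T, exists2 t, T < t & y t = 0.
Proof.
move=> Hpos T; apply: contrapT => nz.
have yn0 t : T < t -> y t != 0.
  by move=> Tt; apply/eqP => yt; apply: nz; exists t.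
have yc : continuous y by move=> t; exact: dcont (ef_y_derive t).
have same t u : T < t -> T < u -> y t < 0 -> 0 < y u -> False.
  move=> Tt Tu yt yu.
  have ivt a b : a <= b -> T < a -> Num.min (y a) (y b) <= 0 <= Num.max (y a) (y b) -> False.
    move=> ab Ta h.
    have [c cab yc0] := IVT ab (continuous_subspaceT yc) h.
    apply: nz; exists c => //; move: cab; rewrite in_itv/= => /andP[ac _].
    exact: lt_le_trans ac.
  case: (leP t u) => [tu|/ltW ut].
    by apply: (ivt t u tu Tt); rewrite ge_min (ltW yt) le_max (ltW yu) orbT.
  by apply: (ivt u t ut Tu); rewrite ge_min (ltW yt) le_max (ltW yu) orbT.
pose s0 := expR (T + 1) ^+ m.
have s00 : 0 < s0 by rewrite exprn_gt0// expR_gt0.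
have st s : s0 <= s -> exists2 t, T < t & s = expR t ^+ m.
  move=> ss; have sp : 0 < s by exact: lt_le_trans ss.
  have mr : m%:R != 0 :> R by rewrite gt_eqF//; have := m3; lra.
  have e : expR (ln s / m%:R) ^+ m = s.
    by rewrite -expRM_natl mulrC divfK// lnK.
  exists (ln s / m%:R) => //.
  rewrite ltNge; apply/negP => le; move: ss; rewrite leNgt => /negP; apply.
  rewrite -e /s0 ltr_pXn2r ?nnegrE ?expR_ge0//.
  by rewrite ltr_expR; lra.
have ys t : v (expR t ^+ m) = y t * expR t by rewrite /ef_y mulfVK.
suff [w [w1 [wd w1d wpos ww]]] : exists w w1 : R -> R,
    [/\ forall s, 0 < s -> is_derive s 1 w (w1 s),
      forall s, 0 < s -> is_derive s 1 w1 (- (w s ^+ (2 * m).+1 * s^-1 ^+ 4)),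
      forall s, s0 <= s -> 0 < w s & forall s, `|w s| = `|v s| /\ `|w1 s| = `|v1 s|].
  have bds := positive_solution_bounds s00 wd w1d wpos.
  pose T' := T + 1 + 1.
  apply: (@ef_no_bounded T' ((2 * m).+1%:R * 2)) => // t Tt.
  (* The extra unit of time in [T'] multiplies [s] by [e^m >= 2], which reaches the range of the
     bounds. *)
  have s2 : 2 * s0 <= expR t ^+ m.
    apply: (@le_trans _ _ (expR T' ^+ m)); last by rewrite lerXn2r ?nnegrE ?expR_ge0// ler_expR.
    rewrite /T' expRD exprMn mulrC -/s0 ler_wpM2l ?(ltW s00)//.
    apply: (@le_trans _ _ (2 ^+ m)).
      by apply: ler_eXnr => //; lra.
    by rewrite lerXn2r ?nnegrE ?expR_ge0//; have := @expR_ge1Dx R 1; lra.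
  have [b1 b2] := bds _ s2; have [e1 e2] := ww (expR t ^+ m).
  have ex0 := expR_gt0 t.
  have w0 : 0 < w (expR t ^+ m) by apply: wpos; lra.
  have we : w (expR t ^+ m) = `|y t| * expR t.
    by rewrite -(gtr0_norm w0) e1 ys normrM (gtr0_norm ex0).
  have y2 : `|y t| <= 2.
    rewrite leNgt; apply/negP => y2; move: b1; rewrite we exprMn.
    have -> : (expR t ^+ m) ^+ 2 = expR t ^+ (2 * m) by rewrite -exprM mulnC.
    rewrite ler_pM2r ?exprn_gt0// leNgt => /negP; apply.
    by apply: (lt_le_trans y2); apply: ler_eXnr => //; lra.
  have y1b : `|y1 t| <= (2 * m).+1%:R * `|y t|.
    rewrite /ef_y1; apply: (le_trans (ler_normB _ _)).
    rewrite -natr1 mulrDl mul1r lerD2r normrM -e2 ger0_norm ?mulr_ge0 ?exprn_ge0 ?expR_ge0//.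
    apply: (@le_trans _ _ (m%:R * expR t ^+ m.-1 * (2 * w (expR t ^+ m) / expR t ^+ m))).
      by rewrite ler_wpM2l// mulr_ge0// exprn_ge0// ltW.
    rewrite we Xm Xm1 natrM le_eqVlt; apply/orP; left; apply/eqP.
    by field; rewrite e0 expf_neq0.
  split.
    apply: (le_trans y2); rewrite -[leLHS]mul1r ler_wpM2r// ler1n//.
  by apply: (le_trans y1b); rewrite ler_wpM2l.
have [pos|neg] := ltP 0 (y (T + 1)).
  exists v, v1; split => // s /st [t Tt ->]; rewrite ys mulr_gt0 ?expR_gt0//.
  rewrite lt_neqAle eq_sym yn0//= leNgt; apply/negP => yt.
  by apply: (same t (T + 1)) => //; lra.
exists (fun s => - v s), (fun s => - v1 s); split.
- by move=> s s1; have h := vd s1; der.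
- move=> s s1; have h := v1d s1; der.
  by rewrite exprNn -signr_odd /= oddM /= expr1; ring.
- move=> s /st [t Tt ->]; rewrite ys oppr_gt0 pmulr_llt0 ?expR_gt0//.
  rewrite lt_neqAle yn0//= leNgt; apply/negP => yt.
  apply: (same (T + 1) t) => //; first by lra.
  by rewrite lt_neqAle yn0//; lra.
- by move=> s; rewrite !normrN.
Qed.

(** At a zero of [y], [H = y1^2 / 2], so [H > 0] makes the zero simple. The point [T] is arbitrary,
    so that accumulation of zeros is excluded everywhere. *)
Lemma ef_isolated : (forall t, 0 < ef_H t) -> forall T, exists2 d, 0 < d &
  forall t, 0 < `|t - T| < d -> y t != 0.
Proof.
move=> Hpos T.
have yc : continuous y by move=> t; exact: dcont (ef_y_derive t).
have y1c : continuous y1 by move=> t; exact: dcont (ef_y1_derive t).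
have near (f : R -> R) : continuous f -> f T != 0 -> exists2 d, 0 < d &
    forall t, `|t - T| < d -> f t != 0.
  move=> fc fT.
  have /cvgrPdist_lt /(_ `|f T|) : f @ T --> f T by exact: fc.
  rewrite normr_gt0 => /(_ fT) [d /= d0 hd]; exists d => // t td.
  apply/eqP => ft; have := hd t; rewrite /= distrC => /(_ td).
  by rewrite ft subr0 ltxx.
have [yT|yT] := eqVneq (y T) 0; last first.
  have [d d0 hd] := near y yc yT; exists d => // t /andP[_]; exact: hd.
have y1T : y1 T != 0.
  have := Hpos T; rewrite /ef_H yT !expr0n /= !mulr0 addr0 subr0 pmulr_rgt0//.
  by apply: contraTneq => ->; rewrite expr0n /= ltxx.
have [d d0 hd] := near y1 y1c y1T; exists d => // t /andP[tT td].
have [tT'|tT'|tT'] := ltgtP t T; last by move: tT; rewrite tT' subrr normr0 ltxx.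
  have [c /andP[c1 c2] e] := mvt_ex tT' (fun x _ => ef_y_derive x).
  rewrite yT sub0r in e; rewrite -oppr_eq0 e; apply: mulf_neq0; last by rewrite subr_eq0 gt_eqF.
  by apply: hd; move: td; rewrite !ltr0_norm ?subr_lt0//; lra.
have [c /andP[c1 c2] e] := mvt_ex tT' (fun x _ => ef_y_derive x).
rewrite yT subr0 in e; rewrite e; apply: mulf_neq0; last by rewrite subr_eq0 gt_eqF.
by apply: hd; move: td; rewrite !gtr0_norm ?subr_gt0//; lra.
Qed.

(** Isolation at the infimum of the zeros beyond [T] makes it one of them; in particular it differs
    from [T]. *)
Lemma ef_next_zero : (forall t, 0 < ef_H t) -> forall T, exists t,
  [/\ T < t, y t = 0 & forall u, T < u < t -> y u != 0].
Proof.
move=> Hpos T.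
pose A := [set t | T < t /\ y t = 0].
have A0 : A !=set0 by have [t Tt yt] := ef_zero_unbounded Hpos T; exists t.
have Alb : has_inf A by split=> //; exists T => t [/ltW].
have Tle : T <= inf A by apply: lb_le_inf => // t [/ltW].
have iso := ef_isolated Hpos (inf A).
have infA : A (inf A).
  have [d d0 hd] := iso.
  have [t At tlt] : exists2 t, A t & t < inf A + d.
    exact: inf_adherent.
  have it : inf A <= t by apply: ge_inf => //; case: Alb.
  have [<-//|ne] := eqVneq t (inf A).
  have := hd t; rewrite normr_gt0 subr_eq0 ne ger0_norm ?subr_ge0//=.
  by rewrite ltrBlDl tlt => /(_ isT) /eqP; case: At.
exists (inf A); case: infA => a b; split => // u /andP[Tu uA].
apply/eqP => yu; move: uA; rewrite ltNge => /negP; apply.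
by apply: ge_inf; [case: Alb | split].
Qed.

(** [H' = (m-2) y1^2], and [y1 a] is nonzero because the zero is simple. *)
Lemma ef_H_strict : (forall t, 0 < ef_H t) -> forall a b, a < b -> y a = 0 -> H a < H b.
Proof.
move=> Hpos a b ab ya.
have y1c : continuous y1 by move=> t; exact: dcont (ef_y1_derive t).
have y1a : y1 a != 0.
  have := Hpos a; rewrite /ef_H ya !expr0n /= !mulr0 addr0 subr0 pmulr_rgt0//.
  by apply: contraTneq => ->; rewrite expr0n /= ltxx.
have /cvgrPdist_lt /(_ `|y1 a|) : y1 @ a --> y1 a by exact: y1c.
rewrite normr_gt0 => /(_ y1a) [d /= d0 hd].
pose c := Num.min b (a + d).
have ac : a < c by rewrite /c lt_min ab ltrDl.
have cb : c <= b by rewrite /c ge_min lexx.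
have cd : c <= a + d by rewrite /c ge_min lexx orbT.
apply: (lt_le_trans _ (ef_H_mono cb)).
apply: (mono_lt ac (fun x _ => ef_H_derive x)) => x /andP[ax xc].
rewrite mulr_gt0//; first by have := m3; lra.
rewrite exprn_even_gt0//=; apply/eqP => y1x.
have := hd x; rewrite /= distrC gtr0_norm ?subr_gt0// y1x subr0 ltxx => h.
by apply: notF; apply: h; lra.
Qed.

End trajectory.

(** [X k = e^(t_k)] for the successive zeros [t_k] of [y]. At such a zero [y1 = m X^(m-1) v1 (X^m)]
    and [H = y1^2 / 2], so the last clause is the strict growth of [H]; its terms are the slopes at
    [r = 1] of the scaled solutions, up to sign. *)
Lemma zeros_of_solution (v v1 : R -> R) :
  (forall s, is_derive s 1 v (v1 s)) -> v 0 = 0 ->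
  (forall s, 0 < s -> is_derive s 1 v1 (- (v s ^+ (2 * m).+1 * s^-1 ^+ 4))) ->
  (forall s, 0 <= s -> `|v s| <= s) -> (forall s, 0 <= s <= 1 -> `|v1 s - 1| <= s) ->
  exists X : nat -> R,
  [/\ forall k, 0 < X k, forall k, X k < X k.+1,
      forall s, 0 < s -> (v s = 0 <-> exists k, s = X k ^+ m) &
      forall k, (X k ^+ m.-1 * v1 (X k ^+ m)) ^+ 2 < (X k.+1 ^+ m.-1 * v1 (X k.+1 ^+ m)) ^+ 2].
Proof.
move=> vd' v0 v1d vs v1s.
have vd s : 0 < s -> is_derive s 1 v (v1 s) by [].
have yd := ef_y_derive vd; have y1d := ef_y1_derive vd v1d; have Hd := ef_H_derive vd v1d.
set y := ef_y v in yd Hd y1d; set y1 := ef_y1 v v1 in yd y1d Hd; set H := ef_H v v1 in Hd.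
have Hmono a b : a <= b -> H a <= H b by exact: (ef_H_mono vd v1d).
have X1 t : t <= 0 -> expR t <= 1 by move=> t0; rewrite expR_le1.
have Xm t : t <= 0 -> expR t ^+ m.-1 <= expR t.
  move=> t0; have -> : (m.-1 = m.-2.+1)%N by lia.
  by rewrite exprS ler_piMr ?expR_ge0// exprn_ile1 ?expR_ge0 ?X1.
have y_small t : t <= 0 -> `|y t| <= expR t.
  move=> t0; rewrite /y /ef_y normrM (ger0_norm (x := _^-1)) ?invr_ge0 ?expR_ge0//.
  rewrite ler_pdivrMr ?expR_gt0//.
  apply: (le_trans (vs _ _)); first by rewrite exprn_ge0// expR_ge0.
  have -> : expR t ^+ m = expR t ^+ m.-1 * expR t by rewrite -exprSr prednK.
  by rewrite ler_wpM2r ?expR_ge0// Xm.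
(* Only the quadratic term of [H] is negative, and it tends to 0 at minus infinity, where
   [y = O(e^t)]; monotonicity carries the bound forward. *)
have H_ge0 t : 0 <= H t.
  apply/ler_addgt0Pr => e e0.
  pose d := e / m%:R.
  have d0 : 0 < d by rewrite divr_gt0//; have := m3; lra.
  have d' : m%:R * d = e by rewrite /d mulrC divfK// gt_eqF//; have := m3; lra.
  pose u := Num.min (Num.min t 0) (ln d).
  have ut : u <= t by rewrite /u !ge_min lexx.
  have u0 : u <= 0 by rewrite /u !ge_min lexx orbT.
  have ud : expR u <= d.
    by rewrite -[leRHS](lnK d0) ler_expR /u !ge_min lexx !orbT.
  apply: (@le_trans _ _ (H u + e)); last by rewrite lerD2r Hmono.
  rewrite /H /ef_H -/(y u) -/(y1 u).
  have h1 : 0 <= 2^-1 * y1 u ^+ 2 by rewrite mulr_ge0 ?sqr_ge0.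
  have h2 : 0 <= m%:R ^+ 2 / (2 * m.+1%:R) * y u ^+ (2 * m.+1).
    apply: mulr_ge0; first by rewrite divr_ge0 ?exprn_ge0// mulr_ge0.
    by rewrite exprM exprn_ge0// sqr_ge0.
  have h3 : (m%:R - 1) / 2 * y u ^+ 2 <= (m%:R - 1) / 2 * d.
    rewrite ler_wpM2l ?divr_ge0//; first by have := m3; lra.
    rewrite -real_normK ?num_real// expr2.
    have a := y_small u u0; have b := X1 u u0; have c := normr_ge0 (y u).
    by nra.
  have h4 : (m%:R - 1) / 2 * d <= e by rewrite -d'; have := m3; nra.
  set A := 2^-1 * _ in h1 *; set B := _ * y u ^+ (2 * m.+1) in h2 *.
  by set D := _ * y u ^+ 2 in h3 *; lra.
(* Strictness comes from times before [- ln 2]: there [v1 > 1/2], so [m v1 s > s >= v] and [y1] does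
   not vanish. *)
have H_gt0 t : 0 < H t.
  pose b := Num.min t (- ln 2).
  have ln20 : 0 < ln 2 :> R by rewrite ln_gt0//; lra.
  have bt : b <= t by rewrite /b ge_min lexx.
  have b2 : b <= - ln 2 by rewrite /b ge_min lexx orbT.
  have ab : b - 1 < b by lra.
  apply: (lt_le_trans _ (Hmono _ _ bt)); apply: (le_lt_trans (H_ge0 (b - 1))).
  apply: (mono_lt ab (fun x _ => Hd x)) => x /andP[_ xb].
  rewrite mulr_gt0//; first by have := m3; lra.
  rewrite exprn_even_gt0//=; apply/negP => /eqP y1x.
  have x0 : x <= 0 by lra.
  have X2 : expR x < 2^-1.
    by rewrite -[ltRHS](lnK (x := 2^-1)) ?posrE ?invr_gt0// ltr_expR lnV ?posrE//; lra.
  have Xp := expR_gt0 x.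
  have Xmx : expR x ^+ m < 2^-1.
    apply: (le_lt_trans _ X2); rewrite -(prednK m0) exprS ler_piMr ?expR_ge0//.
    by rewrite exprn_ile1 ?expR_ge0 ?X1.
  have Xmp : 0 < expR x ^+ m by rewrite exprn_gt0.
  have a1 := v1s (expR x ^+ m); have a2 := vs (expR x ^+ m) (ltW Xmp).
  have {}a1 : 2^-1 < v1 (expR x ^+ m).
    have : `|v1 (expR x ^+ m) - 1| <= expR x ^+ m by apply: a1; lra.
    by rewrite ler_norml => /andP[]; lra.
  move: y1x; rewrite /y1 /ef_y1 /ef_y => /eqP; rewrite subr_eq0 => /eqP.
  move=> /(congr1 (fun z => z * expR x)); rewrite divfK ?gt_eqF//.
  have -> : m%:R * expR x ^+ m.-1 * v1 (expR x ^+ m) * expR x = m%:R * v1 (expR x ^+ m) * expR x ^+ m.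
    have -> : expR x ^+ m = expR x ^+ m.-1 * expR x by rewrite -exprSr prednK.
    by ring.
  move: a2 a1 Xmp; rewrite ler_norml => /andP[_]; set S := expR x ^+ m; set V := v1 S => a2 a1 S0 e.
  have h : 3 / 2 < m%:R * V by have := m3; nra.
  have : 3 / 2 * S < m%:R * V * S by rewrite ltr_pM2r.
  by rewrite e; lra.
have next := ef_next_zero vd v1d H_gt0.
have [nx nxP] := choice next.
have y_neg t : t < 0 -> y t != 0.
  move=> t0; rewrite /y /ef_y mulf_neq0 ?invr_eq0 ?gt_eqF ?expR_gt0//.
  have sp : 0 < expR t ^+ m by rewrite exprn_gt0 ?expR_gt0.
  have s1 : expR t ^+ m < 1 by rewrite exprn_ilt1 ?expR_ge0 ?expR_lt1// -lt0n.
  rewrite -v0; apply: (mono_lt sp (fun x _ => vd' x)) => x /andP[x0 xs].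
  have : `|v1 x - 1| <= x by apply: v1s; lra.
  by rewrite ler_norml => /andP[]; lra.
(* The solution is positive on [(0, 1)], so [y] has no zero for [t < 0] and starting at [-1] misses
   none. *)
pose tk k := iter k nx (nx (-1)).
have tkS k : tk k < tk k.+1 by have [] := nxP (tk k).
have tk0 k : y (tk k) = 0 by case: k => [|k]; [have [] := nxP (-1) | have [] := nxP (tk k)].
have all_tk t : y t = 0 -> exists k, t = tk k.
  move=> yt; apply: contrapT => nk.
  have tk_lt k : tk k < t.
    elim: k => [|k IH].
      have [a b c] := nxP (-1); rewrite /tk /=.
      rewrite lt_neqAle; apply/andP; split; first by apply/eqP => e; apply: nk; exists 0%N.
      rewrite leNgt; apply/negP => tn.
      have t0 : 0 <= t by rewrite leNgt; apply/negP => /y_neg /eqP.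
      have : y t != 0 by apply: c; rewrite tn andbT; lra.
      by rewrite yt eqxx.
    have [a b c] := nxP (tk k); rewrite /tk /= -/(tk k).
    rewrite lt_neqAle; apply/andP; split; first by apply/eqP => e; apply: nk; exists k.+1.
    rewrite leNgt; apply/negP => tn.
    have : y t != 0 by apply: c; rewrite IH tn.
    by rewrite yt eqxx.
  (* A zero missed by the enumeration would bound it, and its supremum would then be an accumulation
     point of zeros. *)
  have hs : has_sup (range tk).
    by split; [exists (tk 0%N), 0%N | exists t => _ [k _ <-]; exact: ltW].
  have [d d0 hd] := ef_isolated vd v1d H_gt0 (sup (range tk)).
  have [_ [k _ <-] kd] := sup_adherent d0 hs.
  have k1 : tk k.+1 <= sup (range tk) by apply: (ub_le_sup hs.2); exists k.+1.
  have k0 := tkS k.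
  have : y (tk k) != 0.
    by apply: hd; rewrite ltr0_norm ?subr_lt0; [apply/andP; split; lra | lra].
  by rewrite tk0 eqxx.
exists (expR \o tk); split => /=.
- by move=> k; exact: expR_gt0.
- by move=> k; rewrite ltr_expR.
- move=> s s0.
  have sE : expR (ln s / m%:R) ^+ m = s.
    rewrite -expRM_natl mulrC divfK ?lnK// gt_eqF//; have := m3; lra.
  split.
    move=> vs0; have [k kE] : exists k, ln s / m%:R = tk k.
      by apply: all_tk; rewrite /y /ef_y sE vs0 mul0r.
    by exists k; rewrite -kE sE.
  move=> [k ->]; have /eqP := tk0 k; rewrite /y /ef_y mulf_eq0 invr_eq0.
  by rewrite (gt_eqF (expR_gt0 _)) orbF => /eqP.
move=> k.
have HE j : H (tk j) = 2^-1 * m%:R ^+ 2 * (expR (tk j) ^+ m.-1 * v1 (expR (tk j) ^+ m)) ^+ 2.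
  rewrite /H /ef_H -/(y _) tk0 !expr0n /= !mulr0 addr0 subr0 /ef_y1 -/(y _) tk0 subr0.
  by rewrite !exprMn; ring.
have := ef_H_strict vd v1d H_gt0 (tkS k) (tk0 k).
rewrite -/(H _) -/(H _) !HE ltr_pM2l// mulr_gt0// exprn_gt0//; have := m3; lra.
Qed.

End emden_fowler_zeros.

(** * Polar coordinates *)

Section density_measure.
Local Open Scope ereal_scope.
Context d (T : measurableType d) (R : realType) (m : {measure set T -> \bar R}).
Variable g : T -> R.
Hypotheses (mg : measurable_fun setT g) (g0 : forall x, (0 <= g x)%R).

Let dm A := \int[m]_(x in A) (g x)%:E.

Let dm0 : dm set0 = 0. Proof. exact: integral_set0. Qed.

Let dm_ge0 A : 0 <= dm A.
Proof. by apply: integral_ge0 => x _; rewrite lee_fin. Qed.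

Let dm_sigma_additive : semi_sigma_additive dm.
Proof.
move=> F mF tF mUF; rewrite /dm ge0_integral_bigcup//.
- by apply: is_cvg_nneseries => n _ _; exact: dm_ge0.
- exact/measurable_EFinP/measurable_funTS.
- by move=> x _; rewrite lee_fin.
Qed.

HB.instance Definition _ := isMeasure.Build _ _ _ dm dm0 dm_ge0 dm_sigma_additive.

Definition density_measure : {measure set T -> \bar R} := dm.

Lemma density_measureE A : density_measure A = \int[m]_(x in A) (g x)%:E.
Proof. by []. Qed.

End density_measure.

Section density.
Local Open Scope ereal_scope.
Context d (T : measurableType d) (R : realType) (m1 m2 : {measure set T -> \bar R}).
Variable g : T -> R.
Hypotheses (mg : measurable_fun setT g) (g0 : forall x, (0 <= g x)%R).
Hypothesis m2E : forall A, measurable A -> m2 A = \int[m1]_(x in A) (g x)%:E.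
Import HBNNSimple.

Let density_nnsfun (h : {nnsfun T >-> R}) :
  \int[m2]_x (h x)%:E = \int[m1]_x ((h x)%:E * (g x)%:E).
Proof.
have mgE : measurable_fun setT (EFin \o g) by exact/measurable_EFinP.
have mi y : measurable (h @^-1` [set y]) by exact: measurable_sfunP.
rewrite integralT_nnsfun sintegralE.
transitivity (\sum_(y \in range h) \int[m1]_x (y%:E * ((\1_(h @^-1` [set y]) x)%:E * (g x)%:E))).
  apply: eq_fsbigr => y; rewrite inE => -[t _ ty].
  rewrite ge0_integralZl//.
  - rewrite m2E// integral_mkcond; congr (_ * _); apply: eq_integral => x _.
    by rewrite epatch_indic muleC.
  - by apply: emeasurable_funM => //; apply/measurable_EFinP; exact: measurable_indic.
  - by move=> x _; rewrite mule_ge0// lee_fin.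
  - by rewrite lee_fin -ty.
rewrite -ge0_integral_fsum//.
- apply: eq_integral => x _.
  rewrite [in RHS](fimfunE h) -fsumEFin// ge0_mule_fsuml; last first.
    by move=> y; exact: nnfun_muleindic_ge0.
  by apply: eq_fsbigr => y _; rewrite EFinM muleA.
- move=> y; apply: measurable_funeM; apply: emeasurable_funM => //.
  by apply/measurable_EFinP; exact: measurable_indic.
- by move=> y x _; rewrite muleA mule_ge0 ?lee_fin//; exact: nnfun_muleindic_ge0.
Qed.

Lemma ge0_integral_density (f : T -> \bar R) : measurable_fun setT f ->
  (forall x, 0 <= f x) -> \int[m2]_x f x = \int[m1]_x (f x * (g x)%:E).
Proof.
move=> mf f0; pose h := nnsfun_approx measurableT mf.
have nd x : {homo (fun n => (h n x)%:E) : a b / (a <= b)%N >-> a <= b}.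
  by move=> a b ab; rewrite lee_fin; exact/lefP/nd_nnsfun_approx.
have cv x : (h n x)%:E @[n --> \oo] --> f x by exact: cvg_nnsfun_approx.
have mh n : measurable_fun setT (EFin \o h n) by exact/measurable_EFinP.
transitivity (limn (fun n => \int[m2]_x (h n x)%:E)).
  rewrite -monotone_convergence//.
  - by apply: eq_integral => x _; apply/esym/cvg_lim => //; exact: cv.
  - by move=> n x _; rewrite lee_fin.
transitivity (limn (fun n => \int[m1]_x ((h n x)%:E * (g x)%:E))).
  by congr (limn _); apply/funext => n; exact: density_nnsfun.
rewrite -monotone_convergence//.
- by apply: eq_integral => x _; apply/cvg_lim => //; apply: cvgeZr => //; exact: cv.
- by move=> n; apply: emeasurable_funM => //; exact/measurable_EFinP.
- by move=> n x _; rewrite mule_ge0// lee_fin.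
- by move=> x _ a b ab; apply: lee_wpmul2r; [rewrite lee_fin | exact: nd].
Qed.

End density.

Section pushforward.
Local Open Scope ereal_scope.
Context d1 d2 (T1 : measurableType d1) (T2 : measurableType d2) (R : realType).
Variables (m : {measure set T1 -> \bar R}) (f : T1 -> T2).
Hypothesis mf : measurable_fun [set: T1] f.

Definition pushm : {measure set T2 -> \bar R} :=
  measure_function_pushforward__canonical__measure_function_Measure m mf.

Lemma pushmE A : pushm A = m (f @^-1` A). Proof. by []. Qed.
End pushforward.

Definition scalem d (T : measurableType d) (R : realType) (k : {nonneg R})
  (m : {measure set T -> \bar R}) : {measure set T -> \bar R} := mscale k m.

Lemma scalemE d (T : measurableType d) (R : realType) (k : {nonneg R})
  (m : {measure set T -> \bar R}) A : scalem k m A = (k%:num%:E * m A)%E.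
Proof. by []. Qed.

(** * Lebesgue measure of space: dilations, balls, polar coordinates *)

Section leb2.
Variable R : realType.
Local Notation mu := (@lebesgue_measure R).

(** The inner product is named so that it carries its own measure and sigma-finiteness structures;
    [leb3] is then a product of two such measures, open to uniqueness and Fubini. *)
Definition leb2 : set (measurableTypeR R * measurableTypeR R) -> \bar R := (mu \x mu)%E.

HB.instance Definition _ := Measure.on leb2.

Lemma leb2_rect X Y : measurable X -> measurable Y -> (leb2 (X `*` Y) = mu X * mu Y)%E.
Proof. exact: product_measure1E. Qed.

Lemma leb2_sigma_finite : sigma_finite setT leb2.
Proof.
pose I n : set (measurableTypeR R) := `[- n%:R, n%:R]%classic.
exists (fun n => I n `*` I n) => [|n].
  apply/esym; rewrite -subTset => -[x y] _.
  exists (Num.truncn (Num.max `|x| `|y|)).+1 => //.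
  have h : Num.max `|x| `|y| < (Num.truncn (Num.max `|x| `|y|)).+1%:R by exact: truncnS_gt.
  move: h; rewrite gt_max => /andP[/ltW hx /ltW hy].
  by split; rewrite /I/= in_itv/= -ler_norml.
have mI : measurable (I n) by exact: measurable_itv.
split; first exact: measurableX.
rewrite leb2_rect// lte_mul_pinfty// ?ge0_fin_numE// /I lebesgue_measure_itv/=.
  by case: ifP; rewrite ?ltry// -EFinB ltry.
by case: ifP; rewrite ?ltry// -EFinB ltry.
Qed.

HB.instance Definition _ := Measure_isSigmaFinite.Build _ _ _ leb2 leb2_sigma_finite.

End leb2.
Arguments leb2 {R}.

Section space3.
Context {R : realType}.
Local Notation mu := (@lebesgue_measure R).
Local Notation E3 := (E3 R).
Implicit Types (x : E3) (r : R).

(** The sigma-algebra of [E3] is the product one; an open set reaches it as a countable union of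
    rational cubes. *)
Lemma open_measurable3 (U : set E3) : open U -> measurable U.
Proof.
move=> oU.
pose box (i : rat * rat * rat * nat) : set E3 :=
  (ball (ratr i.1.1.1 : R) (i.2.+1%:R^-1 : R) `*` ball (ratr i.1.1.2 : R) (i.2.+1%:R^-1 : R))
   `*` ball (ratr i.1.2 : R) (i.2.+1%:R^-1 : R).
have mbox i : measurable (box i).
  by apply: measurableX; [apply: measurableX|]; exact: measurable_ball.
have -> : U = \bigcup_i (if `[< box i `<=` U >] then box i else set0).
  apply/seteqP; split => [[[a b] c] Ux|x [i _]]; last first.
    by case: asboolP => // + h; exact.
  have /nbhs_ballP[e /= e0 eU] : nbhs ((a, b, c) : E3) U by exact: open_nbhs_nbhs.
  have [n ne] : exists n : nat, n.+1%:R^-1 + n.+1%:R^-1 < e.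
    pose n := Num.truncn (2 / e); exists n.
    have h : 2 / e < n.+1%:R by exact: truncnS_gt.
    have n0 : 0 < n.+1%:R :> R by [].
    rewrite -(ltr_pM2r n0) mulrDl mulVf// mulrC; move: h; rewrite ltr_pdivrMr//.
  have rt (z : R) : exists q : rat, `|z - ratr q| < n.+1%:R^-1.
    have zz : z < z + n.+1%:R^-1 by rewrite ltrDl invr_gt0.
    have [q] := rat_in_itvoo zz; rewrite in_itv/= => /andP[q1 q2].
    have i0 : 0 < n.+1%:R^-1 :> R by rewrite invr_gt0.
    exists q; move: q1 q2; move: (ratr q : R) => w q1 q2.
    set i := n.+1%:R^-1 in i0 q2 *.
    by rewrite ltr_norml; apply/andP; split; lra.
  have [qa ha] := rt a; have [qb hb] := rt b; have [qc hc] := rt c.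
  exists (qa, qb, qc, n) => //; rewrite asboolT.
    by split; [split|]; rewrite /= /ball/= distrC.
  move=> [[a' b'] c'] /= [[h1 h2] h3]; apply: eU.
  have aux (q z z' : R) : `|z - q| < n.+1%:R^-1 -> ball q (n.+1%:R^-1 : R) z' -> ball z e z'.
    rewrite /ball/= => u1 u2; apply: lt_trans ne; apply: le_lt_trans (ltrD u1 u2).
    by rewrite -[z - z'](subrKA q) ler_normD.
  by split; [split|]; [exact: aux ha h1 | exact: aux hb h2 | exact: aux hc h3].
apply: countable_bigcupT_measurable; first exact: countableP.
by move=> i; case: ifP.
Qed.

Lemma continuous_measurable3 (D : set E3) (f : E3 -> R) : open D ->
  (forall x, D x -> {for x, continuous f}) -> measurable_fun D f.
Proof.
move=> oD fc; apply: (measurability _ (RGenOpens.measurableE R)).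
move=> _ [_ [a [b ->]] <-]; apply: open_measurable3.
rewrite openE => x [Dx fx]; rewrite /interior; apply: filterI.
  exact: open_nbhs_nbhs.
by apply: (fc x Dx); apply: open_nbhs_nbhs; split => //; exact: interval_open.
Qed.

Lemma measurable_enorm : measurable_fun setT (enorm : E3 -> R).
Proof.
apply: (measurableT_comp (f := @Num.sqrt R)).
  exact: continuous_measurable_fun (@sqrt_continuous R).
by do ! apply: measurable_funD => //; apply: measurable_funX => //;
  do ? apply: measurableT_comp => //.
Qed.

Lemma leb3_rect X Y : measurable X -> measurable Y ->
  (leb3 (X `*` Y : set E3) = leb2 X * mu Y)%E.
Proof. exact: (@product_measure1E _ _ _ _ R leb2 mu). Qed.

Lemma leb2_unique (m' : {measure set (measurableTypeR R * measurableTypeR R) -> \bar R}) :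
  (forall X Y, measurable X -> measurable Y -> m' (X `*` Y) = mu X * mu Y)%E ->
  forall A, measurable A -> leb2 A = m' A.
Proof. exact: product_measure_unique. Qed.

Lemma leb3_unique (m' : {measure set E3 -> \bar R}) :
  (forall X Y, measurable X -> measurable Y -> m' (X `*` Y) = leb2 X * mu Y)%E ->
  forall A, measurable A -> leb3 A = m' A.
Proof. exact: (@product_measure_unique _ _ _ _ R leb2 mu m'). Qed.

Let sc1 r (x : measurableTypeR R) : measurableTypeR R := r * x.
Let sc2 r (x : measurableTypeR R * measurableTypeR R) : measurableTypeR R * measurableTypeR R :=
  (sc1 r x.1, sc1 r x.2).
Let sc3 r (x : E3) : E3 := (sc2 r x.1, sc1 r x.2).

Let msc1 r : measurable_fun setT (sc1 r).
Proof. exact: measurable_funM. Qed.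

Let msc2 r : measurable_fun setT (sc2 r).
Proof. by apply: measurable_fun_pair; apply: measurableT_comp (msc1 r) _. Qed.

Let msc3 r : measurable_fun setT (sc3 r).
Proof.
apply: measurable_fun_pair; first exact: measurableT_comp (msc2 r) _.
exact: measurableT_comp (msc1 r) _.
Qed.

Let preim d1 d2 (T1 : measurableType d1) (T2 : measurableType d2) (f : T1 -> T2) A :
  measurable_fun setT f -> measurable A -> measurable (f @^-1` A).
Proof. by move=> mf mA; rewrite -[X in measurable X]setTI; exact: mf. Qed.

(** [r] times the image measure gives every half-open interval its length, and these values
    determine the measure. In dimensions 2 and 3 the uniqueness of product measures plays this
    role. *)
Lemma lebesgue_measure_dilation r (A : set (measurableTypeR R)) : 0 < r -> measurable A ->
  (mu (sc1 r @^-1` A) = (r^-1)%:E * mu A)%E.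
Proof.
move=> r0 mA.
pose m' := scalem (NngNum (ltW r0)) (pushm mu (msc1 r)).
have H X : ocitv X -> mu X = m' X.
  move=> [[a b] _ <-]; rewrite /m' scalemE pushmE /=.
  have -> : sc1 r @^-1` `]a, b] = `]r^-1 * a, r^-1 * b]%classic.
    apply/seteqP; rewrite /sc1; split => x /=; rewrite !in_itv/= => /andP[xa xb]; apply/andP.
      by rewrite ltr_pdivrMl// ler_pdivlMl.
    by rewrite ltr_pdivrMl// ler_pdivlMl in xa xb *.
  rewrite !lebesgue_measure_itv/= !lte_fin ltr_pM2l ?invr_gt0//.
  case: ifP => // _; last by rewrite mule0.
  by rewrite -!EFinB -EFinM; congr (_%:E); field; rewrite gt_eqF.
rewrite (lebesgue_measure_unique H mA) /m' scalemE pushmE /=.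
by rewrite muleA -EFinM mulVf ?gt_eqF// mul1e.
Qed.

Let leb2_dilation r (A : set (measurableTypeR R * measurableTypeR R)) : 0 < r -> measurable A ->
  (leb2 (sc2 r @^-1` A) = (r^-1 ^+ 2)%:E * leb2 A)%E.
Proof.
move=> r0 mA.
have r20 : 0 <= r ^+ 2 by exact: sqr_ge0.
pose m2 := scalem (NngNum r20) (pushm leb2 (msc2 r)).
have H2 : leb2 A = m2 A.
  apply: leb2_unique mA => X Y mX mY.
  rewrite /m2 scalemE pushmE.
  have -> : sc2 r @^-1` (X `*` Y) = (sc1 r @^-1` X) `*` (sc1 r @^-1` Y) by [].
  rewrite [X in (_ * X)%E = _](leb2_rect (preim (msc1 r) mX) (preim (msc1 r) mY)).
  rewrite !lebesgue_measure_dilation//.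
  have -> : (NngNum r20)%:num = r ^+ 2 by [].
  rewrite muleACA -EFinM !muleA -EFinM.
  by rewrite -expr2 -exprMn mulfV ?gt_eqF// expr1n mul1e.
rewrite H2 /m2 scalemE pushmE.
have -> : (NngNum r20)%:num = r ^+ 2 by [].
by rewrite muleA -EFinM -exprMn mulVf ?gt_eqF// expr1n mul1e.
Qed.

Lemma leb3_dilation r (A : set E3) : 0 < r -> measurable A ->
  (leb3 (sc3 r @^-1` A) = (r^-1 ^+ 3)%:E * leb3 A)%E.
Proof.
move=> r0 mA.
have r30 : 0 <= r ^+ 3 by rewrite exprn_ge0// ltW.
pose m3 := scalem (NngNum r30) (pushm leb3 (msc3 r)).
have H3 : leb3 A = m3 A.
  apply: leb3_unique mA => X Y mX mY.
  rewrite /m3 scalemE pushmE.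
  have -> : sc3 r @^-1` (X `*` Y) = (sc2 r @^-1` X) `*` (sc1 r @^-1` Y) by [].
  rewrite leb3_rect; try exact: preim.
  rewrite leb2_dilation// lebesgue_measure_dilation//.
  have -> : (NngNum r30)%:num = r ^+ 3 by [].
  rewrite muleACA -EFinM !muleA -EFinM.
  by rewrite -exprSr -exprMn mulfV ?gt_eqF// expr1n mul1e.
rewrite H3 /m3 scalemE pushmE.
have -> : (NngNum r30)%:num = r ^+ 3 by [].
by rewrite muleA -EFinM -exprMn mulVf ?gt_eqF// expr1n mul1e.
Qed.

Lemma enorm_ge0 x : 0 <= enorm x. Proof. exact: sqrtr_ge0. Qed.

Lemma enorm_sqr x : enorm x ^+ 2 = x.1.1 ^+ 2 + x.1.2 ^+ 2 + x.2 ^+ 2.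
Proof. by rewrite sqr_sqrtr// !addr_ge0 ?sqr_ge0. Qed.

Lemma enorm_coord x :
  [/\ `|x.1.1| <= enorm x, `|x.1.2| <= enorm x & `|x.2| <= enorm x].
Proof.
have h a : a ^+ 2 <= enorm x ^+ 2 -> `|a| <= enorm x.
  by rewrite -[a ^+ 2]real_normK ?num_real// ler_sqr ?nnegrE ?enorm_ge0.
have := sqr_ge0 x.1.1; have := sqr_ge0 x.1.2; have := sqr_ge0 x.2.
by split; apply: h; rewrite enorm_sqr; lra.
Qed.

Lemma measurable_eball r : measurable (eball r : set E3).
Proof.
have := measurable_enorm measurableT (measurable_itv `]-oo, r[).
by rewrite setTI; congr measurable; apply/seteqP; split => x /=; rewrite in_itv.
Qed.

Lemma leb3_eball1_lty : (leb3 (eball 1 : set E3) < +oo)%E.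
Proof.
pose B : set E3 := (`[-1, 1]%classic `*` `[-1, 1]%classic) `*` `[-1, 1]%classic.
have mB : measurable B by do 2 ? [apply: measurableX]; exact: measurable_itv.
apply: (@le_lt_trans _ _ (leb3 B)).
  apply: le_measure; rewrite ?inE//; first exact: measurable_eball.
  move=> x /= /ltW x1; have [a b c] := enorm_coord x.
  by split; [split|]; rewrite /= in_itv/= -ler_norml; apply: le_trans x1.
rewrite leb3_rect ?leb2_rect//; try exact: measurable_itv.
  by rewrite !lebesgue_measure_itv/= lte_fin ifT ?lt0N1//; rewrite -!EFinB -!EFinM ltry.
by apply: measurableX; exact: measurable_itv.
Qed.

Lemma leb3_eball1_gt0 : (0 < leb3 (eball 1 : set E3))%E.
Proof.
pose B : set E3 := (`[0, 2^-1]%classic `*` `[0, 2^-1]%classic) `*` `[0, 2^-1]%classic.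
have mB : measurable B by do 2 ? [apply: measurableX]; exact: measurable_itv.
have i2 : 0 < 2^-1 :> R by [].
apply: (@lt_le_trans _ _ (leb3 B)).
  rewrite leb3_rect ?leb2_rect//; try exact: measurable_itv.
    by rewrite !lebesgue_measure_itv/= lte_fin i2 !oppr0 !adde0 -!EFinM lte_fin !mulr_gt0.
  by apply: measurableX; exact: measurable_itv.
apply: le_measure; rewrite ?inE//; first exact: measurable_eball.
move=> x /= [[]]; rewrite /= !in_itv/= => /andP[a0 a1] /andP[b0 b1] /andP[c0 c1].
rewrite /eball /= -(@ltr_sqr _ (enorm x)) ?nnegrE ?enorm_ge0// enorm_sqr.
have h (a : R) : 0 <= a -> a <= 2^-1 -> a ^+ 2 <= 4^-1 by move=> *; nra.
by have := h _ a0 a1; have := h _ b0 b1; have := h _ c0 c1; lra.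
Qed.

(** The area of the unit sphere, taken as three times the volume of the unit ball; dilation then
    gives the volume of every ball. *)
Definition kappa : R := 3 * fine (leb3 (eball 1 : set E3)).

Lemma kappa_gt0 : 0 < kappa.
Proof.
rewrite mulr_gt0// fine_gt0// leb3_eball1_gt0; exact: leb3_eball1_lty.
Qed.

Lemma leb3_eball r : 0 < r -> leb3 (eball r : set E3) = (kappa / 3 * r ^+ 3)%:E.
Proof.
move=> r0.
have mE : measurable (eball 1 : set E3) by exact: measurable_eball.
have -> : (eball r : set E3) = sc3 r^-1 @^-1` eball 1.
  have h x : enorm (sc3 r^-1 x) = r^-1 * enorm x.
    rewrite /enorm /sc3 /sc2 /sc1 /= !exprMn -!mulrDr sqrtrM ?sqr_ge0//.
    by rewrite sqrtr_sqr gtr0_norm// invr_gt0.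
  by apply/seteqP; rewrite /eball; split => x /=; rewrite h ltr_pdivrMl// mulr1.
rewrite leb3_dilation ?invr_gt0// invrK.
have fe : leb3 (eball 1 : set E3) \is a fin_num.
  by rewrite ge0_fin_numE// leb3_eball1_lty.
rewrite -[X in (_ * X)%E](fineK fe) -EFinM /kappa; congr (_%:E); by field.
Qed.

Lemma continuous_enorm : continuous (enorm : E3 -> R).
Proof.
move=> x; apply: (@continuous_comp _ _ _ (fun x : E3 => x.1.1 ^+ 2 + x.1.2 ^+ 2 + x.2 ^+ 2) (@Num.sqrt R)); last first.
  exact: sqrt_continuous.
have c1 : {for x, continuous (fun x : E3 => x.1.1 : R)}.
  by apply: (@continuous_comp _ _ _ fst fst); [exact: cvg_fst | exact: cvg_fst].
have c2 : {for x, continuous (fun x : E3 => x.1.2 : R)}.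
  by apply: (@continuous_comp _ _ _ fst snd); [exact: cvg_fst | exact: cvg_snd].
have c3 : {for x, continuous (fun x : E3 => x.2 : R)} by exact: cvg_snd.
have sq (f : E3 -> R) : {for x, continuous f} -> {for x, continuous (fun x => f x ^+ 2)}.
  by move=> fc; apply: (@continuous_comp _ _ _ f (fun y => y ^+ 2)) => //; exact: exprn_continuous.
exact: cvgD (cvgD (sq _ c1) (sq _ c2)) (sq _ c3).
Qed.

Lemma enorm_preimage_open (A : set R) : open A -> open ((@enorm R) @^-1` A).
Proof. by move=> oA; apply: open_comp => // x _; exact: continuous_enorm. Qed.

Lemma exterior_open : open (exterior : set E3).
Proof.
have -> : (exterior : set E3) = (@enorm R) @^-1` `]1, +oo[%classic.
  by apply/seteqP; split => x /=; rewrite in_itv/= andbT.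
by apply: enorm_preimage_open; exact: interval_open.
Qed.

Lemma measurable_exterior : measurable (exterior : set E3).
Proof. exact: open_measurable3 exterior_open. Qed.

Let en : E3 -> measurableTypeR R := enorm.
Let men : measurable_fun setT en. Proof. exact: measurable_enorm. Qed.
Let nu := pushm leb3 men.
Let dens (r : measurableTypeR R) : measurableTypeR R := if 0 < r then kappa * r ^+ 2 else 0.
Let dens_ge0 r : 0 <= dens r.
Proof. by rewrite /dens; case: ifP => // r0; rewrite mulr_ge0 ?sqr_ge0// ltW// kappa_gt0. Qed.
Let mdens : measurable_fun setT dens.
Proof.
apply: measurable_fun_ifT => //; first exact: measurable_fun_ltr.
by apply: measurable_funM => //; apply: measurable_funX.
Qed.

Let dens_itv r : 0 < r -> (\int[mu]_(x in `]-oo, r[) (dens x)%:E = (kappa / 3 * r ^+ 3)%:E)%E.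
Proof.
move=> r0.
have mE : measurable_fun [set: R] (fun r => (dens r)%:E) by exact/measurable_EFinP.
have -> : `]-oo, r[%classic = `]-oo, 0[%classic `|` `[0, r[%classic :> set R.
  by apply/seteqP; split=> x /=; rewrite !in_itv/= ?in_itv/= => h; [case: (ltP x 0) => ?; [left|right]|case: h => [|/andP[]]]; lra.
rewrite ge0_integral_setU//; last 3 first.
- exact: measurable_funTS.
- by move=> x _; rewrite lee_fin.
- by apply/disj_setPS => x /= []; rewrite !in_itv/= => h /andP[]; lra.
rewrite integral0_eq ?add0e; last first.
  by move=> x /=; rewrite in_itv/= /dens => x0; rewrite ltNge (ltW x0).
rewrite integral_itv_bndo_bndc; last exact: measurable_funTS.
transitivity (\int[mu]_(x in `[0%R, r]) (kappa * x ^+ 2)%:E)%E.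
  apply: eq_integral => x; rewrite inE/= in_itv/= /dens => /andP[x0 _].
  by move: x0; rewrite le_eqVlt => /predU1P[<-|->//]; rewrite ltxx expr0n/= mulr0.
have Fd (x : R) : is_derive x 1 (fun x : R => kappa / 3 * x ^+ 3) (kappa * x ^+ 2).
  by der; rewrite /=; field.
have fc : continuous (fun x : R => kappa * x ^+ 2).
  by move=> x; apply: cvgM; [exact: cvg_cst | exact: exprn_continuous].
rewrite (@continuous_FTC2 _ _ (fun x : R => kappa / 3 * x ^+ 3))//.
- by rewrite expr0n/= mulr0 sube0.
- exact: continuous_subspaceT.
- split; first by move=> x _; have [] := Fd x.
    by apply: cvg_at_right_filter; exact: (dcont (Fd 0)).
  by apply: cvg_at_left_filter; exact: (dcont (Fd r)).
by move=> x _; have [_ h] := Fd x; rewrite derive1E.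
Qed.

Let dens_m := density_measure mu mdens dens_ge0.

(** The image of [leb3] under the norm and the measure of density [kappa r^2] agree on the
    half-lines []-oo, r[], where both are the volume of a ball; these are stable under intersection,
    generate the sigma-algebra and exhaust the line with finite measure. *)
Let nu_dens (A : set (measurableTypeR R)) : measurable A -> nu A = dens_m A.
Proof.
have ne r : nu (`]-oo, r[%classic : set (measurableTypeR R)) = leb3 (eball r : set E3).
  have E : en @^-1` `]-oo, r[%classic = eball r.
    by apply/seteqP; split => x /=; rewrite in_itv.
  by rewrite /nu pushmE E.
have H r : nu (`]-oo, r[%classic : set (measurableTypeR R)) = dens_m (`]-oo, r[%classic : set (measurableTypeR R)).
  rewrite ne density_measureE; have [r0|r0] := ltP 0 r.
    by rewrite dens_itv// leb3_eball.
  have -> : (eball r : set E3) = set0.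
    apply/seteqP; split => // x /= xr.
    by have := lt_le_trans xr r0; rewrite ltNge enorm_ge0.
  rewrite measure0 integral0_eq// => x /=; rewrite in_itv/= /dens => xr.
  by rewrite ltNge (ltW (lt_le_trans xr r0)).
have MU := @measure_unique _ R (measurableTypeR R) (@RGenInftyO.G R) (fun k : nat => `]-oo, k%:R[%classic : set (measurableTypeR R)).
move: {+}A; apply: (MU _ _ _ _ nu dens_m).
- exact: RGenInftyO.measurableE.
- move=> X Y [x ->] [y ->]; exists (Num.min x y).
  by apply/seteqP; split => z /=; rewrite !in_itv/= lt_min; [move=> [-> ->]|move=> /andP[-> ->]].
- by move=> k; exists k%:R.
- rewrite -subTset => x _; exists (Num.truncn `|x|).+1 => //=; rewrite in_itv/=.
  by apply: (le_lt_trans (ler_norm _)); exact: truncnS_gt.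
- by move=> X [x ->]; exact: H.
- move=> k; rewrite ne; apply: (@le_lt_trans _ _ (leb3 (eball k.+1%:R : set E3))).
    apply: le_measure; rewrite ?inE; try exact: measurable_eball.
    by move=> x /= /lt_le_trans; apply; rewrite ler_nat.
  by rewrite leb3_eball// ltry.
Qed.

Lemma ge0_polar (f : R -> \bar R) : measurable_fun setT f -> (forall r, 0 <= f r)%E ->
  (\int[leb3]_(x in (exterior : set E3)) f (enorm x) =
   \int[mu]_(r in `]1%R, +oo[) (f r * (kappa * r ^+ 2)%:E))%E.
Proof.
move=> mf f0.
pose I : set (measurableTypeR R) := `]1%R, +oo[%classic.
have m1 : measurable I by exact: measurable_itv.
have -> : (exterior : set E3) = en @^-1` I.
  by apply/seteqP; split => x /=; rewrite /I /= in_itv/= andbT.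
have mf1 : measurable_fun [set: measurableTypeR R] (f : measurableTypeR R -> \bar R) by exact: mf.
rewrite -[LHS](@ge0_integral_pushforward _ _ _ _ R _ men leb3 I f m1 (measurable_funTS mf1) (fun r _ => f0 r)).
transitivity (\int[dens_m]_(r in I) f r)%E.
  by apply: eq_measure_integral => A mA _; exact: nu_dens.
have mf2 : measurable_fun setT (f \_ I) by apply/(measurable_restrictT _ _).1 => //; exact: measurable_funTS.
rewrite integral_mkcond (@ge0_integral_density _ _ _ mu dens_m dens mdens dens_ge0)//; last first.
  by move=> r; rewrite patchE; case: ifP.
rewrite [RHS]integral_mkcond; apply: eq_integral => r _.
rewrite !patchE; case: ifPn => [|_]; last by rewrite mul0e.
rewrite inE /I /= in_itv/= andbT /dens => r1;  by rewrite ifT//; lra.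
Qed.

Lemma polar_integrable (f : R -> R) : measurable_fun setT f ->
  leb3.-integrable (exterior : set E3) (fun x => (f (enorm x))%:E) <->
  mu.-integrable `]1%R, +oo[%classic (fun r => (f r * (kappa * r ^+ 2))%:E).
Proof.
move=> mf.
have mfe : measurable_fun setT (fun r => `|f r|%:E).
  by apply/measurable_EFinP; exact: measurableT_comp.
have E : (\int[leb3]_(x in (exterior : set E3)) `|(f (enorm x))%:E| =
          \int[mu]_(r in `]1%R, +oo[%classic) `|(f r * (kappa * r ^+ 2))%:E|)%E.
  rewrite (ge0_polar (f := fun r => `|f r|%:E)) => //.
  apply: eq_integral => r _; rewrite -EFinM /= normrM; congr ((_ * _)%:E).
  by rewrite ger0_norm// mulr_ge0 ?sqr_ge0// ltW// kappa_gt0.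
have A1 : measurable_fun (exterior : set E3) (fun x => (f (enorm x))%:E).
  apply: measurable_funTS; apply/measurable_EFinP.
  by apply: (measurableT_comp mf); exact: measurable_enorm.
have A2 : measurable_fun (`]1%R, +oo[%classic : set (measurableTypeR R)) (fun r => (f r * (kappa * r ^+ 2))%:E).
  apply/measurable_EFinP; apply: measurable_funTS; apply: measurable_funM => //.
  by apply: measurable_funM => //; apply: measurable_funX.
by split=> /integrableP[_ h]; apply/integrableP; split=> //; rewrite ?E// -E.
Qed.

Lemma polar (f : R -> R) : measurable_fun setT f ->
  (\int[leb3]_(x in (exterior : set E3)) (f (enorm x))%:E =
   \int[mu]_(r in `]1%R, +oo[) (f r * (kappa * r ^+ 2))%:E)%E.
Proof.
move=> mf.
have k0 r : 0 <= kappa * r ^+ 2 by rewrite mulr_ge0 ?sqr_ge0// ltW// kappa_gt0.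
rewrite integralE [RHS]integralE; congr (_ - _)%E.
- transitivity (\int[leb3]_(x in (exterior : set E3)) (maxe (f (enorm x))%:E 0))%E.
    by apply: eq_integral => x _; rewrite funeposE.
  rewrite (ge0_polar (f := fun r => maxe (f r)%:E 0)).
  + apply: eq_integral => r _; rewrite funeposE EFinM maxe_pMl ?lee_fin// mul0e.
    by [].
  + by apply: measurable_maxe => //; exact/measurable_EFinP.
  + by move=> r; rewrite le_max lexx orbT.
- transitivity (\int[leb3]_(x in (exterior : set E3)) (maxe (- (f (enorm x))%:E) 0))%E.
    by apply: eq_integral => x _; rewrite funenegE.
  rewrite (ge0_polar (f := fun r => maxe (- (f r)%:E)%E 0)).
  + by apply: eq_integral => r _; rewrite funenegE (EFinM (f r)) maxe_pMl ?lee_fin// mul0e mulNe.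
  + apply: measurable_maxe => //; apply: measurableT_comp => //; exact/measurable_EFinP.
  + by move=> r; rewrite le_max lexx orbT.
Qed.

End space3.

(** * Smooth functions and test functions *)

(** The algebra generated by [A] and the constants. Smoothness proofs exhibit a class whose
    derivatives stay in its algebra, so that iterated derivatives are never computed. *)
Inductive alg (R : realType) T (A : (T -> R) -> Prop) : (T -> R) -> Prop :=
| alg_gen f : A f -> alg A f
| alg_cst c : alg A (fun=> c)
| alg_add f g : alg A f -> alg A g -> alg A (fun x => f x + g x)
| alg_mul f g : alg A f -> alg A g -> alg A (fun x => f x * g x).

Lemma alg_exp (R : realType) T (A : (T -> R) -> Prop) f n : alg A f -> alg A (fun x => f x ^+ n).
Proof.
move=> h; elim: n => [|n IH].
  by have := alg_cst A 1; congr alg; apply/funext => x; rewrite expr0.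
by have := alg_mul h IH; congr alg; apply/funext => x; rewrite exprS.
Qed.

Lemma alg_mono (R : realType) T (A B : (T -> R) -> Prop) f :
  (forall a, A a -> B a) -> alg A f -> alg B f.
Proof.
move=> AB; elim=> [a /AB|c|g h _ g' _ h'|g h _ g' _ h'].
- exact: alg_gen.
- exact: alg_cst.
- exact: alg_add.
- exact: alg_mul.
Qed.

Section smooth1.
Context {R : realType}.
Implicit Types (I J : set R) (f g h : R -> R) (P : (R -> R) -> Prop).

(** A coinductive form of smoothness: membership in some class of functions stable under
    differentiation on [I]. *)
Definition smooth1 I h := exists2 P, P h &
  forall b, P b -> exists2 b', P b' & forall r, I r -> is_derive r 1 b (b' r).

Lemma smooth1_alg I P f :
  (forall b, P b -> exists2 b', alg P b' & forall r, I r -> is_derive r 1 b (b' r)) ->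
  alg P f -> smooth1 I f.
Proof.
move=> PI Pf; exists (alg P) => // {Pf}f.
elim=> [b /PI//|c|g h Pg [g' Pg' dg] Ph [h' Ph' dh]|g h Pg [g' Pg' dg] Ph [h' Ph' dh]].
- by exists (fun=> 0); [exact: alg_cst | move=> r _; exact: dcst].
- by exists (fun r => g' r + h' r); [exact: alg_add | move=> r Ir; apply: dD; [exact: dg | exact: dh]].
- exists (fun r => g' r * h r + g r * h' r); first by apply: alg_add; exact: alg_mul.
  by move=> r Ir; apply: dM; [exact: dg | exact: dh].
Qed.

Lemma smooth1_deriv I f : smooth1 I f ->
  exists2 f', smooth1 I f' & forall r, I r -> is_derive r 1 f (f' r).
Proof. by case=> P Pf PP; have [f' Pf' df] := PP _ Pf; exists f' => //; exists P. Qed.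

Lemma smooth1_prim I f g : (forall r, I r -> is_derive r 1 f (g r)) -> smooth1 I g -> smooth1 I f.
Proof.
move=> fg [P Pg PP]; exists (fun b => b = f \/ P b); first by left.
move=> b [->|Pb]; first by exists g => //; right.
by have [b' Pb' db] := PP _ Pb; exists b' => //; right.
Qed.

Lemma smooth1_continuous I f r : smooth1 I f -> I r -> {for r, continuous f}.
Proof. by move=> /smooth1_deriv[f' _ df] Ir; exact: dcont (df _ Ir). Qed.

Lemma smooth1_sub I J f : J `<=` I -> smooth1 I f -> smooth1 J f.
Proof.
move=> JI [P Pf PP]; exists P => // b /PP[b' Pb' db]; exists b' => // r /JI; exact: db.
Qed.

Let up2 I f g : smooth1 I f -> smooth1 I g -> exists P, [/\ P f, P g &
  forall b, P b -> exists2 b', alg P b' & forall r, I r -> is_derive r 1 b (b' r)].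
Proof.
move=> [P Pf PP] [Q Qg QQ]; exists (fun b => P b \/ Q b); split; [by left|by right|].
move=> b [/PP|/QQ][b' hb db]; exists b' => //; apply: alg_gen; [by left|by right].
Qed.

Lemma smooth1_cst I c : smooth1 I (fun=> c).
Proof.
apply: (@smooth1_alg I (fun=> False)) => //; exact: alg_cst.
Qed.

Lemma smooth1_add I f g : smooth1 I f -> smooth1 I g -> smooth1 I (fun r => f r + g r).
Proof.
move=> fs gs; have [P [Pf Pg PP]] := up2 fs gs; apply: smooth1_alg PP _.
by apply: alg_add; exact: alg_gen.
Qed.

Lemma smooth1_mul I f g : smooth1 I f -> smooth1 I g -> smooth1 I (fun r => f r * g r).
Proof.
move=> fs gs; have [P [Pf Pg PP]] := up2 fs gs; apply: smooth1_alg PP _.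
by apply: alg_mul; exact: alg_gen.
Qed.

Lemma smooth1_inv : smooth1 [set r | 0 < r] (@GRing.inv R).
Proof.
apply: (@smooth1_alg _ (fun b => b = @GRing.inv R)); last exact: alg_gen.
move=> b ->; exists (fun r => (-1) * (r^-1 * r^-1)).
  apply: alg_mul; first exact: alg_cst.
  by apply: alg_mul; exact: alg_gen.
by move=> r r0; rewrite -expr2; apply: dVid; rewrite gt_eqF.
Qed.

Lemma smooth1_affine I J f a b : smooth1 I f -> (forall r, J r -> I (a * r + b)) ->
  smooth1 J (fun r => f (a * r + b)).
Proof.
move=> [P Pf PP] JI.
apply: (@smooth1_alg _ (fun g => exists2 p, P p & g = (fun r => p (a * r + b)))); last first.
  by apply: alg_gen; exists f.
move=> _ [p Pp ->]; have [p' Pp' dp] := PP _ Pp.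
exists (fun r => p' (a * r + b) * a).
  by apply: alg_mul; [apply: alg_gen; exists p' | exact: alg_cst].
move=> r Jr; have h := dp _ (JI _ Jr).
apply: (deq (dcomp (f := p) (g := fun r => a * r + b) h (dD (dM (dcst r a) (did r)) (dcst r b)))).
by ring.
Qed.

Lemma smooth1_eq I f g : open I -> (forall r, I r -> f r = g r) -> smooth1 I f -> smooth1 I g.
Proof.
move=> oI fg /smooth1_deriv[f' sf' df]; apply: smooth1_prim sf' => r Ir.
apply: dnear (df _ Ir); near=> y; apply: fg; near: y.
exact: open_nbhs_nbhs.
Unshelve. all: by end_near. Qed.

End smooth1.

Section smooth3.
Context {R : realType}.
Local Notation E3 := (E3 R).
Implicit Types (U V : set E3) (f g : E3 -> R) (x : E3) (i : 'I_3).

Let line i x (t : R) : E3 := t *: (basis3 i : E3) + x.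

Lemma is_derive_line i f x d :
  is_derive x (basis3 i) f d <-> is_derive (0 : R) 1 (fun t => f (line i x t)) d.
Proof.
have E : 'D_(basis3 i) f x = 'D_1 (fun t => f (line i x t)) (0 : R).
  have H : (fun h : R => h^-1 *: ((f \o shift x) (h *: (basis3 i : E3)) - f x)) =
      (fun h : R => h^-1 *: (((fun t => f (line i x t)) \o shift 0) (h *: 1) - f (line i x 0))).
    by apply/funext => h /=; rewrite /line scale0r add0r addr0 /GRing.scale/= mulr1.
  by rewrite /derive H.
split=> -[d1 d2]; split.
- exact: (@derivable1P _ _ _ f x (basis3 i)).1.
- by rewrite -E.
- exact: (@derivable1P _ _ _ f x (basis3 i)).2.
- by rewrite E.
Qed.

Lemma pderiv_is_derive i f x d : is_derive x (basis3 i) f d -> pderiv i f x = d.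
Proof. by case. Qed.

Lemma near_line i x (A : set E3) : nbhs x A -> \forall t \near (0 : R), A (line i x t).
Proof.
move=> Ax; have c : {for (0:R), continuous (line i x)}.
  move=> B; rewrite /= {1}/line scale0r add0r => xB.
  have : (fun t : R => t *: (basis3 i : E3) + x) @ (0 : R) --> (0 : R) *: (basis3 i : E3) + x.
    by apply: cvgD; [apply: cvgZr_tmp|exact: cvg_cst].
  by rewrite scale0r add0r; apply.
by apply: c; rewrite /= /line scale0r add0r.
Qed.

Lemma is_derive3_near i f g x d : {near x, f =1 g} ->
  is_derive x (basis3 i) f d -> is_derive x (basis3 i) g d.
Proof.
move=> fg /is_derive_line fd; apply/is_derive_line; apply: dnear fd; exact: near_line fg.
Qed.

Lemma continuous_near f g x : {near x, f =1 g} -> {for x, continuous f} -> {for x, continuous g}.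
Proof.
move=> fg fc; have fx : f x = g x := nbhs_singleton fg.
rewrite /prop_for /continuous_at -fx; apply: cvg_trans fc.
exact: near_eq_cvg fg.
Qed.

Lemma is_derive3D i f g x a b : is_derive x (basis3 i) f a -> is_derive x (basis3 i) g b ->
  is_derive x (basis3 i) (fun x => f x + g x) (a + b).
Proof. by move=> /is_derive_line h1 /is_derive_line h2; apply/is_derive_line; exact: dD h1 h2. Qed.

Lemma is_derive3M i f g x a b : is_derive x (basis3 i) f a -> is_derive x (basis3 i) g b ->
  is_derive x (basis3 i) (fun x => f x * g x) (a * g x + f x * b).
Proof.
move=> /is_derive_line h1 /is_derive_line h2; apply/is_derive_line; apply: (deq (dM h1 h2)).
by rewrite /line scale0r add0r.
Qed.

Lemma is_derive3_cst i (c : R) x : is_derive x (basis3 i) (fun=> c) 0.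
Proof. by apply/is_derive_line/dcst. Qed.

Lemma is_derive3_comp i f (h : R -> R) x a b : is_derive (f x) 1 h a -> is_derive x (basis3 i) f b ->
  is_derive x (basis3 i) (fun x => h (f x)) (a * b).
Proof.
move=> h1 /is_derive_line h2; apply/is_derive_line; apply: (dcomp (f := h)) => //.
by rewrite /line scale0r add0r.
Qed.

Definition coord (i : 'I_3) (x : E3) : R :=
  if i == 0 :> nat then x.1.1 else if i == 1 :> nat then x.1.2 else x.2.

Lemma coord_line i j x (t : R) : coord j (line i x t) = t * (i == j)%:R + coord j x.
Proof.
by case: i => -[|[|[|//]]] ?; case: j => -[|[|[|//]]] ?; rewrite /coord /= /GRing.scale/=.
Qed.

Lemma is_derive3_coord i j x : is_derive x (basis3 i) (coord j) (i == j)%:R.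
Proof.
apply/is_derive_line; apply: (deqf (fun t => coord_line i j x t)).
by apply: (deq (dD (dM (did _) (dcst _ _)) (dcst _ _))); ring.
Qed.

Lemma enormE x : enorm x = Num.sqrt (\sum_(j < 3) coord j x ^+ 2).
Proof. by rewrite !big_ord_recl big_ord0 /enorm /coord /= addr0 addrA. Qed.

Lemma enorm_sqrE x : enorm x ^+ 2 = \sum_(j < 3) coord j x ^+ 2.
Proof. by rewrite enormE sqr_sqrtr// sumr_ge0// => j _; exact: sqr_ge0. Qed.

Lemma is_derive3_enorm i x : 0 < enorm x -> is_derive x (basis3 i) enorm (coord i x / enorm x).
Proof.
move=> x0; have s0 : 0 < \sum_(j < 3) coord j x ^+ 2.
  by rewrite -enorm_sqrE exprn_gt0.
have -> : enorm = fun x : E3 => Num.sqrt (\sum_(j < 3) coord j x ^+ 2).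
  by apply/funext => y; exact: enormE.
have q : is_derive x (basis3 i) (fun x => \sum_(j < 3) coord j x ^+ 2) (2 * coord i x).
  apply/is_derive_line; apply: (@deqf _ (fun t => \sum_(j < 3) (t * (i == j)%:R + coord j x) ^+ 2)).
    by move=> t; apply: eq_bigr => j _; rewrite coord_line.
  have S : forall t, \sum_(j < 3) (t * (i == j)%:R + coord j x) ^+ 2 =
      (t * (i == 0)%:R + coord 0 x) ^+ 2 + (t * (i == 1)%:R + coord 1 x) ^+ 2
      + (t * (i == 2)%:R + coord 2 x) ^+ 2.
    move=> t; rewrite !big_ord_recl big_ord0 addr0 addrA.
    have -> : lift ord0 ord0 = 1 :> 'I_3 by apply/val_inj.
    by have -> : lift ord0 (lift ord0 ord0) = 2 :> 'I_3 by apply/val_inj.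
  apply: (deqf S).
  have dl (c : bool) (e : R) : is_derive (0 : R) 1 (fun t : R => (t * c%:R + e) ^+ 2) (2 * c%:R * e).
    by apply: (deq (dX 2 (dD (dM (did _) (dcst _ _)) (dcst _ _)))); rewrite /=; ring.
  apply: (deq (dD (dD (dl _ _) (dl _ _)) (dl _ _))).
  have -> : coord i x = (i == 0)%:R * coord 0 x + (i == 1)%:R * coord 1 x + (i == 2)%:R * coord 2 x.
    by clear S; case: i => -[|[|[|//]]] p; rewrite /coord /= ?mul1r ?mul0r ?addr0 ?add0r.
  by rewrite /=; ring.
apply: is_derive_eq; first by apply: (is_derive3_comp (h := Num.sqrt) _ q); exact: is_derive1_sqrt.
rewrite -enormE; move: x0; move: (enorm x) (coord i x) => r c r0.
by field; rewrite gt_eqF.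
Qed.

Lemma is_derive3_radial i (h : R -> R) x d : 0 < enorm x -> is_derive (enorm x) 1 h d ->
  is_derive x (basis3 i) (radial_fun h) (d * (coord i x * (enorm x)^-1)).
Proof. by move=> x0 hd; apply: (is_derive3_comp (h := h) hd); exact: is_derive3_enorm. Qed.

(** It suffices that the partial derivatives of the generators lie in the algebra: the product rule
    extends this to [alg A], and each iterated derivative of [f] then coincides on the open set [U]
    with an element of [alg A]. *)
Lemma smooth_on_upto U (A : (E3 -> R) -> Prop) f : open U ->
  (forall a, A a -> (forall x, U x -> {for x, continuous a}) /\
    forall i, exists2 b, alg A b & forall x, U x -> is_derive x (basis3 i) a (b x)) ->
  alg A f -> smooth_on U f.
Proof.
move=> oU AA Af.
have PP a : alg A a -> (forall x, U x -> {for x, continuous a}) /\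
    forall i, exists2 b, alg A b & forall x, U x -> is_derive x (basis3 i) a (b x).
  elim=> [b /AA//|c|g h Ag [gc gd] Ah [hc hd]|g h Ag [gc gd] Ah [hc hd]].
  - split; first by move=> x _; exact: cvg_cst.
    by move=> i; exists (fun=> 0); [exact: alg_cst | move=> x _; exact: is_derive3_cst].
  - split; first by move=> x Ux; apply: cvgD; [exact: gc | exact: hc].
    move=> i; have [g' Ag' dg] := gd i; have [h' Ah' dh] := hd i.
    exists (fun x => g' x + h' x); first exact: alg_add.
    by move=> x Ux; apply: is_derive3D; [exact: dg | exact: dh].
  - split; first by move=> x Ux; apply: cvgM; [exact: gc | exact: hc].
    move=> i; have [g' Ag' dg] := gd i; have [h' Ah' dh] := hd i.
    exists (fun x => g' x * h x + g x * h' x); first by apply: alg_add; exact: alg_mul.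
    by move=> x Ux; apply: is_derive3M; [exact: dg | exact: dh].
have near_eq x (g h : E3 -> R) : (forall y, U y -> g y = h y) -> U x -> {near x, g =1 h}.
  by move=> gh Ux; near=> y; apply: gh; near: y; exact: open_nbhs_nbhs.
have key s : exists2 g, alg A g & forall x, U x -> iter_pderiv s f x = g x.
  elim: s => [|i s [g Ag fg]]; first by exists f.
  have [_ /(_ i)[g' Ag' dg]] := PP _ Ag; exists g' => // x Ux /=.
  apply: pderiv_is_derive; apply: is_derive3_near (dg _ Ux).
  by apply: near_eq Ux => y Uy; rewrite fg.
move=> s x Ux; have [g Ag fg] := key s; have [gc gd] := PP _ Ag.
have gf : {near x, g =1 iter_pderiv s f} by apply: near_eq Ux => y Uy; rewrite fg.
split.
  exact: continuous_near gf (gc x Ux).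
by move=> i; have [g' _ dg] := gd i; have [] := is_derive3_near gf (dg x Ux).
Unshelve. all: by end_near. Qed.

Lemma smooth_on_continuous U f x : smooth_on U f -> U x -> {for x, continuous f}.
Proof. by move=> /(_ [::]) h /h[]. Qed.

Lemma smooth_on_is_derive U f x i : smooth_on U f -> U x -> is_derive x (basis3 i) f (pderiv i f x).
Proof. by move=> /(_ [::]) h /h[_ d]; split => //; exact: d. Qed.

Lemma smooth_on_pderiv U f i : smooth_on U f -> smooth_on U (pderiv i f).
Proof.
move=> h s x Ux; have := h (rcons s i) x Ux.
by rewrite /iter_pderiv foldr_rcons.
Qed.

Lemma smooth_on_alg U (A : (E3 -> R) -> Prop) f : open U -> (forall a, A a -> smooth_on U a) ->
  alg A f -> smooth_on U f.
Proof.
move=> oU AU Af; apply: (@smooth_on_upto U (smooth_on U)) => //; last exact: alg_mono Af.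
move=> a sa; split; first by move=> x; exact: smooth_on_continuous.
move=> i; exists (pderiv i a); first by apply: alg_gen; exact: smooth_on_pderiv.
by move=> x Ux; exact: smooth_on_is_derive sa Ux.
Qed.

Lemma smooth_on_mul U f g : open U -> smooth_on U f -> smooth_on U g ->
  smooth_on U (fun x => f x * g x).
Proof.
move=> oU fs gs; apply: (smooth_on_alg (A := smooth_on U)) => //.
by apply: alg_mul; exact: alg_gen.
Qed.

Lemma smooth_on_add U f g : open U -> smooth_on U f -> smooth_on U g ->
  smooth_on U (fun x => f x + g x).
Proof.
move=> oU fs gs; apply: (smooth_on_alg (A := smooth_on U)) => //.
by apply: alg_add; exact: alg_gen.
Qed.

Lemma smooth_on_cst U (c : R) : open U -> smooth_on U (fun=> c).
Proof. move=> oU; apply: (smooth_on_alg (A := fun=> False)) => //; exact: alg_cst. Qed.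

Lemma smooth_on_sub U V f : V `<=` U -> smooth_on U f -> smooth_on V f.
Proof. by move=> VU sf s x /VU; exact: sf. Qed.

Lemma smooth_on_setU U V f : smooth_on U f -> smooth_on V f -> smooth_on (U `|` V) f.
Proof. by move=> h1 h2 s x [/h1|/h2]; exact. Qed.

Lemma smooth_on_eq U f g : open U -> (forall x, U x -> f x = g x) -> smooth_on U f -> smooth_on U g.
Proof.
move=> oU fg sf; apply: (@smooth_on_upto U (fun b => exists2 a, smooth_on U a & forall x, U x -> a x = b x)) => //.
  move=> b [a sa ab].
  have near_eq x : U x -> {near x, a =1 b}.
    by move=> Ux; near=> y; apply: ab; near: y; exact: open_nbhs_nbhs.
  split.
    by move=> x Ux; exact: continuous_near (near_eq _ Ux) (smooth_on_continuous sa Ux).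
  move=> i; exists (pderiv i a).
    by apply: alg_gen; exists (pderiv i a); [exact: smooth_on_pderiv|].
  by move=> x Ux; apply: is_derive3_near (near_eq _ Ux) _; exact: smooth_on_is_derive sa Ux.
by apply: alg_gen; exists f.
Unshelve. all: by end_near. Qed.

Lemma continuous_coord i : continuous (coord i).
Proof.
have c1 : continuous (fun x : E3 => x.1.1 : R).
  by move=> x; apply: (@continuous_comp _ _ _ fst fst); [exact: cvg_fst | exact: cvg_fst].
have c2 : continuous (fun x : E3 => x.1.2 : R).
  by move=> x; apply: (@continuous_comp _ _ _ fst snd); [exact: cvg_fst | exact: cvg_snd].
have c3 : continuous (fun x : E3 => x.2 : R) by move=> x; exact: cvg_snd.
by case: i => -[|[|[|//]]] ?; rewrite /coord /=.
Qed.

Lemma smooth_on_coord U i : open U -> smooth_on U (coord i).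
Proof.
move=> oU; apply: (@smooth_on_upto U (fun a => a = coord i)) => //; last exact: alg_gen.
move=> a ->; split; first by move=> x _; exact: continuous_coord.
by move=> j; exists (fun=> (j == i)%:R); [exact: alg_cst | move=> x _; exact: is_derive3_coord].
Qed.

(** The derivative of [h(|x|)] along axis [i] is [h'(|x|) x_i / |x|]; so the class stable under
    differentiation also contains the coordinates and [1 / |x|]. *)
Lemma smooth_on_radial (I : set R) (h : R -> R) : open I -> I `<=` [set r | 0 < r] ->
  smooth1 I h -> smooth_on (@enorm R @^-1` I) (radial_fun h).
Proof.
move=> oI I0 [P Ph PP].
have oU : open (@enorm R @^-1` I) by exact: enorm_preimage_open.
pose A (a : E3 -> R) := [\/ exists2 p, P p & a = radial_fun p, exists i, a = coord i | a = radial_fun (@GRing.inv R)].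
have Ar p : P p -> alg A (radial_fun p) by move=> Pp; apply: alg_gen; constructor 1; exists p.
have Ac i : alg A (coord i) by apply: alg_gen; constructor 2; exists i.
have Av : alg A (radial_fun (@GRing.inv R)) by apply: alg_gen; constructor 3.
apply: (smooth_on_upto (A := A)) => //; last exact: Ar.
have cr (p : R -> R) (x : E3) : {for enorm x, continuous p} -> {for x, continuous (radial_fun p)}.
  by move=> pc; apply: continuous_comp => //; exact: continuous_enorm.
move=> a [[p Pp ->]|[j ->]|->]; split.
- move=> x Ux; apply: cr; have [p' _ dp] := PP _ Pp; exact: dcont (dp _ Ux).
- move=> i; have [p' Pp' dp] := PP _ Pp.
  exists (fun x => radial_fun p' x * (coord i x * radial_fun (@GRing.inv R) x)).
    by apply: alg_mul; [exact: Ar | exact: alg_mul].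
  by move=> x Ux; apply: is_derive3_radial; [exact: I0 | exact: dp].
- by move=> x _; exact: continuous_coord.
- by move=> i; exists (fun=> (i == j)%:R); [exact: alg_cst | move=> x _; exact: is_derive3_coord].
- by move=> x Ux; apply: cr; apply: inv_continuous; rewrite gt_eqF//; exact: I0 Ux.
- move=> i; exists (fun x => ((-1) * radial_fun (@GRing.inv R) x ^+ 2) * (coord i x * radial_fun (@GRing.inv R) x)).
    apply: alg_mul; last exact: alg_mul.
    by apply: alg_mul; [exact: alg_cst | exact: alg_exp].
  move=> x Ux; have x0 := I0 _ Ux; apply: is_derive3_radial => //.
  by apply: dVid; rewrite gt_eqF.
Qed.

End smooth3.

(** * Test functions and integration by parts *)

Section test_functions.
Context {R : realType}.
Local Notation mu := (@lebesgue_measure R).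
Local Notation E3 := (E3 R).
Implicit Types (phi f g : E3 -> R) (x : E3) (i : 'I_3).

Lemma continuous_compact_bound (K : set E3) f : continuous f -> compact K ->
  exists M : R, forall x, K x -> `|f x| <= M.
Proof.
move=> fc cK.
have cfK : compact (f @` K) by apply: continuous_compact => //; exact: continuous_subspaceT.
have [M [Mr h]] := compact_bounded cfK.
exists (M + 1) => x Kx; apply: (h (M + 1)); first by rewrite ltrDl.
by exists x.
Qed.

Lemma compact_coord_bound (K : set E3) : compact K ->
  exists2 A : R, 0 < A & forall x, K x -> forall i, `|coord i x| <= A.
Proof.
move=> cK.
have [A0 h0] := continuous_compact_bound (@continuous_coord R 0) cK.
have [A1 h1] := continuous_compact_bound (@continuous_coord R 1) cK.
have [A2 h2] := continuous_compact_bound (@continuous_coord R 2) cK.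
have p0 := normr_ge0 A0; have p1 := normr_ge0 A1; have p2 := normr_ge0 A2.
have q0 := ler_norm A0; have q1 := ler_norm A1; have q2 := ler_norm A2.
exists (`|A0| + `|A1| + `|A2| + 1); first by lra.
move=> x Kx; have := h0 x Kx; have := h1 x Kx; have := h2 x Kx => k2 k1 k0.
by case=> -[|[|[|//]]] ?; rewrite /coord /= in k0 k1 k2 *; lra.
Qed.

Lemma compl_compact_open (K : set E3) : compact K -> open (~` K).
Proof. by move=> cK; apply: closed_openC; apply: compact_closed => //; exact: norm_hausdorff. Qed.

Lemma pderiv_vanish (V : set E3) f i x : open V -> (forall y, V y -> f y = 0) -> V x -> pderiv i f x = 0.
Proof.
move=> oV f0 Vx; apply: pderiv_is_derive.
apply: is_derive3_near (is_derive3_cst i 0 x).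
by near=> y; rewrite f0//; near: y; exact: open_nbhs_nbhs.
Unshelve. all: by end_near. Qed.

Lemma test_continuous phi : test_function phi -> continuous phi.
Proof. by move=> [s _] x; exact: (smooth_on_continuous s). Qed.

Lemma test_is_derive phi i x : test_function phi -> is_derive x (basis3 i) phi (pderiv i phi x).
Proof. by move=> [s _]; exact: (smooth_on_is_derive i s). Qed.

Lemma test_pderiv phi i : test_function phi -> test_function (pderiv i phi).
Proof.
move=> [s [K [cK KU K0]]]; split; first exact: smooth_on_pderiv.
exists K; split => // x nK; apply: (pderiv_vanish (V := ~` K)) => //.
exact: compl_compact_open.
Qed.

Lemma test_vanish phi x : test_function phi -> ~ exterior x -> phi x = 0.
Proof. by move=> [s [K [cK KU K0]]] nx; apply: K0 => /KU. Qed.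

(** [f] is controlled only on the exterior domain, but the product is 0 off the compact support of
    [phi], and these two open sets cover the space. *)
Lemma test_smooth_mul phi f : test_function phi -> smooth_on exterior f ->
  test_function (fun x => f x * phi x).
Proof.
move=> [s [K [cK KU K0]]] sf; split; last first.
  by exists K; split => // x /K0 ->; rewrite mulr0.
have -> : setT = exterior `|` ~` K.
  rewrite eqEsubset; split=> // x _; case: (pselect (K x)) => Kx; [left|right] => //; exact: KU.
have oE := @exterior_open R; have oK := compl_compact_open cK.
apply: smooth_on_setU.
  by apply: smooth_on_mul => //; apply: smooth_on_sub s.
apply: (@smooth_on_eq _ _ (fun=> 0)) => //; last exact: smooth_on_cst.
by move=> x /K0 ->; rewrite mulr0.
Qed.

Lemma test_add phi f : test_function phi -> test_function f -> test_function (fun x => phi x + f x).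
Proof.
move=> [s [K [cK KU K0]]] [t [L [cL LU L0]]]; split; first by apply: smooth_on_add => //; exact: openT.
exists (K `|` L); split.
- exact: compactU.
- by move=> x [/KU|/LU].
- by move=> x /not_orP[/K0 -> /L0 ->]; rewrite addr0.
Qed.

Lemma test_scale phi (c : R) : test_function phi -> test_function (fun x => c * phi x).
Proof. by move=> tp; apply: test_smooth_mul => //; apply: smooth_on_cst; exact: exterior_open. Qed.

Lemma test_sub phi f : test_function phi -> test_function f -> test_function (fun x => phi x - f x).
Proof.
move=> tp tf; have := test_add tp (test_scale (-1) tf).
by congr test_function; apply/funext => x; rewrite mulN1r.
Qed.

Lemma test_bound phi : test_function phi -> exists M A : R, [/\ 0 < A, forall x, `|phi x| <= M &
  forall x i, A < `|coord i x| -> phi x = 0].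
Proof.
move=> tp; have [s [K [cK KU K0]]] := tp.
have [M hM] := continuous_compact_bound (test_continuous tp) cK.
have [A A0 hA] := compact_coord_bound cK.
exists (Num.max M 0), A; split=> // x.
  case: (pselect (K x)) => [/hM h|/K0 ->]; first by rewrite le_max h.
  by rewrite normr0 le_max lexx orbT.
by move=> i Ax; apply: K0 => Kx; have := hA _ Kx i; rewrite leNgt Ax.
Qed.

Lemma test_measurable phi : test_function phi -> measurable_fun setT phi.
Proof.
move=> tp; apply: (@continuous_measurable3 R setT phi openT) => x _; exact: test_continuous.
Qed.

Lemma bounded_support_integrable d (T : measurableType d) (m : {measure set T -> \bar R})
  (B : set T) (f : T -> R) (M : R) : measurable B -> (m B < +oo)%E -> measurable_fun setT f ->
  (forall z, `|f z| <= M) -> (forall z, ~ B z -> f z = 0) -> m.-integrable setT (EFin \o f).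
Proof.
move=> mB fB mf fM f0.
have : m.-integrable B (EFin \o f).
  apply: measurable_bounded_integrable => //; first exact: measurable_funTS.
  exists M; split; first exact: num_real.
  by move=> z Mz x _ /=; apply: le_trans (fM x) (ltW Mz).
move=> /(integrable_mkcond (EFin \o f) mB).1; apply: eq_integrable => //.
move=> x _; rewrite patchE; case: ifPn => // /negP h; rewrite /= f0// => Bx.
by apply: h; rewrite inE.
Qed.

Let I (A : R) : set (measurableTypeR R) := `[- A, A]%classic.
Let mI A : measurable (I A). Proof. exact: measurable_itv. Qed.
Let fI A : (mu (I A) < +oo)%E.
Proof. by rewrite /I lebesgue_measure_itv/=; case: ifP; rewrite ?ltry// -EFinB ltry. Qed.
Let nI A (x : R) : ~ I A x -> A < `|x|.
Proof. by move=> h; rewrite ltNge; apply/negP; rewrite ler_norml => h'; apply: h; rewrite /I /= in_itv. Qed.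

Let f2 A : (leb2 (I A `*` I A) < +oo)%E.
Proof. by rewrite leb2_rect// lte_mul_pinfty// ge0_fin_numE. Qed.
Let f3 A : (leb3 ((I A `*` I A) `*` I A : set E3) < +oo)%E.
Proof.
rewrite leb3_rect//; last exact: measurableX.
by rewrite lte_mul_pinfty// ge0_fin_numE//.
Qed.

Let box3 A x : (forall i, ~ (A < `|coord i x|)) -> ((I A `*` I A) `*` I A : set E3) x.
Proof.
move=> h; split; [split|]; apply: contrapT => /nI k.
- by apply: (h 0).
- by apply: (h 1).
- by apply: (h 2).
Qed.

Lemma test_integrableT phi : test_function phi -> leb3.-integrable setT (EFin \o phi).
Proof.
move=> tp; have [M [A [A0 hM hA]]] := test_bound tp.
apply: (@bounded_support_integrable _ E3 leb3 ((I A `*` I A) `*` I A) phi M) => //.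
- by do 2 ? [apply: measurableX].
- exact: test_measurable.
- by move=> x nB; apply: contrapT => px; apply: nB; apply: box3 => i /hA.
Qed.

Lemma test_integrable phi (D : set E3) : measurable D -> test_function phi ->
  leb3.-integrable D (EFin \o phi).
Proof. by move=> mD tp; apply: integrableS (test_integrableT tp). Qed.

Lemma integral_exteriorT f : (forall x, ~ exterior x -> f x = 0) ->
  (\int[leb3]_(x in exterior) (f x)%:E = \int[leb3]_x (f x)%:E)%E.
Proof.
move=> f0; rewrite integral_mkcond; apply: eq_integral => x _; rewrite patchE.
case: ifPn => // /negP h; rewrite f0// => hx; apply: h; exact: mem_set.
Qed.

Lemma integral_deriv_support (f f' : R -> R) (A : R) : 0 < A ->
  (forall t : R, is_derive t 1 f (f' t)) -> continuous f' ->
  (forall t, A < `|t| -> f t = 0) -> (\int[mu]_t (f' t)%:E = 0)%E.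
Proof.
move=> A0 fd fc f0.
have f'0 t : ~ I (A + 1) t -> f' t = 0.
  move=> /nI At.
  have h : is_derive t 1 (fun=> 0 : R) (f' t).
    apply: dnear (fd t); have : \forall y \near (t : R), ball (t : R) 1 y by exact: nbhsx_ballx.
    apply: filterS => y; rewrite /ball/= => ty; apply: f0.
    by have := ler_normD (t - y) y; rewrite subrK; lra.
  by have [_ <-] := h; have [_ ->] := dcst t (0 : R).
transitivity (\int[mu]_(t in I (A + 1)) (f' t)%:E)%E.
  rewrite [RHS]integral_mkcond; apply: eq_integral => t _; rewrite patchE.
  by case: ifPn => // /negP h; rewrite f'0// => It; apply: h; exact: mem_set.
have AA : - (A + 1) < A + 1 by lra.
rewrite /I (@continuous_FTC2 _ f' f)//.
- by rewrite !f0 ?normrN ?ger0_norm ?subee//; lra.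
- exact: continuous_subspaceT.
- split; first by move=> y _; have [] := fd y.
    by apply: cvg_at_right_filter; exact: (dcont (fd _)).
  by apply: cvg_at_left_filter; exact: (dcont (fd _)).
by move=> y _; have [_ h] := fd y; rewrite derive1E.
Qed.

Let pt i (p : E3) (t : R) : E3 := t *: (basis3 i : E3) + p.

Let ptE i a b c t : pt i (a, b, c) t =
  (t * (i == 0 :> nat)%:R + a, t * (i == 1 :> nat)%:R + b, t * (i == 2 :> nat)%:R + c).
Proof. by []. Qed.

Let ptD i p (s t : R) : pt i p (s + t) = s *: (basis3 i : E3) + pt i p t.
Proof. by rewrite /pt scalerDl addrA. Qed.

Let integral_pt i phi p : test_function phi -> coord i p = 0 ->
  (\int[mu]_t (pderiv i phi (pt i p t))%:E = 0)%E.
Proof.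
move=> tp p0; have [M [A [A0 hM hA]]] := test_bound tp.
apply: (@integral_deriv_support (fun t => phi (pt i p t)) _ A) => //.
- move=> t; have /is_derive_line h := test_is_derive i (pt i p t) tp.
  have k : is_derive (t : R) 1 (fun s : R => s - t) 1.
    by apply: (deq (dD (did t) (dN (dcst t t)))); rewrite oppr0 addr0.
  have h' : is_derive (t - t) 1 (fun s : R => phi (s *: (basis3 i : E3) + pt i p t)) (pderiv i phi (pt i p t)).
    by rewrite subrr.
  have h2 := @dcomp R (fun s : R => phi (s *: (basis3 i : E3) + pt i p t)) (fun s => s - t) t _ 1 h' k.
  rewrite mulr1 in h2.
  by apply: deqf h2 => s; rewrite -ptD subrK.
- move=> t; apply: (@continuous_comp R E3 R (pt i p) (pderiv i phi)).
    by apply: cvgD; [apply: cvgZr_tmp|exact: cvg_cst].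
  exact: test_continuous (test_pderiv i tp) _.
- move=> t At; apply: (hA _ i); rewrite /pt.
  have -> : coord i (t *: (basis3 i : E3) + p) = t + coord i p.
    have := coord_line i i p t; rewrite eqxx mulr1; exact.
  by rewrite p0 addr0.
Qed.

(** As [phi] vanishes off the exterior domain, the integral is over the whole space; Fubini isolates
    the axis [i], on which the integral of a derivative with bounded support is 0. The case on [i]
    selects the order of integration. *)
Lemma test_integral_pderiv phi i : test_function phi ->
  (\int[leb3]_(x in exterior) (pderiv i phi x)%:E = 0)%E.
Proof.
move=> tp; have tq := test_pderiv i tp.
rewrite integral_exteriorT; last by move=> x; exact: test_vanish.
have [M' [A' [A'0 hM' hA']]] := test_bound tp.
have [M [A [A0 hM hA]]] := test_bound tq.
have ci : continuous (pderiv i phi) by exact: test_continuous.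
have mq := test_measurable tq.
have iq := test_integrableT tq.
have i2 z : leb2.-integrable setT (fun p => (pderiv i phi ((p, z) : E3))%:E).
  apply: (@bounded_support_integrable _ _ leb2 (I A `*` I A) (fun p => pderiv i phi ((p, z) : E3)) M) => //.
  - exact: measurableX.
  - exact: f2.
  - exact: (measurableT_comp mq (pair2_measurable z)).
  - move=> p nB; apply: contrapT => pp; apply: nB.
    have [] := @box3 A (p, z) => // j /hA; exact.
case: i tq hM hA ci mq iq i2 => -[|[|[|//]]] ip tq hM hA ci mq iq i2; set i := Ordinal _ in tq hM hA ci mq iq i2 *.
- rewrite -(@fubini2 _ _ _ _ R leb2 mu _ iq) integral0_eq// => z _.
  rewrite /fubini_G -(@fubini2 _ _ _ _ R mu mu _ (i2 z)) integral0_eq// => y _.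
  apply: etrans (@integral_pt i phi (0, y, z) tp erefl); apply: eq_integral => t _.
  by rewrite ptE /= mulr1 !mulr0 ?addr0 !add0r.
- rewrite -(@fubini2 _ _ _ _ R leb2 mu _ iq) integral0_eq// => z _.
  rewrite /fubini_G -(@fubini1 _ _ _ _ R mu mu _ (i2 z)) integral0_eq// => y _.
  apply: etrans (@integral_pt i phi (y, 0, z) tp erefl); apply: eq_integral => t _.
  by rewrite ptE /= mulr1 !mulr0 ?addr0 !add0r.
- rewrite -(@fubini1 _ _ _ _ R leb2 mu _ iq) integral0_eq// => -[y z] _.
  apply: etrans (@integral_pt i phi (y, z, 0) tp erefl); apply: eq_integral => t _.
  by rewrite ptE /= mulr1 !mulr0 ?addr0 !add0r.
Qed.

End test_functions.

(** * Smooth steps and ramps *)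

Section bump.
Context {R : realType}.
Implicit Types (f g : R -> R) (t : R).

Lemma is_derive_quadratic f C : (forall t, `|f t| <= C * t ^+ 2) -> is_derive (0 : R) 1 f 0.
Proof.
move=> fC.
have f0 : f 0 = 0 by apply/eqP; rewrite -normr_le0; have := fC 0; rewrite expr0n/= mulr0.
have H : (fun h : R => h^-1 *: ((f \o shift 0) (h *: 1) - f 0)) @ 0^' --> (0 : R).
  apply/cvgr0Pnorm_le => e e0.
  have C0 : 0 <= C by have := fC 1; rewrite expr1n mulr1; have := normr_ge0 (f 1); lra.
  have d0 : 0 < e / (C + 1) by apply: divr_gt0 => //; lra.
  exists (e / (C + 1)) => //= h; rewrite /ball/= sub0r normrN => he h0.
  rewrite f0 subr0 addr0 /GRing.scale/= mulr1 normrM normfV.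
  rewrite ler_pdivrMl ?normr_gt0//; apply: le_trans (fC h) _.
  rewrite -[h ^+ 2]real_normK ?num_real//; move: he (normr_ge0 h); move: (`|h|) => k.
  rewrite ltr_pdivlMr; last by lra.
  by move=> kC k0; nra.
by split; [apply/cvg_ex; exists 0 | exact/cvg_lim].
Qed.

(** The functions [t^-j e^(-1/t)], extended by 0, have their derivatives in their own span, also at
    0; the whole family is thus smooth at once. *)
Let eb (j : nat) t := if 0 < t then t^-1 ^+ j * expR (- t^-1) else 0.

(** [e^u >= u^(j+2) / (j+2)!] at [u = 1/t]. A quadratic bound is all that differentiability at 0
    requires. *)
Let eb_bound j t : `|eb j t| <= (j.+2)`!%:R * t ^+ 2.
Proof.
rewrite /eb; case: ifPn => [t0|_]; last by rewrite normr0 mulr_ge0 ?sqr_ge0.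
have u0 : 0 < t^-1 by rewrite invr_gt0.
rewrite ger0_norm; last by rewrite mulr_ge0 ?expR_ge0// exprn_ge0// ltW.
have := expR_ge1Dxn j.+1 (ltW u0); rewrite expRN.
have -> : t = t^-1^-1 by rewrite invrK.
rewrite invrK; move: u0; move: (t^-1) => u u0.
have E0 : 0 < expR u by exact: expR_gt0.
have f0 : 0 < (j.+2)`!%:R :> R by rewrite ltr0n fact_gt0.
have p0 : 0 < u ^+ j by exact: exprn_gt0.
have -> : u ^+ j.+2 = u ^+ j * u ^+ 2 by rewrite -exprD addn2.
move: f0 E0 p0; move: (u ^+ j) (_%:R) (expR u) => p f E f0 E0 p0 h.
have {}h : p * u ^+ 2 <= f * E.
  have : p * u ^+ 2 / f <= E by lra.
  by rewrite ler_pdivrMr// (mulrC f E).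
rewrite ler_pdivrMr// mulrAC exprVn -[X in X <= _](@mulfK _ (u ^+ 2)) ?gt_eqF ?exprn_gt0//.
by rewrite ler_pM2r ?invr_gt0 ?exprn_gt0.
Qed.

Let is_derive_eb j t : is_derive t 1 (eb j) (- j%:R * eb j.+1 t + eb j.+2 t).
Proof.
have [t0|t0|->] := ltgtP t 0.
- have -> : - j%:R * eb j.+1 t + eb j.+2 t = 0 by rewrite /eb ltNge (ltW t0) /= mulr0 addr0.
  apply: dnear (dcst t 0); near=> y; rewrite /eb ifF//; apply/negbTE; rewrite -leNgt ltW//.
  by near: y; exact: lt_nbhsl.
- have h : is_derive t 1 (fun t => t^-1 ^+ j * expR (- t^-1)) (- j%:R * eb j.+1 t + eb j.+2 t).
    have tn : t != 0 by rewrite gt_eqF.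
    have dv := dVid tn.
    have h2 := dM (dX j dv) (dexp (dN dv)).
    apply: (deq h2); rewrite /eb t0.
    case: j {h2} => [|j]; first by rewrite /=; ring.
    by rewrite /= !exprS; ring.
  apply: dnear h; near=> y; rewrite /eb ifT//.
  by near: y; exact: lt_nbhsr.
- have -> : - j%:R * eb j.+1 0 + eb j.+2 0 = 0 by rewrite /eb ltxx mulr0 addr0.
  exact: is_derive_quadratic (eb_bound j).
Unshelve. all: by end_near. Qed.

Let smooth_eb j : smooth1 setT (eb j).
Proof.
apply: (@smooth1_alg _ _ (fun b => exists j, b = eb j)); last by apply: alg_gen; exists j.
move=> _ [k ->]; exists (fun t => - k%:R * eb k.+1 t + eb k.+2 t).
  apply: alg_add; last by apply: alg_gen; exists k.+2.
  by apply: alg_mul; [exact: alg_cst | apply: alg_gen; exists k.+1].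
by move=> t _; exact: is_derive_eb.
Qed.

Lemma smooth_step : exists sigma omega : R -> R, [/\ smooth1 setT omega,
  forall t, is_derive t 1 sigma (omega t),
  (forall t, t <= 0 -> sigma t = 0) /\ (forall t, 1 <= t -> sigma t = 1),
  (forall t, 0 <= sigma t <= 1) &
  (forall t, 0 <= omega t) /\ (forall t, t <= 0 \/ 1 <= t -> omega t = 0)].
Proof.
pose b t := eb 0 t * eb 0 (1 - t).
have sb : smooth1 setT b.
  apply: smooth1_mul; first exact: smooth_eb.
  have := @smooth1_affine _ _ setT _ (-1) 1 (smooth_eb 0) (fun _ _ => I).
  by congr smooth1; apply/funext => t; rewrite mulN1r addrC.
have bc : continuous b by move=> t; exact: (smooth1_continuous sb).
have eb0 t : 0 <= eb 0 t by rewrite /eb; case: ifP => // _; rewrite expr0 mul1r expR_ge0.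
have b0 t : 0 <= b t by rewrite mulr_ge0.
have b1 t : t <= 0 \/ 1 <= t -> b t = 0.
  move=> [h|h]; rewrite /b /eb; first by rewrite ltNge h mul0r.
  by rewrite [X in _ * X]ifF ?mulr0//; apply/negbTE; rewrite -leNgt; lra.
have bp t : 0 < t < 1 -> 0 < b t.
  move=> /andP[t0 t1]; rewrite /b /eb t0 ifT; last by lra.
  by rewrite !expr0 !mul1r mulr_gt0 ?expR_gt0.
have [F0 Fd] := primP bc; set F := prim b in F0 Fd.
have F1 : 0 < F 1.
  rewrite -F0; apply: (@mono_lt _ F b 0 1) => // t; exact: bp.
pose c := (F 1)^-1; have c0 : 0 < c by rewrite invr_gt0.
have sd t : is_derive t 1 (fun t => c * F t) (c * b t).
  by have h := Fd t; apply: (deq (dM (dcst t c) h)); ring.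
have w0 t : 0 <= c * b t by rewrite mulr_ge0// ltW.
have lo t : t <= 0 -> c * F t = 0.
  move=> t0; have A x : t <= x <= 0 -> is_derive x 1 F 0.
    by move=> /andP[_ x0]; have := Fd x; rewrite b1//; left.
  by rewrite (const_eq t0 A) F0 mulr0.
have hi t : 1 <= t -> c * F t = 1.
  move=> t1; have A x : 1 <= x <= t -> is_derive x 1 F 0.
    by move=> /andP[x1 _]; have := Fd x; rewrite b1//; right.
  by rewrite -(const_eq t1 A) /c mulVf// gt_eqF.
exists (fun t => c * F t), (fun t => c * b t); split => //.
- by apply: smooth1_mul => //; exact: smooth1_cst.
- have mono s t : s <= t -> c * F s <= c * F t.
    by move=> st; apply: (@mono_le _ (fun t => c * F t) (fun t => c * b t) s t st).
  move=> t; apply/andP; split.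
    by have [h|/ltW h] := leP t 0; [rewrite lo | rewrite -(lo 0)//; exact: mono].
  by have [h|/ltW h] := leP 1 t; [rewrite hi | rewrite -(hi 1)//; exact: mono].
- by split => // t /b1 ->; rewrite mulr0.
Qed.

(** [rho] is a smoothed [max(t, 0)], and [c] the offset that the smoothing leaves behind. *)
Lemma smooth_ramp (sigma omega : R -> R) : smooth1 setT omega ->
  (forall t, is_derive t 1 sigma (omega t)) ->
  (forall t, t <= 0 -> sigma t = 0) -> (forall t, 1 <= t -> sigma t = 1) ->
  exists rho : R -> R, exists c : R, [/\ forall t, is_derive t 1 rho (sigma t),
    forall t, t <= 0 -> rho t = 0 & forall t, 1 <= t -> rho t = t + c].
Proof.
move=> so sd lo hi.
have sc : continuous sigma by move=> t; exact: dcont (sd t).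
have [F0 Fd] := primP sc; set F := prim sigma in F0 Fd.
exists F, (F 1 - 1); split => // t t1.
  have A x : t <= x <= 0 -> is_derive x 1 F 0.
    by move=> /andP[_ x0]; have := Fd x; rewrite lo.
  by rewrite (const_eq t1 A).
have h : (fun t => F t - t) 1 = (fun t => F t - t) t.
  have A x : 1 <= x <= t -> is_derive x 1 (fun t => F t - t) 0.
    move=> /andP[x1 _]; have h := Fd x.
    by apply: (deq (dD h (dN (did x)))); rewrite hi// subrr.
  exact: const_eq t1 A.
by move: h => /=; lra.
Qed.

End bump.

(** * Scaled solutions *)

Section profile.
Context {R : realType}.
Variable m : nat.
Hypothesis hm : (2 < m)%N.
Implicit Types (q : R -> R) (r s x : R).

(** A solution of [q'' + (2/r) q' + q^(2m+1) = 0] vanishing at 1 and decaying like [1/r]: enough to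
    be stationary. No sign is prescribed, so that the solutions [Q k], their opposites and 0 are
    treated together. *)
Record profile q (q' : R -> R) (M : R) : Prop := Profile {
  profile_smooth : smooth1 [set r | 0 < r] q;
  profile_d : forall r, 0 < r -> is_derive r 1 q (q' r);
  profile_dd : forall r, 0 < r -> is_derive r 1 q' (- (2 / r * q' r + q r ^+ (2 * m).+1));
  profile_1 : q 1 = 0;
  profile_bound : forall r, 1 <= r -> `|q r| <= M / r /\ `|q' r| <= M / r ^+ 2 }.

Variables v v1 : R -> R.
Hypotheses (v0 : v 0 = 0) (v10 : v1 0 = 1) (vd : forall s, is_derive s 1 v (v1 s)).
Hypothesis v1d : forall s, 0 < s -> is_derive s 1 v1 (- (v s ^+ (2 * m).+1 * s^-1 ^+ 4)).
Hypothesis v1c : forall s, {for s, continuous v1}.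
Hypothesis vs : forall s, 0 <= s -> `|v s| <= s.
Hypothesis v1s : forall s, 0 <= s <= 1 -> `|v1 s - 1| <= s.

(** The equation is invariant under [u(r) -> a^(-1/m) u(r/a)]; writing [a = X^m] avoids the root. *)
Definition scaled (X : R) r := v (X ^+ m / r) / X.
Definition scaled' (X : R) r := - (X ^+ m / X * v1 (X ^+ m / r) / r ^+ 2).

Variable X : R.
Hypothesis X0 : 0 < X.

Let a0 : 0 < X ^+ m. Proof. exact: exprn_gt0. Qed.

Lemma is_derive_scaled r : 0 < r -> is_derive r 1 (scaled X) (scaled' X r).
Proof.
move=> r0; rewrite /scaled /scaled'.
have rn : r != 0 by rewrite gt_eqF.
have dv := dM (dcst r (X ^+ m)) (dVid rn).
have h := dM (dcomp (f := v) (g := fun r => X ^+ m / r) (vd _) dv) (dcst r X^-1).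
by apply: (deq h); field; rewrite rn gt_eqF.
Qed.

Lemma is_derive_scaled' r : 0 < r ->
  is_derive r 1 (scaled' X) (- (2 / r * scaled' X r + scaled X r ^+ (2 * m).+1)).
Proof.
move=> r0; have rn : r != 0 by rewrite gt_eqF.
have dv := dM (dcst r (X ^+ m)) (dVid rn).
have ar0 : 0 < X ^+ m / r by exact: divr_gt0.
have h := dN (dM (dM (dcst r (X ^+ m / X)) (dcomp (f := v1) (g := fun r => X ^+ m / r) (v1d ar0) dv))
              (dV (f := fun r => r ^+ 2) (expf_neq0 2 rn) (dX 2 (did r)))).
apply: (deq h); rewrite /scaled' /scaled !expr_div_n /=.
set p := v _ ^+ _; set w := v1 _.
have -> : X ^+ (2 * m).+1 = X ^+ m ^+ 2 * X by rewrite exprSr mulnC exprM.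
have Xm : X ^+ m != 0 by rewrite gt_eqF.
have Xn : X != 0 by rewrite gt_eqF.
move: Xm; move: (X ^+ m) => A An.
by field; rewrite rn An Xn.
Qed.

Lemma smooth_scaled : smooth1 [set r | 0 < r] (scaled X).
Proof.
have V0 s : 0 < s -> v1 s = v1 s by [].
(* The identity function belongs to the class because the derivative of [v1] brings the factor
   [(X^m / r)^-4], a polynomial in [r]. *)
pose P (b : R -> R) := [\/ b = (fun r => v (X ^+ m / r)), b = (fun r => v1 (X ^+ m / r)), b = (fun r => r^-1) | b = (fun r => r)].
have P1 : alg P (fun r => v (X ^+ m / r)) by apply: alg_gen; constructor 1.
have P2 : alg P (fun r => v1 (X ^+ m / r)) by apply: alg_gen; constructor 2.
have P3 : alg P (fun r => r^-1) by apply: alg_gen; constructor 3.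
have P4 : alg P (fun r => r) by apply: alg_gen; constructor 4.
have P5 : alg P (fun r => - X ^+ m * (r^-1 * r^-1)).
  by apply: alg_mul; [exact: alg_cst | exact: alg_mul].
have dv r : 0 < r -> is_derive r 1 (fun r => X ^+ m / r) (- X ^+ m * (r^-1 * r^-1)).
  move=> r0; have rn : r != 0 by rewrite gt_eqF.
  by apply: (deq (dM (dcst r (X ^+ m)) (dVid rn))); ring.
apply: (@smooth1_alg _ _ P); last by apply: alg_mul => //; exact: alg_cst.
move=> b [->|->|->|->].
- exists (fun r => v1 (X ^+ m / r) * (- X ^+ m * (r^-1 * r^-1))); first exact: alg_mul.
  by move=> r r0; exact: (dcomp (f := v) (g := fun r => X ^+ m / r) (vd _) (dv _ r0)).
- exists (fun r => (- 1 * (v (X ^+ m / r) ^+ (2 * m).+1 * ((X ^+ m)^-1 * r) ^+ 4)) * (- X ^+ m * (r^-1 * r^-1))).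
    apply: alg_mul => //; apply: alg_mul; first exact: alg_cst.
    apply: alg_mul; first exact: alg_exp.
    by apply: alg_exp; apply: alg_mul => //; exact: alg_cst.
  move=> r r0; have ar0 : 0 < X ^+ m / r by exact: divr_gt0.
  have h := dcomp (f := v1) (g := fun r => X ^+ m / r) (v1d ar0) (dv _ r0).
  by apply: (deq h); rewrite mulN1r invf_div (mulrC r).
- exists (fun r => -1 * (r^-1 * r^-1)).
    by apply: alg_mul; [exact: alg_cst | exact: alg_mul].
  move=> r r0; have rn : r != 0 by rewrite gt_eqF.
  by apply: (deq (dVid rn)); rewrite expr2.
- by exists (fun=> 1); [exact: alg_cst | move=> r _; exact: did].
Qed.

Lemma v1_bound (A : R) : exists2 M : R, 0 < M & forall s, 0 <= s <= A -> `|v1 s| <= M.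
Proof.
have cK : compact (v1 @` `[0, A]).
  apply: continuous_compact; last exact: segment_compact.
  by apply: continuous_subspaceT => s; exact: v1c.
have [M [_ h]] := compact_bounded cK.
exists (`|M| + 1); first by have := normr_ge0 M; lra.
move=> s sA; apply: (h (`|M| + 1)); first by have := ler_norm M; lra.
by exists s => //=; rewrite in_itv.
Qed.

Lemma scaled_bound : exists M, forall r, 1 <= r -> `|scaled X r| <= M / r /\ `|scaled' X r| <= M / r ^+ 2.
Proof.
have [M M0 hM] := v1_bound (X ^+ m).
exists (X ^+ m / X * (M + 1)) => r r1.
have r0 : 0 < r by lra.
have b0 : 0 < X ^+ m / X by exact: divr_gt0.
have ar0 : 0 <= X ^+ m / r by rewrite ltW// divr_gt0.
have ara : X ^+ m / r <= X ^+ m by rewrite ler_pdivrMr// ler_peMr// ltW.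
split.
  rewrite /scaled normrM normfV (gtr0_norm X0).
  apply: (@le_trans _ _ (X ^+ m / r / X)); first by rewrite ler_pM2r ?invr_gt0// vs.
  rewrite mulrAC [leRHS]mulrAC ler_peMr//; first by rewrite divr_ge0// ltW.
  lra.
rewrite /scaled' normrN normrM normrM (gtr0_norm b0) normfV [`|r ^+ 2|]ger0_norm ?sqr_ge0//.
rewrite ler_pM2r ?invr_gt0 ?exprn_gt0// ler_pM2l//.
by have := hM (X ^+ m / r); rewrite ar0 ara => /(_ isT); lra.
Qed.

Lemma v_sub_id s : 0 <= s -> `|v s - s| <= 2 * s ^+ 2.
Proof.
move=> s0; have [s1|/ltW s1] := leP s 1; last first.
  have := vs s0; have := ler_normB (v s) s; rewrite (ger0_norm s0) => h1 h2.
  by have : s <= s ^+ 2; [rewrite expr2 ler_peMl | lra].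
have A x : 0 <= x <= s -> is_derive x 1 (fun x => v x - x) (v1 x - 1).
  by move=> _; have h := vd x; apply: dD => //; apply: dN; exact: did.
have B x : 0 <= x <= s -> is_derive x 1 (fun x => s * x) s.
  by move=> _; apply: (deq (dM (dcst x s) (did x))); ring.
have := mono_norm s0 A B; rewrite v0 => h.
have {}h : `|v s - s| <= s * s.
  move: h; rewrite mulr0 !subr0; apply.
  by move=> x /andP[x0 xs]; apply: le_trans (v1s _) (ltW xs); lra.
by have := sqr_ge0 s; rewrite expr2; lra.
Qed.

Lemma v_gt0 s : 0 < s <= 1 -> 0 < v s.
Proof.
move=> /andP[s0 s1].
have A x : 0 <= x <= s -> is_derive x 1 (fun x => v x) (v1 x) by move=> _; exact: vd.
rewrite -v0; apply: (mono_lt s0 A) => x /andP[x0 xs].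
by have := v1s (s := x); rewrite ler_norml => /(_ _)/andP[]; lra.
Qed.

Lemma scaled_pos : \forall r \near +oo, 0 < scaled X r.
Proof.
near=> r.
have r1 : X ^+ m <= r by near: r; apply: nbhs_pinfty_ge; exact: num_real.
have r0 : 0 < r by exact: lt_le_trans r1.
rewrite /scaled divr_gt0//; apply: v_gt0.
by rewrite divr_gt0//= ler_pdivrMr// mul1r.
Unshelve. all: by end_near. Qed.

Lemma scaled_asymp r : 1 <= r -> `|scaled X r - X ^+ m / X / r| <= 2 * (X ^+ m) ^+ 2 / X * (r ^+ 2)^-1.
Proof.
move=> r1; have r0 : 0 < r by lra.
have -> : scaled X r - X ^+ m / X / r = (v (X ^+ m / r) - X ^+ m / r) / X.
  by rewrite /scaled mulrBl (mulrAC _ X^-1).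
rewrite normrM normfV (gtr0_norm X0).
apply: (@le_trans _ _ (2 * (X ^+ m / r) ^+ 2 / X)).
  by rewrite ler_pM2r ?invr_gt0//; apply: v_sub_id; rewrite ltW// divr_gt0.
by rewrite le_eqVlt; apply/orP; left; apply/eqP; rewrite expr_div_n; field; rewrite !gt_eqF.
Qed.

Lemma scaled'_lim : r ^+ 2 * derive1 (scaled X) r @[r --> +oo] --> - (X ^+ m / X).
Proof.
have b0 : 0 < X ^+ m / X by exact: divr_gt0.
apply/cvgrPdist_le => e e0; near=> r.
have r0 : 0 < r by near: r; exact: nbhs_pinfty_gt.
have r1 : X ^+ m <= r by near: r; apply: nbhs_pinfty_ge; exact: num_real.
have r2 : X ^+ m / X * X ^+ m / e <= r by near: r; apply: nbhs_pinfty_ge; exact: num_real.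
have [_ d] := is_derive_scaled r0; rewrite derive1E d /scaled'.
have -> : - (X ^+ m / X) - r ^+ 2 * - (X ^+ m / X * v1 (X ^+ m / r) / r ^+ 2) =
    X ^+ m / X * (v1 (X ^+ m / r) - 1) by field; rewrite !gt_eqF.
rewrite normrM (gtr0_norm b0); apply: (@le_trans _ _ (X ^+ m / X * (X ^+ m / r))).
  rewrite ler_pM2l//; apply: v1s; rewrite divr_ge0 ?(ltW a0) ?(ltW r0)//=.
  by rewrite ler_pdivrMr// mul1r.
by rewrite mulrA ler_pdivrMr// mulrC -ler_pdivrMl// mulrC.
Unshelve. all: by end_near. Qed.

Lemma scaled_profile : v (X ^+ m) = 0 -> exists M, profile (scaled X) (scaled' X) M.
Proof.
move=> vX; have [M hM] := scaled_bound; exists M; split.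
- exact: smooth_scaled.
- by move=> r; exact: is_derive_scaled.
- by move=> r; exact: is_derive_scaled'.
- by rewrite /scaled divr1 vX mul0r.
- exact: hM.
Qed.

End profile.

(** The zeros in [r] are the numbers [(X k / X j)^m], which exceed 1 exactly for [j < k]; [j = k] is
    the boundary point. *)
Lemma scaled_zeros (R : realType) (m : nat) (hm : (2 < m)%N) (v : R -> R) (X : nat -> R) (k : nat) :
  (forall k, 0 < X k) -> (forall k, X k < X k.+1) ->
  (forall s, 0 < s -> (v s = 0 <-> exists k, s = X k ^+ m)) ->
  ([set r : R | 1 < r /\ scaled m v (X k) r = 0] #= `I_k)%card.
Proof.
move=> X0 Xi vX.
have Xm i j : (i < j)%N -> X i < X j.
  by elim: j => // j IH; rewrite ltnS leq_eqVlt => /predU1P[->//|/IH/lt_trans]; apply.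
have m0 : (0 < m)%N by lia.
have Xinj i j : X i = X j -> i = j.
  move=> e; have [/Xm|/Xm|//] := ltngtP i j; rewrite e ltxx//.
pose f j := (X k / X j) ^+ m.
have f0 j : 0 < X k / X j by exact: divr_gt0.
have -> : [set r : R | 1 < r /\ scaled m v (X k) r = 0] = f @` `I_k.
  apply/seteqP; split => [r [r1 /eqP]|_ [j /= jk <-]].
    have r0 : 0 < r by lra.
    rewrite /scaled mulf_eq0 invr_eq0 [X k == 0]gt_eqF// orbF => /eqP e.
    have /vX[/(_ e)[j je] _] : 0 < X k ^+ m / r by rewrite divr_gt0// exprn_gt0.
    have rE : r = f j by rewrite /f expr_div_n -je invf_div mulrC divfK// gt_eqF// exprn_gt0.
    exists j => //=; rewrite ltnNge; apply/negP => kj.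
    have : f j <= 1.
      rewrite /f exprn_ile1 ?(ltW (f0 j))// ler_pdivrMr// mul1r.
      by move: kj; rewrite leq_eqVlt => /predU1P[->//|/Xm/ltW].
    by rewrite -rE leNgt r1.
  split.
    by rewrite /f exprn_egt1 -?lt0n// ltr_pdivlMr// mul1r Xm.
  rewrite /scaled /f; apply/eqP; rewrite mulf_eq0; apply/orP; left; apply/eqP.
  rewrite expr_div_n invf_div mulrC divfK ?gt_eqF ?exprn_gt0//.
  by apply/vX; [rewrite exprn_gt0 | exists j].
apply: inj_card_eq => i j _ _ /eqP; rewrite /f eqrXn2 ?(ltW (f0 _))//.
have Xk : X k != 0 by rewrite gt_eqF.
by move=> /eqP/(mulfI Xk)/invr_inj; exact: Xinj.
Qed.

(** * Radial functions on the exterior domain *)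

Section radial_tools.
Context {R : realType}.
Local Notation mu := (@lebesgue_measure R).
Local Notation E3 := (E3 R).
Implicit Types (x : E3) (i : 'I_3) (r : R).

Lemma test_integral_div (w : 'I_3 -> E3 -> R) : (forall i, test_function (w i)) ->
  (\int[leb3]_(x in exterior) (\sum_(i < 3) pderiv i (w i) x)%:E = 0)%E.
Proof.
move=> tw; under eq_integral do rewrite -sumEFin.
rewrite integral_sum; first by apply: big1 => i _; exact: test_integral_pderiv.
- exact: measurable_exterior.
- by move=> i; exact: test_integrable (@measurable_exterior R) (test_pderiv i (tw i)).
Qed.

Lemma enorm_gt0_open : open [set x : E3 | 0 < enorm x].
Proof.
have -> : [set x : E3 | 0 < enorm x] = (@enorm R) @^-1` `]0, +oo[%classic.
  by apply/seteqP; split => x /=; rewrite in_itv/= andbT.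
by apply: enorm_preimage_open; exact: interval_open.
Qed.

Lemma smooth_radial_pos (h : R -> R) : smooth1 [set r | 0 < r] h ->
  smooth_on [set x : E3 | 0 < enorm x] (radial_fun h).
Proof. by move=> sh; apply: (@smooth_on_radial R [set r | 0 < r]) => //; exact: open_gt. Qed.

Lemma shell_compact (a b : R) : compact [set x : E3 | a <= enorm x <= b].
Proof.
pose B : set E3 := (`[-b, b]%classic `*` `[-b, b]%classic) `*` `[-b, b]%classic.
have cB : compact B by do 2 ? [apply: compact_setX]; exact: segment_compact.
apply: subclosed_compact cB _.
  have -> : [set x : E3 | a <= enorm x <= b] = (@enorm R) @^-1` `[a, b]%classic.
    by apply/seteqP; split => x /=; rewrite in_itv.
  by apply: closed_comp; [move=> x _; exact: continuous_enorm | exact: interval_closed].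
move=> x /= /andP[_ xb]; have [h1 h2 h3] := enorm_coord x.
by split; [split|]; rewrite /= in_itv/= -ler_norml; apply: le_trans xb.
Qed.

(** [h] is smooth for [r > 0] only; its vanishing below [a > 1] takes care of the origin, where the
    norm is not differentiable. *)
Lemma radial_test (h : R -> R) (a b : R) : 1 < a -> smooth1 [set r | 0 < r] h ->
  (forall r, r <= a \/ b <= r -> h r = 0) -> test_function (radial_fun h).
Proof.
move=> a1 sh h0; split; last first.
  exists [set x | a <= enorm x <= b]; split; first exact: shell_compact.
    by move=> x /= /andP[ax _]; exact: lt_le_trans ax.
  move=> x /= /negP; rewrite negb_and -!ltNge => /orP[xa|xa]; apply: h0; [left|right]; exact: ltW.
have -> : setT = [set x : E3 | 0 < enorm x] `|` eball 1.
  rewrite eqEsubset; split => // x _.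
  by have [x0|x0] := ltP 0 (enorm x); [left|right; rewrite /eball/=; lra].
apply: smooth_on_setU; first exact: smooth_radial_pos.
have oB : open (eball 1 : set E3).
  have -> : (eball 1 : set E3) = (@enorm R) @^-1` `]-oo, 1[%classic.
    by apply/seteqP; split => x /=; rewrite in_itv.
  by apply: enorm_preimage_open; exact: interval_open.
apply: (@smooth_on_eq _ _ (fun=> 0)) => //; last exact: smooth_on_cst.
move=> x; rewrite /eball/= => x1; rewrite /radial_fun h0//; left; lra.
Qed.

Lemma is_derive3_radial_sub i (h1 h2 : R -> R) x d1 d2 : 0 < enorm x ->
  is_derive (enorm x) 1 h1 d1 -> is_derive (enorm x) 1 h2 d2 ->
  pderiv i (fun y => radial_fun h1 y - radial_fun h2 y) x = (d1 - d2) * (coord i x * (enorm x)^-1).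
Proof.
move=> x0 D1 D2; apply: pderiv_is_derive.
by apply: (@is_derive3_radial R i (fun r => h1 r - h2 r)) => //; apply: dD => //; exact: dN.
Qed.

Lemma sum_coord_sq x (c : R) : 0 < enorm x -> \sum_(i < 3) (c * (coord i x * (enorm x)^-1)) ^+ 2 = c ^+ 2.
Proof.
move=> x0; have xn : enorm x ^+ 2 != 0 by rewrite gt_eqF// exprn_gt0.
under eq_bigr do rewrite !exprMn.
by rewrite -mulr_sumr -mulr_suml -enorm_sqrE exprVn mulfV// mulr1.
Qed.

Lemma grad_sq_radial (h : R -> R) x d : 0 < enorm x -> is_derive (enorm x) 1 h d ->
  grad_sq (radial_fun h) x = d ^+ 2.
Proof.
move=> x0 D; rewrite /grad_sq -(sum_coord_sq d x0); apply: eq_bigr => i _.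
by congr (_ ^+ 2); apply: pderiv_is_derive; exact: is_derive3_radial.
Qed.

Lemma grad_sq_radial_sub (h1 h2 : R -> R) x d1 d2 : 0 < enorm x ->
  is_derive (enorm x) 1 h1 d1 -> is_derive (enorm x) 1 h2 d2 ->
  grad_sq (fun y => radial_fun h1 y - radial_fun h2 y) x = (d1 - d2) ^+ 2.
Proof.
move=> x0 D1 D2; rewrite /grad_sq -(sum_coord_sq _ x0); apply: eq_bigr => i _.
by congr (_ ^+ 2); exact: is_derive3_radial_sub.
Qed.

Lemma laplacian_radial (h h1 h2 : R -> R) x : 0 < enorm x ->
  (forall r, 0 < r -> is_derive r 1 h (h1 r)) -> (forall r, 0 < r -> is_derive r 1 h1 (h2 r)) ->
  laplacian (radial_fun h) x = h2 (enorm x) + 2 / enorm x * h1 (enorm x).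
Proof.
move=> x0 D1 D2.
have E i : pderiv i (pderiv i (radial_fun h)) x =
    h2 (enorm x) * (coord i x * (enorm x)^-1) ^+ 2 +
    h1 (enorm x) * (enorm x)^-1 * (1 - (coord i x * (enorm x)^-1) ^+ 2).
  apply: pderiv_is_derive.
  have near0 : \forall y \near x, 0 < enorm y.
    by apply: open_nbhs_nbhs; split => //; exact: enorm_gt0_open.
  have A : {near x, (fun y => radial_fun h1 y * (coord i y * radial_fun (@GRing.inv R) y)) =1 pderiv i (radial_fun h)}.
    near=> y; have y0 : 0 < enorm y by near: y.
    by apply/esym/pderiv_is_derive; apply: is_derive3_radial => //; exact: D1.
  apply: is_derive3_near A _.
  have xn : enorm x != 0 by rewrite gt_eqF.
  have k1 := is_derive3_radial i x0 (D2 _ x0).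
  have k2 := is_derive3M (is_derive3_coord i i x) (is_derive3_radial i x0 (dVid xn)).
  have k3 := is_derive3M k1 k2.
  apply: is_derive_eq k3 _; rewrite eqxx mulr1n /radial_fun; move: xn; move: (enorm x) => r rn.
  by field.
rewrite /laplacian; under eq_bigr do rewrite E.
rewrite big_split /= -!mulr_sumr sumrB.
have S1 : \sum_(i < 3) (coord i x * (enorm x)^-1) ^+ 2 = 1.
  have := sum_coord_sq 1 x0; rewrite expr1n => <-.
  by apply: eq_bigr => i _; rewrite mul1r.
rewrite S1 sumr_const card_ord; field; by rewrite gt_eqF.
Unshelve. all: by end_near. Qed.

Lemma continuous_loc_integrable (u : E3 -> R) :
  (forall x, exterior x -> {for x, continuous u}) -> loc_integrable u.
Proof.
move=> uc K cK KE.
have mK : measurable K.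
  by rewrite -[K]setCK; apply: measurableC; apply: open_measurable3; exact: compl_compact_open.
apply: measurable_bounded_integrable => //.
- have [M hM] := continuous_compact_bound (@continuous_enorm R) cK.
  have M0 : 0 < `|M| + 1 by have := normr_ge0 M; lra.
  apply: (@le_lt_trans _ _ (leb3 (eball (`|M| + 1) : set E3))).
    apply: le_measure; rewrite ?inE//; first exact: measurable_eball.
    move=> x /hM; rewrite ger0_norm ?enorm_ge0// /eball/= => h.
    by have := ler_norm M; lra.
  by rewrite leb3_eball// ltry.
- apply: measurable_funS (KE) _; first exact: measurable_exterior.
  by apply: continuous_measurable3 => //; exact: exterior_open.
- have cu : compact (u @` K).
    apply: continuous_compact => //; apply: continuous_in_subspaceT => x /set_mem Kx.
    by apply: uc; exact: KE.
  have [M [Mr hM]] := compact_bounded cu; exists M; split => // z Mz x Kx /=.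
  by apply: hM => //; exists x.
Qed.

Lemma gt_measurable (a : R) (f : R -> R) : (forall r, a < r -> {for r, continuous f}) ->
  measurable_fun setT (fun r => if a < r then f r else 0).
Proof.
move=> fc; have mI : measurable (`]a, +oo[%classic : set R) by exact: measurable_itv.
have h : measurable_fun (`]a, +oo[%classic : set R) f.
  apply: open_continuous_measurable_fun; first exact: interval_open.
  by move=> r; rewrite inE/= in_itv/= andbT; exact: fc.
move/(measurable_restrictT _ mI).1: h; congr measurable_fun; apply/funext => r.
rewrite patchE; case: ifPn => [|/negP].
  by rewrite inE/= in_itv/= andbT => ->.
by rewrite inE/= in_itv/= andbT => /negP/negbTE ->.
Qed.

Lemma ge0_polar_continuous (f : R -> R) : (forall r, 1 < r -> {for r, continuous f}) ->
  (forall r, 1 < r -> 0 <= f r) ->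
  (\int[leb3]_(x in (exterior : set E3)) (f (enorm x))%:E =
   \int[mu]_(r in `]1%R, +oo[) (kappa * (f r * r ^+ 2))%:E)%E.
Proof.
move=> fc f0; pose g r := if 1 < r then f r else 0.
have mg : measurable_fun setT (EFin \o g) by apply/measurable_EFinP; exact: gt_measurable.
have g0 r : (0 <= (g r)%:E)%E by rewrite lee_fin /g; case: ifP => // /f0.
have := ge0_polar mg g0; rewrite /g => E.
transitivity (\int[leb3]_(x in (exterior : set E3)) (if 1 < enorm x then f (enorm x) else 0)%:E)%E.
  by apply: eq_integral => x; rewrite inE /exterior/= => ->.
rewrite E; apply: eq_integral => r; rewrite inE/= in_itv/= andbT => ->.
by rewrite -EFinM; congr (_%:E); ring.
Qed.

Lemma ge0_integral_y (h H : R -> R) (l : R) : (forall r, 1 <= r -> is_derive r 1 H (h r)) ->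
  (forall r, 1 <= r -> {for r, continuous h}) -> (forall r, 1 <= r -> 0 <= h r) ->
  H r @[r --> +oo] --> l -> (\int[mu]_(r in `]1%R, +oo[) (h r)%:E = (l - H 1)%:E)%E.
Proof.
move=> dH hc h0 Hl.
have hw : {within `[1, +oo[, continuous h}.
  by apply: continuous_in_subspaceT => r; rewrite inE/= in_itv/= andbT; exact: hc.
rewrite integral_itv_obnd_cbnd; last first.
  apply/measurable_EFinP; apply: open_continuous_measurable_fun; first exact: interval_open.
  by move=> r; rewrite inE/= in_itv/= andbT => /ltW; exact: hc.
rewrite (@ge0_continuous_FTC2y _ h H 1 l)// ?EFinB//.
- by move=> r /ltW r1; have [] := dH _ r1.
- by apply: cvg_at_right_filter; exact: dcont (dH 1 (lexx _)).
- by move=> r; rewrite in_itv/= andbT => /ltW r1; have [_ d] := dH _ r1; rewrite derive1E.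
Qed.

(** The majorant [h] has a primitive [H] vanishing at infinity, which makes the bound explicit. *)
Lemma ext_integral_le (f h H : R -> R) : (forall r, 1 < r -> {for r, continuous f}) ->
  (forall r, 1 < r -> 0 <= f r) -> (forall r, 1 < r -> f r * r ^+ 2 <= h r) ->
  (forall r, 1 <= r -> is_derive r 1 H (h r)) ->
  (forall r, 1 <= r -> {for r, continuous h}) -> (forall r, 1 <= r -> 0 <= h r) ->
  H r @[r --> +oo] --> (0 : R) ->
  (\int[leb3]_(x in (exterior : set E3)) (f (enorm x))%:E <= (kappa * - H 1)%:E)%E.
Proof.
move=> fc f0 fh dH hc h0 Hl; rewrite ge0_polar_continuous//.
have k0 := @kappa_gt0 R.
have mI : measurable (`]1%R, +oo[%classic : set R) by exact: measurable_itv.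
have kc r : {for r, continuous (fun=> kappa : R)} by exact: cvg_cst.
have sc r : {for r, continuous (fun r : R => r ^+ 2)} by exact: exprn_continuous.
have E := @ge0_integral_y (fun r => kappa * h r) (fun r => kappa * H r) (kappa * 0).
rewrite mulr0 sub0r -mulrN in E.
have D1 r : 1 <= r -> is_derive r 1 (fun r0 : R => kappa * H r0) (kappa * h r).
  by move=> r1; have d := dH r r1; apply: (deq (dM (dcst r kappa) d)); ring.
rewrite -(E D1); last first.
- by rewrite -[X in _ --> X](mulr0 (kappa : R)); apply: cvgM => //; exact: cvg_cst.
- by move=> r /h0; apply: mulr_ge0; exact: ltW.
- by move=> r r1; apply: cvgM; [exact: cvg_cst | exact: hc].
apply: ge0_le_integral => //.
- move=> r /=; rewrite in_itv/= andbT => r1.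
  rewrite lee_fin; apply: mulr_ge0; first exact: ltW.
  by apply: mulr_ge0; [exact: f0 | exact: sqr_ge0].
- apply/measurable_EFinP; apply: open_continuous_measurable_fun; first exact: interval_open.
  move=> r; rewrite inE/= in_itv/= andbT => r1.
  by apply: cvgM; [exact: cvg_cst | apply: cvgM; [exact: fc | exact: sc]].
- apply/measurable_EFinP; apply: open_continuous_measurable_fun; first exact: interval_open.
  move=> r; rewrite inE/= in_itv/= andbT => /ltW r1.
  by apply: cvgM; [exact: cvg_cst | exact: hc].
- move=> r /=; rewrite in_itv/= andbT => r1.
  by rewrite lee_fin ler_pM2l//; exact: fh.
Qed.

End radial_tools.

Lemma smooth_on_sum (R : realType) (U : set (E3 R)) (F : 'I_3 -> E3 R -> R) : open U ->
  (forall i, smooth_on U (F i)) -> smooth_on U (fun x => \sum_(i < 3) F i x).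
Proof.
move=> oU sF; elim: (index_enum _) => [|i s IH].
  have -> : (fun x => \sum_(i <- [::]) F i x) = (fun=> 0) by apply/funext => x; rewrite big_nil.
  exact: smooth_on_cst.
have -> : (fun x => \sum_(j <- i :: s) F j x) = (fun x => F i x + \sum_(j <- s) F j x).
  by apply/funext => x; rewrite big_cons.
exact: smooth_on_add.
Qed.

(** * Profiles solve the equation in the sense of distributions *)

Section profile_stationary.
Context {R : realType}.
Local Notation mu := (@lebesgue_measure R).
Local Notation E3 := (E3 R).
Implicit Types (i : 'I_3) (r : R) (n : nat).
Variables (m : nat) (q dq : R -> R) (M : R).
Hypothesis qp : profile m q dq M.

Let qd := profile_d qp.
Let dqd := profile_dd qp.
Let q1 := profile_1 qp.
Let sq := profile_smooth qp.

Let M0 : 0 <= M.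
Proof. by have [_] := profile_bound qp (lexx 1); rewrite expr1n divr1; exact: le_trans. Qed.

Let dq_bound r : 1 <= r -> `|dq r| <= M / r ^+ 2.
Proof. by move=> /(profile_bound qp)[]. Qed.

Let q_bound r : 1 <= r -> `|q r| <= M / r.
Proof. by move=> /(profile_bound qp)[]. Qed.

Let q_bound1 r : 1 <= r -> `|q r| <= M * (r - 1).
Proof.
move=> r1.
have A (x : R) : 1 <= x <= r -> is_derive x 1 q (dq x) by move=> /andP[x1 _]; apply: qd; lra.
have B (x : R) : 1 <= x <= r -> is_derive x 1 (fun x => M * x) M.
  by move=> _; apply: (deq (dM (dcst x M) (did x))); ring.
have := mono_norm r1 A B; rewrite q1 subr0 mulrBr; apply => x /andP[x1 xr].
apply: le_trans (dq_bound (ltW x1)) _; rewrite ler_pdivrMr ?exprn_gt0//; last lra.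
by rewrite ler_peMr// expr_ge1//; lra.
Qed.

Let qc r : 0 < r -> {for r, continuous q}.
Proof. by move=> /qd; exact: dcont. Qed.

Let dqc r : 0 < r -> {for r, continuous dq}.
Proof. by move=> /dqd; exact: dcont. Qed.

Let uc (x : E3) : exterior x -> {for x, continuous (radial_fun q)}.
Proof.
rewrite /exterior/= => x1; apply: continuous_comp; first exact: continuous_enorm.
by apply: qc; lra.
Qed.

Lemma profile_radial : radial (radial_fun q : E3 -> R).
Proof.
exists (fun r => if 0 < r then q r else 0); split; first exact: gt_measurable.
apply: aeW => x; rewrite /exterior/= /radial_fun => x1; rewrite ifT//; lra.
Qed.

Let g (x : E3) : R := `|radial_fun q x| ^+ (2 * m) * radial_fun q x.

Let gE (x : E3) : exterior x -> g x = - laplacian (radial_fun q) x.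
Proof.
rewrite /exterior/= => x1; have x0 : 0 < enorm x by lra.
rewrite (laplacian_radial x0 qd dqd) /g /radial_fun.
have -> : `|q (enorm x)| ^+ (2 * m) = q (enorm x) ^+ (2 * m) by rewrite !exprM real_normK ?num_real.
by rewrite exprSr; ring.
Qed.

(** Green's identity: the field [phi grad q - q grad phi] has compact support in the exterior
    domain, so its divergence has integral 0. *)
Lemma profile_poisson : distr_poisson (radial_fun q : E3 -> R) g.
Proof.
split.
- exact: continuous_loc_integrable.
- apply: continuous_loc_integrable => x x1; have c := uc x1.
  apply: cvgM => //; apply: (@continuous_comp _ _ _ (fun x => `|radial_fun q x|) (fun y => y ^+ (2 * m))).
    exact: cvg_norm.
  exact: exprn_continuous.
move=> phi tphi.
have sq3 : smooth_on exterior (radial_fun q : E3 -> R).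
  by apply: smooth_on_sub (smooth_radial_pos sq) => x; rewrite /exterior/=; lra.
have mE := @measurable_exterior R.
pose w i (x : E3) := pderiv i (radial_fun q) x * phi x - radial_fun q x * pderiv i phi x.
have tw i : test_function (w i).
  apply: test_sub; apply: test_smooth_mul => //; first exact: smooth_on_pderiv.
  exact: test_pderiv.
have wE (x : E3) : exterior x -> \sum_(i < 3) pderiv i (w i) x =
    laplacian (radial_fun q) x * phi x - radial_fun q x * laplacian phi x.
  move=> x1; rewrite /laplacian mulr_suml mulr_sumr -sumrB; apply: eq_bigr => i _.
  apply: pderiv_is_derive.
  have k1 := smooth_on_is_derive i (smooth_on_pderiv i sq3) x1.
  have k2 := test_is_derive i x tphi.
  have k3 := smooth_on_is_derive i sq3 x1.
  have k4 := test_is_derive i x (test_pderiv i tphi).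
  have k5 := is_derive3M (is_derive3_cst i (-1) x) (is_derive3M k3 k4).
  have k6 := is_derive3D (is_derive3M k1 k2) k5.
  have -> : w i = (fun x => pderiv i (radial_fun q) x * phi x + -1 * (radial_fun q x * pderiv i phi x)).
    by apply/funext => y; rewrite mulN1r.
  apply: is_derive_eq k6 _.
  move: (pderiv _ _ x) (pderiv _ _ x) (pderiv _ _ x) (pderiv _ _ x) (radial_fun _ _) (phi x) => a b c d e f; ring.
have sl : smooth_on exterior (laplacian (radial_fun q : E3 -> R)).
  by apply: smooth_on_sum => [|i]; [exact: exterior_open | do ! apply: smooth_on_pderiv].
have i1 : leb3.-integrable exterior (EFin \o (fun x : E3 => -1 * (laplacian (radial_fun q) x * phi x))).
  by apply: test_integrable => //; apply: test_scale; exact: test_smooth_mul.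
have i2 : leb3.-integrable exterior (EFin \o (fun x : E3 => \sum_(i < 3) pderiv i (w i) x)).
  have -> : EFin \o (fun x : E3 => \sum_(i < 3) pderiv i (w i) x) = (fun x => \sum_(i < 3) (pderiv i (w i) x)%:E)%E.
    by apply/funext => x /=; rewrite sumEFin.
  by apply: integrable_sum => // i _; exact: test_integrable mE (test_pderiv i (tw i)).
pose T1 (x : E3) : R := -1 * (laplacian (radial_fun q) x * phi x).
pose T2 (x : E3) : R := \sum_(i < 3) pderiv i (w i) x.
transitivity (\int[leb3]_(x in exterior) ((EFin \o T1) x + (EFin \o T2) x))%E.
  apply: eq_integral => x; rewrite inE => x1; rewrite /T1 /T2 /= wE// -EFinD; congr (_%:E).
  move: (laplacian _ _) (laplacian _ _) (radial_fun _ _) (phi x) => a b c d; ring.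
rewrite integralD// test_integral_div// adde0.
by apply: eq_integral => x; rewrite inE => x1; rewrite /T1 /= gE// mulN1r mulNr.
Qed.

End profile_stationary.

(** * Cutoffs near the boundary and near infinity *)

Section cutoff.
Context {R : realType}.
Local Notation mu := (@lebesgue_measure R).
Local Notation E3 := (E3 R).
Implicit Types (r N : R).
Variables (q dq sigma omega : R -> R) (M W : R).
Hypothesis sq : smooth1 [set r | 0 < r] q.
Hypothesis qd : forall r, 0 < r -> is_derive r 1 q (dq r).
Hypothesis dqc : forall r, 0 < r -> {for r, continuous dq}.
Hypothesis M0 : 0 <= M.
Hypothesis W0 : 0 <= W.
Hypothesis dq_bound : forall r, 1 <= r -> `|dq r| <= M / r ^+ 2.
Hypothesis q_bound : forall r, 1 <= r -> `|q r| <= M / r.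
Hypothesis q_bound1 : forall r, 1 <= r -> `|q r| <= M * (r - 1).
Hypothesis so : smooth1 setT omega.
Hypothesis sd : forall r, is_derive r 1 sigma (omega r).
Hypothesis slo : forall r, r <= 0 -> sigma r = 0.
Hypothesis shi : forall r, 1 <= r -> sigma r = 1.
Hypothesis s01 : forall r, 0 <= sigma r <= 1.
Hypothesis o0 : forall r, 0 <= omega r.
Hypothesis oW : forall r, omega r <= W.
Hypothesis oout : forall r, r <= 0 \/ 1 <= r -> omega r = 0.

Let ss : smooth1 setT sigma.
Proof. by apply: smooth1_prim so => r _; exact: sd. Qed.

(** As [sigma] rises on [[0, 1]], [chi1] rises on [[1 + 1/N, 1 + 2/N]] and [chi2] on [[N, 2N]]; so
    [chi] is compactly supported in [(1, oo)] and equals 1 on [[1 + 2/N, N]] when that interval is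
    nonempty. *)
Definition chi1 N r := sigma (N * r + (- N - 1)).
Definition chi2 N r := sigma (N^-1 * r + -1).
Definition chi N r := chi1 N r * (1 + -1 * chi2 N r).
Definition dchi N r := N * omega (N * r + (- N - 1)) * (1 - chi2 N r) -
  chi1 N r * (omega (N^-1 * r + -1) / N).
Definition psi N r := chi N r * q r.
Definition dpsi N r := dchi N r * q r + chi N r * dq r.

Lemma is_derive_chi N r : is_derive r 1 (chi N) (dchi N r).
Proof.
have a1 (a b : R) : is_derive r 1 (fun r => a * r + b) a.
  by apply: (deq (dD (dM (dcst r a) (did r)) (dcst r b))); ring.
have k1 := dcomp (f := sigma) (g := fun r => N * r + (- N - 1)) (sd _) (a1 _ _).
have k2 := dcomp (f := sigma) (g := fun r => N^-1 * r + -1) (sd _) (a1 _ _).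
have k3 := dM k1 (dD (dcst r 1) (dM (dcst r (-1)) k2)).
by apply: (deq k3); rewrite /dchi /chi1 /chi2; ring.
Qed.

Lemma is_derive_psi N r : 0 < r -> is_derive r 1 (psi N) (dpsi N r).
Proof. by move=> r0; have h := qd r0; have k := is_derive_chi N r; exact: dM. Qed.

Lemma smooth_chi1 N : smooth1 setT (chi1 N).
Proof. by apply: (smooth1_affine (I := setT)). Qed.

Lemma smooth_chi N : smooth1 setT (chi N).
Proof.
apply: smooth1_mul; first exact: smooth_chi1.
apply: smooth1_add; first exact: smooth1_cst.
apply: smooth1_mul; first exact: smooth1_cst.
by apply: (smooth1_affine (I := setT)).
Qed.

Lemma smooth_psi N : smooth1 [set r | 0 < r] (psi N).
Proof. by apply: smooth1_mul => //; apply: smooth1_sub (smooth_chi N). Qed.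

Lemma continuous_dpsi N r : 0 < r -> {for r, continuous (dpsi N)}.
Proof.
move=> r0; have [f' sf' df] := smooth1_deriv (smooth_psi N).
have c := smooth1_continuous sf' r0.
have E : {near r, f' =1 dpsi N}.
  near=> y; have y0 : 0 < y by near: y; exact: lt_nbhsr.
  have [_ <-] := df y y0; by have [_ <-] := is_derive_psi N y0.
have fx : f' r = dpsi N r := nbhs_singleton E.
rewrite /prop_for /continuous_at -fx; apply: cvg_trans c; exact: near_eq_cvg E.
Unshelve. all: by end_near. Qed.

Section fixN.
Variable N : R.
Hypothesis N1 : 1 <= N.

Let n0 : 0 < N. Proof. by have := N1; lra. Qed.

Lemma chi1_lo r : r <= 1 + N^-1 -> chi1 N r = 0.
Proof.
move=> h; apply: slo.
have : N * r <= N * (1 + N^-1) by rewrite ler_pM2l.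
by rewrite mulrDr mulfV ?gt_eqF// mulr1; lra.
Qed.

Lemma chi1_hi r : 1 + 2 / N <= r -> chi1 N r = 1 /\ omega (N * r + (- N - 1)) = 0.
Proof.
move=> h.
have : N * (1 + 2 / N) <= N * r by rewrite ler_pM2l.
rewrite mulrDr mulr1 mulrCA mulfV ?gt_eqF// => h2.
by split; [apply: shi; lra | apply: oout; right; lra].
Qed.

Lemma chi2_lo r : r <= N -> chi2 N r = 0 /\ omega (N^-1 * r + -1) = 0.
Proof.
move=> h.
have h2 : N^-1 * r <= 1 by rewrite ler_pdivrMl// mulr1.
by split; [apply: slo; lra | apply: oout; left; lra].
Qed.

Lemma chi2_hi r : 2 * N <= r -> chi2 N r = 1 /\ omega (N^-1 * r + -1) = 0.
Proof.
move=> h.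
have h2 : 2 <= N^-1 * r by rewrite ler_pdivlMl// mulrC.
by split; [apply: shi; lra | apply: oout; right; lra].
Qed.

Lemma psi_test : test_function (radial_fun (psi N) : E3 -> R).
Proof.
apply: (@radial_test R _ (1 + N^-1) (2 * N)); last first.
- move=> r [/chi1_lo h|/chi2_hi[h _]]; rewrite /psi /chi h ?mul0r// mulr1 subrr.
  by rewrite mulr0 mul0r.
- exact: smooth_psi.
- by rewrite ltrDl invr_gt0.
Qed.

Lemma chi_le r : 0 <= chi N r <= 1.
Proof.
have /andP[a1 a2] := s01 (N * r + (- N - 1)); have /andP[b1 b2] := s01 (N^-1 * r + -1).
by rewrite /chi /chi1 /chi2; apply/andP; split; nra.
Qed.

Lemma cutoff_le3 r : r < 1 + 2 / N -> r <= 3.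
Proof.
move=> rl; have : 2 / N <= 2 by rewrite ler_pdivrMr// ler_peMr.
by move: rl; lra.
Qed.

(** The bound is uniform in [N]: near the boundary [chi1' <= N W] is paid by
    [|q| <= M (r - 1) <= 2M/N], near infinity [chi2' <= W/N <= 2W/r] by [|q| <= M/r]. The constant
    18 is 2 times [r^2 <= 9], valid since [r <= 3] in the inner zone. *)
Lemma dpsi_bound r : 1 <= r -> `|dpsi N r| <= (M + (18 * (M * W) + 2 * (M * W))) / r ^+ 2.
Proof.
move=> r1; have r0 : 0 < r by lra.
have MW0 := mulr_ge0 M0 W0.
have r20 : 0 < r ^+ 2 by exact: exprn_gt0.
have T1 : `|chi N r * dq r| <= M / r ^+ 2.
  rewrite normrM; have /andP[c0 c1] := chi_le r.
  rewrite (ger0_norm c0); apply: le_trans (dq_bound r1); exact: ler_piMl.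
have h1 : 0 <= chi1 N r <= 1 by exact: s01.
have h2 : 0 <= 1 - chi2 N r <= 1 by have := s01 (N^-1 * r + -1); rewrite -/(chi2 N r) => /andP[]; lra.
have T2 : `|N * omega (N * r + (- N - 1)) * (1 - chi2 N r) * q r| <= 18 * (M * W) / r ^+ 2.
  have [rl|rl] := leP (1 + 2 / N) r.
    have [_ ->] := chi1_hi rl; rewrite mulr0 !mul0r normr0 divr_ge0//; last exact: ltW.
    by lra.
  have qb : `|q r| <= M * (2 / N).
    by apply: le_trans (q_bound1 r1) _; apply: ler_wpM2l => //; lra.
  have r3 := cutoff_le3 rl.
  have r9 : r ^+ 2 <= 9 by rewrite expr2; nra.
  move: (oW (N * r + (- N - 1))) (o0 (N * r + (- N - 1))); move: (omega _) => w wW w0.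
  have /andP[h20 h21] := h2.
  rewrite !normrM (gtr0_norm n0) (ger0_norm w0) (ger0_norm h20).
  have A : N * w * (1 - chi2 N r) * `|q r| <= N * W * (M * (2 / N)).
    apply: ler_pM => //; first by do 2 ? [apply: mulr_ge0 => //]; exact: ltW.
    apply: le_trans (_ : N * w <= _).
      by rewrite ler_piMr// mulr_ge0// ltW.
    by rewrite ler_pM2l.
  apply: (le_trans A).
  have -> : N * W * (M * (2 / N)) = 2 * (M * W) by field; rewrite gt_eqF.
  rewrite ler_pdivlMr//; move: MW0; move: (M * W) => MW MW0.
  nra.
have T3 : `|chi1 N r * (omega (N^-1 * r + -1) / N) * q r| <= 2 * (M * W) / r ^+ 2.
  have [rl|rl] := leP (2 * N) r.
    have [_ ->] := chi2_hi rl; rewrite mul0r mulr0 mul0r normr0 divr_ge0//; last exact: ltW.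
    by lra.
  move: (oW (N^-1 * r + -1)) (o0 (N^-1 * r + -1)); move: (omega _) => w wW w0.
  have /andP[h10 h11] := h1.
  have wn0 : 0 <= w / N by rewrite divr_ge0// ltW.
  rewrite normrM normrM (ger0_norm h10) (ger0_norm wn0).
  have A : chi1 N r * (w / N) * `|q r| <= W * (2 / r) * (M / r).
    apply: ler_pM => //; [by rewrite mulr_ge0| |exact: q_bound].
    apply: (@le_trans _ _ (w / N)); first by rewrite ler_piMl.
    apply: ler_pM => //; first by rewrite invr_ge0 ltW.
    by rewrite ler_pdivlMr// mulrC ler_pdivrMr// ltW.
  apply: (le_trans A); rewrite le_eqVlt; apply/orP; left; apply/eqP.
  by field; rewrite gt_eqF.
have -> : dpsi N r = chi N r * dq r + (N * omega (N * r + (- N - 1)) * (1 - chi2 N r) * q r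
  - chi1 N r * (omega (N^-1 * r + -1) / N) * q r).
  by rewrite /dpsi /dchi mulrBl addrC.
rewrite mulrDl; apply: le_trans (ler_normD _ _) _; apply: lerD => //.
rewrite mulrDl; apply: le_trans (ler_normB _ _) _; exact: lerD.
Qed.

Lemma tail_integral (f : R -> R) (K : R) : 0 <= K ->
  (forall r, 1 < r -> {for r, continuous f}) -> (forall r, 1 < r -> 0 <= f r) ->
  (forall r, 1 < r -> r < 1 + 2 / N \/ N < r -> f r * r ^+ 2 <= K / r ^+ 2) ->
  (forall r, 1 + 2 / N <= r -> r <= N -> f r = 0) ->
  (\int[leb3]_(x in (exterior : set E3)) (f (enorm x))%:E <= (kappa * (K * 13 / N))%:E)%E.
Proof.
move=> K0 fc f0 fK fmid.
(* [h / K] dominates [r ^- 2] where [r < 1 + 2 / N] or [N < r], has an explicit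
   primitive, and its integral over [1, +oo) is O(1/N). *)
pose h r := K * (9 / (N * (r - 1) + 1) ^+ 2 + 4 / (r + N) ^+ 2).
pose H r := - K * (9 / N * (N * (r - 1) + 1)^-1 + 4 * (r + N)^-1).
have p1 r : 1 <= r -> 0 < N * (r - 1) + 1.
  move=> r1; have : 0 <= N * (r - 1) by apply: mulr_ge0; [exact: ltW | lra].
  lra.
have p2 r : 1 <= r -> 0 < r + N by have := n0; lra.
have dH r : 1 <= r -> is_derive r 1 H (h r).
  move=> r1; have a1 := p1 r r1; have a2 := p2 r r1.
  have d1 : is_derive r 1 (fun r => N * (r - 1) + 1) N.
    by apply: (deq (dD (dM (dcst r N) (dD (did r) (dcst r (-1)))) (dcst r 1))); ring.
  have d2 : is_derive r 1 (fun r => r + N) 1.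
    by apply: (deq (dD (did r) (dcst r N))); ring.
  have k := dM (dcst r (- K)) (dD (dM (dcst r (9 / N)) (dV (f := fun r => N * (r - 1) + 1) (lt0r_neq0 a1) d1)) (dM (dcst r 4) (dV (f := fun r => r + N) (lt0r_neq0 a2) d2))).
  by apply: (deq k); rewrite /h; field; rewrite !gt_eqF.
have hc r : 1 <= r -> {for r, continuous h}.
  move=> r1; have a1 := p1 r r1; have a2 := p2 r r1.
  have c1 : {for r, continuous (fun r => (N * (r - 1) + 1) ^+ 2)}.
    apply: (@continuous_comp _ _ _ (fun r => N * (r - 1) + 1) (fun y : R => y ^+ 2)); last exact: exprn_continuous.
    by apply: cvgD; [apply: cvgM; [exact: cvg_cst|apply: cvgB; [exact: cvg_id|exact: cvg_cst]]|exact: cvg_cst].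
  have c2 : {for r, continuous (fun r => (r + N) ^+ 2)}.
    apply: (@continuous_comp _ _ _ (fun r => r + N) (fun y : R => y ^+ 2)); last exact: exprn_continuous.
    by apply: cvgD; [exact: cvg_id|exact: cvg_cst].
  apply: cvgM; first exact: cvg_cst.
  apply: cvgD.
    by apply: cvgM; [exact: cvg_cst | apply: cvgV => //; rewrite gt_eqF// exprn_gt0].
  by apply: cvgM; [exact: cvg_cst | apply: cvgV => //; rewrite gt_eqF// exprn_gt0].
have h0 r : 1 <= r -> 0 <= h r.
  by move=> r1; rewrite mulr_ge0// addr_ge0// divr_ge0// sqr_ge0.
have fh r : 1 < r -> f r * r ^+ 2 <= h r.
  move=> r1; have a1 := p1 r (ltW r1); have a2 := p2 r (ltW r1).
  have r0 : 0 < r by lra.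
  have q1 : 0 <= K * (9 / (N * (r - 1) + 1) ^+ 2) by rewrite mulr_ge0// divr_ge0// sqr_ge0.
  have q2 : 0 <= K * (4 / (r + N) ^+ 2) by rewrite mulr_ge0// divr_ge0// sqr_ge0.
  (* The constants 9 and 4 come from [N (r - 1) + 1 <= 3] in the inner zone and [r + N <= 2 r]
     beyond [N]; at [r = 1] the primitive contributes [9/N + 4/(1 + N) <= 13/N]. *)
  have [rl|rl] := ltP r (1 + 2 / N).
    apply: le_trans (fK r r1 (or_introl rl)) _; rewrite /h mulrDr.
    suff : K / r ^+ 2 <= K * (9 / (N * (r - 1) + 1) ^+ 2) by move: q2; lra.
    apply: ler_wpM2l => //; apply: (@le_trans _ _ 1).
      by rewrite invf_le1 ?exprn_gt0// expr_ge1// ltW.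
    rewrite ler_pdivlMr ?exprn_gt0// mul1r.
    have : N * (r - 1) <= 2 by rewrite mulrC -ler_pdivlMr//; move: rl; lra.
    by move: a1; move: (N * (r - 1)) => z; nra.
  have [rN|rN] := leP r N; first by rewrite fmid// mul0r h0// ltW.
  apply: le_trans (fK r r1 (or_intror rN)) _; rewrite /h mulrDr.
  suff : K / r ^+ 2 <= K * (4 / (r + N) ^+ 2) by move: q1; lra.
  apply: ler_wpM2l => //; rewrite ler_pdivlMr ?exprn_gt0// mulrC ler_pdivrMr ?exprn_gt0//.
  by move: rN n0; nra.
have Hl : H r @[r --> +oo] --> (0 : R).
  apply/cvgr0Pnorm_le => e e0; near=> r.
  have r1 : 1 <= r by near: r; apply: nbhs_pinfty_ge; exact: num_real.
  have rK : 1 + K * 13 / e <= r by near: r; apply: nbhs_pinfty_ge; exact: num_real.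
  have a1 := p1 r r1; have a2 := p2 r r1.
  have a3 : 0 < r - 1 + 1 by lra.
  rewrite /H normrM normrN (ger0_norm K0) ger0_norm; last first.
    apply: addr_ge0; first by rewrite mulr_ge0 ?divr_ge0 ?invr_ge0// ltW.
    by rewrite mulr_ge0 ?invr_ge0// ltW.
  apply: (@le_trans _ _ (K * (13 * (r - 1 + 1)^-1))).
    apply: ler_wpM2l => //; have -> : 13 * (r - 1 + 1)^-1 = 9 * (r - 1 + 1)^-1 + 4 * (r - 1 + 1)^-1 by ring.
    apply: lerD.
      rewrite -mulrA ler_pM2l// -invfM lef_pV2 ?posrE//; last exact: mulr_gt0.
      by move: r1 N1; nra.
    by rewrite ler_pM2l// lef_pV2 ?posrE//; move: n0; lra.
  by rewrite mulrA ler_pdivrMr// mulrC -ler_pdivrMl// mulrC; move: rK; lra.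
apply: le_trans (ext_integral_le fc f0 fh dH hc h0 Hl) _.
rewrite lee_fin ler_pM2l ?kappa_gt0// /H subrr mulr0 add0r invr1 mulr1 mulNr opprK -mulrA.
apply: ler_wpM2l => //; have -> : 13 / N = 9 / N + 4 * N^-1 by ring.
by rewrite lerD2l ler_pM2l// lef_pV2 ?posrE//; move: n0; lra.
Unshelve. all: by end_near. Qed.

End fixN.

(** Stated for every [N' >= N], so that any two late cutoffs agree, derivatives included, on one
    common interval. *)
Lemma chi_mid N N' r : 1 <= N -> N <= N' -> 1 + 2 / N <= r -> r <= N -> chi N' r = 1 /\ dchi N' r = 0.
Proof.
move=> N1 NN h1 h2; have n0 : 0 < N by lra.
have n1 : 0 < N' by lra.
have N'1 : 1 <= N' by lra.
have [k1 k2] : chi1 N' r = 1 /\ omega (N' * r + (- N' - 1)) = 0.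
  by apply: chi1_hi => //; apply: le_trans h1; rewrite lerD2l ler_pM2l// lef_pV2.
have [k3 k4] : chi2 N' r = 0 /\ omega (N'^-1 * r + -1) = 0.
  by apply: chi2_lo => //; exact: le_trans h2 NN.
by rewrite /chi /dchi k1 k2 k3 k4; split; ring.
Qed.

End cutoff.

Section profile_space.
Context {R : realType}.
Local Notation mu := (@lebesgue_measure R).
Local Notation E3 := (E3 R).
Implicit Types (r : R) (n : nat).

Lemma profile_facts (m : nat) (q dq : R -> R) (M : R) : profile m q dq M ->
  [/\ 0 <= M, forall r, 0 < r -> {for r, continuous q}, forall r, 0 < r -> {for r, continuous dq} &
   forall r, 1 <= r -> `|q r| <= M * (r - 1)].
Proof.
move=> qp.
have M0 : 0 <= M by have [_] := profile_bound qp (lexx 1); rewrite expr1n divr1; exact: le_trans.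
split=> //.
- by move=> r /(profile_d qp); exact: dcont.
- by move=> r /(profile_dd qp); exact: dcont.
move=> r r1.
have A (x : R) : 1 <= x <= r -> is_derive x 1 q (dq x).
  by move=> /andP[x1 _]; apply: (profile_d qp); lra.
have B (x : R) : 1 <= x <= r -> is_derive x 1 (fun x => M * x) M.
  by move=> _; apply: (deq (dM (dcst x M) (did x))); ring.
have := mono_norm r1 A B; rewrite (profile_1 qp) subr0 mulrBr; apply => x /andP[x1 xr].
apply: le_trans (profile_bound qp (ltW x1)).2 _; rewrite ler_pdivrMr ?exprn_gt0//; last lra.
by rewrite ler_peMr// expr_ge1//; lra.
Qed.

Lemma continuous_radial (q : R -> R) : (forall r, 0 < r -> {for r, continuous q}) ->
  forall x : E3, exterior x -> {for x, continuous (radial_fun q)}.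
Proof.
move=> qc x; rewrite /exterior/= => x1; apply: continuous_comp; first exact: continuous_enorm.
by apply: qc; lra.
Qed.

Lemma step_bound (omega : R -> R) : smooth1 setT omega ->
  (forall r, r <= 0 \/ 1 <= r -> omega r = 0) -> exists W : R, 0 <= W /\ forall r, omega r <= W.
Proof.
move=> so oout.
have cK : compact (omega @` `[0, 1]).
  apply: continuous_compact; last exact: segment_compact.
  by apply: continuous_subspaceT => s; exact: (smooth1_continuous so).
have [W [_ h]] := compact_bounded cK; exists (`|W| + 1); split.
  by have := normr_ge0 W; lra.
move=> r; have [r0|r0] := leP r 0.
  by rewrite oout; [have := normr_ge0 W; lra | left].
have [r1|r1] := leP 1 r.
  by rewrite oout; [have := normr_ge0 W; lra | right].
apply: le_trans (ler_norm _) _; apply: (h (`|W| + 1)); first by have := ler_norm W; lra.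
by exists r => //=; rewrite in_itv/= !ltW.
Qed.

Lemma small_fraction (K e : R) : 0 < e -> exists N : nat, forall n, (N <= n)%N -> K / n.+1%:R < e.
Proof.
move=> e0; exists (Num.truncn (`|K| / e)) => n Nn.
have h : `|K| / e < (Num.truncn (`|K| / e)).+1%:R by exact: truncnS_gt.
have n0 : 0 < n.+1%:R :> R by [].
rewrite ltr_pdivrMr// mulrC -ltr_pdivrMr//.
apply: (@le_lt_trans _ _ (`|K| / e)); first by rewrite ler_pM2r ?invr_gt0// ler_norm.
by apply: lt_le_trans h _; rewrite ler_nat ltnS.
Qed.

(** The truncations [psi] at [N = n + 1] have derivatives bounded by [C / r^2] uniformly, and two of
    them coincide except near the boundary and near infinity, where the gradient integrals are
    [O(1/N)]. *)
Lemma profile_dotH10 (m : nat) (q dq : R -> R) (M : R) : profile m q dq M ->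
  dotH10 (radial_fun q : E3 -> R).
Proof.
move=> qp; have [M0 qc dqc qb1] := profile_facts qp.
have [sigma [omega [so sd [slo shi] s01 [ o0 oout]]]] := @smooth_step R.
have [W [W0 oW]] := step_bound so oout.
have sq := profile_smooth qp; have qd := profile_d qp.
have qb r : 1 <= r -> `|q r| <= M / r by move=> /(profile_bound qp)[].
have dqb r : 1 <= r -> `|dq r| <= M / r ^+ 2 by move=> /(profile_bound qp)[].
have uc := continuous_radial qc.
have mE := @measurable_exterior R.
pose nn n : R := n.+1%:R; have nn1 n : 1 <= nn n by rewrite /nn ler1n.
have nn0 n : 0 < nn n by have := nn1 n; lra.
split; first by apply: continuous_measurable3 => //; exact: exterior_open.
exists (fun n => radial_fun (psi q sigma (nn n))); split.
- by move=> n; apply: psi_test => //; exact: nn1.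
- move=> e e0.
  pose C := M + (18 * (M * W) + 2 * (M * W)).
  have C0 : 0 <= C by have := mulr_ge0 M0 W0; rewrite /C; lra.
  (* Two derivatives, each at most [C / r^2], differ by at most [2 C / r^2]; squared and multiplied
     by [r^2] this is [K / r^2]. *)
  pose K := 4 * C ^+ 2; have K0 : 0 <= K by rewrite mulr_ge0// sqr_ge0.
  have [N hN] := small_fraction (kappa * (K * 13)) e0.
  exists N => n p Nn Np.
  pose f r := (dpsi q dq sigma omega (nn n) r - dpsi q dq sigma omega (nn p) r) ^+ 2.
  have NN k : (N <= k)%N -> nn N <= nn k by move=> h; rewrite /nn ler_nat.
  have E : (\int[leb3]_(x in exterior) (grad_sq (fun y : E3 => radial_fun (psi q sigma (nn n)) y - radial_fun (psi q sigma (nn p)) y) x)%:E =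
     \int[leb3]_(x in exterior) (f (enorm x))%:E)%E.
    apply: eq_integral => x; rewrite inE /exterior/= => x1.
    have x0 : 0 < enorm x by lra.
    have D1 := is_derive_psi qd sd (nn n) x0; have D2 := is_derive_psi qd sd (nn p) x0.
    by rewrite (grad_sq_radial_sub x0 D1 D2).
  rewrite E; apply: (@le_lt_trans _ _ (kappa * (K * 13) / N.+1%:R)%:E); last by rewrite lte_fin; exact: hN.
  have -> : kappa * (K * 13) / N.+1%:R = kappa * (K * 13 / nn N) by rewrite -(mulrA kappa).
  apply: (tail_integral (nn1 N) K0).
  + move=> r r1; have r0 : 0 < r by lra.
    apply: (@continuous_comp _ _ _ _ (fun y : R => y ^+ 2)); last exact: exprn_continuous.
    by apply: cvgB; apply: (continuous_dpsi sq qd so sd).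
  + by move=> r _; exact: sqr_ge0.
  + move=> r r1 _; have r0 : 0 < r by lra.
    have B k : `|dpsi q dq sigma omega (nn k) r| <= C / r ^+ 2.
      apply: dpsi_bound; try eassumption; [exact: nn1 | exact: ltW].
    have Bs : `|dpsi q dq sigma omega (nn n) r - dpsi q dq sigma omega (nn p) r| <= 2 * C / r ^+ 2.
      apply: le_trans (ler_normB _ _) _; apply: le_trans (lerD (B n) (B p)) _.
      by rewrite le_eqVlt; apply/orP; left; apply/eqP; ring.
    have -> : K / r ^+ 2 = (2 * C / r ^+ 2) ^+ 2 * r ^+ 2.
      by rewrite /K; field; rewrite gt_eqF.
    rewrite ler_pM2r ?exprn_gt0// /f -[leLHS]real_normK ?num_real//.
    by rewrite ler_sqr ?nnegrE// (le_trans _ Bs).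
  + move=> r r1 r2; rewrite /f /dpsi.
    have [-> ->] := chi_mid slo shi oout (nn1 N) (NN _ Nn) r1 r2.
    by have [-> ->] := chi_mid slo shi oout (nn1 N) (NN _ Np) r1 r2; rewrite subrr expr0n.
- move=> rho.
  (* Once [n + 1 >= rho] only the inner cutoff acts on the ball; there [r <= 3], hence
     [M r <= 27 M / r^2]. *)
  pose K := 27 * M; have K0 : 0 <= K by rewrite /K; lra.
  apply: (@squeeze_cvge _ _ _ _ (fun=> 0%E) _ (fun n => (kappa * (K * 13) * harmonic n)%:E)); last first.
  + apply: cvg_EFin; first by near=> n.
    rewrite -[X in _ --> X](mulr0 (kappa * (K * 13))).
    by apply: cvgM; [exact: cvg_cst | exact: cvg_harmonic].
  + exact: cvg_cst.
  near=> n; apply/andP; split.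
    by apply: integral_ge0 => x _; rewrite abse_ge0 || rewrite lee_fin normr_ge0.
  have rn : rho <= nn n.
    have h : (Num.truncn rho <= n)%N by near: n; exact: nbhs_infty_ge.
    apply: ltW; apply: (@lt_le_trans _ _ (Num.truncn rho).+1%:R); first exact: truncnS_gt.
    by rewrite /nn ler_nat.
  pose f r := (1 - chi1 sigma (nn n) r) * `|q r|.
  have f0 r : 0 <= f r.
    rewrite mulr_ge0//; have /andP[_] := s01 (nn n * r + (- nn n - 1)).
    by rewrite /chi1; lra.
  have fc r : 1 < r -> {for r, continuous f}.
    move=> r1; apply: cvgM; last by apply: cvg_norm; apply: qc; lra.
    by apply: cvgB; [exact: cvg_cst | apply: (smooth1_continuous (smooth_chi1 so sd (nn n)))].
  apply: (@le_trans _ _ (\int[leb3]_(x in (exterior : set E3)) (f (enorm x))%:E)%E).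
    apply: (@le_trans _ _ (\int[leb3]_(x in (exterior : set E3) `&` eball rho) (f (enorm x))%:E)%E).
      rewrite le_eqVlt; apply/orP; left; apply/eqP; apply: eq_integral => x; rewrite inE => -[x1].
      rewrite /eball/= => xr; congr (_%:E); rewrite /radial_fun /psi /chi /f.
      have [-> _] := chi2_lo slo oout (nn1 n) (le_trans (ltW xr) rn).
      have -> : chi1 sigma (nn n) (enorm x) * (1 + -1 * 0) * q (enorm x) - q (enorm x) = (chi1 sigma (nn n) (enorm x) - 1) * q (enorm x) by ring.
      have k : 0 <= 1 - chi1 sigma (nn n) (enorm x).
        by have /andP[_] := s01 (nn n * enorm x + (- nn n - 1)); rewrite /chi1; lra.
      by rewrite normrM distrC (ger0_norm k).
    apply: ge0_subset_integral => //.
    - by apply: measurableI => //; exact: measurable_eball.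
    - apply/measurable_EFinP; apply: continuous_measurable3; first exact: exterior_open.
      move=> x x1; apply: (@continuous_comp _ _ _ (@enorm R) f); first exact: continuous_enorm.
      exact: fc.
    - by move=> x _; rewrite lee_fin.
  have -> : kappa * (K * 13) * harmonic n = kappa * (K * 13 / nn n) by rewrite /harmonic -(mulrA kappa).
  apply: (tail_integral (nn1 n) K0) => //.
  + move=> r r1 _; have r0 : 0 < r by lra.
    have [h|h] := leP (1 + 2 / nn n) r.
      have [e _] := chi1_hi shi oout (nn1 n) h.
      by rewrite /f e subrr !mul0r divr_ge0 ?sqr_ge0.
    have r3 := cutoff_le3 (nn1 n) h.
    have : f r <= M / r.
      apply: le_trans (qb _ (ltW r1)); rewrite /f; apply: ler_piMl => //.
      by have /andP[] := s01 (nn n * r + (- nn n - 1)); rewrite /chi1; lra.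
    move=> hf; apply: (@le_trans _ _ (M / r * r ^+ 2)).
      by rewrite ler_pM2r ?exprn_gt0.
    have -> : M / r * r ^+ 2 = M * r by field; rewrite gt_eqF.
    rewrite ler_pdivlMr ?exprn_gt0// /K.
    have -> : M * r * r ^+ 2 = M * r ^+ 3 by ring.
    rewrite [leRHS]mulrC; apply: ler_wpM2l => //.
    have : r ^+ 3 <= 3 ^+ 3 by apply: lerXn2r => //; rewrite nnegrE ltW.
    by lra.
  + move=> r r1 r2; have [e _] := chi1_hi shi oout (nn1 n) r1.
    by rewrite /f e subrr mul0r.
Unshelve. all: by end_near. Qed.

Lemma profile_stationary (m : nat) (q dq : R -> R) (M : R) : profile m q dq M ->
  stationary m (radial_fun q : E3 -> R).
Proof.
move=> qp; split; [exact: profile_dotH10 qp | exact: profile_radial qp | exact: profile_poisson qp].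
Qed.

Lemma profile_smooth_cl (m : nat) (q dq : R -> R) (M : R) : profile m q dq M ->
  smooth_cl_exterior (radial_fun q : E3 -> R).
Proof.
move=> qp; exists [set x | 0 < enorm x], (radial_fun q); split=> //.
- exact: enorm_gt0_open.
- by move=> x; rewrite /cl_exterior/=; lra.
- by apply: smooth_radial_pos; exact: profile_smooth qp.
Qed.

Lemma cvg0_inv (f : R -> R) (C : R) : (forall r, 1 <= r -> `|f r| <= C / r) ->
  f r @[r --> +oo] --> (0 : R).
Proof.
move=> fC; apply/cvgr0Pnorm_le => e e0; near=> r.
have r1 : 1 <= r by near: r; apply: nbhs_pinfty_ge; exact: num_real.
have rC : C / e <= r by near: r; apply: nbhs_pinfty_ge; exact: num_real.
have r0 : 0 < r by lra.
apply: le_trans (fC r r1) _.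
by rewrite ler_pdivrMr// mulrC -ler_pdivrMr.
Unshelve. all: by end_near. Qed.

(* Virial and Pohozaev identities: both densities have explicit primitives. *)
Lemma profile_energy (m : nat) (q dq : R -> R) (M : R) : (2 < m)%N -> profile m q dq M ->
  energy m (radial_fun q : E3 -> R) (cst 0) = (kappa * (m%:R / (2 * (m%:R - 2)) * dq 1 ^+ 2))%:E.
Proof.
move=> hm qp; have [M0 qc dqc _] := profile_facts qp.
have qb r : 1 <= r -> `|q r| <= M / r by move=> /(profile_bound qp)[].
have dqb r : 1 <= r -> `|dq r| <= M / r ^+ 2 by move=> /(profile_bound qp)[].
have m2 : 2 < m%:R :> R by rewrite ltr_nat.
pose A1 r := r ^+ 2 * (q r * dq r).
pose A2 r := r ^+ 3 * (2^-1 * dq r ^+ 2 + (2 * m%:R + 2)^-1 * q r ^+ (2 * m).+2).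
have dA1 r : 1 <= r -> is_derive r 1 A1 (r ^+ 2 * dq r ^+ 2 - r ^+ 2 * q r ^+ (2 * m).+2).
  move=> r1; have r0 : 0 < r by lra.
  have h1 := profile_d qp r0; have h2 := profile_dd qp r0.
  apply: (deq (dM (dX 2 (did r)) (dM h1 h2))).
  by rewrite /= [q r ^+ (2 * m).+2]exprS; field; rewrite gt_eqF.
have dA2 r : 1 <= r -> is_derive r 1 A2 (- (2^-1 * (r ^+ 2 * dq r ^+ 2)) + 3 / (2 * m%:R + 2) * (r ^+ 2 * q r ^+ (2 * m).+2)).
  move=> r1; have r0 : 0 < r by lra.
  have h1 := profile_d qp r0; have h2 := profile_dd qp r0.
  apply: (deq (dM (dX 3 (did r)) (dD (dM (dcst r 2^-1) (dX 2 h2)) (dM (dcst r (2 * m%:R + 2)^-1) (dX (2 * m).+2 h1))))).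
  have -> : (2 * m).+2%:R = 2 * m%:R + 2 :> R by rewrite -addn2 natrD natrM.
  rewrite /= [q r ^+ (2 * m).+2]exprS; move: (q r ^+ (2 * m).+1) => Q.
  by field; apply/andP; split; rewrite gt_eqF//; lra.
have lA1 : A1 r @[r --> +oo] --> (0 : R).
  apply: (@cvg0_inv _ (M * M)) => r r1; have r0 : 0 < r by lra.
  rewrite /A1 normrM (normrM (q r)) ger0_norm ?sqr_ge0//.
  apply: (@le_trans _ _ (r ^+ 2 * (M / r * (M / r ^+ 2)))).
    by rewrite ler_pM2l ?exprn_gt0//; apply: ler_pM => //; [exact: qb|exact: dqb].
  by rewrite le_eqVlt; apply/orP; left; apply/eqP; field; rewrite gt_eqF.
have lA2 : A2 r @[r --> +oo] --> (0 : R).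
  apply: (@cvg0_inv _ (M ^+ 2 + M ^+ (2 * m).+2)) => r r1; have r0 : 0 < r by lra.
  have e1 : dq r ^+ 2 <= M ^+ 2 / r ^+ 4.
    have -> : M ^+ 2 / r ^+ 4 = (M / r ^+ 2) ^+ 2 by field; rewrite gt_eqF.
    by rewrite -[leLHS]real_normK ?num_real// ler_sqr ?nnegrE// ?dqb// (le_trans _ (dqb r r1)).
  have e2 : q r ^+ (2 * m).+2 <= M ^+ (2 * m).+2 / r ^+ 4.
    apply: le_trans (ler_norm _) _; rewrite normrX.
    apply: (@le_trans _ _ ((M / r) ^+ (2 * m).+2)).
      by apply: lerXn2r (qb r r1); rewrite nnegrE// divr_ge0// ltW.
    rewrite expr_div_n; apply: ler_wpM2l; first exact: exprn_ge0.
    by rewrite lef_pV2 ?posrE ?exprn_gt0//; apply: ler_weXn2l => //; lia.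
  have e3 : 0 <= q r ^+ (2 * m).+2.
    by have -> : ((2 * m).+2 = 2 * m.+1)%N by [lia]; rewrite exprM exprn_ge0// sqr_ge0.
  have i0 : 0 < (2 * m%:R + 2)^-1 :> R by rewrite invr_gt0; lra.
  have i1 : (2 * m%:R + 2)^-1 <= 1 :> R by rewrite invf_le1; lra.
  rewrite /A2 normrM ger0_norm ?exprn_ge0 ?(ltW r0)// ger0_norm; last first.
    by rewrite addr_ge0// mulr_ge0// ?sqr_ge0// ltW.
  have -> : (M ^+ 2 + M ^+ (2 * m).+2) / r = r ^+ 3 * (M ^+ 2 / r ^+ 4 + M ^+ (2 * m).+2 / r ^+ 4).
    by field; rewrite gt_eqF.
  rewrite ler_pM2l ?exprn_gt0//; apply: lerD.
    by have := sqr_ge0 (dq r); lra.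
  by apply: le_trans e2; rewrite ler_piMl.
(* The derivative of [A2 + A1 / 2] is [- (m-2) / (2m+2) r^2 q^(2m+2)]: the gradient terms cancel,
   and [m > 2] allows solving for the potential part. *)
pose c : R := (2 * m%:R + 2) / (m%:R - 2).
pose HV r := - kappa * c * (A2 r + 2^-1 * A1 r).
pose HT r := HV r + kappa * A1 r.
have dHV r : 1 <= r -> is_derive r 1 HV (kappa * (q r ^+ (2 * m).+2 * r ^+ 2)).
  move=> r1; have h1 := dA1 r r1; have h2 := dA2 r r1.
  apply: (deq (dM (dcst r (- kappa * c)) (dD h2 (dM (dcst r 2^-1) h1)))).
  by rewrite /c; field; apply/andP; split; rewrite gt_eqF//; lra.
have dHT r : 1 <= r -> is_derive r 1 HT (kappa * (dq r ^+ 2 * r ^+ 2)).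
  move=> r1; have h1 := dA1 r r1; have h2 := dHV r r1.
  by apply: (deq (dD h2 (dM (dcst r kappa) h1))); ring.
have lHV : HV r @[r --> +oo] --> (0 : R).
  rewrite -[X in _ --> X](mulr0 (- kappa * c : R)); apply: cvgM; first exact: cvg_cst.
  rewrite -[X in _ --> X](addr0 (0 : R)) -[X in _ --> (_ + X)](mulr0 (2^-1 : R)).
  by apply: cvgD => //; apply: cvgM => //; exact: cvg_cst.
have lHT : HT r @[r --> +oo] --> (0 : R).
  rewrite -[X in _ --> X](addr0 (0 : R)) -[X in _ --> (_ + X)](mulr0 (kappa : R)).
  by apply: cvgD => //; apply: cvgM => //; exact: cvg_cst.
have k0 := @kappa_gt0 R.
have r2c r : {for r, continuous (fun r : R => r ^+ 2)} by exact: exprn_continuous.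
have pc (g : R -> R) k r : {for r, continuous g} -> {for r, continuous (fun r => g r ^+ k)}.
  by move=> gc; apply: (@continuous_comp _ _ _ g (fun y => y ^+ k)) => //; exact: exprn_continuous.
have ev (y : R) : 0 <= y ^+ (2 * m).+2.
  by have -> : ((2 * m).+2 = 2 * m.+1)%N by [lia]; rewrite exprM exprn_ge0// sqr_ge0.
have kc (g : R -> R) r : {for r, continuous g} -> {for r, continuous (fun r => kappa * (g r * r ^+ 2))}.
  by move=> gc; apply: cvgM; [exact: cvg_cst | apply: cvgM => //; exact: r2c].
have ET : (\int[leb3]_(x in exterior) (grad_sq (radial_fun q : E3 -> R) x)%:E = (- HT 1)%:E)%E.
  transitivity (\int[leb3]_(x in exterior) (dq (enorm (x : E3)) ^+ 2)%:E)%E.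
    apply: eq_integral => x; rewrite inE /exterior/= => x1; congr (_%:E).
    by apply: grad_sq_radial; [lra | apply: (profile_d qp); lra].
  rewrite (@ge0_polar_continuous R (fun r => dq r ^+ 2)).
  - rewrite (ge0_integral_y dHT _ _ lHT) ?sub0r//.
      by move=> r r1; apply: kc; apply: pc; apply: dqc; lra.
    by move=> r _; rewrite mulr_ge0 ?(ltW k0)// mulr_ge0 ?sqr_ge0.
  - by move=> r r1; apply: pc; apply: dqc; lra.
  - by move=> r _; exact: sqr_ge0.
have EV : (\int[leb3]_(x in exterior) (`|radial_fun q (x : E3)| ^+ (2 * m.+1))%:E = (- HV 1)%:E)%E.
  transitivity (\int[leb3]_(x in exterior) (q (enorm (x : E3)) ^+ (2 * m).+2)%:E)%E.
    apply: eq_integral => x _; congr (_%:E); rewrite -normrX ger0_norm; last first.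
      by rewrite exprM exprn_ge0// sqr_ge0.
    by congr (_ ^+ _); lia.
  rewrite (@ge0_polar_continuous R (fun r => q r ^+ (2 * m).+2)).
  - rewrite (ge0_integral_y dHV _ _ lHV) ?sub0r//.
      by move=> r r1; apply: kc; apply: pc; apply: qc; lra.
    by move=> r _; rewrite mulr_ge0 ?(ltW k0)// mulr_ge0 ?sqr_ge0.
  - by move=> r r1; apply: pc; apply: qc; lra.
  - by move=> r _; exact: ev.
have E0 : (\int[leb3]_(x in exterior) ((cst 0 : E3 -> R) x ^+ 2)%:E = 0)%E.
  by apply: integral0_eq => x _ /=; rewrite expr0n.
rewrite /energy ET EV E0 mule0 adde0 -!EFinM -EFinB; congr (_%:E).
have q10 := profile_1 qp.
have A11 : A1 1 = 0 by rewrite /A1 q10 mul0r mulr0.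
have A21 : A2 1 = 2^-1 * dq 1 ^+ 2 by rewrite /A2 q10 expr0n/= mulr0 addr0 expr1n mul1r.
rewrite /HT /HV A11 A21 /c.
have -> : (2 * m.+1)%:R = 2 * m%:R + 2 :> R by rewrite mulnS natrD natrM addrC.
by field; apply/andP; split; rewrite gt_eqF//; lra.
Qed.

End profile_space.

(** * Stationary solutions as radial weak solutions *)

Section duality.
Context {R : realType}.
Local Notation mu := (@lebesgue_measure R).
Local Notation E3 := (E3 R).
Local Notation ext := (exterior : set E3).
Implicit Types (i : 'I_3) (r : R).

Let mE : measurable ext := @measurable_exterior R.

Lemma test_grad_sq_measurable (phi : E3 -> R) : test_function phi ->
  measurable_fun ext (fun x => (grad_sq phi x)%:E).
Proof.
move=> tp; apply/measurable_EFinP; apply: measurable_funTS.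
apply: measurable_sum => i; apply: measurable_funX; apply: test_measurable; exact: test_pderiv.
Qed.

Lemma grad_sq_ge0 (phi : E3 -> R) x : 0 <= grad_sq phi x.
Proof. by apply: sumr_ge0 => i _; exact: sqr_ge0. Qed.

Lemma test_grad_sq_fin (phi : E3 -> R) : test_function phi ->
  (\int[leb3]_(x in ext) (grad_sq phi x)%:E < +oo)%E.
Proof.
move=> tp.
have ti i : test_function (fun x => pderiv i phi x * pderiv i phi x).
  apply: test_smooth_mul; first exact: test_pderiv.
  by apply: smooth_on_sub (test_pderiv i tp).1.
have h : leb3.-integrable ext (fun x => (grad_sq phi x)%:E).
  have -> : (fun x => (grad_sq phi x)%:E) = (fun x => \sum_(i < 3) (pderiv i phi x * pderiv i phi x)%:E)%E.
    by apply/funext => x; rewrite /grad_sq sumEFin.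
  by apply: integrable_sum => // i _; exact: test_integrable mE (ti i).
have /integrableP[_] := h; apply: le_lt_trans.
by apply: ge0_le_integral => //; [move=> x _; rewrite lee_fin grad_sq_ge0
  | exact: test_grad_sq_measurable | apply: measurableT_comp => //; exact: test_grad_sq_measurable
  | move=> x _; rewrite gee0_abs// lee_fin grad_sq_ge0].
Qed.

(** [|a|^2 <= 2 |a - b|^2 + 2 |b|^2] with [b] the gradient of one late term of the sequence. *)
Lemma cauchy_bound (phi : nat -> E3 -> R) : (forall n, test_function (phi n)) ->
  (forall e : R, 0 < e -> exists N : nat, forall n p : nat, (N <= n)%N -> (N <= p)%N ->
     (\int[leb3]_(x in ext) (grad_sq (fun y => phi n y - phi p y) x)%:E < e%:E)%E) ->
  exists M N, 0 <= M /\ forall n, (N <= n)%N -> (\int[leb3]_(x in ext) (grad_sq (phi n) x)%:E <= M%:E)%E.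
Proof.
move=> tp /(_ 1 ltr01)[N hN].
have fN := test_grad_sq_fin (tp N).
have i0 (f : E3 -> R) : (0 <= \int[leb3]_(x in ext) (grad_sq f x)%:E)%E.
  by apply: integral_ge0 => x _; rewrite lee_fin grad_sq_ge0.
pose S := fine (\int[leb3]_(x in ext) (grad_sq (phi N) x)%:E)%E.
have SE : (\int[leb3]_(x in ext) (grad_sq (phi N) x)%:E)%E = S%:E by rewrite fineK// ge0_fin_numE.
have S0 : 0 <= S by rewrite fine_ge0.
exists (2 * 1 + 2 * S), N; split; first lra.
move=> n Nn.
have td := test_sub (tp n) (tp N).
have m1 := test_grad_sq_measurable td; have m2 := test_grad_sq_measurable (tp N).
apply: (@le_trans _ _ (\int[leb3]_(x in ext) (2%:E * (grad_sq (fun y => (phi n y - phi N y)%R) x)%:E + 2%:E * (grad_sq (phi N) x)%:E))%E).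
  apply: ge0_le_integral => //.
  - by move=> x _; rewrite lee_fin grad_sq_ge0.
  - exact: test_grad_sq_measurable.
  - by apply: emeasurable_funD; exact: measurable_funeM.
  move=> x _; rewrite -!EFinM -EFinD lee_fin /grad_sq !mulr_sumr -big_split /=.
  apply: ler_sum => i _.
  have -> : pderiv i (fun y => phi n y - phi N y) x = pderiv i (phi n) x - pderiv i (phi N) x.
    apply: pderiv_is_derive.
    have k1 := test_is_derive i x (tp n); have k2 := test_is_derive i x (tp N).
    exact: is_deriveB k1 k2.
  by have := sqr_ge0 (pderiv i (phi n) x - 2 * pderiv i (phi N) x); nra.
rewrite ge0_integralD//; last first.
- exact: measurable_funeM.
- by move=> x _; rewrite mule_ge0// lee_fin grad_sq_ge0.
- exact: measurable_funeM.
- by move=> x _; rewrite mule_ge0// lee_fin grad_sq_ge0.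
rewrite !ge0_integralZl//; last first.
- by move=> x _; rewrite lee_fin grad_sq_ge0.
- by move=> x _; rewrite lee_fin grad_sq_ge0.
have -> : (2 * 1 + 2 * S)%:E = (2%:E * 1%:E + 2%:E * S%:E)%E by rewrite -!EFinM -EFinD.
rewrite SE; apply: leeD => //.
by apply: lee_wpmul2l => //; apply: ltW; exact: hN.
Qed.

Section field.
Variables (G g : R -> R) (b c : R).
Hypotheses (b1 : 1 < b) (dG : forall r, is_derive r 1 G (g r)) (sg : smooth1 setT g).
Hypothesis g0 : forall r, r <= b \/ c <= r -> g r = 0.

(** The field is [V = G(|x|) x / |x|^3]. As [x / |x|^3] is divergence free away from the origin,
    [div V = g(|x|) / |x|^2], while [|V|^2 = G^2 / |x|^4]. *)
Let k r := G r * (r^-1 * (r^-1 * r^-1)).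
Let V i (x : E3) : R := coord i x * radial_fun k x.

Let sinv : smooth1 [set r : R | 0 < r] (fun r => r^-1) := @smooth1_inv R.

Let sG : smooth1 [set r | 0 < r] G.
Proof. by apply: smooth1_sub (smooth1_prim (fun r _ => dG r) sg). Qed.

Let sV i : smooth_on ext (V i).
Proof.
apply: smooth_on_mul; [exact: exterior_open|apply: smooth_on_coord; exact: exterior_open|].
apply: smooth_on_sub (smooth_radial_pos _); first by move=> x; rewrite /exterior/=; lra.
by apply: smooth1_mul => //; do 2 ? [apply: smooth1_mul => //].
Qed.

Let cG r : {for r, continuous G}. Proof. exact: dcont (dG r). Qed.

Let cGn n r : 1 < r -> {for r, continuous (fun r => G r ^+ 2 / r ^+ n)}.
Proof.
move=> r1; apply: cvgM.
  by apply: (@continuous_comp _ _ _ G (fun y => y ^+ 2)); [exact: cG | exact: exprn_continuous].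
by apply: cvgV; [rewrite gt_eqF// exprn_gt0//; lra | exact: exprn_continuous].
Qed.
Let cG2 := @cGn 2.
Let cG4 := @cGn 4.

Let divV (x : E3) : ext x -> \sum_(i < 3) pderiv i (V i) x = g (enorm x) / enorm x ^+ 2.
Proof.
rewrite /exterior/= => x1; have x0 : 0 < enorm x by lra.
have xn : enorm x != 0 by rewrite gt_eqF.
have dk : is_derive (enorm x) 1 k (g (enorm x) * (enorm x)^-1 ^+ 3 - 3 * G (enorm x) * (enorm x)^-1 ^+ 4).
  have h := dVid xn; have h2 := dG (enorm x).
  by apply: (deq (dM h2 (dM h (dM h h)))); ring.
have E i : pderiv i (V i) x = k (enorm x) +
    (g (enorm x) * (enorm x)^-1 ^+ 3 - 3 * G (enorm x) * (enorm x)^-1 ^+ 4) * enorm x * (1 * (coord i x * (enorm x)^-1)) ^+ 2.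
  apply: pderiv_is_derive.
  have k1 := is_derive3M (is_derive3_coord i i x) (is_derive3_radial i x0 dk).
  apply: is_derive_eq k1 _; rewrite eqxx mulr1n /radial_fun.
  by move: xn; move: (enorm x) (coord i x) => r z rn; field.
under eq_bigr do rewrite E.
rewrite big_split /= -[X in _ + X]mulr_sumr (sum_coord_sq 1 x0) sumr_const card_ord /k.
by move: xn; move: (enorm x) => r rn; rewrite -mulr_natl; field.
Qed.

Let sumV2 (x : E3) : ext x -> \sum_(i < 3) V i x ^+ 2 = G (enorm x) ^+ 2 / enorm x ^+ 4.
Proof.
rewrite /exterior/= => x1; have x0 : 0 < enorm x by lra.
have -> : G (enorm x) ^+ 2 / enorm x ^+ 4 = (G (enorm x) / enorm x ^+ 2) ^+ 2.
  by field; rewrite gt_eqF.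
rewrite -(sum_coord_sq _ x0); apply: eq_bigr => i _; congr (_ ^+ 2).
by rewrite /V /radial_fun /k; field; rewrite gt_eqF.
Qed.

(** Integration by parts against [V], then [|V . grad phi| <= tau |grad phi|^2 + |V|^2 / tau]. The
    free parameter [tau] stands in for the Cauchy-Schwarz inequality and is chosen where the
    estimate is used. [V] need not have compact support, since [phi] has. *)
Lemma test_dual (phi : E3 -> R) (M D tau : R) : test_function phi ->
  (\int[leb3]_(x in ext) (grad_sq phi x)%:E <= M%:E)%E ->
  (\int[mu]_(r in `]1%R, +oo[) (G r ^+ 2 / r ^+ 2)%:E <= D%:E)%E -> 0 < tau ->
  (`|\int[leb3]_(x in ext) (phi x * (g (enorm x) / enorm x ^+ 2))%:E| <= (tau * M + kappa * D / tau)%:E)%E.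
Proof.
move=> tp hM hD tau0.
pose w i x := V i x * phi x.
have tw i : test_function (w i) by apply: test_smooth_mul.
pose T (x : E3) : R := \sum_(i < 3) V i x * pderiv i phi x.
have sdiv : smooth_on ext (fun x => \sum_(i < 3) pderiv i (V i) x).
  by apply: smooth_on_sum => [|i]; [exact: exterior_open | exact: smooth_on_pderiv].
have t1 : test_function (fun x => (\sum_(i < 3) pderiv i (V i) x) * phi x) by exact: test_smooth_mul.
have iT : leb3.-integrable ext (EFin \o T).
  have -> : EFin \o T = (fun x => \sum_(i < 3) (V i x * pderiv i phi x)%:E)%E.
    by apply/funext => x /=; rewrite sumEFin.
  apply: integrable_sum => // i _; apply: (test_integrable mE (phi := fun x => V i x * pderiv i phi x)).
  by apply: test_smooth_mul => //; exact: test_pderiv.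
have wE (x : E3) : ext x -> \sum_(i < 3) pderiv i (w i) x = (\sum_(i < 3) pderiv i (V i) x) * phi x + T x.
  move=> x1; rewrite mulr_suml -big_split; apply: eq_bigr => i _; apply: pderiv_is_derive.
  exact: is_derive3M (smooth_on_is_derive i (sV i) x1) (test_is_derive i x tp).
have E : (\int[leb3]_(x in ext) (phi x * (g (enorm x) / enorm x ^+ 2))%:E = - \int[leb3]_(x in ext) (T x)%:E)%E.
  have h := test_integral_div tw.
  have i1 := test_integrable mE t1.
  pose T1 (x : E3) : R := (\sum_(i < 3) pderiv i (V i) x) * phi x.
  have {}h : (\int[leb3]_(x in ext) ((EFin \o T1) x + (EFin \o T) x) = 0)%E.
    by rewrite -[RHS]h; apply: eq_integral => x; rewrite inE => /wE ->.
  rewrite integralD// in h.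
  have f1 := integrable_fin_num mE i1; have f2 := integrable_fin_num mE iT.
  transitivity (\int[leb3]_(x in ext) (EFin \o T1) x)%E.
    by apply: eq_integral => x; rewrite inE => x1; rewrite /T1 /= divV// mulrC.
  move: f1 f2 h; rewrite -/T1; move: (integral _ _ (EFin \o T1)) (integral _ _ (EFin \o T)) => [x| |] [y| |]//= _ _.
  by rewrite -EFinD => -[] h; congr (_%:E); lra.
rewrite E abseN; apply: le_trans (le_abse_integral _ mE _) _; first by case/integrableP: iT.
have mg := test_grad_sq_measurable tp.
have cF (x : E3) : ext x -> {for x, continuous (fun x : E3 => G (enorm x) ^+ 2 / enorm x ^+ 4)}.
  rewrite /exterior/= => x1; apply: (@continuous_comp _ _ _ (@enorm R) (fun r => G r ^+ 2 / r ^+ 4)).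
    exact: continuous_enorm.
  exact: cG4.
have mF : measurable_fun ext (fun x : E3 => (G (enorm x) ^+ 2 / enorm x ^+ 4)%:E).
  by apply/measurable_EFinP; apply: continuous_measurable3 => //; exact: exterior_open.
have F0 (x : E3) : (0 <= (G (enorm x) ^+ 2 / enorm x ^+ 4)%:E)%E.
  by rewrite lee_fin divr_ge0// ?sqr_ge0// exprn_ge0// enorm_ge0.
apply: (@le_trans _ _ (\int[leb3]_(x in ext) (tau%:E * (grad_sq phi x)%:E + tau^-1%:E * (G (enorm x) ^+ 2 / enorm x ^+ 4)%:E))%E).
  apply: ge0_le_integral => //.
  - by apply: measurableT_comp => //; case/integrableP: iT.
  - by apply: emeasurable_funD; exact: measurable_funeM.
  move=> x x1; rewrite -!EFinM -EFinD lee_fin -sumV2// /grad_sq /T !mulr_sumr -big_split /=.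
  apply: le_trans (ler_norm_sum _ _ _) _; apply: ler_sum => i _.
  move: (V i x) (pderiv i phi x) => p d.
  have ti : 0 < tau^-1 by rewrite invr_gt0.
  have e1 : tau * tau^-1 = 1 by rewrite mulfV// gt_eqF.
  have h1 : 0 <= tau * (d - tau^-1 * p) ^+ 2 by rewrite mulr_ge0 ?sqr_ge0// ltW.
  have h2 : 0 <= tau * (d + tau^-1 * p) ^+ 2 by rewrite mulr_ge0 ?sqr_ge0// ltW.
  have e2 : tau * (d - tau^-1 * p) ^+ 2 = tau * d ^+ 2 - 2 * (tau * tau^-1) * (p * d) + (tau * tau^-1) * (tau^-1 * p ^+ 2) by ring.
  have e3 : tau * (d + tau^-1 * p) ^+ 2 = tau * d ^+ 2 + 2 * (tau * tau^-1) * (p * d) + (tau * tau^-1) * (tau^-1 * p ^+ 2) by ring.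
  have n1 : 0 <= tau * d ^+ 2 + tau^-1 * p ^+ 2 by rewrite addr_ge0// mulr_ge0 ?sqr_ge0// ltW.
  rewrite e2 e1 in h1; rewrite e3 e1 in h2.
  by rewrite ler_norml; apply/andP; split; lra.
have ti : 0 < tau^-1 by rewrite invr_gt0.
rewrite ge0_integralD//; last first.
- exact: measurable_funeM.
- by move=> x _; rewrite mule_ge0// lee_fin ltW.
- exact: measurable_funeM.
- by move=> x _; rewrite mule_ge0// lee_fin ?grad_sq_ge0// ltW.
rewrite !ge0_integralZl ?lee_fin ?(ltW tau0) ?(ltW ti)//; last first.
- by move=> x _; rewrite lee_fin grad_sq_ge0.
rewrite EFinD (EFinM tau M); apply: leeD.
  by apply: lee_wpmul2l => //; rewrite lee_fin ltW.
rewrite mulrC EFinM; apply: lee_wpmul2l; first by rewrite lee_fin ltW.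
rewrite EFinM (@ge0_polar_continuous R (fun r => G r ^+ 2 / r ^+ 4)); last 2 first.
- by move=> r r1; exact: cG4.
- by move=> r r1; rewrite divr_ge0 ?sqr_ge0// exprn_ge0//; lra.
apply: (@le_trans _ _ (kappa%:E * \int[mu]_(r in `]1%R, +oo[) (G r ^+ 2 / r ^+ 2)%:E)%E).
  rewrite -ge0_integralZl//; last first.
  - by rewrite lee_fin ltW// kappa_gt0.
  - by move=> r _; rewrite lee_fin divr_ge0 ?sqr_ge0.
  - apply/measurable_EFinP; apply: open_continuous_measurable_fun; first exact: interval_open.
    by move=> r; rewrite inE/= in_itv/= andbT; exact: cG2.
  rewrite le_eqVlt; apply/orP; left; apply/eqP; apply: eq_integral => r; rewrite inE/= in_itv/= andbT => r1.
  by rewrite -EFinM; congr (_%:E); field; rewrite gt_eqF//; lra.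
by apply: lee_wpmul2l => //; rewrite lee_fin ltW// kappa_gt0.
Qed.

End field.

(** Closed shells are compact in the exterior domain; polar coordinates turn local integrability
    there into integrability on [[b, c]], the weight [r^2] being at least 1. *)
Lemma shell_integrable (u : E3 -> R) (q : R -> R) (b c : R) : measurable_fun ext u ->
  measurable_fun setT q -> ae_eq leb3 ext u (radial_fun q) -> loc_integrable u -> 1 < b ->
  mu.-integrable `[b, c]%classic (EFin \o q).
Proof.
move=> mu_ mq uq lu b1.
have mI : measurable (`[b, c]%classic : set (measurableTypeR R)) by exact: measurable_itv.
pose K : set E3 := [set x | b <= enorm x <= c].
have KE : K `<=` ext by move=> x /andP[bx _]; rewrite /exterior/=; lra.
have iu := lu K (@shell_compact R b c) KE.
have mK : measurable K.
  rewrite -[K]setCK; apply: measurableC; apply: open_measurable3; apply: compl_compact_open.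
  exact: shell_compact.
pose f : R -> R := q \_ `[b, c].
have mIR : measurable (`[b, c]%classic : set R) by exact: measurable_itv.
have mf : measurable_fun setT f := (measurable_restrictT q mIR).1 (measurable_funTS mq).
have fE (x : E3) : K x -> f (enorm x) = q (enorm x).
  by move=> Kx; rewrite /f patchE ifT// inE/= in_itv.
have f0 (x : E3) : ~ K x -> f (enorm x) = 0.
  by move=> Kx; rewrite /f patchE ifF//; apply/negbTE/negP; rewrite inE/= in_itv/=.
have me : measurable_fun ext (fun x : E3 => (f (enorm x))%:E).
  apply: measurable_funTS; apply/measurable_EFinP.
  by apply: (measurableT_comp mf); exact: measurable_enorm.
have iE : leb3.-integrable ext (fun x : E3 => (f (enorm x))%:E).
  apply/integrableP; split => //.
  have [_] := integrableP _ _ _ iu; apply: le_lt_trans.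
  have -> : (\int[leb3]_(x in K) `|(EFin \o u) x| = \int[leb3]_(x in ext) ((fun x => `|u x|%:E) \_ K) x)%E.
    rewrite -integral_mkcondr setIC; congr (integral _ _ _); apply/seteqP; split=> x //=.
      by move=> Kx; split => //; exact: KE.
    by case.
  rewrite le_eqVlt; apply/orP; left; apply/eqP; apply: ae_eq_integral => //.
  - exact: measurableT_comp.
  - have hU : measurable_fun K (fun x : E3 => `|u x|%:E).
      by apply/measurable_EFinP; apply: measurableT_comp => //; exact: measurable_funS mE KE mu_.
    exact: measurable_funTS ((measurable_restrictT _ mK).1 hU).
  apply: filterS uq => x h x1; have := h x1 => {}h.
  rewrite patchE; case: ifPn => [/set_mem Kx|/negP nK].
    by rewrite /= fE// h.
  have nx : ~ K x by move=> /mem_set.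
  by rewrite f0//= normr0.
have k0 := @kappa_gt0 R.
have /integrableP[mi _] := (polar_integrable mf).1 iE.
have i1 := (polar_integrable mf).1 iE.
have i2 : mu.-integrable `[b, c]%classic (fun r => (f r * (kappa * r ^+ 2))%:E).
  have mJ : measurable (`]1%R, +oo[%classic : set (measurableTypeR R)) by exact: measurable_itv.
  apply: (integrableS mJ mI _ i1).
  by move=> r /=; rewrite !in_itv/= andbT => /andP[br _]; lra.
have i3 := integrableZl mI kappa^-1 i2.
apply: le_integrable i3 => //.
  by apply/measurable_EFinP; exact: measurable_funTS.
move=> r /= rI; have := rI; rewrite in_itv/= => /andP[br rc].
rewrite lee_fin /= /f patchE ifT ?inE//=.
have -> : kappa^-1 * (q r * (kappa * r ^+ 2)) = q r * r ^+ 2 by field; rewrite gt_eqF.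
rewrite normrM ler_peMr// ger0_norm ?sqr_ge0// expr_ge1//; lra.
Qed.

Lemma kernel_integrable (q g : R -> R) (b c K : R) :
  1 < b -> (mu.-integrable `[b, c]%classic (EFin \o q)) -> measurable_fun setT q -> measurable_fun setT g ->
  (forall r, `|g r| <= K) -> (forall r, r < b \/ c < r -> g r = 0) ->
  mu.-integrable `]1%R, +oo[%classic (fun r => (q r * g r)%:E).
Proof.
move=> b1 iq mq mg gK g0.
have mI : measurable (`[b, c]%classic : set (measurableTypeR R)) by exact: measurable_itv.
have mJ : measurable (`]1%R, +oo[%classic : set (measurableTypeR R)) by exact: measurable_itv.
have i1 := (integrable_mkcond _ mI).1 (integrableZl mI K iq).
apply: le_integrable (integrableS measurableT mJ (@subsetT _ _) i1) => //.
  by apply/measurable_EFinP; apply: measurable_funTS; exact: measurable_funM.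
move=> r _; rewrite patchE; case: ifPn => [_|/negP].
  rewrite /= lee_fin !normrM mulrC; apply: ler_wpM2r => //.
  by apply: le_trans (gK r) _; exact: ler_norm.
rewrite inE/= in_itv/= => /negP; rewrite negb_and -!ltNge => h.
by rewrite g0 ?mulr0//; case/orP: h; [left|right].
Qed.

Lemma smooth_support_bound (g : R -> R) (b c : R) : (forall r, {for r, continuous g}) ->
  (forall r, r <= b \/ c <= r -> g r = 0) -> exists2 K, 0 <= K & forall r, `|g r| <= K.
Proof.
move=> gc g0.
have cK : compact (g @` `[b, c]).
  apply: continuous_compact; last exact: segment_compact.
  by apply: continuous_subspaceT => s; exact: gc.
have [K [_ h]] := compact_bounded cK; exists (`|K| + 1).
  by have := normr_ge0 K; lra.
move=> r; have [rb|rb] := leP r b.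
  by rewrite g0 ?normr0; [have := normr_ge0 K; lra | left].
have [rc|rc] := leP c r.
  by rewrite g0 ?normr0; [have := normr_ge0 K; lra | right].
apply: (h (`|K| + 1)); first by have := ler_norm K; lra.
by exists r => //=; rewrite in_itv/= !ltW.
Qed.

(** All that membership in the energy space gives about [q]. The primitive [G] is free up to a
    constant, because elements of the space vanish at the boundary; both normalizations serve
    below. *)
Lemma dotH10_dual (u : E3 -> R) (q : R -> R) : dotH10 u -> measurable_fun setT q ->
  ae_eq leb3 ext u (radial_fun q) -> loc_integrable u -> exists M : R, 0 <= M /\
  forall (G g : R -> R) (b c D tau : R), 1 < b -> (forall r, is_derive r 1 G (g r)) ->
    smooth1 setT g -> (forall r, r <= b \/ c <= r -> g r = 0) ->
    (\int[mu]_(r in `]1%R, +oo[) (G r ^+ 2 / r ^+ 2)%:E <= D%:E)%E -> 0 < tau ->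
    (`|\int[mu]_(r in `]1%R, +oo[) (q r * g r)%:E| <= (tau * M + D / tau)%:E)%E.
Proof.
move=> [mu_ [phi [tp cau lim]]] mq uq lu.
have [M [N [M0 hM]]] := cauchy_bound tp cau.
have k0 := @kappa_gt0 R.
(* [test_dual] bounds an integral over space; returning to the half-line divides it by [kappa],
   which also cancels the [kappa] in front of [D]. *)
exists (M / kappa); split; first by rewrite divr_ge0// ltW.
move=> G g b c D tau b1 dG sg g0 hD tau0.
pose F (x : E3) : R := g (enorm x) / enorm x ^+ 2.
have gc r : {for r, continuous g} by exact: (smooth1_continuous sg).
have [K K0 gK] := smooth_support_bound gc g0.
have FK (x : E3) : ext x -> `|F x| <= K.
  rewrite /exterior/= => x1; rewrite /F normrM normfV [`|_ ^+ 2|]ger0_norm ?sqr_ge0//.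
  have e1 : 1 <= enorm x ^+ 2 by rewrite expr_ge1//; lra.
  by rewrite ler_pdivrMr; [apply: le_trans (gK _) _; rewrite ler_peMr | lra].
have mF : measurable_fun ext F.
  apply: continuous_measurable3; first exact: exterior_open.
  move=> x; rewrite /exterior/= => x1; apply: (@continuous_comp _ _ _ (@enorm R) (fun r => g r / r ^+ 2)).
    exact: continuous_enorm.
  apply: cvgM; first exact: gc.
  by apply: cvgV; [rewrite gt_eqF// exprn_gt0//; lra | exact: exprn_continuous].
have F0 (x : E3) : ~ eball c x -> F x = 0.
  by rewrite /eball/= => /negP; rewrite -leNgt => h; rewrite /F g0 ?mul0r//; right.
pose A := ext `&` eball c.
have mA : measurable A by apply: measurableI => //; exact: measurable_eball.
have mphi n : measurable_fun A (phi n) by apply: measurable_funTS; exact: test_measurable.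
have muA : measurable_fun A u by apply: measurable_funS (mu_) => //; exact: subIsetl.
have mFA : measurable_fun A F by apply: measurable_funS (mF) => //; exact: subIsetl.
have restrict (f : E3 -> R) : (\int[leb3]_(x in ext) (f x * F x)%:E = \int[leb3]_(x in A) (f x * F x)%:E)%E.
  rewrite /A integral_mkcondr; apply: eq_integral => x _; rewrite patchE; case: ifPn => // /negP h.
  by rewrite F0 ?mulr0// => cx; apply: h; rewrite inE.
have K1 : 0 < K + 1 by lra.
have iphi n : leb3.-integrable A (EFin \o phi n) by exact: test_integrable.
have mulF (f : E3 -> R) : leb3.-integrable A (EFin \o f) -> leb3.-integrable A (fun x => (f x * F x)%:E).
  move=> fi; have /integrableP[mf _] := fi; move/measurable_EFinP: mf => mf.
  apply: le_integrable (integrableZl mA K fi) => //.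
    by apply/measurable_EFinP; exact: measurable_funM.
  move=> x [x1 _]; rewrite /= lee_fin normrM (normrM K) mulrC; apply: ler_wpM2r => //.
  by apply: le_trans (FK x x1) _; exact: ler_norm.
have close (e : R) : 0 < e -> exists n, (N <= n)%N /\ (\int[leb3]_(x in A) `|phi n x - u x|%:E < e%:E)%E.
  move=> e0; have /fine_cvgP[fn cv] := lim c.
  have ev : \forall n \near \oo, fine (\int[leb3]_(x in A) `|phi n x - u x|%:E)%E < e.
    by apply: (cvgr_lt 0 cv).
  near \oo => n; exists n; split; first by near: n; exact: nbhs_infty_ge.
  have h1 : fine (\int[leb3]_(x in A) `|phi n x - u x|%:E)%E < e by near: n.
  have h2 : (\int[leb3]_(x in A) `|phi n x - u x|%:E)%E \is a fin_num by near: n.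
  by rewrite -(fineK h2) lte_fin.
have idiff n e : (\int[leb3]_(x in A) `|phi n x - u x|%:E < e%:E)%E -> leb3.-integrable A (EFin \o (fun x => u x - phi n x)).
  move=> h; apply/integrableP; split.
    by apply/measurable_EFinP; exact: measurable_funB.
  apply: le_lt_trans (lt_trans h (ltry _)).
  rewrite le_eqVlt; apply/orP; left; apply/eqP; apply: eq_integral => x _.
  by rewrite /= distrC.
(* [F] is bounded by [K] and supported in the ball of radius [c], where some [phi n] is [L^1]-close
   to [u]: the error is at most [K e / (K + 1)]. *)
have key (e : R) : 0 < e -> (`|\int[leb3]_(x in ext) (u x * F x)%:E| <= (tau * M + kappa * D / tau)%:E + e%:E)%E.
  move=> e0; have e1 : 0 < e / (K + 1) by exact: divr_gt0.
  have [n [Nn hn]] := close _ e1.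
  have id := idiff _ _ hn.
  have iD := mulF _ id; have iP := mulF _ (iphi n).
  have -> : (\int[leb3]_(x in ext) (u x * F x)%:E = \int[leb3]_(x in A) (phi n x * F x)%:E + \int[leb3]_(x in A) ((u x - phi n x) * F x)%:E)%E.
    rewrite restrict -integralD//; apply: eq_integral => x _.
    by rewrite -EFinD; congr (_%:E); ring.
  apply: le_trans (lee_abs_add _ _) _; apply: leeD.
    rewrite -restrict.
    exact: (test_dual dG sg (tp n) (hM n Nn) hD tau0).
  apply: le_trans (le_abse_integral _ mA _) _; first by case/integrableP: iD.
  apply: (@le_trans _ _ (\int[leb3]_(x in A) (K%:E * `|phi n x - u x|%:E))%E).
    apply: ge0_le_integral => //.
    - by apply: measurableT_comp => //; case/integrableP: iD.
    - apply: measurable_funeM; apply/measurable_EFinP; apply: measurableT_comp => //.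
      exact: measurable_funB.
    move=> x [x1 _]; rewrite -EFinM lee_fin /= normrM mulrC distrC.
    by apply: ler_wpM2r => //; exact: FK.
  rewrite ge0_integralZl//; last first.
    by apply/measurable_EFinP; apply: measurableT_comp => //; exact: measurable_funB.
  apply: le_trans (lee_wpmul2l _ (ltW hn)) _; first by rewrite lee_fin.
  by rewrite -EFinM lee_fin mulrA ler_pdivrMr// mulrC ler_pM2l//; lra.
have {}key : (`|\int[leb3]_(x in ext) (u x * F x)%:E| <= (tau * M + kappa * D / tau)%:E)%E.
  by apply/lee_addgt0Pr => e /key.
have gb0 r : r < b \/ c < r -> g r = 0 by move=> [h|h]; apply: g0; [left|right]; exact: ltW.
have mg : measurable_fun setT g by apply: continuous_measurable_fun => r; exact: gc.
have iq := kernel_integrable b1 (shell_integrable c mu_ mq uq lu b1) mq mg gK gb0.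
have mJ : measurable (`]1%R, +oo[%classic : set (measurableTypeR R)) by exact: measurable_itv.
have fq := integrable_fin_num mJ iq.
pose f r := q r * (if 1 < r then g r / r ^+ 2 else 0).
have mf : measurable_fun setT f.
  apply: measurable_funM => //; apply: gt_measurable => r r1; apply: cvgM; first exact: gc.
  by apply: cvgV; [rewrite gt_eqF// exprn_gt0//; lra | exact: exprn_continuous].
have E : (\int[leb3]_(x in ext) (u x * F x)%:E = kappa%:E * \int[mu]_(r in `]1%R, +oo[) (q r * g r)%:E)%E.
  transitivity (\int[leb3]_(x in ext) (f (enorm x))%:E)%E.
    apply: ae_eq_integral => //.
    - by apply/measurable_EFinP; exact: measurable_funM.
    - apply/measurable_EFinP; apply: measurable_funTS.
      by apply: (measurableT_comp mf); exact: measurable_enorm.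
    apply: filterS uq => x h x1; have := h x1 => {}h; rewrite h /radial_fun /f /F ifT//.
  rewrite polar// -(integralZl mJ iq).
  apply: eq_integral => r; rewrite inE/= in_itv/= andbT => r1.
  by rewrite /f r1 -EFinM; congr (_%:E); field; rewrite gt_eqF//; lra.
rewrite E abseM in key; move: key fq; case: (integral _ _ _) => [z| |]// key _.
move: key; rewrite /= -EFinM !lee_fin (gtr0_norm k0) => key.
rewrite -(ler_pM2l k0); apply: le_trans key _.
by rewrite le_eqVlt; apply/orP; left; apply/eqP; field; apply/andP; split; rewrite gt_eqF.
Unshelve. all: by end_near. Qed.

End duality.

(** * Integrals on half-lines and approximate Dirac masses *)

Section line_integrals.
Context {R : realType}.
Local Notation mu := (@lebesgue_measure R).
Local Notation I1 := (`]1%R, +oo[%classic : set (measurableTypeR R)).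
Implicit Types (r : R) (f g h k : R -> R).

Lemma measurable_ray (a : R) : measurable (`]a, +oo[%classic : set (measurableTypeR R)).
Proof. exact: measurable_itv. Qed.

Lemma ray_measurable_continuous (a : R) f : (forall r, a < r -> {for r, continuous f}) ->
  measurable_fun (`]a, +oo[%classic : set (measurableTypeR R)) (fun r => (f r)%:E).
Proof.
move=> fc; apply/measurable_EFinP; apply: open_continuous_measurable_fun; first exact: interval_open.
by move=> r; rewrite inE/= in_itv/= andbT; exact: fc.
Qed.

Lemma ge0_integral_ray (h H : R -> R) (a l : R) : (forall r, a <= r -> is_derive r 1 H (h r)) ->
  (forall r, a <= r -> {for r, continuous h}) -> (forall r, a <= r -> 0 <= h r) ->
  H r @[r --> +oo] --> l -> (\int[mu]_(r in `]a, +oo[) (h r)%:E = (l - H a)%:E)%E.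
Proof.
move=> dH hc h0 Hl.
have hw : {within `[a, +oo[, continuous h}.
  by apply: continuous_in_subspaceT => r; rewrite inE/= in_itv/= andbT; exact: hc.
rewrite integral_itv_obnd_cbnd; last by apply: ray_measurable_continuous => r /ltW; exact: hc.
rewrite (@ge0_continuous_FTC2y _ h H a l)// ?EFinB//.
- by move=> r /ltW r1; have [] := dH _ r1.
- by apply: cvg_at_right_filter; exact: dcont (dH a (lexx _)).
- by move=> r; rewrite in_itv/= andbT => /ltW r1; have [_ d] := dH _ r1; rewrite derive1E.
Qed.

Lemma ge0_integrable_ray (h H : R -> R) (a l : R) : (forall r, a <= r -> is_derive r 1 H (h r)) ->
  (forall r, a <= r -> {for r, continuous h}) -> (forall r, a <= r -> 0 <= h r) ->
  H r @[r --> +oo] --> l -> mu.-integrable `]a, +oo[%classic (fun r => (h r)%:E).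
Proof.
move=> dH hc h0 Hl; apply/integrableP; split.
  by apply: ray_measurable_continuous => r /ltW; exact: hc.
apply: (@le_lt_trans _ _ (\int[mu]_(r in `]a, +oo[) (h r)%:E)%E).
  rewrite le_eqVlt; apply/orP; left; apply/eqP; apply: eq_integral => r.
  by rewrite inE/= in_itv/= andbT => /ltW /h0 h0r; rewrite ger0_norm.
by rewrite (ge0_integral_ray dH hc h0 Hl) ltry.
Qed.

(** The majorant [k] makes [g + k] and [k] nonnegative; the signed case is their difference. *)
Lemma integral_ray (g H k K : R -> R) (a l l2 : R) :
  (forall r, a <= r -> is_derive r 1 H (g r)) -> (forall r, a <= r -> {for r, continuous g}) ->
  (forall r, a <= r -> is_derive r 1 K (k r)) -> (forall r, a <= r -> {for r, continuous k}) ->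
  (forall r, a <= r -> `|g r| <= k r) -> H r @[r --> +oo] --> l -> K r @[r --> +oo] --> l2 ->
  mu.-integrable `]a, +oo[%classic (fun r => (g r)%:E) /\
  (\int[mu]_(r in `]a, +oo[) (g r)%:E = (l - H a)%:E)%E.
Proof.
move=> dH gc dK kc gk Hl Kl.
have k0 r : a <= r -> 0 <= k r by move=> /gk; exact: le_trans.
have dHK r : a <= r -> is_derive r 1 (fun r => H r + K r) (g r + k r).
  by move=> ar; have h1 := dH r ar; have h2 := dK r ar; exact: dD.
have gkc r : a <= r -> {for r, continuous (fun r => g r + k r)}.
  by move=> ar; apply: cvgD; [exact: gc | exact: kc].
have gk0 r : a <= r -> 0 <= g r + k r by move=> /gk; rewrite ler_norml => /andP[]; lra.
have HKl : H r + K r @[r --> +oo] --> l + l2 by exact: cvgD.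
have i1 := ge0_integrable_ray dHK gkc gk0 HKl; have i2 := ge0_integrable_ray dK kc k0 Kl.
have e1 := ge0_integral_ray dHK gkc gk0 HKl; have e2 := ge0_integral_ray dK kc k0 Kl.
have mI := measurable_ray a.
have i3 := integrableB mI i1 i2.
have E : (fun r => (g r)%:E) = (fun r => (g r + k r)%:E - (k r)%:E)%E.
  by apply/funext => r; rewrite -EFinB addrK.
rewrite E; split => //; rewrite integralB// e1 e2 -EFinB; congr (_%:E); ring.
Qed.

Lemma ae_mono (P P' : R -> Prop) : (forall x, P x -> P' x) ->
  {ae mu, forall x, P x} -> {ae mu, forall x, P' x}.
Proof.
move=> PP' [N [mN N0 PN]]; exists N; split => // x /= nx; apply: PN => /= Px.
by apply: nx; exact: PP'.
Qed.

Lemma ae_exists (P : R -> Prop) (a b : R) : a < b -> {ae mu, forall x, P x} ->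
  exists2 x, a < x < b & P x.
Proof.
move=> ab [N [mN N0 PN]]; apply: contrapT => H.
have : (mu `]a, b[%classic <= mu N)%E.
  apply: le_measure; rewrite ?inE//.
  move=> x /=; rewrite in_itv/= => xab; apply: PN => /= Px; apply: H; by exists x.
by rewrite N0 lebesgue_measure_itv/= lte_fin ab -EFinB lee_fin; lra.
Qed.

End line_integrals.

Section good_points.
Context {R : realType}.
Local Notation mu := (@lebesgue_measure R).
Local Notation I1 := (`]1%R, +oo[%classic : set (measurableTypeR R)).
Implicit Types (r a : R) (q : R -> R) (n : nat).
Variables (sigma omega : R -> R) (W : R).
Hypothesis W0 : 0 <= W.
Hypothesis so : smooth1 setT omega.
Hypothesis sd : forall r, is_derive r 1 sigma (omega r).
Hypothesis slo : forall r, r <= 0 -> sigma r = 0.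
Hypothesis shi : forall r, 1 <= r -> sigma r = 1.
Hypothesis s01 : forall r, 0 <= sigma r <= 1.
Hypothesis o0 : forall r, 0 <= omega r.
Hypothesis oW : forall r, omega r <= W.
Hypothesis oout : forall r, r <= 0 \/ 1 <= r -> omega r = 0.

Local Notation nn := (fun n : nat => n.+1%:R : R).
Let nn0 n : 0 < nn n. Proof. by []. Qed.

(** A smoothed Heaviside function at [a]; its derivative [kern] is an approximate Dirac mass carried
    by [[a, a + 1/(n+1)]], on the right of [a], which keeps its support inside the exterior domain
    for every [a > 1]. *)
Definition step n a r := sigma (nn n * r + - (nn n * a)).
Definition kern n a r := nn n * omega (nn n * r + - (nn n * a)).

Lemma is_derive_step n a r : is_derive r 1 (step n a) (kern n a r).
Proof.
have a1 : is_derive r 1 (fun r => nn n * r + - (nn n * a)) (nn n).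
  by apply: (deq (dD (dM (dcst r (nn n)) (did r)) (dcst r _))); ring.
by apply: (deq (dcomp (f := sigma) (g := fun r => nn n * r + - (nn n * a)) (sd _) a1)); rewrite /kern mulrC.
Qed.

Lemma smooth_kern n a : smooth1 setT (kern n a).
Proof.
by apply: smooth1_mul; [exact: smooth1_cst | apply: (smooth1_affine (I := setT))].
Qed.

Lemma continuous_kern n a r : {for r, continuous (kern n a)}.
Proof. exact: (smooth1_continuous (smooth_kern n a)). Qed.

Lemma step_lo n a r : r <= a -> step n a r = 0.
Proof.
by move=> ra; apply: slo; rewrite -mulrBr; apply: mulr_ge0_le0; [exact: ltW|lra].
Qed.

Lemma step_hi n a r : a + (nn n)^-1 <= r -> step n a r = 1.
Proof.
move=> ra; apply: shi; rewrite -mulrBr -ler_pdivrMl// mulr1.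
by move: ra => /=; move: (n.+1%:R^-1) => z; lra.
Qed.

Lemma kern_out n a r : r <= a \/ a + (nn n)^-1 <= r -> kern n a r = 0.
Proof.
move=> h; rewrite /kern oout ?mulr0// -mulrBr; case: h => ra; [left|right].
  by apply: mulr_ge0_le0; [exact: ltW|lra].
by rewrite -ler_pdivrMl// mulr1; move: ra => /=; move: (n.+1%:R^-1) => z; lra.
Qed.

Lemma kern_bound n a r : `|kern n a r| <= nn n * W.
Proof. by rewrite normrM ger0_norm// ler_pM2l// ger0_norm. Qed.

Lemma kern_ge0 n a r : 0 <= kern n a r. Proof. exact: mulr_ge0. Qed.

Lemma step_cvg n a : step n a r @[r --> +oo] --> (1 : R).
Proof.
apply/cvgrPdist_le => e e0; near=> r.
have h : a + (nn n)^-1 <= r by near: r; apply: nbhs_pinfty_ge; exact: num_real.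
by rewrite step_hi// subrr normr0 ltW.
Unshelve. all: by end_near. Qed.

Lemma integral_kern n a : 1 < a -> (\int[mu]_(r in I1) (kern n a r)%:E = 1)%E.
Proof.
move=> a1.
have D r : 1 <= r -> is_derive r 1 (step n a) (kern n a r) by move=> _; exact: is_derive_step.
rewrite (ge0_integral_ray D (l := 1)).
- by rewrite step_lo ?subr0// ltW.
- by move=> r _; exact: continuous_kern.
- by move=> r _; exact: kern_ge0.
- exact: step_cvg.
Qed.

(** The points at which testing against the kernels recovers the value of the chosen
    representative. *)
Definition good q a := fine (\int[mu]_(r in I1) (q r * kern n a r)%:E)%E @[n --> \oo] --> q a.

(** Lebesgue differentiation: at a Lebesgue point of a truncation of [q], the mollification error is
    controlled by the mean of [|q - q a|] over small balls. *)
Lemma ae_good q : measurable_fun setT q ->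
  (forall b c : R, 1 < b -> mu.-integrable `[b, c]%classic (EFin \o q)) ->
  {ae mu, forall a, 1 < a -> good q a}.
Proof.
move=> mq iq.
(* Truncation away from 1 and from infinity makes [q] integrable on the line; each [a > 1] has some
   [B j] containing [[a, a + 1]], hence the supports of all kernels at [a]. *)
pose B j : set (measurableTypeR R) := `[1 + (j.+1%:R)^-1, j.+1%:R]%classic.
have mB j : measurable (B j) by exact: measurable_itv.
pose Q j : R -> R := q \_ (B j).
have mQ j : measurable_fun setT (Q j).
  have mBR : measurable (`[1 + (j.+1%:R)^-1, j.+1%:R]%classic : set R) by exact: measurable_itv.
  exact: (measurable_restrictT q mBR).1 (measurable_funTS mq).
have b1 j : 1 < 1 + (j.+1%:R)^-1 :> R by rewrite ltrDl invr_gt0.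
have iQ j : mu.-integrable setT (EFin \o Q j).
  have := (integrable_mkcond _ (mB j)).1 (iq _ (j.+1%:R) (b1 j)).
  by congr (integrable _ _ _); apply/funext => r /=; rewrite /Q !patchE; case: ifP.
have lQ j : locally_integrable setT (Q j) by apply: open_integrable_locally => //; exact: openT.
have H : {ae mu, forall a j, lebesgue_pt (Q j) a}.
  by apply: ae_foralln => j; exact: lebesgue_differentiation (lQ j).
apply: ae_mono H => a La a1.
have [j [j1 j2]] : exists j : nat, 1 + (j.+1%:R)^-1 < a /\ a + 1 < j.+1%:R.
  pose j := Num.truncn (Num.max (a + 1) (a - 1)^-1); exists j.
  have h : Num.max (a + 1) (a - 1)^-1 < j.+1%:R by exact: truncnS_gt.
  move: h; rewrite gt_max => /andP[h1 h2]; split => //.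
  have p : 0 < a - 1 by lra.
  have : (j.+1%:R)^-1 < a - 1 by rewrite -[a - 1]invrK ltf_pV2 ?posrE ?invr_gt0.
  by move: (j.+1%:R^-1) => z; lra.
have {}La := La j.
have BP r : a <= r -> r <= a + 1 -> B j r.
  move=> ar ra; rewrite /B/= in_itv/=; apply/andP; split.
    by apply: le_trans ar; exact: ltW.
  by apply: le_trans ra _; exact: ltW.
have QE r : a <= r -> r <= a + 1 -> Q j r = q r.
  by move=> ar ra; rewrite /Q patchE ifT// inE; exact: BP.
have Qa : Q j a = q a by apply: QE => //; lra.
pose u n : R := (n.+1%:R)^-1.
have u0 n : 0 < u n by rewrite invr_gt0.
have u1 n : u n <= 1 by rewrite invf_le1// ler1n.
have cd : davg (Q j) a (u n) @[n --> \oo] --> 0%:E.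
  have /cvge_at_rightP := La; apply; split => //; exact: cvg_harmonic.
have mI := @measurable_ray R 1.
pose h n r := (Q j r - q a) * kern n a r.
have kE n r : ~ ball a (u n) r -> kern n a r = 0.
  move=> nb; apply: kern_out; apply: contrapT => /not_orP[/negP h1 /negP h2]; apply: nb.
  move: h1 h2; rewrite -!ltNge -/(u n) => h1 h2; rewrite /ball/= ltr_distlC; apply/andP; split; lra.
have ik n : mu.-integrable I1 (fun r => (kern n a r)%:E).
  apply/integrableP; split; first by apply: ray_measurable_continuous => r _; exact: continuous_kern.
  have -> : (\int[mu]_(r in I1) `|(kern n a r)%:E| = \int[mu]_(r in I1) (kern n a r)%:E)%E.
    by apply: eq_integral => r _; rewrite gee0_abs// lee_fin kern_ge0.
  by rewrite integral_kern// ltry.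
have mk n : measurable_fun setT (kern n a).
  by apply: continuous_measurable_fun => r; exact: continuous_kern.
have iQk n : mu.-integrable I1 (fun r => (Q j r * kern n a r)%:E).
  apply: le_integrable (integrableS measurableT mI (@subsetT _ _) (integrableZl measurableT (nn n * W) (iQ j))) => //.
    by apply/measurable_EFinP; apply: measurable_funTS; exact: measurable_funM (mQ j) (mk n).
  move=> r _; rewrite /= lee_fin normrM (normrM (nn n * W)) mulrC; apply: ler_wpM2r => //.
  by apply: le_trans (kern_bound n a r) _; exact: ler_norm.
have ih n : mu.-integrable I1 (fun r => (h n r)%:E).
  have := integrableB mI (iQk n) (integrableZl mI (q a) (ik n)).
  by congr (integrable _ _ _); apply/funext => r; rewrite -EFinM -EFinB /h mulrBl.
have E1 n : (\int[mu]_(r in I1) (q r * kern n a r)%:E = \int[mu]_(r in I1) (h n r)%:E + (q a)%:E)%E.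
  have -> : (q a)%:E = (\int[mu]_(r in I1) ((q a)%:E * (kern n a r)%:E))%E.
    by rewrite integralZl// integral_kern// mule1.
  rewrite -integralD//; last exact: integrableZl.
  apply: eq_integral => r _; rewrite -EFinM -EFinD /h; congr (_%:E).
  case: (pselect (kern n a r = 0)) => [->|k0]; first by ring.
  have [r1 r2] : a <= r /\ r <= a + 1.
    split; rewrite leNgt; apply/negP => h1; apply: k0; apply: kern_out; [left|right]; first exact: ltW.
    by have := u1 n; rewrite /u => h2; move: h2 h1; move: (n.+1%:R^-1) => z; lra.
  by rewrite QE//; ring.
have fh n := integrable_fin_num mI (ih n).
have E2 n : fine (\int[mu]_(r in I1) (q r * kern n a r)%:E)%E = fine (\int[mu]_(r in I1) (h n r)%:E)%E + q a.
  by rewrite E1 fineD.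
(* [kern <= (n+1) W], and the ball of radius [1/(n+1)] has measure [2/(n+1)]: hence the factor [2 W]
   before the mean. *)
have E3 n : (`|\int[mu]_(r in I1) (h n r)%:E| <= (2 * W)%:E * davg (Q j) a (u n))%E.
  have mb : measurable (ball a (u n) : set (measurableTypeR R)) by exact: measurable_ball.
  have mQa : measurable_fun setT (fun r => `|Q j r - q a|).
    by apply: measurableT_comp => //; apply: measurable_funB.
  have -> : ((2 * W)%:E * davg (Q j) a (u n) = \int[mu]_(r in ball a (u n)) ((nn n * W)%:E * `|Q j r - q a|%:E))%E.
    rewrite ge0_integralZl//; last 2 first.
    - by apply/measurable_EFinP; exact: measurable_funTS.
    - by rewrite lee_fin mulr_ge0// ltW.
    rewrite /davg /iavg lebesgue_measure_ball ?(ltW (u0 n))// muleA inver ifF; last first.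
      by apply/negbTE; rewrite gt_eqF// mulr2n addr_gt0.
    rewrite -EFinM; congr (_%:E * _)%E.
      by rewrite /u -mulr_natr; have := nn0 n; move: (nn n) => z z0; field; rewrite gt_eqF.
    by apply: eq_integral => r _; rewrite /= Qa.
  apply: le_trans (le_abse_integral _ mI _) _; first by case/integrableP: (ih n).
  rewrite integral_mkcond [leRHS]integral_mkcond; apply: ge0_le_integral => //.
  - by move=> r _; rewrite patchE; case: ifP.
  - have hU : measurable_fun I1 (fun r => `|(h n r)%:E|)%E.
      by apply: measurableT_comp => //; case/integrableP: (ih n).
    exact: (measurable_restrictT _ mI).1 hU.
  - have hU : measurable_fun (ball a (u n) : set (measurableTypeR R)) (fun r => (nn n * W)%:E * `|Q j r - q a|%:E)%E.
      by apply: measurable_funeM; apply/measurable_EFinP; exact: measurable_funTS.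
    exact: (measurable_restrictT _ mb).1 hU.
  move=> r _; rewrite !patchE; case: ifPn => [_|_]; last first.
    by case: ifP => // _; rewrite mule_ge0// lee_fin mulr_ge0// ltW.
  case: ifPn => [_|/negP nb].
    rewrite -EFinM lee_fin /h normrM mulrC; apply: ler_wpM2r => //; exact: kern_bound.
  have e : h n r = 0 by rewrite /h kE ?mulr0// => hb; apply: nb; rewrite inE.
  by rewrite e abse0.
have ch : fine (\int[mu]_(r in I1) (h n r)%:E)%E @[n --> \oo] --> (0 : R).
  have /fine_cvgP[fd cd'] := cd.
  apply/cvgr0Pnorm_le => e e0.
  have W2 : 0 < 2 * W + 1 by have := W0; lra.
  have ev : \forall n \near \oo, fine (davg (Q j) a (u n)) < e / (2 * W + 1).
    by apply: (cvgr_lt 0 cd'); exact: divr_gt0.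
  near=> n.
  have h1 : fine (davg (Q j) a (u n)) < e / (2 * W + 1) by near: n.
  have h2 : davg (Q j) a (u n) \is a fin_num by near: n.
  have := E3 n; rewrite -(fineK h2) -(fineK (fh n)) /= -EFinM lee_fin => h3.
  apply: (le_trans h3); apply: (@le_trans _ _ (2 * W * (e / (2 * W + 1)))).
    by apply: ler_wpM2l; [rewrite mulr_ge0 | exact: ltW].
  by rewrite mulrA ler_pdivrMr// mulrC ler_pM2l//; lra.
rewrite /good; have -> : (fun n => fine (\int[mu]_(r in I1) (q r * kern n a r)%:E)%E) = (fun n => fine (\int[mu]_(r in I1) (h n r)%:E)%E + q a).
  by apply/funext => n; exact: E2.
rewrite -[X in _ --> X](add0r (q a)); apply: cvgD => //; exact: cvg_cst.
Unshelve. all: by end_near. Qed.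

End good_points.

(** * The weak equation in the radial variable *)

Section weak_radial.
Context {R : realType}.
Local Notation mu := (@lebesgue_measure R).
Local Notation E3 := (E3 R).
Local Notation ext := (exterior : set E3).
Local Notation I1 := (`]1%R, +oo[%classic : set (measurableTypeR R)).
Implicit Types (r a b c : R).

(* With [f = r q], the radial equation becomes [f'' = source m q]. *)
Definition source (m : nat) (q : R -> R) r := - (r * (`|q r| ^+ (2 * m) * q r)).

Lemma measurable_source (m : nat) (q : R -> R) : measurable_fun setT q ->
  measurable_fun setT (fun r => `|q r| ^+ (2 * m) * q r).
Proof.
move=> mq; apply: measurable_funM => //; apply: measurable_funX; exact: measurableT_comp.
Qed.

Lemma integrable_mul_r (f : R -> R) b c : 1 < b -> measurable_fun setT f ->
  mu.-integrable `[b, c]%classic (EFin \o f) ->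
  mu.-integrable `[b, c]%classic (EFin \o (fun r => r * f r)).
Proof.
move=> b1 mf fi.
have mI : measurable (`[b, c]%classic : set (measurableTypeR R)) by exact: measurable_itv.
apply: le_integrable (integrableZl mI c fi) => //.
  by apply/measurable_EFinP; apply: measurable_funTS; apply: measurable_funM.
move=> r /=; rewrite in_itv/= => /andP[br rc]; rewrite lee_fin !normrM.
by apply: ler_wpM2r => //; rewrite !ger0_norm//; lra.
Qed.

Section weak.
Variables (m : nat) (u : E3 -> R) (q : R -> R).
Hypotheses (mq : measurable_fun setT q) (uq : ae_eq leb3 ext u (radial_fun q)).
Hypothesis mu_ : measurable_fun ext u.
Hypothesis poisson : distr_poisson u (fun x => `|u x| ^+ (2 * m) * u x).

Let mP := measurable_source m mq.

Lemma weak_integrable b c : 1 < b ->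
  mu.-integrable `[b, c]%classic (EFin \o q) /\
  mu.-integrable `[b, c]%classic (EFin \o (fun r => `|q r| ^+ (2 * m) * q r)).
Proof.
move=> b1; have [lu lg _] := poisson; split; first exact: shell_integrable mu_ mq uq lu b1.
apply: (shell_integrable c _ mP _ lg b1).
  apply: measurable_funM => //; apply: measurable_funX; exact: measurableT_comp.
by apply: filterS uq => x h x1; have := h x1 => ->.
Qed.

(** The test function is [chi(|x|) / |x|], whose Laplacian is [chi''(|x|) / |x|]; the weight [r^2]
    of polar coordinates leaves one factor [r] on each side. *)
Lemma weak_radial (chi chi1 chi2 : R -> R) b c : 1 < b ->
  (forall r, is_derive r 1 chi (chi1 r)) -> (forall r, is_derive r 1 chi1 (chi2 r)) ->
  smooth1 setT chi2 -> (forall r, r <= b \/ c <= r -> chi r = 0) ->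
  (\int[mu]_(r in I1) (r * q r * chi2 r))%R = (\int[mu]_(r in I1) (source m q r * chi r))%R.
Proof.
move=> b1 d1 d2 s2 chi0.
have s1 : smooth1 setT chi1 by apply: smooth1_prim s2 => r _; exact: d2.
have s0 : smooth1 setT chi by apply: smooth1_prim s1 => r _; exact: d1.
have [lu lg eq] := poisson.
have k0 := @kappa_gt0 R.
have chi10 r : r < b \/ c < r -> chi1 r = 0.
  move=> h; have z : is_derive r 1 chi 0.
    apply: dnear (dcst r 0); case: h => h; near=> y; rewrite chi0//.
      by left; apply: ltW; near: y; exact: lt_nbhsl.
    by right; apply: ltW; near: y; exact: lt_nbhsr.
  by have [_ <-] := d1 r; have [_ ->] := z.
have chi20 r : r < b \/ c < r -> chi2 r = 0.
  move=> h; have z : is_derive r 1 chi1 0.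
    apply: dnear (dcst r 0); case: h => h; near=> y; rewrite chi10//.
      by left; near: y; exact: lt_nbhsl.
    by right; near: y; exact: lt_nbhsr.
  by have [_ <-] := d2 r; have [_ ->] := z.
have c0 r : {for r, continuous chi} by exact: (smooth1_continuous s0).
have c2 r : {for r, continuous chi2} by exact: (smooth1_continuous s2).
have chi2' r : r <= b - 1 \/ c + 1 <= r -> chi2 r = 0 by move=> h; apply: chi20; lra.
have [K2 _ hK2] := smooth_support_bound c2 chi2'.
have [K0 _ hK0] := smooth_support_bound c0 chi0.
have mchi : measurable_fun setT chi by apply: continuous_measurable_fun => r; exact: c0.
have mchi2 : measurable_fun setT chi2 by apply: continuous_measurable_fun => r; exact: c2.
have [iq iP] := weak_integrable c b1.
have mJ := @measurable_ray R 1.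
have mrq : measurable_fun setT (fun r => r * q r) by exact: measurable_funM.
have i1 : mu.-integrable I1 (fun r => (r * q r * chi2 r)%:E).
  exact: kernel_integrable b1 (integrable_mul_r b1 mq iq) mrq mchi2 hK2 chi20.
have mrP : measurable_fun setT (fun r => r * (`|q r| ^+ (2 * m) * q r)) by exact: measurable_funM.
have i2 : mu.-integrable I1 (fun r => (source m q r * chi r)%:E).
  have ch r : r < b \/ c < r -> chi r = 0 by move=> [h|h]; apply: chi0; [left|right]; exact: ltW.
  have := kernel_integrable b1 (integrable_mul_r b1 mP iP) mrP mchi hK0 ch.
  move/(integrableZl mJ (-1)); congr (integrable _ _ _); apply/funext => r.
  by rewrite -EFinM /source; congr (_%:E); ring.
pose psi r := chi r * r^-1.
have tpsi : test_function (radial_fun psi : E3 -> R).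
  apply: (@radial_test R psi b c b1).
    by apply: smooth1_mul; [exact: smooth1_sub s0 | exact: smooth1_inv].
  by move=> r h; rewrite /psi chi0// mul0r.
have dp1 r : 0 < r -> is_derive r 1 psi (chi1 r * r^-1 - chi r * r^-1 ^+ 2).
  move=> r0; have rn : r != 0 by rewrite gt_eqF.
  have h := d1 r; have k := dVid rn.
  by apply: (deq (dM h k)); ring.
have dp2 r : 0 < r -> is_derive r 1 (fun r => chi1 r * r^-1 - chi r * r^-1 ^+ 2)
    (chi2 r * r^-1 - 2 * chi1 r * r^-1 ^+ 2 + 2 * chi r * r^-1 ^+ 3).
  move=> r0; have rn : r != 0 by rewrite gt_eqF.
  have h := d1 r; have h' := d2 r; have k := dVid rn.
  by apply: (deq (dD (dM h' k) (dN (dM h (dX 2 k))))); rewrite /=; ring.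
have lap (x : E3) : ext x -> laplacian (radial_fun psi) x = chi2 (enorm x) / enorm x.
  rewrite /exterior/= => x1; have x0 : 0 < enorm x by lra.
  rewrite (laplacian_radial x0 dp1 dp2); move: x0; move: (enorm x) => r r0.
  by field; rewrite gt_eqF.
pose f1 r := q r * (if 1 < r then - (chi2 r / r) else 0).
pose f2 r := (`|q r| ^+ (2 * m) * q r) * (if 1 < r then chi r / r else 0).
have ic r : 1 < r -> {for r, continuous (fun r : R => r^-1)}.
  by move=> r1; apply: inv_continuous; rewrite gt_eqF//; lra.
have mf1 : measurable_fun setT f1.
  by apply: measurable_funM => //; apply: gt_measurable => r r1; apply: cvgN; apply: cvgM; [exact: c2|exact: ic].
have mf2 : measurable_fun setT f2.
  by apply: measurable_funM => //; apply: gt_measurable => r r1; apply: cvgM; [exact: c0|exact: ic].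
have me (f : R -> R) : measurable_fun setT f -> measurable_fun ext (fun x : E3 => (f (enorm x))%:E).
  move=> mf; apply/measurable_EFinP; apply: measurable_funTS.
  by apply: (measurableT_comp mf); exact: measurable_enorm.
have mE := @measurable_exterior R.
have EL : (\int[leb3]_(x in ext) (u x * - laplacian (radial_fun psi) x)%:E = \int[leb3]_(x in ext) (f1 (enorm x))%:E)%E.
  apply: ae_eq_integral => //; last 2 first.
  - exact: me.
  - apply: filterS uq => x h x1; have := h x1 => {}h; rewrite h lap// /f1 /radial_fun.
    by move: x1; rewrite /exterior/= => ->.
  have h : measurable_fun ext (fun x : E3 => u x * - (chi2 (enorm x) / enorm x)).
    apply: measurable_funM => //; apply: continuous_measurable3; first exact: exterior_open.
    move=> x; rewrite /exterior/= => x1; apply: (@continuous_comp _ _ _ (@enorm R) (fun r => - (chi2 r / r))).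
      exact: continuous_enorm.
    by apply: cvgN; apply: cvgM; [exact: c2|exact: ic].
  move/measurable_EFinP: h; apply: eq_measurable_fun => x; rewrite inE => x1.
  by rewrite /= lap.
have ER : (\int[leb3]_(x in ext) (`|u x| ^+ (2 * m) * u x * radial_fun psi x)%:E = \int[leb3]_(x in ext) (f2 (enorm x))%:E)%E.
  apply: ae_eq_integral => //; last 2 first.
  - exact: me.
  - apply: filterS uq => x h x1; have := h x1 => {}h; rewrite h /f2 /radial_fun /psi.
    by move: x1; rewrite /exterior/= => ->.
  apply/measurable_EFinP; apply: measurable_funM; last first.
    by apply: measurable_funTS; exact: test_measurable.
  by apply: measurable_funM => //; apply: measurable_funX; exact: measurableT_comp.
have := eq _ tpsi; rewrite EL ER polar// polar//.
have -> : (\int[mu]_(r in I1) (f1 r * (kappa * r ^+ 2))%:E = (- kappa)%:E * \int[mu]_(r in I1) (r * q r * chi2 r)%:E)%E.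
  rewrite -integralZl//; apply: eq_integral => r; rewrite inE/= in_itv/= andbT => r1.
  by rewrite /f1 r1 -EFinM; congr (_%:E); field; rewrite gt_eqF//; lra.
have -> : (\int[mu]_(r in I1) (f2 r * (kappa * r ^+ 2))%:E = (- kappa)%:E * \int[mu]_(r in I1) (source m q r * chi r)%:E)%E.
  rewrite -integralZl//; apply: eq_integral => r; rewrite inE/= in_itv/= andbT => r1.
  by rewrite /f2 r1 /source -EFinM; congr (_%:E); field; rewrite gt_eqF//; lra.
rewrite /Rintegral; have := integrable_fin_num mJ i1; have := integrable_fin_num mJ i2.
case: (integral _ _ _) => [x| |]// _; case: (integral _ _ _) => [y| |]// _.
rewrite -!EFinM => -[] /=; apply: mulfI; rewrite oppr_eq0 gt_eqF//.
Unshelve. all: by end_near. Qed.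

End weak.
End weak_radial.

(** * The integral equation *)

Section limits.
Context {R : realType}.
Local Notation mu := (@lebesgue_measure R).
Local Notation I1 := (`]1%R, +oo[%classic : set (measurableTypeR R)).
Implicit Types (r a : R).

Lemma cvg_norm_le (u : nat -> R) (l B : R) : u n @[n --> \oo] --> l ->
  (forall e, 0 < e -> \forall n \near \oo, `|u n| <= B + e) -> `|l| <= B.
Proof.
move=> ul h; apply/ler_addgt0Pr => e e0.
have e2 : 0 < e / 2 by exact: divr_gt0.
have /cvgrPdist_le /(_ _ e2) h1 := ul; have h2 := h _ e2.
near \oo => n.
have k1 : `|l - u n| <= e / 2 by near: n.
have k2 : `|u n| <= B + e / 2 by near: n.
have := ler_normD (l - u n) (u n); rewrite subrK => k3.
by apply: le_trans k3 _; apply: le_trans (lerD k1 k2) _; lra.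
Unshelve. all: by end_near. Qed.

Lemma near_inv_le (e : R) : 0 < e -> \forall n \near \oo, (n.+1%:R)^-1 <= e.
Proof.
move=> e0; have /cvgrPdist_le /(_ _ e0) h := @cvg_harmonic R.
near=> n; have : `|0 - harmonic n| <= e by near: n.
by rewrite sub0r normrN /harmonic /= ger0_norm// invr_ge0.
Unshelve. all: by end_near. Qed.

Lemma inv_sq_integral (C s : R) : 0 <= C -> - 1 < s ->
  (\int[mu]_(r in I1) (C / (r + s) ^+ 2)%:E = (C / (1 + s))%:E)%E.
Proof.
move=> C0 s1.
have p r : 1 <= r -> 0 < r + s by lra.
have D r : 1 <= r -> is_derive r 1 (fun r => - C * (r + s)^-1) (C / (r + s) ^+ 2).
  move=> r1; have rs := p r r1; have d : is_derive r 1 (fun r => r + s) 1.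
    by apply: (deq (dD (did r) (dcst r s))); ring.
  apply: (deq (dM (dcst r (- C)) (dV (f := fun r => r + s) (lt0r_neq0 rs) d))); field.
  by rewrite gt_eqF.
rewrite (ge0_integral_ray D (l := 0)).
- by congr (_%:E); ring.
- move=> r r1; have rs := p r r1; apply: cvgM; first exact: cvg_cst.
  apply: cvgV; first by rewrite gt_eqF// exprn_gt0.
  apply: (@continuous_comp _ _ _ (fun r => r + s) (fun y : R => y ^+ 2)); last exact: exprn_continuous.
  by apply: cvgD; [exact: cvg_id|exact: cvg_cst].
- by move=> r r1; rewrite divr_ge0// sqr_ge0.
apply/cvgr0Pnorm_le => e e0; near=> r.
have r1 : 1 <= r by near: r; apply: nbhs_pinfty_ge; exact: num_real.
have r2 : C / e - s <= r by near: r; apply: nbhs_pinfty_ge; exact: num_real.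
have rs := p r r1.
rewrite normrM normrN (ger0_norm C0) normfV (gtr0_norm rs) ler_pdivrMr// mulrC -ler_pdivrMr//.
by move: r2; lra.
Unshelve. all: by end_near. Qed.

Lemma ae_le_integrable d (T : measurableType d) (m : {measure set T -> \bar R}) (D : set T) (f g : T -> \bar R) :
  measurable D -> measurable_fun D f -> m.-integrable D g ->
  {ae m, forall x, D x -> (`|f x| <= `|g x|)%E} -> m.-integrable D f.
Proof.
move=> mD mf gi fg; apply/integrableP; split => //.
have /integrableP[mg gf] := gi; apply: le_lt_trans gf.
by apply: ae_ge0_le_integral => //; apply: measurableT_comp.
Qed.

End limits.

Section ode_line.
Context {R : realType}.
Local Notation mu := (@lebesgue_measure R).
Local Notation I1 := (`]1%R, +oo[%classic : set (measurableTypeR R)).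
Implicit Types (r a b c : R) (n : nat).
Variables (sigma omega : R -> R) (W : R).
Hypothesis W0 : 0 <= W.
Hypothesis so : smooth1 setT omega.
Hypothesis sd : forall r, is_derive r 1 sigma (omega r).
Hypothesis slo : forall r, r <= 0 -> sigma r = 0.
Hypothesis shi : forall r, 1 <= r -> sigma r = 1.
Hypothesis s01 : forall r, 0 <= sigma r <= 1.
Hypothesis o0 : forall r, 0 <= omega r.
Hypothesis oW : forall r, omega r <= W.
Hypothesis oout : forall r, r <= 0 \/ 1 <= r -> omega r = 0.
Variables (rho : R -> R) (rc : R).
Hypothesis rd : forall r, is_derive r 1 rho (sigma r).
Hypothesis rlo : forall r, r <= 0 -> rho r = 0.
Hypothesis rhi : forall r, 1 <= r -> rho r = r + rc.

Variables (m : nat) (q : R -> R) (M : R).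
Hypothesis hm : (2 < m)%N.
Hypothesis mq : measurable_fun setT q.
Hypothesis iq : forall b c, 1 < b -> mu.-integrable `[b, c]%classic (EFin \o q).
Hypothesis M0 : 0 <= M.
Hypothesis dual : forall (G g : R -> R) (b c D tau : R), 1 < b -> (forall r, is_derive r 1 G (g r)) ->
    smooth1 setT g -> (forall r, r <= b \/ c <= r -> g r = 0) ->
    (\int[mu]_(r in `]1%R, +oo[) (G r ^+ 2 / r ^+ 2)%:E <= D%:E)%E -> 0 < tau ->
    (`|\int[mu]_(r in `]1%R, +oo[) (q r * g r)%:E| <= (tau * M + D / tau)%:E)%E.
Hypothesis weak : forall (chi chi1 chi2 : R -> R) b c, 1 < b ->
  (forall r, is_derive r 1 chi (chi1 r)) -> (forall r, is_derive r 1 chi1 (chi2 r)) ->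
  smooth1 setT chi2 -> (forall r, r <= b \/ c <= r -> chi r = 0) ->
  (\int[mu]_(r in I1) (r * q r * chi2 r))%R = (\int[mu]_(r in I1) (source m q r * chi r))%R.

Let mI := @measurable_ray R 1.
Local Notation kern := (kern omega).
Local Notation step := (step sigma).
Local Notation good := (good omega).
Local Notation nn := (fun n : nat => n.+1%:R : R).

Let mk n a : measurable_fun setT (kern n a).
Proof. by apply: continuous_measurable_fun => r; exact: continuous_kern. Qed.

Lemma kern_int (f : R -> R) n a : 1 < a -> measurable_fun setT f ->
  (forall b c, 1 < b -> mu.-integrable `[b, c]%classic (EFin \o f)) ->
  mu.-integrable I1 (fun r => (f r * kern n a r)%:E).
Proof.
move=> a1 mf fi; apply: (kernel_integrable a1 (fi a (a + (nn n)^-1) a1) mf (mk n a)).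
  by move=> r; apply: kern_bound.
by move=> r [h|h]; apply: kern_out => //; [left|right]; exact: ltW.
Qed.

Let step_cont n a r : {for r, continuous (step n a)}.
Proof. exact: dcont (is_derive_step sd n a r). Qed.

Let dual_limit a D tau (G : nat -> R -> R) : 1 < a -> good q a -> 0 < tau ->
  (forall n r, is_derive r 1 (G n) (kern n a r)) ->
  (forall e, 0 < e -> \forall n \near \oo, (\int[mu]_(r in I1) (G n r ^+ 2 / r ^+ 2)%:E <= (D + e)%:E)%E) ->
  `|q a| <= tau * M + D / tau.
Proof.
move=> a1 ga tau0 dG hD; apply: cvg_norm_le ga _ => e e0.
have e1 : 0 < e * tau by exact: mulr_gt0.
near=> n.
have h : (\int[mu]_(r in I1) (G n r ^+ 2 / r ^+ 2)%:E <= (D + e * tau)%:E)%E by near: n; exact: hD.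
have := dual a1 (dG n) (smooth_kern so n a) (@kern_out R omega oout n a) h tau0.
have := integrable_fin_num mI (kern_int n a1 mq iq).
case: (integral _ _ _) => [x| |]//= _; rewrite lee_fin => /le_trans; apply.
by rewrite mulrDl mulfK ?gt_eqF// addrA.
Unshelve. all: by end_near. Qed.

Let sq_meas (G : R -> R) : (forall r, {for r, continuous G}) ->
  measurable_fun I1 (fun r => (G r ^+ 2 / r ^+ 2)%:E).
Proof.
move=> Gc; apply: ray_measurable_continuous => r r1; apply: cvgM.
  by apply: (@continuous_comp _ _ _ G (fun y : R => y ^+ 2)) => //; exact: exprn_continuous.
by apply: cvgV; [rewrite gt_eqF// exprn_gt0//; lra | exact: exprn_continuous].
Qed.

Let inv_meas (C s : R) : - 1 < s -> measurable_fun I1 (fun r => (C / (r + s) ^+ 2)%:E).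
Proof.
move=> s1; apply: ray_measurable_continuous => r r1; apply: cvgM; first exact: cvg_cst.
apply: cvgV; first by rewrite gt_eqF// exprn_gt0//; lra.
apply: (@continuous_comp _ _ _ (fun r => r + s) (fun y : R => y ^+ 2)); last exact: exprn_continuous.
by apply: cvgD; [exact: cvg_id|exact: cvg_cst].
Qed.

(** Here [G] is the step itself, 0 near the boundary. The majorant [4 / (r + a)^2] replaces
    [1 / r^2] on [r > a] by a function smooth on the whole half-line. *)
Lemma decay_infinity a tau : 1 < a -> good q a -> 0 < tau -> `|q a| <= tau * M + 4 / a / tau.
Proof.
move=> a1 ga tau0; apply: (@dual_limit a (4 / a) tau (fun n => step n a)) => //.
  by move=> n r; exact: is_derive_step.
move=> e e0; near=> n.
apply: (@le_trans _ _ (\int[mu]_(r in I1) (4 / (r + a) ^+ 2)%:E)%E).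
  apply: ge0_le_integral => //.
  - by move=> r _; rewrite lee_fin divr_ge0// sqr_ge0.
  - exact: sq_meas.
  - by apply: inv_meas; lra.
  move=> r /=; rewrite in_itv/= andbT => r1; rewrite lee_fin.
  have r0 : 0 < r by lra.
  have ra0 : 0 < r + a by lra.
  have [ra|ra] := leP r a.
    by rewrite step_lo// expr0n/= mul0r divr_ge0// sqr_ge0.
  have /andP[t0 t1] : 0 <= step n a r <= 1 by exact: s01.
  rewrite ler_pdivrMr ?exprn_gt0// mulrAC ler_pdivlMr ?exprn_gt0//.
  have h1 : step n a r ^+ 2 <= 1 by rewrite expr_le1.
  have h2 : (r + a) ^+ 2 <= 4 * r ^+ 2 by nra.
  by apply: le_trans h2; rewrite ler_piMl// sqr_ge0.
rewrite inv_sq_integral//; last by lra.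
rewrite lee_fin; suff : 4 / (1 + a) <= 4 / a by lra.
by rewrite ler_pM2l// lef_pV2 ?posrE//; lra.
Unshelve. all: by end_near. Qed.

(** Here [G] is the step minus 1, supported in [r <= a + 1/(n+1)], so the dual norm is small when
    [a] is close to 1: this is the Dirichlet condition. *)
Lemma decay_boundary a tau : 1 < a -> good q a -> 0 < tau -> `|q a| <= tau * M + 4 * (a - 1) / tau.
Proof.
move=> a1 ga tau0; apply: (@dual_limit a (4 * (a - 1)) tau (fun n r => step n a r - 1)) => //.
  move=> n r; have h := is_derive_step sd n a r.
  by apply: (deq (dD h (dN (dcst r 1)))); rewrite oppr0 addr0.
move=> e e0; have e4 : 0 < e / 4 by exact: divr_gt0.
near=> n.
have hn : (nn n)^-1 <= e / 4 by near: n; exact: near_inv_le.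
(* The step is 1 beyond [A]; for [r < A] one has [r + A - 2 <= 2 (A - 1)], and the majorant
   integrates to [4 (A - 1)]. *)
pose A := a + (nn n)^-1.
have A1 : 1 < A by rewrite /A; have : 0 < (nn n)^-1 :> R by []; move: ((nn n)^-1) => z; lra.
apply: (@le_trans _ _ (\int[mu]_(r in I1) (4 * (A - 1) ^+ 2 / (r + (A - 2)) ^+ 2)%:E)%E).
  apply: ge0_le_integral => //.
  - by move=> r _; rewrite lee_fin divr_ge0// sqr_ge0.
  - by apply: sq_meas => r; apply: cvgB; [exact: step_cont | exact: cvg_cst].
  - by apply: inv_meas; lra.
  move=> r /=; rewrite in_itv/= andbT => r1; rewrite lee_fin.
  have r0 : 0 < r by lra.
  have ra0 : 0 < r + (A - 2) by lra.
  have [ra|ra] := leP A r.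
    by rewrite step_hi// subrr expr0n/= mul0r divr_ge0 ?sqr_ge0// mulr_ge0 ?sqr_ge0.
  have /andP[t0 t1] : 0 <= step n a r <= 1 by exact: s01.
  rewrite ler_pdivrMr ?exprn_gt0// mulrAC ler_pdivlMr ?exprn_gt0//.
  have h1 : (step n a r - 1) ^+ 2 <= 1 by move: t0 t1; move: (step n a r) => z; nra.
  have h2 : (r + (A - 2)) ^+ 2 <= 4 * (A - 1) ^+ 2 by nra.
  apply: (@le_trans _ _ (4 * (A - 1) ^+ 2)).
    by apply: le_trans h2; rewrite ler_piMl// sqr_ge0.
  apply: ler_peMr; first by apply: mulr_ge0 => //; exact: sqr_ge0.
  by rewrite expr_ge1//; lra.
rewrite inv_sq_integral//; last by lra.
  rewrite lee_fin; have -> : 4 * (A - 1) ^+ 2 / (1 + (A - 2)) = 4 * (A - 1).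
    by field; rewrite gt_eqF//; lra.
  by rewrite /A; move: hn; move: ((nn n)^-1) => z; lra.
by rewrite mulr_ge0 ?sqr_ge0.
Unshelve. all: by end_near. Qed.

Let B := M + 4.

(** The choice [tau = a^(-1/2)] balances the two terms of [decay_infinity]. *)
Lemma decay_sqrt a : 1 < a -> good q a -> `|q a| <= B / Num.sqrt a.
Proof.
move=> a1 ga; have s0 : 0 < Num.sqrt a by rewrite sqrtr_gt0; lra.
have t0 : 0 < (Num.sqrt a)^-1 by rewrite invr_gt0.
apply: le_trans (decay_infinity a1 ga t0) _.
have aE : a = Num.sqrt a ^+ 2 by rewrite sqr_sqrtr//; lra.
rewrite [X in 4 / X]aE /B; move: s0; move: (Num.sqrt a) => s s0.
by rewrite le_eqVlt; apply/orP; left; apply/eqP; field; rewrite gt_eqF.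
Qed.

Let h := source m q.
Let mh : measurable_fun setT h.
Proof. by apply: measurableT_comp => //; apply: measurable_funM => //; exact: measurable_source. Qed.

Lemma ae_good_q : {ae mu, forall a, 1 < a -> good q a}.
Proof. exact: (ae_good W0 so sd slo shi o0 oW oout mq iq). Qed.

Let irq b c : 1 < b -> mu.-integrable `[b, c]%classic (EFin \o (fun r => r * q r)).
Proof. by move=> b1; apply: integrable_mul_r => //; exact: iq. Qed.

Let mrq : measurable_fun setT (fun r => r * q r).
Proof. exact: measurable_funM. Qed.

Lemma ae_good_rq : {ae mu, forall a, 1 < a -> good (fun r => r * q r) a}.
Proof. exact: (ae_good W0 so sd slo shi o0 oW oout mrq irq). Qed.

Let B0 : 0 <= B. Proof. by rewrite /B; have := M0; lra. Qed.

(** By [decay_sqrt], [|r h| <= B^(2m+1) r^(2 - (2m+1)/2)], which is dominated by a multiple of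
    [r^(-3/2)]. *)
Lemma weighted_source_integrable : mu.-integrable I1 (fun r => (r * h r)%:E).
Proof.
pose K := B ^+ (2 * m).+1.
have K0 : 0 <= K by exact: exprn_ge0.
have s1 r : 1 <= r -> 1 <= Num.sqrt r by move=> r1; rewrite -[X in X <= _]sqrtr1 ler_wsqrtr.
have s0 r : 1 <= r -> 0 < Num.sqrt r by move=> /s1; lra.
have sE r : 1 <= r -> Num.sqrt r ^+ 2 = r by move=> r1; rewrite sqr_sqrtr//; lra.
have sc r : {for r, continuous (@Num.sqrt R)} by exact: sqrt_continuous.
pose k r := K * (Num.sqrt r)^-1 ^+ 3.
have dk r : 1 <= r -> is_derive r 1 (fun r => - 2 * K * (Num.sqrt r)^-1) (k r).
  move=> r1; have r0 : 0 < r by lra.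
  have d := is_derive1_sqrt r0; have sn : Num.sqrt r != 0 by rewrite gt_eqF// s0.
  apply: (deq (dM (dcst r (- 2 * K)) (dV (f := Num.sqrt) sn d))).
  by rewrite /k; move: sn; move: (Num.sqrt r) => s sn; field.
have kc r : 1 <= r -> {for r, continuous k}.
  move=> r1; apply: cvgM; first exact: cvg_cst.
  apply: (@continuous_comp _ _ _ (fun r => (Num.sqrt r)^-1) (fun y : R => y ^+ 3)); last exact: exprn_continuous.
  by apply: cvgV; [rewrite gt_eqF// s0 | exact: sc].
have k0 r : 1 <= r -> 0 <= k r by move=> r1; rewrite mulr_ge0// exprn_ge0// invr_ge0 ltW// s0.
have lk : - 2 * K * (Num.sqrt r)^-1 @[r --> +oo] --> (0 : R).
  apply/cvgr0Pnorm_le => e e0; near=> r.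
  have r1 : 1 <= r by near: r; apply: nbhs_pinfty_ge; exact: num_real.
  have r2 : (2 * K / e) ^+ 2 <= r by near: r; apply: nbhs_pinfty_ge; exact: num_real.
  rewrite normrM normrM normrN (ger0_norm K0) (ger0_norm (x := 2))// normfV (gtr0_norm (s0 r r1)).
  rewrite ler_pdivrMr ?s0// [leRHS]mulrC -ler_pdivrMr//.
  rewrite -(@ler_sqr _ _ (Num.sqrt r)) ?nnegrE ?sqrtr_ge0 ?sE// divr_ge0 ?mulr_ge0//; exact: ltW.
have ik := ge0_integrable_ray dk kc k0 lk.
apply: (ae_le_integrable mI _ ik _).
  by apply/measurable_EFinP; apply: measurable_funTS; exact: measurable_funM.
apply: ae_mono ae_good_q => r gr /=; rewrite in_itv/= andbT => r1.
have r0 : 0 < r by lra.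
have qr := decay_sqrt r1 (gr r1).
have sr1 := s1 r (ltW r1); have sr0 := s0 r (ltW r1); have srE := sE r (ltW r1).
rewrite lee_fin (ger0_norm (k0 r (ltW r1))) /h /source /k mulrN normrN.
rewrite normrM (gtr0_norm r0) normrM (gtr0_norm r0) normrM normrX normr_id.
have -> : `|q r| ^+ (2 * m) * `|q r| = `|q r| ^+ (2 * m).+1 by rewrite exprSr.
have q1 : `|q r| ^+ (2 * m).+1 <= (B / Num.sqrt r) ^+ (2 * m).+1.
  by apply: lerXn2r qr; rewrite nnegrE// divr_ge0// ltW.
apply: (@le_trans _ _ (r * (r * (B / Num.sqrt r) ^+ (2 * m).+1))).
  by rewrite !ler_pM2l.
rewrite expr_div_n -/K mulrA mulrCA mulrA -mulrA.
apply: ler_wpM2l => //.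
rewrite -{1 2}srE; move: sr1 sr0; move: (Num.sqrt r) => s s1' s0'.
(* With [s] the square root of [r], [s^4 / s^(2m+1) <= s^-3] requires [2m+1 >= 7], that is
   [m > 2]. *)
have e7 : ((2 * m).+1 = 7 + (2 * m - 6))%N by move: hm; clear; lia.
rewrite e7 exprD.
have p : 1 <= s ^+ (2 * m - 6) by exact: exprn_ege1.
have -> : s ^+ 2 * s ^+ 2 / (s ^+ 7 * s ^+ (2 * m - 6)) = s^-1 ^+ 3 / s ^+ (2 * m - 6).
  by field; rewrite !gt_eqF// exprn_gt0.
by rewrite ler_pdivrMr ?(lt_le_trans ltr01 p)// ler_peMr// exprn_ge0// invr_ge0 ltW.
Unshelve. all: by end_near. Qed.

Lemma source_integrable : mu.-integrable I1 (fun r => (h r)%:E).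
Proof.
apply: (le_integrable mI _ _ weighted_source_integrable).
  by apply/measurable_EFinP; exact: measurable_funTS.
move=> r /=; rewrite in_itv/= andbT => r1; rewrite lee_fin normrM ler_peMl// ger0_norm; lra.
Qed.

Lemma source_mul_integrable (g : R -> R) (C : R) : measurable_fun setT g ->
  (forall r, 1 < r -> `|g r| <= C * r) -> mu.-integrable I1 (fun r => (h r * g r)%:E).
Proof.
move=> mg gC.
apply: (le_integrable mI _ _ (integrableZl mI C weighted_source_integrable)).
  by apply/measurable_EFinP; apply: measurable_funTS; exact: measurable_funM.
move=> r /=; rewrite in_itv/= andbT => r1; rewrite lee_fin !normrM.
have r0 : 0 < r by lra.
rewrite (gtr0_norm r0) mulrA mulrC; apply: ler_wpM2r => //.
apply: le_trans (gC r r1) _; apply: ler_wpM2r; [exact: ltW | exact: ler_norm].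
Qed.

(** Formally the solution of [F'' = h] decaying at infinity, the integral of [(r - a) h] over
    [r > a]. The truncated factor keeps the domain of integration independent of [a]. *)
Definition potential a := (\int[mu]_(r in I1) (h r * Num.max (r - a) 0))%R.

(** A primitive of [step], converging uniformly to [max(r - a, 0)]; beyond [a + 1/(n+1)] it is
    affine with an offset that does not depend on [a]. *)
Let ramp n a r := (nn n)^-1 * rho (nn n * r + - (nn n * a)).

Let ramp_d n a r : is_derive r 1 (ramp n a) (step n a r).
Proof.
have n0 : 0 < nn n by [].
have a1 : is_derive r 1 (fun r => nn n * r + - (nn n * a)) (nn n).
  by apply: (deq (dD (dM (dcst r (nn n)) (did r)) (dcst r _))); ring.
have k := dM (dcst r (nn n)^-1) (dcomp (f := rho) (g := fun r => nn n * r + - (nn n * a)) (rd _) a1).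
by apply: (deq k); rewrite /step mul0r add0r mulrCA mulVf ?mulr1// gt_eqF.
Qed.

Let ramp_lo n a r : r <= a -> ramp n a r = 0.
Proof.
move=> ra; rewrite /ramp rlo ?mulr0// -mulrBr; apply: mulr_ge0_le0 => //.
by move: ra; lra.
Qed.

Let ramp_hi n a r : a + (nn n)^-1 <= r -> ramp n a r = r - a + rc / nn n.
Proof.
move=> ra; have n0 : 0 < nn n by [].
have : 1 <= nn n * (r - a).
  by rewrite -ler_pdivrMl// mulr1; move: ra; move: ((nn n)^-1) => z; lra.
rewrite /ramp -mulrBr => h1; rewrite rhi//.
by move: n0; move: (nn n) => z z0; field; rewrite gt_eqF.
Qed.

Let rho_mid t : 0 <= t -> 0 <= rho t <= t.
Proof.
move=> t0; have r0 : rho 0 = 0 by exact: rlo.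
have A x : 0 <= x <= t -> is_derive x 1 rho (sigma x) by move=> _; exact: rd.
have A2 x : 0 <= x <= t -> is_derive x 1 (fun x => x - rho x) (1 - sigma x).
  by move=> _; have k := rd x; exact: (dD (did x) (dN k)).
have h1 := mono_le t0 A (fun x _ => (andP (s01 x)).1).
have h2 : 0 - rho 0 <= t - rho t.
  by apply: (mono_le t0 A2) => x _; have /andP[_] := s01 x; lra.
by rewrite r0 in h1 h2; apply/andP; split; lra.
Qed.

Let K := 1 + `|rc|.
Let K0 : 0 <= K. Proof. by rewrite /K; have := normr_ge0 rc; lra. Qed.

Let ramp_close n a r : `|ramp n a r - Num.max (r - a) 0| <= K / nn n.
Proof.
have n0 : 0 < nn n by [].
have Kn : 0 <= K / nn n by rewrite divr_ge0// ltW.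
have [ra|ra] := leP r a.
  by rewrite ramp_lo// max_r ?subrr ?normr0//; lra.
rewrite max_l; last by lra.
have [rh|rh] := leP (a + (nn n)^-1) r.
  rewrite ramp_hi//; have -> : r - a + rc / nn n - (r - a) = rc / nn n by ring.
  rewrite normrM normfV (gtr0_norm n0) ler_pM2r ?invr_gt0// /K; lra.
have t0 : 0 <= nn n * r + - (nn n * a) by rewrite -mulrBr mulr_ge0//; lra.
have t1 : nn n * r + - (nn n * a) <= 1.
  rewrite -mulrBr -ler_pdivlMl// mulr1; move: rh; move: ((nn n)^-1) => z; lra.
have /andP[k1 k2] := rho_mid t0.
have -> : ramp n a r - (r - a) = (rho (nn n * r + - (nn n * a)) - (nn n * r + - (nn n * a))) / nn n.
  by rewrite /ramp; move: n0; move: (nn n) => z z0; field; rewrite gt_eqF.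
rewrite normrM normfV (gtr0_norm n0) ler_pM2r ?invr_gt0//.
by rewrite ler_norml /K; have := normr_ge0 rc; move=> ?; apply/andP; split; lra.
Qed.

Let mmax a : measurable_fun setT (fun r : R => Num.max (r - a) 0).
Proof. by apply: measurable_maxr => //; exact: measurable_funB. Qed.

Let mramp n a : measurable_fun setT (ramp n a).
Proof. by apply: continuous_measurable_fun => r; exact: dcont (ramp_d n a r). Qed.

Lemma potential_integrable a : 1 <= a -> mu.-integrable I1 (fun r => (h r * Num.max (r - a) 0)%:E).
Proof.
move=> a1; apply: (source_mul_integrable (C := 1)) => // r r1.
by rewrite ger0_norm ?le_max ?lexx ?orbT// ge_max; apply/andP; split; lra.
Qed.

Let iramp n a : 1 <= a -> mu.-integrable I1 (fun r => (h r * ramp n a r)%:E).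
Proof.
move=> a1; apply: (source_mul_integrable (C := 1 + K)) => // r r1.
have := ramp_close n a r; have nK : K / nn n <= K by rewrite ler_pdivrMr// ler_peMr// ler1n.
have m0 : 0 <= Num.max (r - a) 0 by rewrite le_max lexx orbT.
have m1 : Num.max (r - a) 0 <= r by rewrite ge_max; apply/andP; split; lra.
rewrite !ler_norml => /andP[h1 h2]; have := K0; move: (K / nn n) nK h1 h2 => z nK h1 h2 k0.
by apply/andP; split; nra.
Qed.

Let ramp_cvg a : 1 <= a -> (\int[mu]_(r in I1) (h r * ramp n a r))%R @[n --> \oo] --> potential a.
Proof.
move=> a1; pose S := (\int[mu]_(r in I1) `|h r|)%R.
have ia : mu.-integrable I1 (EFin \o (fun r => `|h r|)).
  have := integrable_norm source_integrable; congr (integrable _ _ _).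
have S0 : 0 <= S by apply: Rintegral_ge0 => r _; exact: normr_ge0.
apply/cvgrPdist_le => e e0.
have e1 : 0 < e / (K * S + 1) by apply: divr_gt0 => //; have := mulr_ge0 K0 S0; lra.
near=> n; have hn : (nn n)^-1 <= e / (K * S + 1) by near: n; exact: near_inv_le.
rewrite /potential -(RintegralB mI (potential_integrable a1) (iramp n a1)).
have id : mu.-integrable I1 (EFin \o (fun r => h r * Num.max (r - a) 0 - h r * ramp n a r)).
  have := integrableB mI (potential_integrable a1) (iramp n a1).
  by congr (integrable _ _ _).
apply: le_trans (le_normr_Rintegral mI id) _.
apply: (@le_trans _ _ (\int[mu]_(r in I1) (K / nn n * `|h r|))%R).
  apply: le_Rintegral => //.
  - by have := integrable_norm id; congr (integrable _ _ _).
  - exact: (integrableZl mI (K / nn n) ia).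
  move=> r _; rewrite -mulrBr normrM mulrC; apply: ler_wpM2r => //.
  by rewrite distrC; exact: ramp_close.
rewrite RintegralZl// -/S.
apply: (@le_trans _ _ (K * S * (e / (K * S + 1)))).
  have -> : K / nn n * S = K * S * (nn n)^-1 by ring.
  by apply: ler_wpM2l => //; exact: mulr_ge0.
have KS := mulr_ge0 K0 S0.
rewrite mulrA ler_pdivrMr; last by lra.
by rewrite mulrC ler_pM2l//; lra.
Unshelve. all: by end_near. Qed.

Let lin3 (f1 f2 f3 : R -> R) (l1 l2 l3 : R) : mu.-integrable I1 (fun r => (f1 r)%:E) ->
  mu.-integrable I1 (fun r => (f2 r)%:E) -> mu.-integrable I1 (fun r => (f3 r)%:E) ->
  (\int[mu]_(r in I1) (l1 * f1 r + l2 * f2 r + l3 * f3 r))%R =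
  l1 * (\int[mu]_(r in I1) (f1 r))%R + l2 * (\int[mu]_(r in I1) (f2 r))%R + l3 * (\int[mu]_(r in I1) (f3 r))%R.
Proof.
move=> i1 i2 i3.
have j1 := integrableZl mI l1 i1; have j2 := integrableZl mI l2 i2; have j3 := integrableZl mI l3 i3.
have j12 : mu.-integrable I1 (EFin \o (fun r => l1 * f1 r + l2 * f2 r)).
  by have := integrableD mI j1 j2; congr (integrable _ _ _).
by rewrite (RintegralD mI j12 j3) (RintegralD mI j1 j2) !RintegralZl.
Qed.

(* The second derivative of a combination of ramps with vanishing moments is a
   combination of approximate Dirac masses. *)
Lemma three_points (a1 a2 a3 l1 l2 l3 : R) : 1 < a1 -> 1 < a2 -> 1 < a3 ->
  let f := fun r => r * q r in good f a1 -> good f a2 -> good f a3 ->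
  l1 + l2 + l3 = 0 -> l1 * a1 + l2 * a2 + l3 * a3 = 0 ->
  l1 * f a1 + l2 * f a2 + l3 * f a3 = l1 * potential a1 + l2 * potential a2 + l3 * potential a3.
Proof.
move=> A1 A2 A3 f g1 g2 g3 s0 s1.
pose b := Num.min a1 (Num.min a2 a3); pose c := Num.max a1 (Num.max a2 a3) + 1.
have b1 : 1 < b by rewrite !lt_min A1 A2 A3.
pose chi n r := l1 * ramp n a1 r + l2 * ramp n a2 r + l3 * ramp n a3 r.
pose chi1 n r := l1 * step n a1 r + l2 * step n a2 r + l3 * step n a3 r.
pose chi2 n r := l1 * kern n a1 r + l2 * kern n a2 r + l3 * kern n a3 r.
have d1 n r : is_derive r 1 (chi n) (chi1 n r).
  have k1 := ramp_d n a1 r; have k2 := ramp_d n a2 r; have k3 := ramp_d n a3 r.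
  apply: (deq (dD (dD (dM (dcst r l1) k1) (dM (dcst r l2) k2)) (dM (dcst r l3) k3))).
  by rewrite /chi1; ring.
have d2 n r : is_derive r 1 (chi1 n) (chi2 n r).
  have k1 := is_derive_step sd n a1 r; have k2 := is_derive_step sd n a2 r; have k3 := is_derive_step sd n a3 r.
  apply: (deq (dD (dD (dM (dcst r l1) k1) (dM (dcst r l2) k2)) (dM (dcst r l3) k3))).
  by rewrite /chi2; ring.
have s2 n : smooth1 setT (chi2 n).
  by do ! apply: smooth1_add; (apply: smooth1_mul; [exact: smooth1_cst | exact: smooth_kern]).
have chi0 n r : r <= b \/ c <= r -> chi n r = 0.
  move=> [rb|cr].
    move: rb; rewrite /b !le_min => /and3P[h1 h2 h3].
    by rewrite /chi !ramp_lo// !mulr0 !addr0.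
  have n1 : (nn n)^-1 <= 1 :> R by rewrite invf_le1// ler1n.
  have ge x : x <= Num.max a1 (Num.max a2 a3) -> x + (nn n)^-1 <= r.
    by move=> xc; apply: le_trans cr; exact: lerD.
  rewrite /chi !ramp_hi; try by apply: ge; rewrite !le_max lexx ?orbT.
  (* The offset [rc / (n+1)], common to the three ramps, disappears because the coefficients sum to
     0; with the second moment condition [chi n] vanishes beyond [c]. *)
  have -> : l1 * (r - a1 + rc / nn n) + l2 * (r - a2 + rc / nn n) + l3 * (r - a3 + rc / nn n) =
    (l1 + l2 + l3) * (r + rc / nn n) - (l1 * a1 + l2 * a2 + l3 * a3) by ring.
  by rewrite s0 s1 mul0r subr0.
have E n : l1 * (\int[mu]_(r in I1) (f r * kern n a1 r))%R + l2 * (\int[mu]_(r in I1) (f r * kern n a2 r))%R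
    + l3 * (\int[mu]_(r in I1) (f r * kern n a3 r))%R =
  l1 * (\int[mu]_(r in I1) (h r * ramp n a1 r))%R + l2 * (\int[mu]_(r in I1) (h r * ramp n a2 r))%R
    + l3 * (\int[mu]_(r in I1) (h r * ramp n a3 r))%R.
  rewrite -!lin3; try exact: (kern_int n _ mrq irq); try by apply: iramp; exact: ltW.
  have := weak b1 (d1 n) (d2 n) (s2 n) (chi0 n); rewrite -/h => w.
  transitivity (\int[mu]_(r in I1) (r * q r * chi2 n r))%R.
    by congr fine; apply: eq_integral => r _; congr (_%:E); rewrite /chi2 /f; ring.
  by rewrite w; congr fine; apply: eq_integral => r _; congr (_%:E); rewrite /chi; ring.
have L : l1 * (\int[mu]_(r in I1) (f r * kern n a1 r))%R + l2 * (\int[mu]_(r in I1) (f r * kern n a2 r))%R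
    + l3 * (\int[mu]_(r in I1) (f r * kern n a3 r))%R @[n --> \oo] --> l1 * f a1 + l2 * f a2 + l3 * f a3.
  by apply: cvgD; [apply: cvgD|]; (apply: cvgM; [exact: cvg_cst|]); [exact: g1|exact: g2|exact: g3].
have Rr : l1 * (\int[mu]_(r in I1) (h r * ramp n a1 r))%R + l2 * (\int[mu]_(r in I1) (h r * ramp n a2 r))%R
    + l3 * (\int[mu]_(r in I1) (h r * ramp n a3 r))%R @[n --> \oo] --> l1 * potential a1 + l2 * potential a2 + l3 * potential a3.
  by apply: cvgD; [apply: cvgD|]; (apply: cvgM; [exact: cvg_cst|]); apply: ramp_cvg; exact: ltW.
have {}L := cvg_lim (@norm_hausdorff _ _) L; have {}Rr := cvg_lim (@norm_hausdorff _ _) Rr.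
rewrite -L -Rr; congr (lim (_ @ \oo)); apply/funext => n; exact: E.
Qed.

Lemma potential_bound a : 1 <= a -> `|potential a| <= (\int[mu]_(r in I1) `|r * h r|)%R.
Proof.
move=> a1; apply: le_trans (le_normr_Rintegral mI (potential_integrable a1)) _.
apply: le_Rintegral => //.
- by have := integrable_norm (potential_integrable a1); congr (integrable _ _ _).
- by have := integrable_norm weighted_source_integrable; congr (integrable _ _ _).
move=> r /=; rewrite in_itv/= andbT => r1; rewrite !normrM mulrC; apply: ler_wpM2r => //.
by rewrite !ger0_norm ?le_max ?lexx ?orbT//; [rewrite ge_max; apply/andP; split; lra | lra].
Qed.

(** [three_points] with two fixed good points shows that [r q] minus the potential is affine. Its
    slope is 0, because [r q] is [O(r^(1/2))] and the potential is bounded. *)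
Lemma affine_representation : exists alpha : R,
  {ae mu, forall a, 1 < a -> a * q a = alpha + potential a}.
Proof.
pose f r := r * q r; pose w r := f r - potential r.
have [p /andP[p1 p2] gp] := ae_exists (ltr_nat R 2 3 : (2 < 3 :> R)) ae_good_rq.
have [s /andP[t1 t2] gs] := ae_exists (ltr_nat R 4 5 : (4 < 5 :> R)) ae_good_rq.
have p11 : 1 < p by lra.
have s11 : 1 < s by lra.
have {}gp := gp p11; have {}gs := gs s11.
pose beta := (w s - w p) / (s - p); pose alpha := w p - beta * p.
have sp : s - p != 0 by rewrite gt_eqF//; lra.
have wa a : 1 < a -> good f a -> w a = alpha + beta * a.
  move=> a1 ga.
  (* These coefficients annihilate constants and the identity: up to a factor they express [a] as an
     affine combination of [p] and [s]. *)
  have := @three_points a p s (s - p) (- (s - a)) (p - a) a1 p11 s11 ga gp gs.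
  rewrite -/f => h3; have e1 : (s - p) + (- (s - a)) + (p - a) = 0 by ring.
  have e2 : (s - p) * a + - (s - a) * p + (p - a) * s = 0 by ring.
  have {}h3 := h3 e1 e2.
  have h4 : (s - p) * w a = (s - a) * w p + (a - p) * w s.
    by rewrite /w; move: h3 => /=; rewrite -/(f a) -/(f p) -/(f s); lra.
  by apply: (mulfI sp); rewrite h4 /alpha /beta; field.
pose S := (\int[mu]_(r in I1) `|r * h r|)%R.
have b0 : beta = 0.
  apply/eqP; rewrite -normr_le0; apply/ler_addgt0Pr => e e0; rewrite add0r.
  pose T := (B / e) ^+ 2 + (`|alpha| + S) / e.
  have be2 : 0 < e / 2 by exact: divr_gt0.
  (* Beyond [A] both [B a^(1/2)] and [|alpha| + S] are at most [e a / 2]; since [|beta| a] is at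
     most their sum, [|beta| <= e]. *)
  pose A := Num.max 2 (Num.max ((2 * B / e) ^+ 2) (2 * (`|alpha| + S) / e)).
  have AA : A < A + 1 by rewrite ltrDl.
  have Hae : {ae mu, forall a, 1 < a -> good q a /\ good f a}.
    have [N1 [mN1 N10 h1]] := ae_good_q; have [N2 [mN2 N20 h2]] := ae_good_rq.
    exists (N1 `|` N2); split.
    - exact: measurableU.
    - by rewrite measureU0.
    move=> x /= nx; apply: contrapT => /not_orP[n1 n2]; apply: nx => x1; split.
      by have := contra_not (h1 x) n1; rewrite /= notK; apply.
    by have := contra_not (h2 x) n2; rewrite /= notK; apply.
  have [a /andP[aA _] ga] := ae_exists AA Hae.
  move: aA; rewrite /A !gt_max => /and3P[aA1 aA2 aA3].
  have a1 : 1 < a by lra.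
  have [gqa gfa] := ga a1.
  have a0 : 0 < a by lra.
  have hw := wa a a1 gfa.
  have hq := decay_sqrt a1 gqa.
  have hF := potential_bound (ltW a1); rewrite -/S in hF.
  have s0 : 0 < Num.sqrt a by rewrite sqrtr_gt0.
  have fE : `|f a| <= B * Num.sqrt a.
    rewrite /f normrM (gtr0_norm a0); apply: le_trans (ler_wpM2l (ltW a0) hq) _.
    rewrite -{1}(sqr_sqrtr (ltW a0)); move: s0; move: (Num.sqrt a) => z z0.
    by rewrite le_eqVlt; apply/orP; left; apply/eqP; field; rewrite gt_eqF.
  have sa : 2 * B / e <= Num.sqrt a.
    rewrite -(@ler_sqr _ (2 * B / e)) ?nnegrE ?sqrtr_ge0 ?sqr_sqrtr ?(ltW a0) ?(ltW aA2)//.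
    by rewrite divr_ge0 ?mulr_ge0// ltW.
  have h5 : `|beta| * a <= B * Num.sqrt a + (`|alpha| + S).
    have -> : `|beta| * a = `|f a - potential a - alpha|.
      have -> : f a - potential a - alpha = beta * a by move: hw; rewrite /w; lra.
      by rewrite [RHS]normrM; congr (_ * _); rewrite gtr0_norm.
    apply: le_trans (ler_normB _ _) _; have := ler_normB (f a) (potential a); lra.
  have h6 : B * Num.sqrt a <= e / 2 * a.
    rewrite -{2}(sqr_sqrtr (ltW a0)); move: sa s0; move: (Num.sqrt a) => z.
    by rewrite ler_pdivrMr// => hz z0; rewrite expr2; nra.
  have h7 : `|alpha| + S <= e / 2 * a.
    by move: aA3; rewrite ltr_pdivrMr//; lra.
  rewrite -(ler_pM2r a0); lra.
exists alpha; apply: ae_mono ae_good_rq => a ga a1.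
by have := wa a a1 (ga a1); rewrite b0 mul0r addr0 /w /f; lra.
Qed.

End ode_line.

(** * Uniqueness for the integral equation *)

Section uniqueness.
Context {R : realType}.
Local Notation mu := (@lebesgue_measure R).
Local Notation I1 := (`]1%R, +oo[%classic : set (measurableTypeR R)).
Implicit Types (r a : R) (q Q g : R -> R).

Let mI : measurable I1 := measurable_ray 1.

Lemma max_ray g a : 1 <= a -> mu.-integrable `]a, +oo[%classic (fun r => (g r * (r - a))%:E) ->
  mu.-integrable I1 (fun r => (g r * Num.max (r - a) 0)%:E) /\
  (\int[mu]_(r in I1) (g r * Num.max (r - a) 0)%:E = \int[mu]_(r in `]a, +oo[) (g r * (r - a))%:E)%E.
Proof.
move=> a1; have E : (fun r => (g r * Num.max (r - a) 0)%:E) \_ I1 = (fun r => (g r * (r - a))%:E) \_ `]a, +oo[%classic.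
  apply/funext => r; rewrite !patchE !mem_setE !in_itv/= !andbT.
  have [ar|ra] := ltP a r; first by rewrite (le_lt_trans a1 ar) max_l// subr_ge0 ltW.
  by rewrite max_r ?subr_le0// mulr0; case: ifP.
move=> /(integrable_mkcond _ (measurable_ray a)) i; split.
  by apply/(integrable_mkcond _ mI); rewrite E.
by rewrite integral_mkcond E -integral_mkcond.
Qed.

(** The weight [exp(L / r)] satisfies [w'' >= 2 L r^-3 w], where [L r^-3] will be a Lipschitz
    constant of the source in terms of [r q]; the factor 2 yields a contraction by one half. *)
Definition weight (L : R) r := expR (L * r^-1).
Definition weight'' (L : R) r := (L ^+ 2 * r^-1 ^+ 4 + 2 * L * r^-1 ^+ 3) * weight L r.

Lemma weight_gt0 L r : 0 < weight L r. Proof. exact: expR_gt0. Qed.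

(** Taylor's formula from infinity, where the weight tends to 1: the primitive of [(r - a) w''] is
    [(r - a) w' - w]. *)
Lemma weight_integral L a : 0 <= L -> 1 <= a ->
  mu.-integrable I1 (fun r => (weight'' L r * Num.max (r - a) 0)%:E) /\
  (\int[mu]_(r in I1) (weight'' L r * Num.max (r - a) 0)%:E = (weight L a - 1)%:E)%E.
Proof.
move=> L0 a1.
pose H r := (- L * (r - a) * r^-1 ^+ 2 - 1) * weight L r.
have p r : a <= r -> 0 < r by move=> ar; lra.
have dE r : a <= r -> is_derive r 1 (weight L) (- L * r^-1 ^+ 2 * weight L r).
  move=> ar; have rn := lt0r_neq0 (p r ar).
  apply: (deq (dexp (dM (dcst r L) (dVid rn)))); rewrite /weight; ring.
have dH r : a <= r -> is_derive r 1 H (weight'' L r * (r - a)).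
  move=> ar; have rn := lt0r_neq0 (p r ar).
  have k1 := dM (dM (dcst r (- L)) (dD (did r) (dN (dcst r a)))) (dX 2 (dVid rn)).
  apply: (deq (dM (dD k1 (dN (dcst r 1))) (dE r ar))); rewrite /weight''.
  by move: (weight L r) => z /=; field.
have hc r : a <= r -> {for r, continuous (fun r => weight'' L r * (r - a))}.
  move=> ar; have rn := lt0r_neq0 (p r ar).
  have iv : GRing.inv @ r --> r^-1 by exact: cvgV.
  have ie : weight L @ r --> weight L r by exact: dcont (dE r ar).
  apply: cvgM; last by apply: cvgB; [exact: cvg_id | exact: cvg_cst].
  apply: cvgM => //; apply: cvgD; apply: cvgM; try exact: cvg_cst.
    exact: dcont (dX 4 (dVid rn)).
  exact: dcont (dX 3 (dVid rn)).
have h0 r : a <= r -> 0 <= weight'' L r * (r - a).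
  move=> ar; have r0 := p r ar; have v0 : 0 <= r^-1 by rewrite invr_ge0 ltW.
  apply: mulr_ge0; last by rewrite subr_ge0.
  apply: mulr_ge0; last by rewrite ltW// weight_gt0.
  by rewrite addr_ge0// !mulr_ge0// exprn_ge0.
have vl : r^-1 @[r --> +oo] --> (0 : R).
  apply: (@cvg0_inv _ _ 1) => r r1; rewrite ger0_norm ?mul1r// invr_ge0; lra.
have wl : weight L r @[r --> +oo] --> (1 : R).
  have h : L * r^-1 @[r --> +oo] --> (0 : R) by rewrite -(mulr0 L); apply: cvgM => //; exact: cvg_cst.
  by have := cvg_comp _ _ h (@continuous_expR R 0); rewrite expR0; apply.
have Hl : H r @[r --> +oo] --> (- 1 : R).
  have z : - L * (r - a) * r^-1 ^+ 2 - 1 @[r --> +oo] --> (0 - 1 : R).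
    apply: cvgB; last exact: cvg_cst.
    apply: (@cvg0_inv _ _ (L * (1 + `|a|))) => r r1; have r0 : 0 < r by lra.
    have i0 : 0 < r^-1 by rewrite invr_gt0.
    rewrite expr2 !normrM normrN (ger0_norm L0) (gtr0_norm i0) mulrA ler_pM2r// -mulrA.
    apply: ler_wpM2l => //; rewrite ler_pdivrMr//; apply: le_trans (ler_normB _ _) _; rewrite (gtr0_norm r0).
    have := normr_ge0 a; nra.
  by have := cvgM z wl; rewrite sub0r mulN1r; apply.
have i := ge0_integrable_ray dH hc h0 Hl; have e := ge0_integral_ray dH hc h0 Hl.
have [j ->] := max_ray a1 i; split => //; rewrite e /H; congr (_%:E); rewrite subrr; ring.
Qed.

Lemma source_pow m q r : source m q r = - (r * q r ^+ (2 * m).+1).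
Proof.
rewrite /source exprSr !exprM; congr (- (_ * (_ ^+ m * _))); exact: real_normK (num_real _).
Qed.

(** [x] and [y] are at most [B / r], so the power has Lipschitz constant [(2m+1) (B/r)^(2m)];
    weakening [r^(-2m)] to [r^-3] is enough for the weight. *)
Lemma source_lip m B x y r : (1 < m)%N -> 1 < r -> `|r * x| <= B -> `|r * y| <= B ->
  `|r * x ^+ (2 * m).+1 - r * y ^+ (2 * m).+1| <= (2 * m).+1%:R * B ^+ (2 * m) * r^-1 ^+ 3 * `|r * x - r * y|.
Proof.
move=> m1 r1 xB yB; have r0 : 0 < r by lra.
have B0 : 0 <= B by exact: le_trans xB.
have h z : `|r * z| <= B -> `|z| <= B / r by rewrite normrM (gtr0_norm r0) ler_pdivlMr// mulrC.
have := pow_lip (2 * m).+1 (h _ xB) (h _ yB) => /= k.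
rewrite -!mulrBr !normrM (gtr0_norm r0).
apply: (le_trans (ler_wpM2l (ltW r0) k)); rewrite expr_div_n.
have -> : r * ((2 * m).+1%:R * (B ^+ (2 * m) / r ^+ (2 * m)) * `|x - y|) =
  (2 * m).+1%:R * B ^+ (2 * m) * r^-1 ^+ (2 * m) * (r * `|x - y|) by rewrite exprVn; ring.
apply: ler_wpM2r; first by rewrite mulr_ge0// ltW.
apply: ler_wpM2l; first by rewrite mulr_ge0// exprn_ge0.
have v0 : 0 <= r^-1 by rewrite invr_ge0 ltW.
have v1 : r^-1 <= 1 by rewrite invf_le1// ltW.
have -> : (2 * m = 3 + (2 * m - 3))%N by lia.
by rewrite exprD ler_piMr ?exprn_ge0// exprn_ile1.
Qed.

(* In the weighted norm [sup |D| / weight], the integral operator is a contraction. *)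
Lemma integral_equation_unique m q Q (alpha B : R) : (1 < m)%N -> 0 <= B ->
  {ae mu, forall a, 1 < a -> a * q a = alpha + potential m q a} ->
  (forall a, 1 < a -> mu.-integrable I1 (fun r => (source m q r * Num.max (r - a) 0)%:E)) ->
  (forall a, 1 < a -> `|alpha + potential m q a| <= B) ->
  (forall a, 1 < a -> a * Q a = alpha + potential m Q a) ->
  (forall a, 1 < a -> mu.-integrable I1 (fun r => (source m Q r * Num.max (r - a) 0)%:E)) ->
  (forall a, 1 < a -> `|a * Q a| <= B) ->
  forall a, 1 < a -> alpha + potential m q a = a * Q a.
Proof.
move=> m1 B0 qE iq qB QE iQ QB.
pose L := (2 * m).+1%:R * B ^+ (2 * m).
have L0 : 0 <= L by rewrite mulr_ge0// exprn_ge0.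
pose D a := alpha + potential m q a - a * Q a.
have step S : 0 <= S -> (forall a, 1 < a -> `|D a| <= S * weight L a) ->
    forall a, 1 < a -> `|D a| <= S / 2 * weight L a.
  move=> S0 h a a1; have [wi we] := weight_integral L0 (ltW a1).
  have -> : D a = (\int[mu]_(r in I1) (source m q r * Num.max (r - a) 0 - source m Q r * Num.max (r - a) 0))%R.
    by rewrite (RintegralB mI (iq a a1) (iQ a a1)) /D QE// /potential; lra.
  have id : mu.-integrable I1 (EFin \o (fun r => source m q r * Num.max (r - a) 0 - source m Q r * Num.max (r - a) 0)).
    by have := integrableB mI (iq a a1) (iQ a a1); congr (integrable _ _ _).
  apply: le_trans (le_normr_Rintegral mI id) _.
  have S2 : 0 <= S / 2 by rewrite divr_ge0.
  apply: (@le_trans _ _ (S / 2 * (weight L a - 1))); last by apply: ler_wpM2l => //; lra.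
  have ia := integrable_norm id.
  have wf : (\int[mu]_(r in I1) (S / 2 * (weight'' L r * Num.max (r - a) 0))%:E = (S / 2 * (weight L a - 1))%:E)%E.
    by rewrite EFinM -we -integralZl//.
  have fin := integrable_fin_num mI ia.
  rewrite -lee_fin /Rintegral fineK// -wf; apply: ae_ge0_le_integral => //.
  - by case/integrableP: ia.
  - move=> r; rewrite /= in_itv/= andbT => r1; rewrite lee_fin mulr_ge0//.
    have v0 : 0 <= r^-1 by rewrite invr_ge0; lra.
    by rewrite !mulr_ge0 ?le_max ?lexx ?orbT// ?(ltW (weight_gt0 _ _))// addr_ge0// !mulr_ge0// exprn_ge0.
  - by case/integrableP: (integrableZl mI (S / 2) wi).
  apply: ae_mono qE => r qr; rewrite /= in_itv/= andbT => r1; rewrite lee_fin.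
  have M0 : 0 <= Num.max (r - a) 0 by rewrite le_max lexx orbT.
  rewrite -mulrBl normrM (ger0_norm M0) mulrA; apply: ler_wpM2r => //.
  rewrite !source_pow opprK addrC.
  have qBr : `|r * q r| <= B by rewrite qr// qB.
  apply: le_trans (source_lip m1 r1 (QB r r1) qBr) _; rewrite -/L.
  have := h r r1; rewrite /D -qr// distrC => hr.
  have v0 : 0 <= r^-1 by rewrite invr_ge0; lra.
  apply: (@le_trans _ _ (L * r^-1 ^+ 3 * (S * weight L r))); first by rewrite ler_wpM2l// mulr_ge0// exprn_ge0.
  have w0 := weight_gt0 L r.
  have -> : S / 2 * weight'' L r = L * r^-1 ^+ 3 * (S * weight L r) + S / 2 * (L ^+ 2 * r^-1 ^+ 4) * weight L r.
    by rewrite /weight''; field; lra.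
  rewrite lerDl; apply: mulr_ge0; last exact: ltW.
  by rewrite !mulr_ge0// exprn_ge0.
have it n b : 1 < b -> `|D b| <= 2 * B * 2^-1 ^+ n * weight L b.
  elim: n b => [|n IH] a a1.
    rewrite expr0 mulr1; apply: (@le_trans _ _ (2 * B)).
      apply: le_trans (ler_normB _ _) _; have := qB a a1; have := QB a a1; lra.
    rewrite ler_peMr ?mulr_ge0//; apply: le_trans (expR_ge1Dx _).
    by rewrite lerDl mulr_ge0// invr_ge0; lra.
  rewrite exprSr mulrA; apply: step => //.
  by rewrite !mulr_ge0// exprn_ge0// invr_ge0.
move=> a a1; apply/eqP; rewrite -subr_eq0 -normr_le0 -/(D a); apply/ler_addgt0Pr => e e0; rewrite add0r.
have [n hn] := geometric_small (2 * B * weight L a) e0.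
by apply: le_trans (it n a a1) _; rewrite mulrAC.
Qed.

(** With [f = r q], a primitive of [(r - a) f''] is [(r - a) f' - f = r^2 q' - a (q + r q')], which
    tends to [- c] at infinity and equals [- f] at [a]. *)
Lemma integral_equation m (q q' : R -> R) (M c : R) : (1 < m)%N ->
  (forall r, 0 < r -> is_derive r 1 q (q' r)) ->
  (forall r, 0 < r -> is_derive r 1 q' (- (2 / r * q' r + q r ^+ (2 * m).+1))) ->
  (forall r, 1 <= r -> `|q r| <= M / r /\ `|q' r| <= M / r ^+ 2) ->
  r ^+ 2 * derive1 q r @[r --> +oo] --> - c ->
  forall a, 1 <= a -> mu.-integrable I1 (fun r => (source m q r * Num.max (r - a) 0)%:E) /\
    a * q a = c + potential m q a.
Proof.
move=> m1 dq dq' qM ql a a1.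
have M0 : 0 <= M.
  by have [h _] := qM 1 (lexx _); rewrite divr1 in h; exact: le_trans h.
have p r : a <= r -> 0 < r by move=> ar; lra.
pose H r := (r - a) * (q r + r * q' r) - r * q r.
have dH r : a <= r -> is_derive r 1 H (source m q r * (r - a)).
  move=> ar; have r0 := p r ar; have rn := lt0r_neq0 r0.
  have k1 := dq r r0; have k2 := dq' r r0.
  apply: (deq (dD (dM (dD (did r) (dN (dcst r a))) (dD k1 (dM (did r) k2))) (dN (dM (did r) k1)))).
  by rewrite source_pow; move: (q r ^+ _) => z; field.
have gc r : a <= r -> {for r, continuous (fun r => source m q r * (r - a))}.
  move=> ar; have -> : (fun r => source m q r * (r - a)) = (fun r => - (r * q r ^+ (2 * m).+1) * (r - a)).
    by apply/funext => x; rewrite source_pow.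
  have k1 := dq r (p r ar); have k := dM (dN (dM (did r) (dX (2 * m).+1 k1))) (dD (did r) (dN (dcst r a))).
  exact: dcont k.
pose N := M ^+ (2 * m).+1; have N0 : 0 <= N by exact: exprn_ge0.
have dK r : a <= r -> is_derive r 1 (fun r => - N * r^-1) (N * r^-1 ^+ 2).
  move=> ar; have rn := lt0r_neq0 (p r ar).
  by apply: (deq (dM (dcst r (- N)) (dVid rn))); ring.
have kc r : a <= r -> {for r, continuous (fun r => N * r^-1 ^+ 2)}.
  move=> ar; have rn := lt0r_neq0 (p r ar); exact: dcont (dM (dcst r N) (dX 2 (dVid rn))).
have gk r : a <= r -> `|source m q r * (r - a)| <= N * r^-1 ^+ 2.
  move=> ar; have r0 := p r ar; have r1 : 1 <= r by lra.
  have [h _] := qM r r1; rewrite source_pow normrM normrN normrM normrX (gtr0_norm r0).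
  rewrite (ger0_norm (_ : 0 <= r - a)) ?subr_ge0//.
  have h2 : `|q r| ^+ (2 * m).+1 <= N * r^-1 ^+ (2 * m).+1.
    by rewrite -exprMn; apply: lerXn2r => //; rewrite nnegrE ?divr_ge0 ?mulr_ge0 ?invr_ge0 ?(ltW r0).
  have v0 : 0 <= r^-1 by rewrite invr_ge0 ltW.
  have v1 : r^-1 <= 1 by rewrite invf_le1.
  have h3 : r^-1 ^+ (2 * m).+1 <= r^-1 ^+ 4.
    have -> : ((2 * m).+1 = 4 + (2 * m).+1 - 4)%N by lia.
    by rewrite -addnBA; [rewrite exprD ler_piMr ?exprn_ge0// exprn_ile1 | lia].
  apply: (@le_trans _ _ (r * (N * r^-1 ^+ 4) * r)).
    apply: ler_pM; rewrite ?subr_ge0 ?mulr_ge0 ?exprn_ge0 ?(ltW r0)//; last by lra.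
    by apply: ler_wpM2l; [exact: ltW | apply: le_trans h2 _; exact: ler_wpM2l].
  by rewrite le_eqVlt; apply/orP; left; apply/eqP; field; rewrite gt_eqF.
have Hl : H r @[r --> +oo] --> - c.
  have z : q r + r * q' r @[r --> +oo] --> (0 : R).
    apply: (@cvg0_inv _ _ (2 * M)) => r r1; have [h1 h2] := qM r r1; have r0 : 0 < r by lra.
    apply: le_trans (ler_normD _ _) _; rewrite normrM (gtr0_norm r0).
    have : r * `|q' r| <= M / r.
      have -> : M / r = r * (M / r ^+ 2) by field; rewrite gt_eqF.
      by apply: ler_wpM2l => //; exact: ltW.
    lra.
  have z2 : r ^+ 2 * derive1 q r - a * (q r + r * q' r) @[r --> +oo] --> - c - a * 0.
    by apply: cvgB => //; apply: cvgM => //; exact: cvg_cst.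
  rewrite mulr0 subr0 in z2; apply: cvg_trans z2; apply: near_eq_cvg; near=> r.
  have r0 : 0 < r by near: r; exact: nbhs_pinfty_gt.
  by have [_ d] := dq r r0; rewrite derive1E d /H; ring.
have Kl : - N * r^-1 @[r --> +oo] --> (0 : R).
  apply: (@cvg0_inv _ _ N) => r r1; rewrite normrM normrN (ger0_norm N0) ger0_norm// invr_ge0; lra.
have [i e] := integral_ray dH gc dK kc gk Hl Kl.
have [i2 e2] := max_ray a1 i; split => //.
by rewrite /potential /Rintegral e2 e /= /H; ring.
Unshelve. all: by end_near. Qed.

End uniqueness.

(** * Classification *)

Section classification.
Context {R : realType}.
Local Notation mu := (@lebesgue_measure R).
Local Notation E3 := (E3 R).
Local Notation ext := (exterior : set E3).
Local Notation I1 := (`]1%R, +oo[%classic : set (measurableTypeR R)).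
Implicit Types (r a s alpha Y : R) (q Q : R -> R) (u : E3 -> R).

(** In polar coordinates the points whose radius lies in a null set form a null set. *)
Lemma radial_ae q Q : {ae mu, forall a, 1 < a -> q a = Q a} ->
  ae_eq leb3 ext (radial_fun q) (radial_fun Q).
Proof.
move=> [N [mN N0 PN]].
exists ((@enorm R) @^-1` N `&` ext); split.
- apply: measurableI; last exact: measurable_exterior.
  by rewrite -[X in measurable X]setTI; exact: (@measurable_enorm R).
- rewrite -integral_indic; last 2 first.
  - exact: measurable_exterior.
  - by rewrite -[X in measurable X]setTI; exact: (@measurable_enorm R).
  transitivity (\int[leb3]_(x in ext) ((\1_N (enorm x))%:E))%E; first by [].
  rewrite (@ge0_polar _ (fun r => (\1_N r)%:E)).
  + rewrite (ae_eq_integral (cst 0%E)) ?integral0//.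
    * by apply: emeasurable_funM; apply/measurable_EFinP; apply: measurable_funTS => //; apply: measurable_funM.
    * exists N; split=> // r /= h; apply: contrapT => rN; apply: h => _.
      by rewrite indicE memNset// mul0e.
  + by apply/measurable_EFinP.
  + by [].
move=> x /= nx; split; last first.
  by apply: contrapT => nx1; apply: nx => /nx1.
by apply: PN => /= H; apply: nx => x1; exact: H.
Qed.

Lemma stationary_line m u : (2 < m)%N -> stationary m u ->
  exists q : R -> R, exists M : R, exists S : R, exists alpha : R,
  [/\ ae_eq leb3 ext u (radial_fun q),
      0 <= M /\ {ae mu, forall a, 1 < a -> forall tau, 0 < tau -> `|q a| <= tau * M + 4 * (a - 1) / tau},
      forall a, 1 <= a -> mu.-integrable I1 (fun r => (source m q r * Num.max (r - a) 0)%:E),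
      forall a, 1 <= a -> `|potential m q a| <= S &
      {ae mu, forall a, 1 < a -> a * q a = alpha + potential m q a}].
Proof.
move=> hm [uH [q [mq uq]] uP].
have [lu _ _] := uP; have mu_ := uH.1.
have [M [M0 dual]] := dotH10_dual uH mq uq lu.
have [sigma [omega [so sd [slo shi] s01 [ o0 oout]]]] := @smooth_step R.
have [W [W0 oW]] := step_bound so oout.
have [rho [rc [rd rlo rhi]]] := smooth_ramp so sd slo shi.
have iq b c : 1 < b -> mu.-integrable `[b, c]%classic (EFin \o q).
  by move=> b1; exact: (weak_integrable mq uq mu_ uP c b1).1.
have weak := @weak_radial _ _ _ _ mq uq mu_ uP.
have [alpha h] := affine_representation W0 so sd slo shi s01 o0 oW oout rd rlo rhi hm mq iq M0 dual weak.
exists q, M, (\int[mu]_(r in I1) `|r * source m q r|)%R, alpha; split => //.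
- split=> //; apply: ae_mono (ae_good_q W0 so sd slo shi o0 oW oout mq iq) => a ga a1 tau t0.
  exact: (decay_boundary so sd shi s01 o0 oW oout mq iq dual a1 (ga a1) t0).
- by move=> a a1; exact: (potential_integrable W0 so sd slo shi s01 o0 oW oout hm mq iq M0 dual a1).
- by move=> a a1; exact: (potential_bound W0 so sd slo shi s01 o0 oW oout hm mq iq M0 dual a1).
Qed.

(** [r q] and [r Q] satisfy the integral equation with the same [alpha], hence agree. The estimate
    of [q] near 1 then passes to the continuous [Q] and gives its boundary value. *)
Lemma line_unique m q Q Q' (M S alpha MQ : R) : (1 < m)%N ->
  0 <= M -> {ae mu, forall a, 1 < a -> forall tau, 0 < tau -> `|q a| <= tau * M + 4 * (a - 1) / tau} ->
  (forall a, 1 <= a -> mu.-integrable I1 (fun r => (source m q r * Num.max (r - a) 0)%:E)) ->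
  (forall a, 1 <= a -> `|potential m q a| <= S) ->
  {ae mu, forall a, 1 < a -> a * q a = alpha + potential m q a} ->
  (forall r, 0 < r -> is_derive r 1 Q (Q' r)) ->
  (forall r, 0 < r -> is_derive r 1 Q' (- (2 / r * Q' r + Q r ^+ (2 * m).+1))) ->
  (forall r, 1 <= r -> `|Q r| <= MQ / r /\ `|Q' r| <= MQ / r ^+ 2) ->
  r ^+ 2 * derive1 Q r @[r --> +oo] --> - alpha ->
  Q 1 = 0 /\ {ae mu, forall a, 1 < a -> q a = Q a}.
Proof.
move=> m1 M0 qd iq qS qE dQ dQ' QM Ql.
have QE := integral_equation m1 dQ dQ' QM Ql.
have qQ : {ae mu, forall a, 1 < a -> q a = Q a}.
  apply: (ae_mono _ qE) => a qa a1; have an : a != 0 by rewrite gt_eqF//; lra.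
  apply: (mulfI an); rewrite qa//.
  have S0 : 0 <= S by apply: le_trans (qS 1 (lexx _)).
  have MQ0 : 0 <= MQ by have [h _] := QM 1 (lexx _); rewrite divr1 in h; exact: le_trans h.
  apply: (integral_equation_unique (B := `|alpha| + S + MQ) m1 _ qE _ _ _ _ _ a1).
  - by have := normr_ge0 alpha; lra.
  - by move=> b /ltW; exact: iq.
  - move=> b /ltW b1; apply: le_trans (ler_normD _ _) _; have := qS b b1; lra.
  - by move=> b /ltW b1; exact: (QE b b1).2.
  - by move=> b /ltW b1; exact: (QE b b1).1.
  - move=> b b1; have [h _] := QM b (ltW b1); have b0 : 0 < b by lra.
    rewrite normrM (gtr0_norm b0); have := normr_ge0 alpha.
    by move: h; rewrite ler_pdivlMr// mulrC; lra.
split=> //; apply/eqP; rewrite -normr_le0; apply/ler_addgt0Pr => e e0; rewrite add0r.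
(* Thirds of [e]: [tau M] by this choice, [4 (a - 1) / tau] by the second entry of [del], and the
   continuity of [Q] at 1 by the first. *)
pose tau := e / 3 / (M + 1); have t0 : 0 < tau by rewrite !divr_gt0//; lra.
have tM : tau * M <= e / 3.
  rewrite /tau -mulrA ler_piMr//; last by rewrite mulrC ler_pdivrMr; lra.
  by lra.
have Qc : Q @ (1 : R) --> Q 1 by exact: dcont (dQ 1 ltr01).
have e3 : 0 < e / 3 by lra.
have /cvgrPdist_le /(_ _ e3) /nbhs_ballP[d /= d0 hd] := Qc.
pose del := Num.min d (e / 3 * tau / 4).
have del0 : 0 < del by rewrite lt_min d0/=; apply: divr_gt0 => //; exact: mulr_gt0.
have H : {ae mu, forall a, 1 < a -> `|Q a| <= tau * M + 4 * (a - 1) / tau}.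
  have [N1 [mN1 N10 h1]] := qQ; have [N2 [mN2 N20 h2]] := qd.
  exists (N1 `|` N2); split; [exact: measurableU | by rewrite measureU0 |].
  move=> x /= nx; apply: contrapT => /not_orP[n1 n2]; apply: nx => x1.
  have := contra_not (h1 x) n1; rewrite /= notK => /(_ x1) <-.
  by have := contra_not (h2 x) n2; rewrite /= notK => /(_ x1 tau t0).
have d1 : 1 < 1 + del by rewrite ltrDl.
have [a /andP[a1 ad] Ha] := ae_exists d1 H.
have {}Ha := Ha a1.
move: ad; rewrite -ltrBlDl lt_min => /andP[ad1 ad2].
have k1 : `|Q 1 - Q a| <= e / 3.
  by apply: hd; rewrite /ball/= ltr0_norm; lra.
have k2 : 4 * (a - 1) / tau <= e / 3.
  by rewrite ler_pdivrMr//; move: ad2; rewrite ltr_pdivlMr//; lra.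
have := ler_normD (Q 1 - Q a) (Q a); rewrite subrK; lra.
Qed.

Lemma opp_pow m (x : R) : (- x) ^+ (2 * m).+1 = - x ^+ (2 * m).+1.
Proof. by rewrite !exprSr !exprM sqrrN mulrN. Qed.

Section family.
Variables (m : nat) (v v1 : R -> R) (X : nat -> R).
Hypothesis hm : (2 < m)%N.
Hypotheses (v0 : v 0 = 0) (vd : forall s, is_derive s 1 v (v1 s)).
Hypothesis v1d : forall s, 0 < s -> is_derive s 1 v1 (- (v s ^+ (2 * m).+1 * s^-1 ^+ 4)).
Hypothesis v1c : forall s, {for s, continuous v1}.
Hypothesis vs : forall s, 0 <= s -> `|v s| <= s.
Hypothesis v1s : forall s, 0 <= s <= 1 -> `|v1 s - 1| <= s.
Hypothesis X0 : forall k, 0 < X k.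
Hypothesis vX : forall s, 0 < s -> (v s = 0 <-> exists k, s = X k ^+ m).

(** [Y = alpha^(1/(m-1))]: the scaled solutions realize every positive leading coefficient at
    infinity. *)
Lemma slope_surjective alpha : 0 < alpha -> exists2 Y, 0 < Y & Y ^+ m / Y = alpha.
Proof.
move=> a0; pose Y := expR (ln alpha / m.-1%:R).
have Y0 : 0 < Y by exact: expR_gt0.
have m0 : m.-1%:R != 0 :> R by rewrite pnatr_eq0; lia.
exists Y => //; have -> : (m = m.-1.+1)%N by lia.
rewrite exprSr mulfK ?gt_eqF//= -expRM_natl mulrC divfK//.
by rewrite lnK// posrE.
Qed.

Lemma scaled_node Y : 0 < Y -> scaled m v Y 1 = 0 -> exists k, Y = X k.
Proof.
move=> Y0 /eqP; rewrite /scaled divr1 mulf_eq0 invr_eq0 (gt_eqF Y0) orbF => /eqP vY.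
have [k /eqP e] := (vX (exprn_gt0 m Y0)).1 vY; exists k; apply/eqP.
by move: e; rewrite eqrXn2 ?ltW//; lia.
Qed.

(** The sign of [alpha] decides: a scaled solution, its opposite or 0 has this coefficient,
    [line_unique] identifies it with [u], and the boundary value 0 forces the scale to be one of the
    [X k]. *)
Lemma classification u : stationary m u ->
  [\/ ae_eq leb3 ext u (cst 0),
      exists k, ae_eq leb3 ext u (radial_fun (scaled m v (X k))) |
      exists k, ae_eq leb3 ext u (radial_fun (fun r => - scaled m v (X k) r))].
Proof.
move=> us; have m1 : (1 < m)%N by lia.
have [q [M [S [alpha [uq [M0 qd] iq qS qE]]]]] := stationary_line hm us.
have key := line_unique m1 M0 qd iq qS qE.
have [aneg|apos|a0] := ltgtP alpha 0.
- have na : 0 < - alpha by rewrite oppr_gt0.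
  have [Y Y0 YE] := slope_surjective na.
  have [MQ QM] := scaled_bound m v1c vs Y0.
  have [||||Q1 qQ] := key (fun r => - scaled m v Y r) (fun r => - scaled' m v1 Y r) MQ.
  + by move=> r r0; have h := is_derive_scaled m vd Y0 r0; exact: dN.
  + move=> r r0; have h := is_derive_scaled' v1d Y0 r0.
    by apply: (deq (dN h)); rewrite opp_pow; ring.
  + by move=> r r1; rewrite (normrN (scaled m v Y r)) (normrN (scaled' m v1 Y r)); exact: QM.
  + have h : - (r ^+ 2 * derive1 (scaled m v Y) r) @[r --> +oo] --> - alpha.
      by rewrite -YE -[X in _ --> X]opprK; apply: cvgN; exact: scaled'_lim.
    apply: cvg_trans h; apply: near_eq_cvg; near=> r.
    have r0 : 0 < r by near: r; exact: nbhs_pinfty_gt.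
    have k := is_derive_scaled m vd Y0 r0; have [_ e1] := k; have [_ e2] := dN k.
    by rewrite !derive1E e2 e1; apply: esym; exact: mulrN.
  have [k Yk] := scaled_node Y0 (oppr_inj (etrans Q1 (esym (oppr0 _)))).
  by constructor 3; exists k; rewrite -Yk; apply: ae_eq_trans uq _; exact: radial_ae.
- have [Y Y0 YE] := slope_surjective apos.
  have [MQ QM] := scaled_bound m v1c vs Y0.
  have [||||Q1 qQ] := key (scaled m v Y) (scaled' m v1 Y) MQ.
  + by move=> r; exact: is_derive_scaled.
  + by move=> r; exact: is_derive_scaled'.
  + exact: QM.
  + by rewrite -YE; exact: scaled'_lim.
  have [k Yk] := scaled_node Y0 Q1.
  by constructor 2; exists k; rewrite -Yk; apply: ae_eq_trans uq _; exact: radial_ae.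
have d1 r : 0 < r -> is_derive r 1 (cst 0 : R -> R) (cst 0 r) by move=> _; exact: dcst.
have d2 r : 0 < r -> is_derive r 1 (cst 0 : R -> R) (- (2 / r * cst 0 r + cst 0 r ^+ (2 * m).+1)).
  by move=> _; apply: (deq (dcst r 0)); rewrite /= expr0n/=; ring.
have [||_ qQ] := key _ _ 0 d1 d2.
- by move=> r r1; rewrite /= normr0 !mul0r.
- rewrite a0 oppr0; have -> : (fun r : R => r ^+ 2 * (cst 0 : R -> R)^`()%classic r) = cst 0.
    by apply/funext => r; rewrite derive1_cst mulr0.
  exact: cvg_cst.
by constructor 1; apply: ae_eq_trans uq _; exact: (radial_ae (Q := cst 0)).
Unshelve. all: by end_near. Qed.

End family.

End classification.

(** * From classes to functions, and the assembly of the theorem *)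

Section conclusion.
Context {R : realType}.
Local Notation mu := (@lebesgue_measure R).
Local Notation E3 := (E3 R).
Local Notation ext := (exterior : set E3).
Implicit Types (r : R) (q Q : R -> R) (u w : E3 -> R).

(** Otherwise the shell between [b] and [c] would be a null set, though its measure is at least
    [kappa (c - b)]. *)
Lemma ae_radial_exists (P : R -> Prop) (b c : R) : 1 <= b -> b < c ->
  {ae leb3, forall x : E3, ext x -> P (enorm x)} -> exists2 r, b < r < c & P r.
Proof.
move=> b1 bc [N [mN N0 PN]]; apply: contrapT => H.
have mbc : measurable (`]b, c[%classic : set (measurableTypeR R)) by exact: measurable_itv.
have menorm : measurable ((@enorm R) @^-1` `]b, c[%classic).
  by rewrite -[X in measurable X]setTI; exact: (@measurable_enorm R).
have z : leb3 ((@enorm R) @^-1` `]b, c[%classic `&` ext) = 0%E.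
  apply: (subset_measure0 _ mN _ N0); first by apply: measurableI => //; exact: measurable_exterior.
  move=> x [/=]; rewrite in_itv/= => xbc x1; apply: PN => /= Px; apply: H.
  by exists (enorm x) => //; exact: Px.
have k0 := @kappa_gt0 R.
have : (\int[mu]_(r in `]1%R, +oo[) ((\1_(`]b, c[%classic) r)%:E * (kappa * r ^+ 2)%:E) = 0)%E.
  rewrite -(@ge0_polar _ (fun r => (\1_(`]b, c[%classic) r)%:E))//; last first.
    by apply/measurable_EFinP.
  by rewrite -z -integral_indic//; exact: measurable_exterior.
apply/eqP; rewrite gt_eqF//.
have mI := @measurable_ray R 1.
have pos : (0 < kappa%:E * mu `]b, c[%classic)%E.
  by rewrite lebesgue_measure_itv/= lte_fin bc -EFinB -EFinM lte_fin mulr_gt0// subr_gt0.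
apply: (lt_le_trans pos).
have -> : (mu `]b, c[%classic = mu (`]b, c[%classic `&` `]1%R, +oo[%classic))%E.
  congr (mu _); apply/seteqP; split=> [r /=|r []//].
  by rewrite !in_itv/= andbT => rbc; split=> //; lra.
rewrite -integral_indic// -ge0_integralZl//; last 2 first.
- by apply/measurable_EFinP; exact: measurable_funTS.
- by rewrite lee_fin ltW.
apply: ge0_le_integral => //.
- by move=> r _; rewrite -EFinM lee_fin mulr_ge0// ltW.
- by apply: measurable_funeM; apply/measurable_EFinP; exact: measurable_funTS.
- by apply: emeasurable_funM; apply/measurable_EFinP; apply: measurable_funTS => //; apply: measurable_funM.
move=> r /=; rewrite in_itv/= andbT => r1; rewrite muleC lee_wpmul2l// lee_fin ler_peMr ?(ltW k0)//.
by rewrite expr_ge1//; lra.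
Qed.

Lemma radial_ae_eq_continuous q Q : (forall r, 1 < r -> {for r, continuous q}) ->
  (forall r, 1 < r -> {for r, continuous Q}) -> ae_eq leb3 ext (radial_fun q) (radial_fun Q) ->
  forall r, 1 < r -> q r = Q r.
Proof.
move=> qc Qc e r r1; apply/eqP; rewrite -subr_eq0 -normr_le0; apply/ler_addgt0Pr => d d0; rewrite add0r.
have c : (fun x => q x - Q x) @ r --> q r - Q r by apply: cvgB; [exact: qc | exact: Qc].
have /cvgrPdist_le /(_ _ d0) /nbhs_ballP[t /= t0 ht] := c.
have rt : r < r + t by rewrite ltrDl.
have [x /andP[rx xt] ex] := @ae_radial_exists (fun y => q y = Q y) _ _ (ltW r1) rt e.
have : `|q r - Q r - (q x - Q x)| <= d by apply: ht; rewrite /ball/= ltr0_norm; lra.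
by rewrite ex subrr subr0.
Qed.

(** Each clause of stationarity, apart from the measurability assumed for [w], is an integral or an
    almost everywhere condition over the exterior domain. *)
Lemma stationary_ae m u w : measurable_fun ext w -> ae_eq leb3 ext w u -> stationary m u -> stationary m w.
Proof.
move=> mw wu [[mu_ [phi [tphi cphi lphi]]] [q [mq uq]] [lu lg eq]].
have mext := @measurable_exterior R.
have mt phi' : test_function phi' -> measurable_fun ext (phi' : E3 -> R).
  by move=> /test_measurable h; exact: measurable_funTS.
split.
- split=> //; exists phi; split=> // rho.
  suff -> : (fun n => \int[leb3]_(x in ext `&` eball rho) `|phi n x - w x|%:E)%E =
    (fun n => \int[leb3]_(x in ext `&` eball rho) `|phi n x - u x|%:E)%E by exact: lphi.
  apply/funext => n.
  have mB : measurable (ext `&` eball rho).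
    apply: measurableI => //.
    have -> : eball rho = (@enorm R) @^-1` `]-oo, rho[%classic by apply/seteqP; split => x /=; rewrite in_itv.
    by rewrite -[X in measurable X]setTI; exact: (@measurable_enorm R).
  have mm (f : E3 -> R) : measurable_fun ext f -> measurable_fun (ext `&` eball rho) (fun x => `|phi n x - f x|%:E).
    move=> mf; apply/measurable_EFinP; apply: measurableT_comp => //.
    apply: (measurable_funS mext) => //; apply: measurable_funB => //; exact: mt.
  apply: ae_eq_integral => //; [exact: mm | exact: mm |].
  by apply: filterS wu => x h [x1 _]; rewrite h.
- by exists q; split => //; exact: ae_eq_trans wu uq.
have mg (f : E3 -> R) : measurable_fun ext f -> measurable_fun ext (fun x => `|f x| ^+ (2 * m) * f x).
  by move=> mf; apply: measurable_funM => //; apply: measurable_funX; exact: measurableT_comp.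
have loc (f g : E3 -> R) : measurable_fun ext f -> ae_eq leb3 ext f g -> loc_integrable g -> loc_integrable f.
  move=> mf fg lg' K cK Kext.
  have mK : measurable K by rewrite -[K]setCK; apply: measurableC; apply: open_measurable3; exact: compl_compact_open.
  apply: (@ae_le_integrable _ _ _ leb3 K (EFin \o f) (EFin \o g)) => //; last 2 first.
  - exact: lg'.
  - by apply: filterS fg => x h /Kext x1; rewrite /= h.
  by apply/measurable_EFinP; exact: measurable_funS mf.
have wg : ae_eq leb3 ext (fun x => `|w x| ^+ (2 * m) * w x) (fun x => `|u x| ^+ (2 * m) * u x).
  by apply: filterS wu => x h x1; rewrite h.
split; [exact: loc wu lu | by apply: (loc _ _ _ wg lg); exact: mg | move=> psi tpsi].
have h := eq psi tpsi.
have ml : measurable_fun ext (laplacian psi).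
  by apply: measurable_sum => i; apply: mt; apply: test_pderiv; exact: test_pderiv.
transitivity (\int[leb3]_(x in ext) (u x * - laplacian psi x)%:E)%E.
  apply: ae_eq_integral => //.
  - by apply/measurable_EFinP; apply: measurable_funM => //; exact: measurableT_comp.
  - by apply/measurable_EFinP; apply: measurable_funM => //; exact: measurableT_comp.
  by apply: filterS wu => x k x1; rewrite k.
rewrite h; apply: ae_eq_integral => //.
- by apply/measurable_EFinP; apply: measurable_funM; [exact: mg | exact: mt].
- by apply/measurable_EFinP; apply: measurable_funM; [exact: mg | exact: mt].
by apply: filterS wu => x k x1; rewrite k.
Qed.

Lemma profile_opp m q dq M : profile m q dq M -> profile m (fun r => - q r) (fun r => - dq r) M.
Proof.
move=> qp; split.
- apply: (@smooth1_eq _ _ (fun r => -1 * q r)); first exact: open_gt.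
  + by move=> r _; rewrite mulN1r.
  + by apply: smooth1_mul; [exact: smooth1_cst | exact: profile_smooth qp].
- by move=> r r0; have h := profile_d qp r0; exact: dN.
- move=> r r0; have h := profile_dd qp r0; apply: (deq (dN h)); rewrite opp_pow; ring.
- by rewrite (profile_1 qp) oppr0.
- by move=> r r1; rewrite (normrN (q r)) (normrN (dq r)); exact: (profile_bound qp r1).
Qed.

Lemma profile_zero m : profile m (cst (0 : R)) (cst 0) 0.
Proof.
split.
- exact: smooth1_cst.
- by move=> r _; exact: dcst.
- by move=> r _; apply: (deq (dcst r 0)); rewrite /= expr0n/=; ring.
- by [].
- by move=> r r1; rewrite /= normr0 !mul0r.
Qed.

Lemma axis_point r : 0 <= r -> @enorm R ((r, 0), 0) = r.
Proof. by move=> r0; rewrite /enorm /= expr0n/= !addr0 sqrtr_sqr ger0_norm. Qed.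

(** Restriction to a half-axis, where the norm is the coordinate, turns continuity in space into
    continuity of the radial function. *)
Lemma smooth_cl_continuous q : smooth_cl_exterior (radial_fun q : E3 -> R) ->
  forall r, 1 < r -> {for r, continuous q}.
Proof.
move=> [U [g [oU eU sg gq]]] r r1.
pose p (t : R) : E3 := ((t, 0), 0).
have pc : continuous p.
  by move=> t; apply: (cvg_pair (cvg_pair cvg_id (cvg_cst _)) (cvg_cst _)).
have x1 : cl_exterior (p r) by rewrite /cl_exterior/= axis_point; lra.
have gc : {for p r, continuous g} := smooth_on_continuous sg (eU _ x1).
have c : {for r, continuous (g \o p)} by apply: continuous_comp; [exact: pc | exact: gc].
have E : forall t, 1 <= t -> (g \o p) t = q t.
  by move=> t t1; rewrite /= gq /radial_fun ?/cl_exterior/= axis_point//; lra.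
rewrite /prop_for /continuous_at -E ?(ltW r1)//.
apply: cvg_trans c; apply: near_eq_cvg.
have o : nbhs r [set t | 1 < t] by apply: open_nbhs_nbhs; split => //; exact: open_gt.
by apply: filterS o => t t1; exact: (E t (ltW t1)).
Qed.

End conclusion.

Theorem proposition1p1 (R : realType) (m : nat) (hm : (2 < m)%N) :
  exists Q : nat -> R -> R,
    [/\ forall k : nat,
          [/\ nodal_solution m k (Q k),
              forall q : R -> R, nodal_solution m k q ->
                forall r : R, 1 <= r -> q r = Q k r &
              exists c : R,
                [/\ 0 < c,
                    exists C : R, 0 < C /\
                      forall r : R, 1 <= r ->
                        `|Q k r - c / r| <= C * (r ^+ 2)^-1 &
                    r ^+ 2 * derive1 (Q k) r @[r --> +oo] --> - c]],
        forall k : nat, energy m (radial_fun (Q k)) (cst 0%R) \is a fin_num,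
        forall k : nat,
          (energy m (radial_fun (Q k)) (cst 0%R)
             < energy m (radial_fun (Q k.+1)) (cst 0%R))%E &
        [set u : E3 R -> R | stationary m u] =
          (\bigcup_(k in [set: nat]) ae_class (radial_fun (Q k)))
          `|` (\bigcup_(k in [set: nat]) ae_class (radial_fun (fun r => - Q k r)))
          `|` ae_class (cst 0%R)].
Proof.
have [v [v1 [v0 v10 vd v1d [v1c vs v1s]]]] := @emden_fowler_solution R m hm.
have [X [X0 Xi vX slope]] := zeros_of_solution hm vd v0 v1d vs v1s.
have Xm0 k : 0 < X k ^+ m by exact: exprn_gt0.
have vXk k : v (X k ^+ m) = 0 by apply/(vX _ (Xm0 k)); exists k.
pose Q k := scaled m v (X k); pose dQ k := scaled' m v1 (X k).
have prof k : exists M, profile m (Q k) (dQ k) M by exact: scaled_profile (X0 k) (vXk k).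
have stat k : stationary m (radial_fun (Q k) : E3 R -> R).
  by have [M p] := prof k; exact: profile_stationary p.
have statN k : stationary m (radial_fun (fun r => - Q k r) : E3 R -> R).
  by have [M p] := prof k; exact: profile_stationary (profile_opp p).
have stat0 : stationary m (cst 0 : E3 R -> R) := profile_stationary (@profile_zero R m).
have Q1 k : Q k 1 = 0 by have [M p] := prof k; exact: profile_1 p.
have Qc k r : 1 < r -> {for r, continuous (Q k)}.
  by move=> r1; have [M p] := prof k; have [_ c _ _] := profile_facts p; apply: c; lra.
have pos k : \forall r \near +oo, 0 < Q k r by exact: scaled_pos.
have class u := @classification R m v v1 X hm vd v1d v1c vs v1s X0 vX u.
have nodes k := scaled_zeros hm k X0 Xi vX.
(* The factor of [profile_energy]; since [dQ k 1] is minus [X^(m-1) v1 (X^m)] at [X = X k], the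
   ordering by [slope] is that of the energies. *)
pose c0 : R := kappa * (m%:R / (2 * (m%:R - 2))).
have c00 : 0 < c0.
  have m2 : 2 < m%:R :> R by rewrite ltr_nat.
  by rewrite mulr_gt0 ?kappa_gt0// divr_gt0//; lra.
have energyE k : energy m (radial_fun (Q k) : E3 R -> R) (cst 0) =
    (c0 * (X k ^+ m.-1 * v1 (X k ^+ m)) ^+ 2)%:E.
  have [M p] := prof k; rewrite (profile_energy hm p) mulrA /dQ /scaled' !divr1 expr1n divr1 sqrrN.
  by have -> : X k ^+ m / X k = X k ^+ m.-1 by rewrite -{1}(ltn_predK hm) exprSr mulfK// gt_eqF.
exists Q; split.
- move=> k; split.
  + split=> //.
    * by have [M p] := prof k; exact: profile_smooth_cl p.
    * by move=> x x1; rewrite /radial_fun x1.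
    * exact: nodes.
  (* By classification and continuity, [q] equals 0, some [Q j] or some [- Q j] on [r > 1].
     Positivity for large [r] leaves [Q j], and the number of zeros gives [j = k]. *)
  + move=> q [qs qsm q1 qz qpos] r; rewrite le_eqVlt => /predU1P[<-|r1].
      have e : @enorm R ((1, 0), 0) = 1 by exact: axis_point.
      by have := q1 _ e; rewrite /radial_fun e Q1.
    have qc := smooth_cl_continuous qsm.
    have absurd (w : R -> R) : (forall r, 1 < r -> {for r, continuous w}) ->
        (\forall r \near +oo, w r <= 0) -> ~ ae_eq leb3 (exterior : set (E3 R)) (radial_fun q) (radial_fun w).
      move=> wc wn e; have qw := radial_ae_eq_continuous qc wc e.
      near (+oo : set_system R) => t.
      have t1 : 1 < t by near: t; apply: nbhs_pinfty_gt; exact: num_real.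
      have h1 : 0 < q t by near: t.
      have h2 : w t <= 0 by near: t.
      by move: h1; rewrite qw// ltNge h2.
    have [e|[j e]|[j e]] := class _ qs.
    * case: (absurd (cst 0) _ _ e); first by move=> t _; exact: cvg_cst.
      by near=> t.
    * have qQ := radial_ae_eq_continuous qc (Qc j) e.
      suff -> : k = j by exact: qQ.
      have E : [set r : R | 1 < r /\ q r = 0] = [set r | 1 < r /\ Q j r = 0].
        by apply/seteqP; split => t /= [t1 t0]; split=> //; rewrite -t0 qQ.
      apply/card_eq_II; rewrite E in qz; apply: card_eq_trans (nodes j).
      by rewrite card_eq_sym.
    * case: (absurd (fun r => - Q j r) _ _ e).
        by move=> t t1; apply: cvgN; exact: Qc.
      have := pos j; apply: filterS => t; rewrite oppr_le0; exact: ltW.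
  exists (X k ^+ m / X k); split.
  + exact: divr_gt0.
  + exists (2 * (X k ^+ m) ^+ 2 / X k); split; first by rewrite divr_gt0// mulr_gt0// exprn_gt0.
    by move=> r r1; exact: scaled_asymp.
  + exact: scaled'_lim.
- by move=> k; rewrite energyE.
- by move=> k; rewrite !energyE lte_fin ltr_pM2l//; exact: slope.
apply/seteqP; split=> [u /= us|u /=].
  have mu_ : measurable_fun exterior u by case: us => [[]].
  have [e|[k e]|[k e]] := class u us; first by right.
  + by left; left; exists k.
  + by left; right; exists k.
move=> [[[k _ [mu_ e]]|[k _ [mu_ e]]]|[mu_ e]].
- exact: stationary_ae mu_ e (stat k).
- exact: stationary_ae mu_ e (statN k).
- exact: stationary_ae mu_ e stat0.
Unshelve. all: by end_near.
Qed.
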